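(* Let $\mathbf{M}$ be an admissible weight sequence, let $\Omega\subseteq\mathbb{R}^n$ be open, and let $P$ be a linear partial differential operator with coefficients in $\mathcal{E}^{\{\mathbf{M}\}}(\Omega)$. Assume that there is a continuous linear operator $R: L^2(\Omega)\to L^2(\Omega)$ such that $PR=\mathrm{Id}$ (i.e. $P(Rf)=f$ in the sense of distributions on $\Omega$ for all $f\in L^2(\Omega)$). Then $P$ is $\{\mathbf{M}\}$-hypoelliptic at a point $x_0\in\Omega$ if and only if there is a neighborhood $U_0\subseteq\Omega$ of $x_0$ such that for all open sets $V\Subset U\subseteq U_0$ there are constants $C,L>0$ such that for all $u\in\mathcal{D}'(U)$ and all $k\in\mathbb{Z}_+$ we have $$Pu\in H^k(U)\Longrightarrow u\in H^k(V),$$ $$\lVert u\rVert_{H^k(V)}\leq C L^k\left(|||Pu|||_{U,\mathbf{M},k}+M_k\lVert u\rVert_{L^2(U)}\right).$$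
   Context: Notation: $\mathbb{N}=\{1,2,\dots\}$, $\mathbb{Z}_+=\{0,1,2,\dots\}$. $V\Subset U$ means that $\overline V$ is a compact subset of $U$. $\mathcal{D}'(U)$ is the space of distributions on $U$. $D^\alpha=D_1^{\alpha_1}\cdots D_n^{\alpha_n}$ with $D_j=-i\partial_{x_j}$. A linear partial differential operator is a finite sum $P=\sum_{|\alpha|\le m}a_\alpha(x)D^\alpha$. $H^k(V)$ is the $L^2$-based Sobolev space with $\lVert u\rVert_{H^k(V)}^2=\sum_{|\alpha|\le k}\lVert D^\alpha u\rVert_{L^2(V)}^2$. Weight sequences: A sequence of positive numbers $\mathbf{M}=(M_k)_{k\in\mathbb{Z}_+}$ is a weight sequence if $M_0=1$, $M_1\ge 1$, $M_k^2\le M_{k-1}M_{k+1}$ for all $k\in\mathbb{N}$, and $\lim_{k\to\infty}M_k^{1/k}=\infty$. It is admissible if moreover (i) there are $C,h>0$ with $k!\le C h^k M_k$ for all $k\in\mathbb{Z}_+$, and (ii) there is $A>0$ with $M_{j+k}\le A^{j+k}M_jM_k$ for all $j,k\in\mathbb{Z}_+$. Put $\Lambda_k=M_k^{1/k}$ for $k\in\mathbb{N}$. Denjoy-Carleman class: for $U\subseteq\mathbb{R}^n$ open, $\mathcal{E}^{\{\mathbf{M}\}}(U)$ is the set of $f\in C^\infty(U)$ such that for every compact $K\subseteq U$ there are $C,h>0$ with $\sup_{x\in K}|D^\alpha f(x)|\le C h^{|\alpha|}M_{|\alpha|}$ for all $\alpha\in\mathbb{Z}_+^n$. Hypoellipticity: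 $P$ (with coefficients in $\mathcal{E}^{\{\mathbf{M}\}}(U)$) is $\{\mathbf{M}\}$-hypoelliptic in an open set $U$ if for every $u\in\mathcal{D}'(U)$ and every open $V\subseteq U$: $Pu|_V\in\mathcal{E}^{\{\mathbf{M}\}}(V)$ implies $u|_V\in\mathcal{E}^{\{\mathbf{M}\}}(V)$. $P$ is $\{\mathbf{M}\}$-hypoelliptic at $x_0$ if there is a neighborhood $U_0$ of $x_0$ such that $P$ is $\{\mathbf{M}\}$-hypoelliptic in $U_0$. Neighborhoods are open. Weighted Sobolev norm: $|||u|||_{U,\mathbf{M},k}=\sum_{|\alpha|\le k}\Lambda_k^{k-|\alpha|}\lVert D^\alpha u\rVert_{L^2(U)}$; for $k=0$ this is $\lVert u\rVert_{L^2(U)}$. An $L^2$ norm of a distribution not in $L^2$ is understood as $+\infty$, so the estimate has content only when its right-hand side is finite. *)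

(* Defs.v *)
From HB Require Import structures.
From mathcomp Require Import all_boot all_order all_algebra.
From mathcomp Require Import all_classical all_reals all_analysis.
From mathcomp.real_closed Require Import complex.
Set Implicit Arguments.
Unset Strict Implicit.
Unset Printing Implicit Defensive.
Import Order.TTheory GRing.Theory Num.Theory.
Import numFieldNormedType.Exports.
Local Open Scope classical_set_scope.
Local Open Scope ring_scope.

Definition measure_rV_display : measure_display -> measure_display.
Proof. exact. Qed.

Section measurable_rV.
Context (R : realType) (n : nat).

Let coors : 'I_n -> 'rV[R]_n -> measurableTypeR R := fun i x => x ord0 i.

Let rV_set0 : g_sigma_preimage coors set0.
Proof. exact: sigma_algebra0. Qed.

Let rV_setC A : g_sigma_preimage coors A -> g_sigma_preimage coors (~` A).
Proof. exact: sigma_algebraC. Qed.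

Let rV_bigcup (F : _^nat) : (forall i, g_sigma_preimage coors (F i)) ->
  g_sigma_preimage coors (\bigcup_i (F i)).
Proof. exact: sigma_algebra_bigcup. Qed.

(* Product sigma-algebra, as for tuples; it is the Borel sigma-algebra, see
   open_measurable_rV. *)
HB.instance Definition _ := @isMeasurable.Build
  (measure_rV_display (R.-ocitv.-measurable).-sigma)
  'rV[R]_n (g_sigma_preimage coors) rV_set0 rV_setC rV_bigcup.

Lemma measurable_coor (i : 'I_n) :
  measurable_fun [set: 'rV[R]_n] (fun x => x ord0 i : measurableTypeR R).
Proof.
move=> _ Y mY; rewrite setTI; apply: sub_sigma_algebra => /=.
rewrite -bigcup_seq/=; exists i => /=; first by rewrite mem_index_enum.
by exists Y => //; rewrite setTI.
Qed.

Lemma measurable_fun_rVP d (T : measurableType d) (f : T -> 'rV[R]_n) :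
  (forall i, measurable_fun [set: T] (fun t => f t ord0 i : measurableTypeR R)) ->
  measurable_fun [set: T] f.
Proof.
move=> mf.
suff H : g_sigma_preimage (fun i => coors i \o f) `<=` @measurable _ T.
  move=> _ A mA; apply: H; rewrite g_sigma_preimage_comp.
  by exists A.
apply: smallest_sub; first exact: sigma_algebra_measurable.
rewrite -bigcup_seq/=; apply: bigcup_sub => i _ A [B mB <-].
exact: mf.
Qed.

Lemma open_measurable_rV (U : set 'rV[R]_n) : open U -> measurable U.
Proof.
move=> oU.
pose I := ('rV[rat]_n * nat)%type.
pose B (p : I) : set 'rV[R]_n := 
  ball (map_mx (@ratr R) p.1 : 'rV[R]_n) (p.2.+1%:R^-1).
pose F (p : I) : set 'rV[R]_n := if `[< B p `<=` U >] then B p else set0.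
have -> : U = \bigcup_p F p.
  apply/seteqP; split => [x Ux|x [p _]]; last first.
    by rewrite /F; case: asboolP => // + ?; exact.
  have [e /= e0 xeU] := (@nbhs_ballP _ _ _ _).1 (open_nbhs_nbhs (conj oU Ux)).
  have [k ke] : exists k : nat, 2 * k.+1%:R^-1 < e.
    have e2 : 0 < e / 2 by rewrite divr_gt0.
    have [k kh] := ltr_add_invr e2; exists k; rewrite add0r in kh.
    by rewrite mulrC -ltr_pdivlMr.
  have k0 : 0 < (k.+1%:R^-1 : R) by rewrite invr_gt0.
  have qj j : exists q : rat, `|x ord0 j - ratr q| < k.+1%:R^-1 :> R.
    have /rat_in_itvoo[q] : x ord0 j - k.+1%:R^-1 < x ord0 j + k.+1%:R^-1.
      by rewrite ltrBlDr -addrA ltrDl addr_gt0.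
    rewrite in_itv/= => qx; exists q; rewrite distrC ltr_distl//.
  have [q' q'P] := choice qj; pose q : 'rV[rat]_n := \row_j q' j.
  have Bx : B (q, k) x.
    by split => // i j; rewrite !mxE ord1 /ball/= distrC; exact: q'P.
  exists (q, k) => //; rewrite /F; case: asboolP => // -[] y By.
  apply: xeU; apply: le_ball (ltW ke) _ _.
  rewrite mulr_natl mulr2n; apply: ball_triangle By.
  exact: ball_sym.
apply: countable_bigcupT_measurable; first exact: countableP.
move=> p; rewrite /F; case: asboolP => // _.
have -> : B p = \big[setI/setT]_(j < n)
    ((fun x : 'rV[R]_n => x ord0 j : measurableTypeR R) @^-1`
      (ball (ratr (p.1 ord0 j) : R) (p.2.+1%:R^-1) : set R)).
  apply/seteqP; split => x; rewrite -bigcap_seq.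
    by move=> [_ Bx] j _ /=; have := Bx ord0 j; rewrite !mxE.
  move=> Bx; split=> [|i j]; first by rewrite invr_gt0.
  by rewrite ord1 !mxE; exact: (Bx j (mem_index_enum j)).
apply: bigsetI_measurable => j _; rewrite -[X in measurable X]setTI.
by apply: measurable_coor => //; rewrite ball_itv; exact: measurable_itv.
Qed.

End measurable_rV.

Section sigma_finite_measure_ex.
Local Open Scope ereal_scope.
Context d (T : measurableType d) (R : realType) (f : set T -> \bar R).
Context (f0 : f set0 = 0) (f_ge0 : forall A, 0 <= f A).
Context (fsa : semi_sigma_additive f) (sf : sigma_finite setT f).

Let g := f.
HB.instance Definition _ := isMeasure.Build _ _ _ g f0 f_ge0 fsa.
HB.instance Definition _ := Measure_isSigmaFinite.Build _ _ _ g sf.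

Lemma sigma_finite_measure_ex :
  exists m : {sigma_finite_measure set T -> \bar R}, m = f :> (set T -> \bar R).
Proof. by exists g. Qed.

End sigma_finite_measure_ex.

Section lebesgue_rV.
Context (R : realType).
Local Open Scope ereal_scope.

Definition cons_rV n (p : measurableTypeR R * 'rV[R]_n) : 'rV[R]_n.+1 :=
  row_mx (const_mx p.1 : 'rV[R]_1) p.2.

Lemma measurable_cons_rV n : measurable_fun setT (@cons_rV n).
Proof.
apply: measurable_fun_rVP => i; rewrite /cons_rV.
have [j ->|j ->] := split_ordP (i : 'I_(1 + n)).
  rewrite (_ : (fun _ => _) = fst); first exact: measurable_fst.
  by apply/funext => t; rewrite [LHS]row_mxEl mxE.
rewrite (_ : (fun _ => _) =
    (fun x : 'rV[R]_n => x ord0 j : measurableTypeR R) \o snd).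
  exact: measurableT_comp (measurable_coor j) measurable_snd.
by apply/funext => t; rewrite [LHS]row_mxEr.
Qed.

Fixpoint lebesgue_rV n : set 'rV[R]_n -> \bar R :=
  if n is n'.+1 then
    pushforward (lebesgue_measure \x @lebesgue_rV n') (@cons_rV n')
  else \d_ (0%R : 'rV[R]_0).

Lemma lebesgue_rV_spec n :
  exists m : {sigma_finite_measure set 'rV[R]_n -> \bar R},
    (m : set 'rV[R]_n -> \bar R) = @lebesgue_rV n.
Proof.
elim: n => [|n [m mE]]; first by exists \d_ (0%R : 'rV[R]_0).
pose f := pushforward (lebesgue_measure \x m) (@cons_rV n).
pose mp := measure_function_pushforward__canonical__measure_function_Measure
  (lebesgue_measure \x m) (@measurable_cons_rV n).
have f0 : f set0 = 0 by exact: (measure0 mp).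
have f_ge0 A : 0 <= f A by exact: (measure_ge0 mp).
have fsa : semi_sigma_additive f by exact: (@measure_semi_sigma_additive _ _ _ mp).
have sf : sigma_finite setT f.
  have [F FT Foo] : sigma_finite setT (lebesgue_measure \x m).
    have /sigma_finiteP[F [TF ndF Foo]] := sigma_finiteT (@lebesgue_measure R).
    have /sigma_finiteP[G [TG ndG Goo]] := sigma_finiteT m.
    exists (fun k => F k `*` G k); last first.
      move=> k; have [mF ?] := Foo k; have [mG ?] := Goo k.
      split; first exact: measurableX.
      by rewrite product_measure1E// lte_mul_pinfty// ge0_fin_numE.
    rewrite -setXTT TF TG; apply/seteqP; split => -[x y].
      move=> [/= [i _ Fix] [j _ Gjy]]; exists (maxn i j) => //; split.
        by move: x Fix; exact/subsetPset/ndF/leq_maxl.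
      by move: y Gjy; exact/subsetPset/ndG/leq_maxr.
    by move=> [i _ [/= ? ?]]; split; exists i.
  pose g (x : 'rV[R]_n.+1) : measurableTypeR R * 'rV[R]_n :=
    (x ord0 (lshift n (ord0 : 'I_1)), rsubmx (x : 'rV[R]_(1 + n))).
  have gK : cancel (@cons_rV n) g.
    move=> [a b]; rewrite /g /cons_rV row_mxKr; congr pair.
    by rewrite [LHS]row_mxEl mxE.
  have mg : measurable_fun setT g.
    apply: measurable_fun_pair; first exact: measurable_coor.
    apply: measurable_fun_rVP => i.
    rewrite (_ : (fun _ => _) = (fun x : 'rV[R]_n.+1 =>
      x ord0 (rshift 1 i) : measurableTypeR R)); first exact: measurable_coor.
    by apply/funext => x; rewrite mxE.
  exists (fun k => g @^-1` F k); first by rewrite -preimage_bigcup -FT.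
  move=> k; have [mF Fk] := Foo k; split.
    by rewrite -[X in measurable X]setTI; exact: mg.
  rewrite /f /pushforward -comp_preimage (_ : g \o _ = id)//.
  exact/funext.
have [m' m'E] := sigma_finite_measure_ex f0 f_ge0 fsa sf.
by exists m'; rewrite m'E /f mE.
Qed.

Let lebesgue_rV0 n : @lebesgue_rV n set0 = 0.
Proof. by have [m <-] := lebesgue_rV_spec n; exact: measure0. Qed.

Let lebesgue_rV_ge0 n A : 0 <= @lebesgue_rV n A.
Proof. by have [m <-] := lebesgue_rV_spec n; exact: measure_ge0. Qed.

Let lebesgue_rV_sigma_additive n : semi_sigma_additive (@lebesgue_rV n).
Proof.
by have [m <-] := lebesgue_rV_spec n; exact: measure_semi_sigma_additive.
Qed.

HB.instance Definition _ n := isMeasure.Build _ _ _ (@lebesgue_rV n)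
  (@lebesgue_rV0 n) (@lebesgue_rV_ge0 n) (@lebesgue_rV_sigma_additive n).

Let lebesgue_rV_sigma_finite n : sigma_finite setT (@lebesgue_rV n).
Proof. by have [m <-] := lebesgue_rV_spec n; exact: sigma_finiteT. Qed.

HB.instance Definition _ n := Measure_isSigmaFinite.Build _ _ _
  (@lebesgue_rV n) (@lebesgue_rV_sigma_finite n).

End lebesgue_rV.

Section multi_indices.
Context (n : nat).
Local Open Scope nat_scope.

Definition mabs (a : {ffun 'I_n -> nat}) : nat := \sum_i a i.

Definition midx (k : nat) : seq {ffun 'I_n -> nat} :=
  [seq a <- [seq [ffun i => val (b i)]
             | b : {ffun 'I_n -> 'I_k.+1} <- enum {: {ffun 'I_n -> 'I_k.+1}}]
     | mabs a <= k].

Lemma mem_midx k a : (a \in midx k) = (mabs a <= k).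
Proof.
rewrite mem_filter andbC; case: (leqP (mabs a) k) => [ak|]; last by rewrite andbF.
rewrite andbT; apply/mapP; exists [ffun i => inord (a i)]; first by rewrite mem_enum.
apply/ffunP => i; rewrite !ffunE /= inordK// ltnS (leq_trans _ ak)//.
by rewrite /mabs (bigD1 i)//= leq_addr.
Qed.

Lemma midx_uniq k : uniq (midx k).
Proof.
apply: filter_uniq; rewrite map_inj_uniq ?enum_uniq// => b c /ffunP bc.
by apply/ffunP => i; apply/val_inj; have := bc i; rewrite !ffunE.
Qed.

End multi_indices.

Section smooth_functions.
Context (R : realType) (n : nat).
Implicit Types (U : set 'rV[R]_n) (f : 'rV[R]_n -> R[i]) (j : 'I_n).

Definition pderiv j f : 'rV[R]_n -> R[i] := fun x =>
  Complex ('D_(delta_mx ord0 j) (fun y => complex.Re (f y)) x)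
          ('D_(delta_mx ord0 j) (fun y => complex.Im (f y)) x).

(* C^oo on the open set U: all iterated partial derivatives exist and are
   continuous. The values of f outside U are irrelevant. *)
Definition smooth U f := forall (s : seq 'I_n) x, U x ->
  let g := foldr pderiv f s in
  [/\ {for x, continuous (fun y => complex.Re (g y))},
      {for x, continuous (fun y => complex.Im (g y))} &
      forall j, derivable (fun y => complex.Re (g y)) x (delta_mx ord0 j) /\
                derivable (fun y => complex.Im (g y)) x (delta_mx ord0 j)].

Definition Dj j f : 'rV[R]_n -> R[i] := fun x => - 'i%C * pderiv j f x.

(* D^a = D_1^(a_1) ... D_n^(a_n) *)
Definition Dmi (a : {ffun 'I_n -> nat}) f : 'rV[R]_n -> R[i] :=
  foldr (fun j g => iter (a j) (Dj j) g) f (enum 'I_n).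

Definition supp f : set 'rV[R]_n := closure [set x | f x != 0].

Definition test_fun U f :=
  [/\ smooth setT f, compact (supp f) & supp f `<=` U].

End smooth_functions.

Section weight_sequences.
Context (R : realType).
Implicit Types M : nat -> R.

Definition Lambda M (k : nat) : R := M k `^ (k%:R^-1).

Definition weight_seq M :=
  [/\ forall k, 0 < M k, M 0%N = 1, 1 <= M 1%N,
      forall k, M k.+1 ^+ 2 <= M k * M k.+2 &
      Lambda M k @[k --> \oo] --> +oo].

Definition admissible M :=
  [/\ weight_seq M,
      exists C h : R, [/\ 0 < C, 0 < h & forall k, k`!%:R <= C * h ^+ k * M k] &
      exists2 A : R, 0 < A &
        forall j k, M (j + k)%N <= A ^+ (j + k) * M j * M k].

(* The Denjoy-Carleman class E^{M}(U) of Roumieu type. *)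
Definition DC_class n M (U : set 'rV[R]_n) (f : 'rV[R]_n -> R[i]) :=
  smooth U f /\
  forall K : set 'rV[R]_n, compact K -> K `<=` U ->
    exists C h : R, [/\ 0 < C, 0 < h &
      forall x a, K x -> Normc.normc (Dmi a f x) <= C * h ^+ mabs a * M (mabs a)].

End weight_sequences.

Section distributions.
Context (R : realType) (n : nat).
Notation fct := ('rV[R]_n -> R[i]).
(* A distribution on U is given by a functional defined on all functions, of
   which only the values on D(U) matter; see is_distr and eq_distr. The
   restriction of u to an open subset of U is thus u itself. *)
Notation functional := (fct -> R[i]).
Implicit Types (U V : set 'rV[R]_n) (f phi : fct) (u v : functional).

Definition is_distr U u :=
  (forall (c : R[i]) phi psi, test_fun U phi -> test_fun U psi ->
     u (fun x => c * phi x + psi x) = c * u phi + u psi) /\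
  (forall K : set 'rV[R]_n, compact K -> K `<=` U ->
     exists (C : R) (m : nat), forall phi, test_fun U phi -> supp phi `<=` K ->
       Normc.normc (u phi) <=
         C * \sum_(a <- midx n m) sup (range (fun x => Normc.normc (Dmi a phi x)))).

Definition eq_distr U u v := forall phi, test_fun U phi -> u phi = v phi.

Definition Ddistr (a : {ffun 'I_n -> nat}) u : functional :=
  fun phi => (-1) ^+ mabs a * u (Dmi a phi).

Definition Mdistr f u : functional := fun phi => u (fun x => f x * phi x).

Definition cintegral U f : R[i] :=
  Complex (\int[@lebesgue_rV R n]_(x in U) complex.Re (f x))
          (\int[@lebesgue_rV R n]_(x in U) complex.Im (f x)).

Definition distr_of U f : functional := fun phi => cintegral U (fun x => f x * phi x).

Definition DC_distr (M : nat -> R) U u :=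
  exists2 f, DC_class M U f & eq_distr U u (distr_of U f).

Definition L2norm U f : \bar R :=
  'N[@lebesgue_rV R n]_2%:E[(fun x => (Normc.normc (f x))%:E) \_ U].

Definition L2fun U f :=
  [/\ measurable_fun U (fun x => complex.Re (f x) : measurableTypeR R),
      measurable_fun U (fun x => complex.Im (f x) : measurableTypeR R) &
      (L2norm U f < +oo)%E].

Definition L2rep U u f := L2fun U f /\ eq_distr U u (distr_of U f).

(* The infimum is over the almost everywhere unique L^2 function representing
   u, and is +oo if there is none. *)
Definition L2norm_distr U u : \bar R := ereal_inf [set L2norm U f | f in L2rep U u].

Definition Sobolev (k : nat) U u :=
  forall a, (mabs a <= k)%N -> exists f, L2rep U (Ddistr a u) f.

Definition Sobolev_norm (k : nat) U u : \bar R :=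
  sqrte (\sum_(a <- midx n k) L2norm_distr U (Ddistr a u) ^+ 2)%E.

Definition weighted_norm (M : nat -> R) (k : nat) U u : \bar R :=
  (\sum_(a <- midx n k)
     (Lambda M k ^+ (k - mabs a))%:E * L2norm_distr U (Ddistr a u))%E.

(* The operator sum_(|a| <= pdo_order) pdo_coef a * D^a; the other values of coef are
   not used. *)
Record pdo := PDO { pdo_order : nat ; pdo_coef : {ffun 'I_n -> nat} -> fct }.

Definition pdo_app (P : pdo) u : functional := fun phi =>
  \sum_(a <- midx n (pdo_order P)) Mdistr (pdo_coef P a) (Ddistr a u) phi.

Definition pdo_DC (M : nat -> R) U (P : pdo) :=
  forall a, (mabs a <= pdo_order P)%N -> DC_class M U (pdo_coef P a).

Definition hypoelliptic (M : nat -> R) (P : pdo) U :=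
  forall u, is_distr U u -> forall V, open V -> V `<=` U ->
    DC_distr M V (pdo_app P u) -> DC_distr M V u.

Definition hypoelliptic_at (M : nat -> R) (P : pdo) (Omega : set 'rV[R]_n)
    (x0 : 'rV[R]_n) :=
  exists U0, [/\ open U0, U0 x0, U0 `<=` Omega & hypoelliptic M P U0].

(* Operators on L^2(U) act on representatives: linearity is required almost
   everywhere, and together with boundedness it makes T compatible with almost
   everywhere equality. *)
Definition L2_operator U (T : fct -> fct) :=
  [/\ forall f, L2fun U f -> L2fun U (T f),
      forall (c : R[i]) f g, L2fun U f -> L2fun U g ->
        {ae @lebesgue_rV R n, forall x, U x ->
          T (fun y => c * f y + g y) x = c * T f x + T g x} &
      exists C : R, forall f, L2fun U f -> (L2norm U (T f) <= C%:E * L2norm U f)%E].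

Definition pdo_right_inverse (P : pdo) U (T : fct -> fct) :=
  forall f, L2fun U f -> eq_distr U (pdo_app P (distr_of U (T f))) (distr_of U f).

Definition rel_compact V U := compact (closure V) /\ closure V `<=` U.

End distributions.

(* Main.v *)
(* Necessity. Hypoellipticity gives, by a sliding hump argument, Denjoy-Carleman bounds for the
   solutions v of P v = e, with e a trigonometric polynomial of controlled growth, which depend
   on v only through its L^2 norm. Given P u = f, multiply f by a cutoff adapted to k
   (Ehrenpreis), expand the product g in a Fourier series, and solve P r_xi = exp(i xi.x) with the
   right inverse. The dyadic blocks of frequencies of size at least Lambda_k of the solution
   u_oo = sum_xi g_xi r_xi are smooth, and each of their first k + 1 derivatives costs one power of
   the frequency: apply the bounds at the order which is optimal for this frequency and
   interpolate. One integration by parts shows that distinct blocks are almost orthogonal, so that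
   u_oo converges in H^k. Finally u - u_oo solves the homogeneous equation where the cutoff is 1,
   so the first step applies to it.

   Sufficiency. The estimates bound the L^2 norm of D^a u by C L^|a| M_|a| near each point.
   With n + 1 more derivatives the Fourier coefficients of a localization of D^a u are summable,
   which gives a smooth representative with the same bounds in sup norm; these local
   representatives glue by uniqueness. *)

From mathcomp Require Import all_boot all_order all_algebra.
From mathcomp Require Import all_classical all_reals all_analysis.
From mathcomp Require Import measurable_realfun.
From mathcomp.real_closed Require Import complex.
From mathcomp Require Import ring lra zify.
Require Import Defs.
Set Implicit Arguments.
Unset Strict Implicit.
Unset Printing Implicit Defensive.
Import Order.TTheory GRing.Theory Num.Theory.
Import numFieldNormedType.Exports.
Local Open Scope classical_set_scope.
Local Open Scope ring_scope.

(** Hypoellipticity speaks only of data in the class, while [P u] has just k derivatives; hence the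
    detour through trigonometric polynomials, which lie in the class with constants read off from
    their frequencies. Counting the frequencies of a block costs a factor N^n, which M_(p+n) <=
    A^(p+n) M_p M_n absorbs. The threshold Lambda_k is dictated by the weights of the norm: above it
    the index that maximizes N^l / M_l exceeds k, so that interpolation between 0 and l reaches the
    order k + 1. Adding the norms of the blocks would require their summability, whereas Bessel
    gives only square summability; so the cross terms must decay, and the derivative moved to obtain
    this decay is the reason why the blocks are estimated up to order k + 1 and not k. The cutoffs
    grow by a factor C (k+1) per derivative because k^q <= C h^k Lambda_k^q for q <= k turns this
    loss into the weights. The right inverse enters through solutions with exponential data whose
    superpositions are bounded in L^2 by the l^2 norm of the coefficients. *)

Notation nc := Normc.normc.
Notation Rec := (@complex.Re _).
Notation Imc := (@complex.Im _).

(** * Complex-valued integrable functions *)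

Section normc_theory.
Context (R : realType).
Implicit Types z w : R[i].

Lemma nc_sqr z : nc z ^+ 2 = Rec z ^+ 2 + Imc z ^+ 2.
Proof. by case: z => a b /=; rewrite sqr_sqrtr// addr_ge0// sqr_ge0. Qed.

Lemma nc_ge0 z : 0 <= nc z.
Proof. by case: z => a b; exact: sqrtr_ge0. Qed.

Lemma nc0 : nc (0 : R[i]) = 0.
Proof. exact: Normc.normc0. Qed.

Lemma nc1 : nc (1 : R[i]) = 1.
Proof. exact: Normc.normc1. Qed.

Lemma ncM z w : nc (z * w) = nc z * nc w.
Proof. exact: Normc.normcM. Qed.

Lemma ncX z k : nc (z ^+ k) = nc z ^+ k.
Proof. by elim: k => [|k IH]; rewrite ?expr0 ?nc1// !exprS ncM IH. Qed.

Lemma ncD z w : nc (z + w) <= nc z + nc w.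
Proof. exact: le_normcD. Qed.

Lemma ncN z : nc (- z) = nc z.
Proof. exact: normcN. Qed.

Lemma ncB z w : nc (z - w) = nc (w - z).
Proof. by rewrite -ncN opprB. Qed.

Lemma nc_eq0 z : nc z = 0 -> z = 0.
Proof. exact: Normc.eq0_normc. Qed.

Lemma ncJ z : nc (conjc z) = nc z.
Proof. by case: z => a b /=; rewrite sqrrN. Qed.

Lemma nc_real (r : R) : nc (r%:C)%C = `|r|.
Proof. by rewrite /= expr0n addr0 sqrtr_sqr. Qed.

Lemma Re_le_nc z : `|Rec z| <= nc z.
Proof.
rewrite -ler_sqr ?nnegrE ?nc_ge0// nc_sqr -normrX ger0_norm ?sqr_ge0//.
by rewrite lerDl sqr_ge0.
Qed.

Lemma Im_le_nc z : `|Imc z| <= nc z.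
Proof.
rewrite -ler_sqr ?nnegrE ?nc_ge0// nc_sqr -normrX ger0_norm ?sqr_ge0//.
by rewrite lerDr sqr_ge0.
Qed.

Lemma nc_le_ReIm z : nc z <= `|Rec z| + `|Imc z|.
Proof.
rewrite -ler_sqr ?nnegrE ?nc_ge0 ?addr_ge0// nc_sqr sqrrD !real_normK ?num_real//.
by rewrite -addrA lerD2l lerDr mulrn_wge0// mulr_ge0.
Qed.

Lemma nc_sum I (r : seq I) (P : pred I) (F : I -> R[i]) :
  nc (\sum_(i <- r | P i) F i) <= \sum_(i <- r | P i) nc (F i).
Proof.
elim/big_ind2 : _ => [|x y z t xy zt|//]; first by rewrite nc0.
by rewrite (le_trans (ncD _ _))// lerD.
Qed.

Lemma nc_prod I (r : seq I) (P : pred I) (F : I -> R[i]) :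
  nc (\prod_(i <- r | P i) F i) = \prod_(i <- r | P i) nc (F i).
Proof.
elim/big_ind2 : _ => [|x y z t xy zt|//]; first by rewrite nc1.
by rewrite ncM xy zt.
Qed.

Lemma ReD z w : Rec (z + w) = Rec z + Rec w. Proof. by case: z w => [a b] [c e]. Qed.
Lemma ImD z w : Imc (z + w) = Imc z + Imc w. Proof. by case: z w => [a b] [c e]. Qed.
Lemma ReN z : Rec (- z) = - Rec z. Proof. by case: z => [a b]. Qed.
Lemma ImN z : Imc (- z) = - Imc z. Proof. by case: z => [a b]. Qed.
Lemma cReM z w : Rec (z * w) = Rec z * Rec w - Imc z * Imc w.
Proof. by case: z w => [a b] [c e]. Qed.
Lemma cImM z w : Imc (z * w) = Rec z * Imc w + Imc z * Rec w.
Proof. by case: z w => [a b] [c e]. Qed.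
Lemma ReJ z : Rec (conjc z) = Rec z. Proof. by case: z. Qed.
Lemma ImJ z : Imc (conjc z) = - Imc z. Proof. by case: z. Qed.

Lemma mulcJ z : z * conjc z = (nc z ^+ 2)%:C%C.
Proof.
rewrite nc_sqr; case: z => a b; apply/eqP; rewrite eq_complex/= ; apply/andP.
by split; apply/eqP; ring.
Qed.

Lemma eq_cplx z w : Rec z = Rec w -> Imc z = Imc w -> z = w.
Proof. by case: z w => [a b] [c e] /= -> ->. Qed.

End normc_theory.

Section complex_integral.
Context d (T : measurableType d) (R : realType).
Variable mu : {measure set T -> \bar R}.
Implicit Types f g : T -> R[i].

Definition cmeas f := measurable_fun setT (Rec \o f) /\ measurable_fun setT (Imc \o f).

Definition cintegrable f :=
  mu.-integrable setT (EFin \o (Rec \o f)) /\ mu.-integrable setT (EFin \o (Imc \o f)).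

Definition cint f : R[i] :=
  Complex (\int[mu]_x Rec (f x)) (\int[mu]_x Imc (f x)).

Lemma cmeasM f g : cmeas f -> cmeas g -> cmeas (fun x => f x * g x).
Proof.
move=> [f1 f2] [g1 g2]; split.
  rewrite (_ : _ \o _ = (fun x => (Rec \o f) x * (Rec \o g) x - (Imc \o f) x * (Imc \o g) x)).
    by apply: measurable_funB; exact: measurable_funM.
  by apply/funext => x /=; rewrite cReM.
rewrite (_ : _ \o _ = (fun x => (Rec \o f) x * (Imc \o g) x + (Imc \o f) x * (Rec \o g) x)).
  by apply: measurable_funD; exact: measurable_funM.
by apply/funext => x /=; rewrite cImM.
Qed.

Lemma cmeasD f g : cmeas f -> cmeas g -> cmeas (fun x => f x + g x).
Proof.
move=> [f1 f2] [g1 g2]; split.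
  rewrite (_ : _ \o _ = (Rec \o f) \+ (Rec \o g)); first exact: measurable_funD.
  by apply/funext => x /=; rewrite ReD.
rewrite (_ : _ \o _ = (Imc \o f) \+ (Imc \o g)); first exact: measurable_funD.
by apply/funext => x /=; rewrite ImD.
Qed.

Lemma cmeasN f : cmeas f -> cmeas (fun x => - f x).
Proof.
move=> [f1 f2]; split.
  rewrite (_ : _ \o _ = (\- (Rec \o f))); first exact: measurable_funN.
  by apply/funext => x /=; rewrite ReN.
rewrite (_ : _ \o _ = (\- (Imc \o f))); first exact: measurable_funN.
by apply/funext => x /=; rewrite ImN.
Qed.

Lemma cmeas_cst (c : R[i]) : cmeas (fun=> c).
Proof. by split; exact: measurable_cst. Qed.

Lemma cmeasJ f : cmeas f -> cmeas (fun x => conjc (f x)).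
Proof.
move=> [f1 f2]; split.
  by rewrite (_ : _ \o _ = Rec \o f)//; apply/funext => x /=; rewrite ReJ.
rewrite (_ : _ \o _ = (\- (Imc \o f))); first exact: measurable_funN.
by apply/funext => x /=; rewrite ImJ.
Qed.

Lemma cmeas_nc f : cmeas f -> measurable_fun setT (fun x => nc (f x)).
Proof.
move=> [f1 f2]; rewrite (_ : (fun _ => _) =
  (@Num.sqrt R) \o (fun x => (Rec \o f) x ^+ 2 + (Imc \o f) x ^+ 2)); last first.
  by apply/funext => x /=; case: (f x).
apply: measurableT_comp.
  by apply: continuous_measurable_fun; exact: sqrt_continuous.
by apply: measurable_funD; exact: measurable_funX.
Qed.

Lemma cintegrable_meas f : cintegrable f -> cmeas f.
Proof.
by move=> [/measurable_int/measurable_EFinP ? /measurable_int/measurable_EFinP ?].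
Qed.

Lemma cintegrable_le f (g : T -> R) : cmeas f -> mu.-integrable setT (EFin \o g) ->
  (forall x, nc (f x) <= g x) -> cintegrable f.
Proof.
move=> [f1 f2] ig fg; split; apply: (le_integrable _ _ _ ig) => //.
- exact/measurable_EFinP.
- move=> x _ /=; rewrite lee_fin (le_trans (Re_le_nc _))// (le_trans (fg x))//.
  exact: ler_norm.
- exact/measurable_EFinP.
- move=> x _ /=; rewrite lee_fin (le_trans (Im_le_nc _))// (le_trans (fg x))//.
  exact: ler_norm.
Qed.

Lemma cintegrable_nc f : cintegrable f -> mu.-integrable setT (EFin \o (fun x => nc (f x))).
Proof.
move=> cf; have [i1 i2] := cf.
have := integrableD measurableT (integrable_abse i1) (integrable_abse i2).
apply: le_integrable => //.
  by apply/measurable_EFinP/cmeas_nc/cintegrable_meas.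
move=> x _ /=; rewrite lee_fin ger0_norm ?nc_ge0// (le_trans (nc_le_ReIm _))//.
exact: ler_norm.
Qed.

Lemma integrableDR (f g : T -> R) : mu.-integrable setT (EFin \o f) ->
  mu.-integrable setT (EFin \o g) -> mu.-integrable setT (EFin \o (fun x => f x + g x)).
Proof. by move=> i j; have := integrableD measurableT i j; exact. Qed.

Lemma integrable_indicR (A : set T) : measurable A -> (mu A < +oo)%E ->
  mu.-integrable setT (EFin \o \1_A).
Proof.
move=> mA Aoo; apply/integrableP; split; first exact/measurable_EFinP/measurable_indic.
rewrite (eq_integral (fun x => (\1_A x)%:E)); last by move=> t _ /=; rewrite ger0_norm.
by rewrite integral_indic// setIT.
Qed.

Lemma cintegrableD f g : cintegrable f -> cintegrable g -> cintegrable (fun x => f x + g x).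
Proof.
move=> cf cg; have := integrableDR (cintegrable_nc cf) (cintegrable_nc cg).
move=> h; apply: (cintegrable_le _ h) => [|x]; last exact: ncD.
by apply: cmeasD; exact: cintegrable_meas.
Qed.

Lemma integrableZR (k : R) (f : T -> R) : mu.-integrable setT (EFin \o f) ->
  mu.-integrable setT (EFin \o (fun x => k * f x)).
Proof. by move=> i; have := integrableZl measurableT k i; exact. Qed.

Lemma cintegrableZ (c : R[i]) f : cintegrable f -> cintegrable (fun x => c * f x).
Proof.
move=> cf; have := integrableZR (nc c) (cintegrable_nc cf).
move=> h; apply: (cintegrable_le _ h) => [|x]; last by rewrite ncM.
by apply: cmeasM; [exact: cmeas_cst|exact: cintegrable_meas].
Qed.

Lemma cintegrable0 : cintegrable (fun=> 0).
Proof.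
by split; rewrite (_ : EFin \o _ = cst 0%E)//; exact: integrable0.
Qed.

Lemma cintD f g : cintegrable f -> cintegrable g ->
  cint (fun x => f x + g x) = cint f + cint g.
Proof.
move=> [f1 f2] [g1 g2]; apply: eq_cplx => /=.
  under eq_Rintegral do rewrite ReD.
  by rewrite RintegralD// ReD.
under eq_Rintegral do rewrite ImD.
by rewrite RintegralD// ImD.
Qed.

Lemma cintZ (c : R[i]) f : cintegrable f -> cint (fun x => c * f x) = c * cint f.
Proof.
move=> [f1 f2]; apply: eq_cplx.
  rewrite cReM /=; under eq_Rintegral do rewrite cReM.
  by rewrite RintegralB ?RintegralZl//; exact: integrableZR.
rewrite cImM /=; under eq_Rintegral do rewrite cImM.
by rewrite RintegralD ?RintegralZl//; exact: integrableZR.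
Qed.

Lemma cint0 : cint (fun=> 0) = 0.
Proof. by apply: eq_cplx => /=; rewrite Rintegral_cst// mul0r. Qed.

Lemma cintN f : cintegrable f -> cint (fun x => - f x) = - cint f.
Proof.
move=> cf; rewrite -mulN1r -cintZ//; congr cint; apply/funext => x.
by rewrite mulN1r.
Qed.

Lemma cintegrableN f : cintegrable f -> cintegrable (fun x => - f x).
Proof.
move=> cf; rewrite (_ : (fun _ => _) = (fun x => -1 * f x)); first exact: cintegrableZ.
by apply/funext => x; rewrite mulN1r.
Qed.

Lemma cintB f g : cintegrable f -> cintegrable g ->
  cint (fun x => f x - g x) = cint f - cint g.
Proof. by move=> cf cg; rewrite cintD ?cintN//; exact: cintegrableN. Qed.

Lemma cintegrable_sum I (s : seq I) (F : I -> T -> R[i]) :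
  (forall i, cintegrable (F i)) -> cintegrable (fun x => \sum_(i <- s) F i x).
Proof.
move=> cF; elim: s => [|i s IH].
  by under eq_fun do rewrite big_nil; exact: cintegrable0.
by under eq_fun do rewrite big_cons; exact: cintegrableD.
Qed.

Lemma cint_sum I (s : seq I) (F : I -> T -> R[i]) : (forall i, cintegrable (F i)) ->
  cint (fun x => \sum_(i <- s) F i x) = \sum_(i <- s) cint (F i).
Proof.
move=> cF; elim: s => [|i s IH].
  by under eq_fun do rewrite big_nil; rewrite cint0 big_nil.
under eq_fun do rewrite big_cons; rewrite cintD//; last exact: cintegrable_sum.
by rewrite IH big_cons.
Qed.

Lemma cintJ f : cintegrable f -> cint (fun x => conjc (f x)) = conjc (cint f).
Proof.
move=> [f1 f2]; apply: eq_cplx; rewrite ?ReJ ?ImJ /=.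
  by under eq_Rintegral do rewrite ReJ.
under eq_Rintegral do rewrite ImJ -mulN1r.
by rewrite RintegralZl// mulN1r.
Qed.

(** Multiplying by the conjugate of the integral z makes the integral real: |z|^2 is the real part
    of the integral of conj(z) f, which is at most |z| times the integral of |f|. *)
Lemma nc_cint f : cintegrable f -> nc (cint f) <= \int[mu]_x nc (f x).
Proof.
move=> cf; move zE : (cint f) => z; have cn := cintegrable_nc cf.
have [->|z0] := eqVneq (nc z) 0; first by apply: Rintegral_ge0 => x _; exact: nc_ge0.
have zp : 0 < nc z by rewrite lt_neqAle eq_sym z0 nc_ge0.
rewrite -(ler_pM2l zp) -expr2.
have -> : nc z ^+ 2 = Rec (cint (fun x => conjc z * f x)).
  by rewrite cintZ// zE mulrC mulcJ.
have [i1 i2] := cintegrableZ (conjc z) cf.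
rewrite -RintegralZl//=; apply: le_Rintegral => //.
  exact: integrableZR.
by move=> x _; rewrite (le_trans (ler_norm _))// (le_trans (Re_le_nc _))// ncM ncJ.
Qed.

Lemma cint_real (f : T -> R) : cint (fun x => (f x)%:C%C) = (\int[mu]_x f x)%:C%C.
Proof. by apply: eq_cplx => //=; rewrite Rintegral_cst// mul0r. Qed.

End complex_integral.

(** * Square integrable functions, Cauchy-Schwarz and completeness *)

Section L2_theory.
Context d (T : measurableType d) (R : realType).
Variable mu : {measure set T -> \bar R}.
Implicit Types f g h : T -> R[i].

Definition L2 f := cmeas f /\ mu.-integrable setT (EFin \o (fun x => nc (f x) ^+ 2)).

Definition l2 f : R := Num.sqrt (\int[mu]_x (nc (f x) ^+ 2)).

Lemma l2_ge0 f : 0 <= l2 f. Proof. exact: sqrtr_ge0. Qed.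

Lemma l2_sqr f : l2 f ^+ 2 = \int[mu]_x (nc (f x) ^+ 2).
Proof. by rewrite sqr_sqrtr// Rintegral_ge0// => x _; rewrite sqr_ge0. Qed.

Lemma L2_le f g : cmeas f -> L2 g -> (forall x, nc (f x) <= nc (g x)) -> L2 f.
Proof.
move=> mf [mg ig] fg; split=> //; apply: le_integrable ig => //.
  by apply/measurable_EFinP/measurable_funX/cmeas_nc.
move=> x _ /=; rewrite lee_fin !ger0_norm ?sqr_ge0//.
by rewrite ler_pXn2r ?nnegrE ?nc_ge0.
Qed.

Lemma l2_le f g : L2 f -> L2 g -> (forall x, nc (f x) <= nc (g x)) -> l2 f <= l2 g.
Proof.
move=> [mf jf] [mg jg] fg; apply: ler_wsqrtr; apply: le_Rintegral => // x _.
by rewrite ler_pXn2r ?nnegrE ?nc_ge0.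
Qed.

Lemma L2Z (c : R[i]) f : L2 f -> L2 (fun x => c * f x).
Proof.
move=> [mf jf]; split; first by apply: cmeasM => //; exact: cmeas_cst.
rewrite (_ : EFin \o _ = EFin \o (fun x => nc c ^+ 2 * nc (f x) ^+ 2)).
  exact: integrableZR.
by apply/funext => x /=; rewrite ncM exprMn.
Qed.

Lemma l2Z (c : R[i]) f : L2 f -> l2 (fun x => c * f x) = nc c * l2 f.
Proof.
move=> [mf jf]; rewrite /l2; under eq_Rintegral do rewrite ncM exprMn.
by rewrite RintegralZl// sqrtrM ?sqr_ge0// sqrtr_sqr ger0_norm// nc_ge0.
Qed.

Lemma L2_cintegrableM f g : L2 f -> L2 g -> cintegrable mu (fun x => f x * g x).
Proof.
move=> [mf jf] [mg jg]; have := integrableDR jf jg.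
move=> h; apply: (cintegrable_le _ h) => [|x]; first exact: cmeasM.
rewrite ncM; have := nc_ge0 (f x); have := nc_ge0 (g x); nra.
Qed.

Lemma L2D f g : L2 f -> L2 g -> L2 (fun x => f x + g x).
Proof.
move=> [mf jf] [mg jg]; split; first exact: cmeasD.
have := integrableD measurableT (integrableZR 2 jf) (integrableZR 2 jg).
apply: le_integrable => //.
  by apply/measurable_EFinP/measurable_funX/cmeas_nc; exact: cmeasD.
move=> x _ /=; rewrite lee_fin ger0_norm ?sqr_ge0//.
apply: le_trans (ler_norm _).
have h := ncD (f x) (g x).
have : nc (f x + g x) ^+ 2 <= (nc (f x) + nc (g x)) ^+ 2.
  by rewrite ler_pXn2r ?nnegrE ?addr_ge0 ?nc_ge0.
have := sqr_ge0 (nc (f x) - nc (g x)).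
nra.
Qed.

Lemma L2N f : L2 f -> L2 (fun x => - f x).
Proof.
move=> h; rewrite (_ : (fun _ => _) = (fun x => -1 * f x)); first exact: L2Z.
by apply/funext => x; rewrite mulN1r.
Qed.

Lemma L2B f g : L2 f -> L2 g -> L2 (fun x => f x - g x).
Proof. by move=> hf hg; apply: L2D => //; exact: L2N. Qed.

Lemma L2_0 : L2 (fun=> 0).
Proof.
split; first exact: cmeas_cst.
by rewrite (_ : EFin \o _ = cst 0%E); [exact: integrable0|apply/funext => x; rewrite /comp nc0 expr0n].
Qed.

Lemma L2_sum I (s : seq I) (F : I -> T -> R[i]) :
  (forall i, L2 (F i)) -> L2 (fun x => \sum_(i <- s) F i x).
Proof.
move=> cF; elim: s => [|i s IH].
  by under eq_fun do rewrite big_nil; exact: L2_0.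
by under eq_fun do rewrite big_cons; exact: L2D.
Qed.

Lemma L2J f : L2 f -> L2 (fun x => conjc (f x)).
Proof.
move=> h; have [mf _] := h; apply: L2_le h _; first exact: cmeasJ.
by move=> x; rewrite ncJ.
Qed.

Lemma l2J f : l2 (fun x => conjc (f x)) = l2 f.
Proof. by rewrite /l2; under eq_Rintegral do rewrite ncJ. Qed.

Lemma l2N f : l2 (fun x => - f x) = l2 f.
Proof. by rewrite /l2; under eq_Rintegral do rewrite ncN. Qed.

Lemma l2_0 : l2 (fun=> 0) = 0.
Proof. by rewrite /l2 Rintegral_cst// nc0 expr0n mul0r sqrtr0. Qed.

(** The conclusion is the infimum over [t] of the upper bound, attained at t = b / a. If [a] or [b]
    vanishes the infimum is only approached, for t tending to infinity or to 0, hence the margin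
    [e]. Cauchy-Schwarz follows by integrating the weighted mean inequality. *)
Lemma quadratic_bound (a b x : R) : 0 <= a -> 0 <= b ->
  (forall t, 0 < t -> 2 * x <= t * a ^+ 2 + b ^+ 2 / t) -> x <= a * b.
Proof.
move=> a0 b0 h; apply/ler_addgt0Pr => e e0.
have [a0'|an0] := eqVneq a 0.
  have := h ((b ^+ 2 + 1) / e); rewrite divr_gt0// ?ltr_wpDl ?sqr_ge0//.
  move=> /(_ isT); rewrite a0' expr0n mulr0 add0r mul0r add0r invf_div => h1.
  have h2 : b ^+ 2 * (e / (b ^+ 2 + 1)) <= e.
    rewrite mulrA ler_pdivrMr ?ltr_wpDl ?sqr_ge0//; have := sqr_ge0 b; nra.
  lra.
have [b0'|bn0] := eqVneq b 0.
  have := h (e / (a ^+ 2 + 1)); rewrite divr_gt0// ?ltr_wpDl ?sqr_ge0//.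
  move=> /(_ isT); rewrite b0' expr0n mul0r addr0 mulr0 add0r => h1.
  have h2 : (e / (a ^+ 2 + 1)) * a ^+ 2 <= e.
    rewrite mulrAC ler_pdivrMr ?ltr_wpDl ?sqr_ge0//; have := sqr_ge0 a; nra.
  lra.
have ap : 0 < a by rewrite lt_neqAle eq_sym an0.
have bp : 0 < b by rewrite lt_neqAle eq_sym bn0.
have := h (b / a); rewrite divr_gt0// => /(_ isT).
have -> : b / a * a ^+ 2 + b ^+ 2 / (b / a) = 2 * (a * b).
  by field; rewrite an0 bn0.
lra.
Qed.

Lemma int_nc_prod_le f g : L2 f -> L2 g ->
  \int[mu]_x (nc (f x) * nc (g x)) <= l2 f * l2 g.
Proof.
move=> Lf Lg; apply: quadratic_bound; rewrite ?l2_ge0// => t t0.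
rewrite !l2_sqr; have [mf jf] := Lf; have [mg jg] := Lg.
have ifg := cintegrable_nc (L2_cintegrableM Lf Lg).
rewrite (_ : (fun x => nc (f x * g x)) = (fun x => nc (f x) * nc (g x))) in ifg; last first.
  by apply/funext => x; rewrite ncM.
rewrite [_ / t]mulrC -!RintegralZl// -RintegralD//; try exact: integrableZR.
apply: le_Rintegral => //.
- exact: integrableZR.
- have := integrableD measurableT (integrableZR t jf) (integrableZR t^-1 jg).
  exact.
move=> x _.
have : 0 <= t * (nc (f x) - nc (g x) / t) ^+ 2 by rewrite mulr_ge0 ?sqr_ge0// ltW.
have -> : t * (nc (f x) - nc (g x) / t) ^+ 2 =
  t * nc (f x) ^+ 2 + t^-1 * nc (g x) ^+ 2 - 2 * (nc (f x) * nc (g x)).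
  by field; rewrite gt_eqF.
by rewrite subr_ge0.
Qed.

Lemma cauchy_schwarz f g : L2 f -> L2 g -> nc (cint mu (fun x => f x * g x)) <= l2 f * l2 g.
Proof.
move=> Lf Lg; apply: le_trans (nc_cint (L2_cintegrableM Lf Lg)) _.
under eq_Rintegral do rewrite ncM.
exact: int_nc_prod_le.
Qed.

Lemma l2D f g : L2 f -> L2 g -> l2 (fun x => f x + g x) <= l2 f + l2 g.
Proof.
move=> Lf Lg; rewrite -ler_sqr ?nnegrE ?addr_ge0 ?l2_ge0//.
rewrite sqrrD !l2_sqr; have [mf jf] := Lf; have [mg jg] := Lg.
have ifg := cintegrable_nc (L2_cintegrableM Lf Lg).
rewrite (_ : (fun x => nc (f x * g x)) = (fun x => nc (f x) * nc (g x))) in ifg; last first.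
  by apply/funext => x; rewrite ncM.
have [_ jfg] := L2D Lf Lg.
have i2 := integrableD measurableT (integrableD measurableT jf (integrableZR 2 ifg)) jg.
apply: le_trans (_ : \int[mu]_x (nc (f x) ^+ 2 + 2 * (nc (f x) * nc (g x)) + nc (g x) ^+ 2) <= _).
  apply: le_Rintegral => // x _.
  have : nc (f x + g x) ^+ 2 <= (nc (f x) + nc (g x)) ^+ 2.
    by rewrite ler_pXn2r ?nnegrE ?addr_ge0 ?nc_ge0 ?ncD.
  by move=> /le_trans; apply; rewrite sqrrD mulr_natl.
rewrite RintegralD//; last exact: (integrableD measurableT jf (integrableZR 2 ifg)).
rewrite RintegralD ?RintegralZl//; last exact: integrableZR.
by rewrite lerD2r lerD2l -[leRHS]mulr_natl ler_pM2l// int_nc_prod_le.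
Qed.

Lemma l2_sum I (s : seq I) (F : I -> T -> R[i]) : (forall i, L2 (F i)) ->
  l2 (fun x => \sum_(i <- s) F i x) <= \sum_(i <- s) l2 (F i).
Proof.
move=> cF; elim: s => [|i s IH].
  by under eq_fun do rewrite big_nil; rewrite big_nil l2_0.
under eq_fun do rewrite big_cons; rewrite big_cons.
by apply: le_trans (l2D _ _) _ => //; [exact: L2_sum|rewrite lerD2l].
Qed.

Lemma l2_dist f g : L2 f -> L2 g -> l2 f <= l2 g + l2 (fun x => f x - g x).
Proof.
move=> Lf Lg; apply: le_trans (l2D Lg (L2B Lf Lg)).
by rewrite (_ : (fun x => g x + (f x - g x)) = f)//; apply/funext => x; rewrite addrC subrK.
Qed.

Lemma L2_bounded f (B : R) (A : set T) : measurable A -> (mu A < +oo)%E ->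
  cmeas f -> (forall x, A x -> nc (f x) <= B) -> (forall x, ~ A x -> f x = 0) ->
  L2 f /\ l2 f <= B * Num.sqrt (fine (mu A)).
Proof.
move=> mA Aoo mf fB f0.
have iA : mu.-integrable setT (EFin \o (fun x => B ^+ 2 * \1_A x)).
  by apply: integrableZR; exact: integrable_indicR.
have h x : nc (f x) ^+ 2 <= B ^+ 2 * \1_A x.
  rewrite indicE; have [/[!inE] xA|/negP xA] := boolP (x \in A).
    by rewrite mulr1 ler_pXn2r ?nnegrE ?nc_ge0 ?fB// (le_trans _ (fB _ xA))// nc_ge0.
  by rewrite f0 ?nc0 ?expr0n ?mulr0//; rewrite inE in xA.
have Lf : L2 f.
  split=> //; apply: le_integrable iA => //.
    by apply/measurable_EFinP/measurable_funX/cmeas_nc.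
  by move=> x _ /=; rewrite lee_fin ger0_norm ?sqr_ge0// (le_trans (h x))// ler_norm.
(* [B] may be negative when [A] is empty. *)
split=> //; have [A0|/set0P[x0 Ax0]] := eqVneq A set0.
  rewrite A0 measure0 /= sqrtr0 mulr0 -(l2_0) (_ : f = fun=> 0)//.
  by apply/funext => x; apply: f0; rewrite A0.
have B0 : 0 <= B by exact: le_trans (nc_ge0 _) (fB _ Ax0).
rewrite -[B in leRHS]ger0_norm// -sqrtr_sqr -sqrtrM ?sqr_ge0//.
apply: ler_wsqrtr; apply: le_trans (_ : \int[mu]_x (B ^+ 2 * \1_A x) <= _).
  by apply: le_Rintegral => //; case: Lf.
rewrite RintegralZl//; last exact: integrable_indicR.
by rewrite /Rintegral integral_indic// setIT.
Qed.

Lemma L2_mulb f g (B : R) : cmeas g -> (forall x, nc (g x) <= B) -> L2 f ->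
  L2 (fun x => g x * f x) /\ l2 (fun x => g x * f x) <= B * l2 f.
Proof.
move=> mg gB Lf; have [mf _] := Lf; have [B0|Bn0] := leP 0 B; last first.
  split; last first.
    have h (x : T) : False by have := gB x; have := nc_ge0 (g x); lra.
    have e (k : T -> R[i]) : l2 k = 0.
      by rewrite -(l2_0); congr l2; apply/funext => x; case: (h x).
    by rewrite !e mulr0.
  apply: (L2_le _ (L2Z 0 Lf)); first exact: cmeasM.
  by move=> x; have := gB x; have := nc_ge0 (g x); lra.
have h x : nc (g x * f x) <= nc (B%:C%C * f x).
  by rewrite !ncM nc_real ger0_norm// ler_wpM2r ?nc_ge0.
have L1 : L2 (fun x => g x * f x) by apply: L2_le (L2Z B%:C%C Lf) h; exact: cmeasM.
split=> //; apply: le_trans (l2_le L1 (L2Z _ Lf) h) _.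
by rewrite l2Z// nc_real ger0_norm.
Qed.

End L2_theory.

Section L2_complete.
Context d (T : measurableType d) (R : realType).
Variable mu : {measure set T -> \bar R}.
Implicit Types f g h : T -> R[i].

Lemma cmeas_real (f : T -> R) : measurable_fun setT f -> cmeas (fun x => (f x)%:C%C).
Proof. by move=> mf; split => //; exact: measurable_cst. Qed.

(** The upper limit is a candidate for the limit that is measurable before any convergence is
    known. *)
Lemma measurable_fine_esup (u : nat -> T -> R) : (forall k, measurable_fun setT (u k)) ->
  measurable_fun setT (fun x => fine (limn_esup (fun k => (u k x)%:E))).
Proof.
move=> mu_; apply: (@measurableT_comp _ _ _ _ _ _ fine); first exact: fine_measurable.
by apply: measurable_fun_limn_esup => k; exact/measurable_EFinP.
Qed.

Lemma fine_esup_cvg (u : nat -> R) : cvgn u -> u @ \oo --> fine (limn_esup (fun k => (u k)%:E)).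
Proof.
move=> cu; have h : (fun k => (u k)%:E) @ \oo --> (limn u)%:E.
  by apply: cvg_EFin; [exact: nearW|exact: cu].
by rewrite is_cvg_limn_esupE; [rewrite (cvg_lim _ h)|apply: cvgP h].
Qed.

Lemma abs_telescope_cvg (u a : nat -> R) : (forall k, `|u k.+1 - u k| <= a k) ->
  has_ubound (range (series a)) -> cvgn u.
Proof.
move=> ua ub.
have a0 k : 0 <= a k by exact: le_trans (normr_ge0 _) (ua k).
have ca : cvgn (series a).
  by apply: nondecreasing_is_cvgn => //; apply: nondecreasing_series => k _ _.
have cs : cvgn (series (telescope u)).
  apply: normed_cvg; apply: (series_le_cvg _ _ _ ca) => // k; exact: normr_ge0.
rewrite telescopeK in cs.
have -> : u = (fun n => (u n - u 0%N) + u 0%N) by apply/funext => n; rewrite subrK.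
by apply: is_cvgD => //; exact: is_cvg_cst.
Qed.

(** Riesz-Fischer: along a subsequence with consecutive differences at most 2^-k, monotone
    convergence bounds the sum of the absolute differences in L^2, so this sum is finite almost
    everywhere. Fatou's lemma then transfers the Cauchy bounds to the limit. *)
Lemma l2_complete (F : nat -> T -> R[i]) : (forall m, L2 mu (F m)) ->
  (forall e, 0 < e -> exists N, forall p q, (N <= p)%N -> (N <= q)%N ->
     l2 mu (fun x => F p x - F q x) <= e) ->
  exists2 f, L2 mu f & forall e, 0 < e -> exists N, forall p, (N <= p)%N ->
     l2 mu (fun x => F p x - f x) <= e.
Proof.
move=> LF cF.
have pk (k : nat) : 0 < (2^-1 : R) ^+ k by rewrite exprn_gt0// invr_gt0.
have [N0 N0P] := choice (fun k => cF _ (pk k)).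
(* The maximum makes [n k] exceed [N0 i] for all i <= k, not only for i = k. *)
pose n k := (k + \max_(i < k.+1) N0 i)%N.
have nge k j : (k <= j)%N -> (N0 k <= n j)%N.
  rewrite -ltnS => kj; apply: leq_trans (leq_addl _ _).
  exact: (@leq_bigmax _ (fun i : 'I_j.+1 => N0 i) (Ordinal kj)).
pose D k x := F (n k.+1) x - F (n k) x.
pose a k x := nc (D k x).
have LD k : L2 mu (D k) by apply: L2B.
have La k : L2 mu (fun x => (a k x)%:C%C).
  apply: L2_le (LD k) _; first by apply/cmeas_real/cmeas_nc; case: (LD k).
  by move=> x; rewrite nc_real ger0_norm// nc_ge0.
have la k : l2 mu (fun x => (a k x)%:C%C) <= 2^-1 ^+ k.
  apply: le_trans (N0P k (n k.+1) (n k) _ _); rewrite ?nge//.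
  by apply: l2_le => //; [exact: L2B|move=> x; rewrite nc_real ger0_norm// nc_ge0].
pose S K x := \sum_(k < K) a k x.
have S0 K x : 0 <= S K x by apply: sumr_ge0 => i _; exact: nc_ge0.
have LS K : L2 mu (fun x => (S K x)%:C%C).
  rewrite (_ : (fun _ => _) = fun x => \sum_(k < K) (a k x)%:C%C); first exact: L2_sum.
  by apply/funext => x; rewrite /S rmorph_sum.
have mS K : measurable_fun setT (S K) by have [[]] := LS K.
have geo K : \sum_(k < K) (2^-1 : R) ^+ k <= 2.
  suff -> : \sum_(k < K) (2^-1 : R) ^+ k = 2 - 2 * 2^-1 ^+ K.
    by rewrite gerBl mulr_ge0// ltW.
  elim: K => [|K IH]; first by rewrite big_ord0 expr0; lra.
  by rewrite big_ord_recr/= IH exprS; lra.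
have lS K : \int[mu]_x (S K x ^+ 2) <= 4.
  have : l2 mu (fun x => (S K x)%:C%C) <= 2.
    apply: le_trans (geo K).
    rewrite (_ : (fun _ => _) = fun x => \sum_(k < K) (a k x)%:C%C); last first.
      by apply/funext => x; rewrite /S rmorph_sum.
    by apply: le_trans (l2_sum _ _) _ => //; apply: ler_sum.
  move=> h; have -> : \int[mu]_x (S K x ^+ 2) = l2 mu (fun x => (S K x)%:C%C) ^+ 2.
    by rewrite l2_sqr; apply: eq_Rintegral => x _; rewrite nc_real ger0_norm.
  by have := l2_ge0 mu (fun x => (S K x)%:C%C); nra.
have iS K : (\int[mu]_x (S K x ^+ 2)%:E <= 4%:E)%E.
  have [_ /integrable_fin_num i2] := LS K.
  have := lS K; rewrite /Rintegral -lee_fin fineK//.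
  have := i2 measurableT; congr (_ \is a fin_num); apply: eq_integral => x _ /=.
  by rewrite -/(S K x) expr0n addr0 sqrtr_sqr ger0_norm.
pose G x := limn (fun K => (S K x ^+ 2)%:E).
have ndS x : nondecreasing_seq (fun K => (S K x ^+ 2)%:E).
  move=> K K' KK'; rewrite lee_fin ler_pXn2r ?nnegrE//.
  rewrite -(subnKC KK') /S big_split_ord/= lerDl.
  by apply: sumr_ge0 => i _; exact: nc_ge0.
have mS2 K : measurable_fun setT (fun x => (S K x ^+ 2)%:E).
  exact/measurable_EFinP/measurable_funX.
have iG : (\int[mu]_x G x <= 4%:E)%E.
  rewrite /G monotone_convergence//; last by move=> K x _; rewrite lee_fin sqr_ge0.
  apply: lime_le; last exact: nearW.
  apply: ereal_nondecreasing_is_cvgn => K K' KK'; apply: ge0_le_integral => //.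
  - by move=> x _; rewrite lee_fin sqr_ge0.
  - by move=> x _; exact: ndS.
have G0 x : (0 <= G x)%E.
  apply: lime_ge; first exact: ereal_nondecreasing_is_cvgn.
  by apply: nearW => K; rewrite lee_fin sqr_ge0.
have mG : measurable_fun setT G.
  apply: emeasurable_fun_cvg mS2 _ => x _.
  exact: ereal_nondecreasing_is_cvgn.
have IG : mu.-integrable setT G.
  apply/integrableP; split => //; under eq_integral do rewrite gee0_abs//.
  exact: le_lt_trans iG (ltry _).
have aeG := integrable_ae measurableT IG.
have cvS x : G x \is a fin_num -> has_ubound (range (series (a^~ x))).
  move=> Gx; exists (fine (G x) + 1) => _ [K _ <-].
  have : ((S K x ^+ 2)%:E <= G x)%E.
    apply: lime_ge; first exact: ereal_nondecreasing_is_cvgn.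
    by exists K => // K' /= KK'; exact: ndS.
  rewrite -(fineK Gx) lee_fin /series /= big_mkord -/(S K x) => h.
  by have := S0 K x; nra.
pose f x : R[i] := Complex (fine (limn_esup (fun k => (Rec (F (n k) x))%:E)))
  (fine (limn_esup (fun k => (Imc (F (n k) x))%:E))).
have mf : cmeas f.
  by split; apply: measurable_fine_esup => k; have [[]] := LF (n k).
have cf x : G x \is a fin_num -> (Rec (F (n k) x) @[k --> \oo] --> Rec (f x)) /\
    (Imc (F (n k) x) @[k --> \oo] --> Imc (f x)).
  move=> /cvS ub; split; apply: fine_esup_cvg; apply: abs_telescope_cvg ub => k.
    by rewrite -ReN -ReD; exact: Re_le_nc.
  by rewrite -ImN -ImD; exact: Im_le_nc.
have key e p : 0 < e -> (forall q, (p <= q)%N -> l2 mu (fun x => F p x - F q x) <= e) ->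
    L2 mu (fun x => F p x - f x) /\ l2 mu (fun x => F p x - f x) <= e.
  move=> e0 he.
  have mpf : cmeas (fun x => F p x - f x).
    by apply: cmeasD; [case: (LF p)|exact: cmeasN].
  pose h k x := (nc (F p x - F (n k) x) ^+ 2)%:E.
  have Lpq k : L2 mu (fun x => F p x - F (n k) x) by exact: L2B.
  have mh k : measurable_fun setT (h k).
    by apply/measurable_EFinP/measurable_funX/cmeas_nc; case: (Lpq k).
  have h0 k x : setT x -> (0 <= h k x)%E by rewrite lee_fin sqr_ge0.
  have hlim x : G x \is a fin_num -> h ^~ x @ \oo --> (nc (F p x - f x) ^+ 2)%:E.
    move=> /cf[c1 c2]; apply: cvg_EFin; first exact: nearW.
    rewrite nc_sqr !ReD !ImD !ReN !ImN /=.
    rewrite (_ : _ \o _ = (fun k => (Rec (F p x) - Rec (F (n k) x)) ^+ 2 +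
       (Imc (F p x) - Imc (F (n k) x)) ^+ 2)); last first.
      by apply/funext => k /=; rewrite nc_sqr !ReD !ImD !ReN !ImN.
    by apply: cvgD; rewrite expr2; apply: cvgM; apply: cvgB => //; exact: cvg_cst.
  have I1 : (\int[mu]_x (nc (F p x - f x) ^+ 2)%:E <= (e ^+ 2)%:E)%E.
    (* Almost everywhere the integrand is the limit of [h], hence its lower limit, the form in which
       Fatou applies. *)
    rewrite (_ : (\int[mu]_x _ = \int[mu]_x limn_einf (h ^~ x))%E); last first.
      apply: ge0_ae_eq_integral => //.
      - exact/measurable_EFinP/measurable_funX/cmeas_nc.
      - rewrite (_ : (fun _ => _) = (fun x => - limn_esup (fun k => - h k x))%E).
          by apply: measurableT_comp => //; apply: measurable_fun_limn_esup => k; exact: measurableT_comp.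
        by apply/funext => x; rewrite -[LHS]oppeK -limn_esupN.
      - by move=> x _; rewrite lee_fin sqr_ge0.
      - move=> x _; rewrite limn_einf_lim; apply: lime_ge; first exact: is_cvg_einfs.
        apply: nearW => k; apply: le_ereal_inf_tmp => _ [j _ <-]; exact: h0.
      case: aeG => N [mN muN sN]; exists N; split => // x /= hx; apply: sN => /= gx.
      apply: hx => _; have hl := hlim x (gx Logic.I).
      rewrite is_cvg_limn_einfE; last exact: cvgP hl.
      by apply/esym/cvg_lim.
    apply: le_trans (fatou _ measurableT mh h0) _.
    rewrite limn_einf_lim; apply: lime_le; first exact: is_cvg_einfs.
    apply: nearW => k; pose j := maxn k p.
    have [j' kj' pj'] : exists2 j', (k <= j')%N & l2 mu (fun x => F p x - F (n j') x) <= e.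
      exists j; first exact: leq_maxl.
      by apply: he; rewrite (leq_trans (leq_maxr k p))// leq_addr.
    apply: le_trans (_ : _ <= \int[mu]_x h j' x)%E _; first by apply: ereal_inf_lbound; exists j'.
    have [_ /integrable_fin_num i2] := Lpq j'.
    have := i2 measurableT; rewrite (_ : (\int[mu]_x _)%E = (\int[mu]_x h j' x)%E)// => i3.
    rewrite -(fineK i3) lee_fin.
    have -> : fine (\int[mu]_x h j' x)%E = l2 mu (fun x => F p x - F (n j') x) ^+ 2 by rewrite l2_sqr.
    by have := l2_ge0 mu (fun x => F p x - F (n j') x); nra.
  have Lpf : L2 mu (fun x => F p x - f x).
    split=> //; apply/integrableP; split; first exact/measurable_EFinP/measurable_funX/cmeas_nc.
    under eq_integral do rewrite /= ger0_norm ?sqr_ge0//.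
    exact: le_lt_trans I1 (ltry _).
  split=> //; rewrite -ler_sqr ?nnegrE ?l2_ge0 ?(ltW e0)// l2_sqr -lee_fin fineK//.
  by have [_ /integrable_fin_num] := Lpf; apply.
have Lf : L2 mu f.
  have [p0 hp0] := cF 1 ltr01.
  have [|Lpf _] := key 1 p0 ltr01; first by move=> q; exact: hp0.
  have := L2B (LF p0) Lpf; congr L2; apply/funext => x.
  by rewrite opprB addrC subrK.
exists f => // e e0; have [N1 hN1] := cF e e0; exists N1 => p Np.
by have [|] := key e p e0 => // q pq; apply: hN1 => //; exact: leq_trans pq.
Qed.

End L2_complete.

(** * Smooth functions *)

Section calculus.
Context (R : realType) (n : nat).
Notation E := 'rV[R]_n.
Notation fct := (E -> R[i]).
Implicit Types (U : set E) (f g : fct) (j : 'I_n) (s : seq 'I_n).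

Definition basis_vec j : E := delta_mx ord0 j.
Local Notation e := basis_vec.

Definition ccont f (x : E) :=
  (Rec (f y) @[y --> x] --> Rec (f x)) /\ (Imc (f y) @[y --> x] --> Imc (f x)).

Definition cder j f (x : E) (l : R[i]) :=
  is_derive x (e j) (fun y => Rec (f y)) (Rec l) /\
  is_derive x (e j) (fun y => Imc (f y)) (Imc l).

Definition C1 f (x : E) := ccont f x /\ forall j, exists l, cder j f x l.

Lemma cder_pderiv j f x l : cder j f x l -> pderiv j f x = l.
Proof.
by move=> [d1 d2]; apply: eq_cplx; rewrite /pderiv /=; [case: d1|case: d2].
Qed.

Lemma C1_cder f x j : C1 f x -> cder j f x (pderiv j f x).
Proof. by move=> [_ /(_ j)[l h]]; rewrite (cder_pderiv h). Qed.

Lemma smoothP U f : smooth U f <-> forall s x, U x -> C1 (foldr (@pderiv R n) f s) x.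
Proof.
split=> h s x Ux.
  have [c1 c2 d] := h s x Ux; split=> // j; have [d1 d2] := d j.
  by exists (pderiv j (foldr (@pderiv R n) f s) x); split; exact: derivableP.
have [[c1 c2] d] := h s x Ux; split => // j; have [l [d1 d2]] := d j.
by split; [case: d1|case: d2].
Qed.

Lemma near_eq_cder j f g x l : (\near x, f x = g x) -> cder j f x l -> cder j g x l.
Proof.
move=> fg [d1 d2]; split.
  by apply: near_eq_is_derive d1; apply: filterS fg => y ->.
by apply: near_eq_is_derive d2; apply: filterS fg => y ->.
Qed.

Lemma near_eq_ccont f g (x : E) : (\near x, f x = g x) -> ccont f x -> ccont g x.
Proof.
move=> fg [c1 c2]; rewrite /ccont -(nbhs_singleton fg); split.
  by move=> A /c1 hA; apply: (@filterS2 _ _ (nbhs_filter x) _ _ _ _ fg hA) => y /= ->.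
by move=> A /c2 hA; apply: (@filterS2 _ _ (nbhs_filter x) _ _ _ _ fg hA) => y /= ->.
Qed.

Lemma near_eq_C1 f g (x : E) : (\near x, f x = g x) -> C1 f x -> C1 g x.
Proof.
move=> fg [c d]; split; first exact: near_eq_ccont fg c.
by move=> j; have [l h] := d j; exists l; exact: near_eq_cder fg h.
Qed.

Lemma near_eq_pderiv f g (x : E) j : (\near x, f x = g x) -> pderiv j f x = pderiv j g x.
Proof.
move=> fg; rewrite /pderiv; congr Complex; apply: near_eq_derive.
  by near=> y; congr complex.Re; near: y; exact: fg.
by near=> y; congr complex.Im; near: y; exact: fg.
Unshelve. all: by end_near. Qed.

Lemma open_eq_near U f g (x : E) : open U -> (forall y, U y -> f y = g y) -> U x ->
  \near x, f x = g x.
Proof.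
move=> oU fg Ux; near=> y; apply: fg; near: y; exact: open_nbhs_nbhs.
Unshelve. all: by end_near. Qed.

Lemma pderiv_eq U f g j : open U -> (forall x, U x -> f x = g x) ->
  forall x, U x -> pderiv j f x = pderiv j g x.
Proof. by move=> oU fg x Ux; apply: near_eq_pderiv; exact: open_eq_near oU fg Ux. Qed.

(* Unlike [Dmi], without the factors -i. *)
Definition Dw s f : fct := foldr (@pderiv R n) f s.

Lemma Dw_eq U f g s : open U -> (forall x, U x -> f x = g x) ->
  forall x, U x -> Dw s f x = Dw s g x.
Proof.
by move=> oU fg; elim: s => [|j s IH] x Ux /=; [exact: fg|exact: pderiv_eq oU IH _ Ux].
Qed.

(* A record, so that unification never unfolds [smooth]. *)
Record sm U f : Prop := Sm { sm_smooth : smooth U f }.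

Lemma smP U f : sm U f <-> forall s x, U x -> C1 (Dw s f) x.
Proof. by split=> [[/smoothP]|h]//; split; apply/smoothP. Qed.

(** Smoothness as a greatest fixed point: a class of [C1] functions that is stable under partial
    derivatives, up to equality on [U], consists of smooth functions. Choosing the class replaces
    inductions on iterated derivatives. *)
Lemma sm_coind U (S : set fct) : open U ->
  (forall f, S f -> forall x, U x -> C1 f x) ->
  (forall f, S f -> forall j, exists2 g, S g & forall x, U x -> pderiv j f x = g x) ->
  forall f, S f -> sm U f.
Proof.
move=> oU S1 Sd f Sf; apply/smP => s.
have [g Sg fg] : exists2 g, S g & forall x, U x -> Dw s f x = g x.
  elim: s => [|j s [g Sg IH]]; first by exists f.
  have [g' Sg' gg'] := Sd g Sg j; exists g' => // x Ux /=.
  by rewrite (pderiv_eq j oU IH)// gg'.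
move=> x Ux; apply: near_eq_C1 (S1 g Sg x Ux).
by apply: (open_eq_near oU) Ux => y Uy; rewrite -fg.
Qed.

Lemma Dw_cat s t f : Dw (s ++ t) f = Dw s (Dw t f).
Proof. by rewrite /Dw foldr_cat. Qed.

Lemma sm_C1 U f x : sm U f -> U x -> C1 f x.
Proof. by move=> /smP/(_ [::]); exact. Qed.

Lemma sm_Dw U f s : sm U f -> sm U (Dw s f).
Proof.
by move=> /smP h; apply/smP => t x Ux; rewrite -Dw_cat; exact: h.
Qed.

Lemma sm_pderiv U f j : sm U f -> sm U (pderiv j f).
Proof. exact: (@sm_Dw _ _ [:: j]). Qed.

Lemma sm_eq U f g : open U -> (forall x, U x -> f x = g x) -> sm U f -> sm U g.
Proof.
move=> oU fg /smP h; apply/smP => s x Ux; apply: near_eq_C1 (h s x Ux).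
exact: open_eq_near oU (Dw_eq s oU fg) Ux.
Qed.

Lemma sm_sub U V f : V `<=` U -> sm U f -> sm V f.
Proof. by move=> VU [h]; split => s x /VU; exact: h. Qed.

Lemma sm_local U f : (forall x, U x -> exists2 V, V x & sm V f) -> sm U f.
Proof. by move=> h; split => s x /h[V Vx [h']]; exact: h'. Qed.

Lemma cderD j f g x a b : cder j f x a -> cder j g x b ->
  cder j (fun y => f y + g y) x (a + b).
Proof.
move=> [f1 f2] [g1 g2]; split.
  rewrite ReD (_ : (fun y => _) = (fun y => Rec (f y)) + (fun y => Rec (g y))).
    exact: is_deriveD.
  by apply/funext => y; rewrite ReD.
rewrite ImD (_ : (fun y => _) = (fun y => Imc (f y)) + (fun y => Imc (g y))).
  exact: is_deriveD.
by apply/funext => y; rewrite ImD.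
Qed.

Lemma cderM j f g x a b : cder j f x a -> cder j g x b ->
  cder j (fun y => f y * g y) x (a * g x + f x * b).
Proof.
move=> [f1 f2] [g1 g2]; split.
  rewrite (_ : (fun y => _) = (fun y => Rec (f y)) * (fun y => Rec (g y))
     - (fun y => Imc (f y)) * (fun y => Imc (g y))); last by apply/funext => y; rewrite cReM.
  apply: (is_derive_eq (is_deriveB (is_deriveM f1 g1) (is_deriveM f2 g2))).
  by rewrite ReD !cReM /GRing.scale /=; ring.
rewrite (_ : (fun y => _) = (fun y => Rec (f y)) * (fun y => Imc (g y))
     + (fun y => Imc (f y)) * (fun y => Rec (g y))); last by apply/funext => y; rewrite cImM.
apply: (is_derive_eq (is_deriveD (is_deriveM f1 g2) (is_deriveM f2 g1))).
by rewrite ImD !cImM /GRing.scale /=; ring.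
Qed.

Lemma cder_cst j (c : R[i]) x : cder j (fun=> c) x 0.
Proof. by split; exact: is_derive_cst. Qed.

Lemma cderJ j f x a : cder j f x a -> cder j (fun y => conjc (f y)) x (conjc a).
Proof.
move=> [f1 f2]; split.
  by rewrite ReJ (_ : (fun y => _) = (fun y => Rec (f y)))//; apply/funext => y; rewrite ReJ.
rewrite ImJ (_ : (fun y => _) = - (fun y => Imc (f y))); first exact: is_deriveN.
by apply/funext => y; rewrite ImJ.
Qed.

Lemma ccontD f g x : ccont f x -> ccont g x -> ccont (fun y => f y + g y) x.
Proof.
move=> [f1 f2] [g1 g2]; split.
  by under eq_fun do rewrite ReD; rewrite ReD; apply: (@cvgD _ _ _ _ (nbhs_filter x)).
by under eq_fun do rewrite ImD; rewrite ImD; apply: (@cvgD _ _ _ _ (nbhs_filter x)).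
Qed.

Lemma ccontM f g x : ccont f x -> ccont g x -> ccont (fun y => f y * g y) x.
Proof.
move=> [f1 f2] [g1 g2]; split.
  by under eq_fun do rewrite cReM; rewrite cReM; apply: (@cvgB _ _ _ _ (nbhs_filter x)); apply: (@cvgM _ _ _ (nbhs_filter x)).
by under eq_fun do rewrite cImM; rewrite cImM; apply: (@cvgD _ _ _ _ (nbhs_filter x)); apply: (@cvgM _ _ _ (nbhs_filter x)).
Qed.

Lemma ccont_cst (c : R[i]) x : ccont (fun=> c) x.
Proof. by split; apply: (@cvg_cst _ _ _ _ (nbhs_filter x)). Qed.

Lemma ccontJ f x : ccont f x -> ccont (fun y => conjc (f y)) x.
Proof.
move=> [f1 f2]; split.
  by under eq_fun do rewrite ReJ; rewrite ReJ.
by under eq_fun do rewrite ImJ; rewrite ImJ; apply: (@cvgN _ _ _ _ (nbhs_filter x)).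
Qed.

Lemma C1D f g x : C1 f x -> C1 g x -> C1 (fun y => f y + g y) x.
Proof.
move=> [cf df] [cg dg]; split; first exact: ccontD.
by move=> j; have [a ?] := df j; have [b ?] := dg j; exists (a + b); exact: cderD.
Qed.

Lemma C1M f g x : C1 f x -> C1 g x -> C1 (fun y => f y * g y) x.
Proof.
move=> [cf df] [cg dg]; split; first exact: ccontM.
move=> j; have [a ?] := df j; have [b ?] := dg j.
by exists (a * g x + f x * b); exact: cderM.
Qed.

Lemma C1_cst (c : R[i]) x : C1 (fun=> c) x.
Proof. by split; [exact: ccont_cst|move=> j; exists 0; exact: cder_cst]. Qed.

Lemma C1J f x : C1 f x -> C1 (fun y => conjc (f y)) x.
Proof.
move=> [cf df]; split; first exact: ccontJ.
by move=> j; have [a ?] := df j; exists (conjc a); exact: cderJ.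
Qed.

Lemma pderivD j f g x : C1 f x -> C1 g x ->
  pderiv j (fun y => f y + g y) x = pderiv j f x + pderiv j g x.
Proof. by move=> /(C1_cder j) hf /(C1_cder j) hg; exact/cder_pderiv/cderD. Qed.

Lemma pderivM j f g x : C1 f x -> C1 g x ->
  pderiv j (fun y => f y * g y) x = pderiv j f x * g x + f x * pderiv j g x.
Proof. by move=> /(C1_cder j) hf /(C1_cder j) hg; exact/cder_pderiv/cderM. Qed.

Lemma pderiv_cst j (c : R[i]) x : pderiv j (fun=> c) x = 0.
Proof. exact/cder_pderiv/cder_cst. Qed.

Lemma pderivZ j (c : R[i]) f x : C1 f x -> pderiv j (fun y => c * f y) x = c * pderiv j f x.
Proof. by move=> hf; rewrite (pderivM j (C1_cst c x) hf) pderiv_cst mul0r add0r. Qed.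

Lemma pderivJ j f x : C1 f x -> pderiv j (fun y => conjc (f y)) x = conjc (pderiv j f x).
Proof. by move=> /(C1_cder j) hf; exact/cder_pderiv/cderJ. Qed.

Lemma sm_cst U (c : R[i]) : open U -> sm U (fun=> c).
Proof.
move=> oU; apply: (@sm_coind U [set f | exists c, f = fun=> c]) => //.
- by move=> _ [c' ->] x _; exact: C1_cst.
- by move=> _ [c' ->] j; exists (fun=> 0); [exists 0|move=> x _; exact: pderiv_cst].
by exists c.
Qed.

Lemma smD U f g : open U -> sm U f -> sm U g -> sm U (fun x => f x + g x).
Proof.
move=> oU sf sg; apply: (@sm_coind U
  [set h | exists f' g', [/\ sm U f', sm U g' & h = fun x => f' x + g' x]]) => //.
- by move=> _ [f' [g' [sf' sg' ->]]] x Ux; apply: C1D; exact: sm_C1 Ux.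
- move=> _ [f' [g' [sf' sg' ->]]] j; exists (fun x => pderiv j f' x + pderiv j g' x).
    by exists (pderiv j f'), (pderiv j g'); split => //; exact: sm_pderiv.
  by move=> x Ux; apply: pderivD; exact: sm_C1 Ux.
by exists f, g.
Qed.

Lemma sm_sum U I (r : seq I) (F : I -> fct) : open U -> (forall i, sm U (F i)) ->
  sm U (fun x => \sum_(i <- r) F i x).
Proof.
move=> oU sF; elim: r => [|i r IH].
  by under eq_fun do rewrite big_nil; exact: sm_cst.
by under eq_fun do rewrite big_cons; exact: smD.
Qed.

Lemma smM U f g : open U -> sm U f -> sm U g -> sm U (fun x => f x * g x).
Proof.
move=> oU sf sg.
pose good (p : fct * fct) := sm U p.1 /\ sm U p.2.
(* Finite sums of products are stable under the Leibniz rule, single products are not. *)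
pose S := [set h : fct | exists2 r : seq (fct * fct), (forall p, List.In p r -> good p) &
  h = fun x => \sum_(p <- r) p.1 x * p.2 x].
apply: (@sm_coind U S) => //.
- move=> _ [r gr ->] x Ux; elim: r gr => [|p r IH] gr.
    by under eq_fun do rewrite big_nil; exact: C1_cst.
  under eq_fun do rewrite big_cons; apply: C1D.
    by have [s1 s2] := gr p (or_introl erefl); apply: C1M; exact: sm_C1 Ux.
  by apply: IH => q qr; apply: gr; right.
- move=> _ [r gr ->] j; elim: r gr => [|p r IH] gr.
    exists (fun=> 0).
      by exists [::] => //; apply/funext => x; rewrite big_nil.
    move=> x Ux; under eq_fun do rewrite big_nil; exact: pderiv_cst.
  have [s1 s2] := gr p (or_introl erefl).
  have gr' q : List.In q r -> good q by move=> qr; apply: gr; right.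
  have [_ [r' gr'' ->] h] := IH gr'.
  exists (fun x => \sum_(p <- (pderiv j p.1, p.2) :: (p.1, pderiv j p.2) :: r') p.1 x * p.2 x).
    exists ((pderiv j p.1, p.2) :: (p.1, pderiv j p.2) :: r') => // q [<-|[<-|/gr''//]].
      by split => //=; exact: sm_pderiv.
    by split => //=; exact: sm_pderiv.
  move=> x Ux; under eq_fun do rewrite big_cons; rewrite !big_cons addrA -h//= pderivD.
  - by rewrite pderivM//; exact: sm_C1 Ux.
  - by apply: C1M; exact: sm_C1 Ux.
  elim: r gr' {gr IH h r' gr''} => [|q r IH] gr.
    by under eq_fun do rewrite big_nil; exact: C1_cst.
  under eq_fun do rewrite big_cons; apply: C1D.
    by have [t1 t2] := gr q (or_introl erefl); apply: C1M; exact: sm_C1 Ux.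
  by apply: IH => q' qr; apply: gr; right.
exists [:: (f, g)]; first by move=> _ [<-|[]].
by apply/funext => x; rewrite big_seq1.
Qed.

Lemma smZ U (c : R[i]) f : open U -> sm U f -> sm U (fun x => c * f x).
Proof. by move=> oU sf; apply: smM => //; exact: sm_cst. Qed.

Lemma smN U f : open U -> sm U f -> sm U (fun x => - f x).
Proof.
move=> oU sf; rewrite (_ : (fun _ => _) = (fun x => -1 * f x)); first exact: smZ.
by apply/funext => x; rewrite mulN1r.
Qed.

Lemma smJ U f : open U -> sm U f -> sm U (fun x => conjc (f x)).
Proof.
move=> oU sf; apply: (@sm_coind U
  [set h | exists2 f', sm U f' & h = fun x => conjc (f' x)]) => //.
- by move=> _ [f' sf' ->] x Ux; apply: C1J; exact: sm_C1 Ux.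
- move=> _ [f' sf' ->] j; exists (fun x => conjc (pderiv j f' x)).
    by exists (pderiv j f') => //; exact: sm_pderiv.
  by move=> x Ux; apply: pderivJ; exact: sm_C1 Ux.
by exists f.
Qed.

Lemma DwD U f g s x : open U -> sm U f -> sm U g -> U x ->
  Dw s (fun y => f y + g y) x = Dw s f x + Dw s g x.
Proof.
move=> oU sf sg; elim: s x => [//|j s IH] x Ux /=.
rewrite (pderiv_eq j oU IH)// pderivD//; exact: sm_C1 (sm_Dw _ _) Ux.
Qed.

Lemma DwZ U (c : R[i]) f s x : open U -> sm U f -> U x ->
  Dw s (fun y => c * f y) x = c * Dw s f x.
Proof.
move=> oU sf; elim: s x => [//|j s IH] x Ux /=.
rewrite (pderiv_eq j oU IH)// pderivZ//; exact: sm_C1 (sm_Dw _ _) Ux.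
Qed.

Lemma Dw_sum U I (r : seq I) (F : I -> fct) s x : open U -> (forall i, sm U (F i)) -> U x ->
  Dw s (fun y => \sum_(i <- r) F i y) x = \sum_(i <- r) Dw s (F i) x.
Proof.
move=> oU sF Ux; elim: r => [|i r IH].
  rewrite big_nil; under [X in Dw s X x]eq_fun do rewrite big_nil -[0](mul0r 0).
  by rewrite (DwZ 0 s oU (sm_cst 0 oU) Ux) mul0r.
under [X in Dw s X x]eq_fun do rewrite big_cons.
by rewrite (DwD s oU (sF i) (sm_sum r oU sF) Ux) IH big_cons.
Qed.

End calculus.

(** * Boxes of the sup norm, mean values and symmetry of second derivatives *)

Section box_neighbourhoods.
Context (R : realType) (n : nat).
Notation E := 'rV[R]_n.
Implicit Types (x y : E) (d : R).

Definition box x d y := forall i : 'I_n, `|y ord0 i - x ord0 i| < d.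

Lemma nbhs_boxP x (A : set E) : nbhs x A <-> exists2 d, 0 < d & forall y, box x d y -> A y.
Proof.
split=> [/nbhs_ballP[d /= d0 dA]|[d d0 dA]].
  exists d => // y xy; apply: dA; split => // i j; rewrite ord1 /ball /= distrC; exact: xy.
apply/nbhs_ballP; exists d => //= y [_ xy]; apply: dA => i.
by rewrite distrC; exact: (xy ord0 i).
Qed.

Lemma open_box x d : open (box x d).
Proof.
rewrite openE => y xy; apply/nbhs_boxP.
pose m := \big[Num.max/0]_i `|y ord0 i - x ord0 i|.
(* In dimension 0 every box is the whole space, even for d <= 0, and [d - m] may fail to be
   positive. *)
have [n0|n0] := posnP n.
  by exists 1 => // z _ i; exfalso; move: (ltn_ord i); rewrite {2}n0.
have md : m < d.
  apply/bigmax_ltP; split; last by move=> i _; exact: xy.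
  by apply: le_lt_trans (xy (Ordinal n0)); exact: normr_ge0.
exists (d - m); first by rewrite subr_gt0.
move=> z yz i; rewrite -(subrK (y ord0 i) (z ord0 i)) -addrA.
rewrite (le_lt_trans (ler_normD _ _))// -(subrK m d) ltr_leD//.
by apply: le_bigmax.
Qed.

Lemma box_refl x d : 0 < d -> box x d x.
Proof. by move=> d0 i; rewrite subrr normr0. Qed.

Lemma open_boxP (U : set E) x : open U -> U x -> exists2 d, 0 < d & box x d `<=` U.
Proof.
move=> oU Ux; have /nbhs_boxP[d d0 dU] := open_nbhs_nbhs (conj oU Ux).
by exists d.
Qed.

Lemma ccontP (f : E -> R[i]) x : ccont f x <->
  forall e, 0 < e -> exists2 d, 0 < d & forall y, box x d y -> nc (f y - f x) < e.
Proof.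
split=> [[c1 c2] e e0|h].
  have e2 : 0 < e / 2 by rewrite divr_gt0.
  have /(@cvgrPdist_lt _ _ _ _ (nbhs_filter x))/(_ _ e2)/nbhs_boxP[d1 d10 h1] := c1.
  have /(@cvgrPdist_lt _ _ _ _ (nbhs_filter x))/(_ _ e2)/nbhs_boxP[d2 d20 h2] := c2.
  exists (Num.min d1 d2); first by rewrite lt_min d10.
  move=> y xy; rewrite (le_lt_trans (nc_le_ReIm _))// ReD ImD ReN ImN (splitr e).
  rewrite ltrD// distrC; [apply: h1|apply: h2] => i; have := xy i.
    by rewrite lt_min => /andP[].
  by rewrite lt_min => /andP[].
split; apply/(@cvgrPdist_lt _ _ _ _ (nbhs_filter x)) => e e0; apply/nbhs_boxP;
  have [d d0 hd] := h e e0; exists d => // y /hd; rewrite distrC.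
  by rewrite -ReN -ReD; exact: le_lt_trans (Re_le_nc _).
by rewrite -ImN -ImD; exact: le_lt_trans (Im_le_nc _).
Qed.

Lemma box_shift2 x (i j : 'I_n) (d s t : R) : 0 <= s -> 0 <= t -> s + t < d ->
  box x d (x + s *: basis_vec R i + t *: basis_vec R j).
Proof.
move=> s0 t0 std k; rewrite !mxE !eqxx /=.
set a := s * _; set b := t * _.
have -> : x ord0 k + a + b - x ord0 k = a + b by ring.
apply: le_lt_trans std; rewrite (le_trans (ler_normD _ _))// /a /b !normrM.
rewrite (ger0_norm s0) (ger0_norm t0).
by apply: lerD; rewrite ler_piMr//; case: eqP => _ /=; rewrite ?normr1 ?normr0.
Qed.

End box_neighbourhoods.

Section lines.
Context (R : realType) (V : normedModType R).
Implicit Types (G H : V -> R) (a v : V).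

Lemma is_derive_line G a v t l : is_derive (a + t *: v) v G l ->
  is_derive t (1 : R) (fun s => G (a + s *: v)) l.
Proof.
move=> [d <-].
have e : (fun h : R => h^-1 *: ((G \o shift (a + t *: v)) (h *: v) - G (a + t *: v))) =
    (fun h : R => h^-1 *: (((fun s => G (a + s *: v)) \o shift t) (h *: (1 : R)) - G (a + t *: v))).
  apply/funext => h; congr (_ *: (G _ - _)) => /=.
  by rewrite [h%:A]mulr1 scalerDl addrCA.
by apply: DeriveDef; rewrite /derivable /derive -e.
Qed.

Lemma line_mvt G (G' : V -> R) a v h : 0 <= h ->
  (forall t, 0 <= t <= h -> is_derive (a + t *: v) v G (G' (a + t *: v))) ->
  exists2 c, 0 <= c <= h & G (a + h *: v) - G a = G' (a + c *: v) * h.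
Proof.
move=> h0 dG.
have dg t : t \in `[0, h] -> is_derive t (1 : R) (fun s => G (a + s *: v)) (G' (a + t *: v)).
  by rewrite in_itv /= => th; apply/is_derive_line/dG.
have [c ch E] := @MVT_segment R (fun s => G (a + s *: v)) (fun s => G' (a + s *: v)) 0 h h0
  (fun t th => dg t (subset_itv_oo_cc th))
  (derivable_within_continuous (fun t th => @ex_derive _ _ _ _ _ _ _ (dg t th))).
exists c; first by move: ch; rewrite in_itv.
by move: E; rewrite scale0r addr0 subr0.
Qed.

End lines.

Section schwarz.
Context (R : realType) (n : nat).
Notation E := 'rV[R]_n.
Local Notation e := (@basis_vec R n).

(** The mean value theorem is applied in direction [i] to the increment of [G] in direction [j],
    then in direction [j] to [Gi]. The second difference itself is symmetric in [i] and [j], which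
    [schwarz_real] exploits. *)
Lemma second_difference (G Gi Gji : E -> R) x i j d h : 0 <= h -> h + h < d ->
  (forall y, box x d y -> is_derive y (e i) G (Gi y)) ->
  (forall y, box x d y -> is_derive y (e j) Gi (Gji y)) ->
  exists2 y, box x d y &
    G (x + h *: e i + h *: e j) - G (x + h *: e i) - G (x + h *: e j) + G x = Gji y * h ^+ 2.
Proof.
move=> h0 hd dG dGi.
have bx s t : 0 <= s <= h -> 0 <= t <= h -> box x d (x + s *: e i + t *: e j).
  move=> /andP[s0 sh] /andP[t0 th]; apply: box_shift2 => //.
  by apply: le_lt_trans hd; exact: lerD.
have hh : 0 <= h <= h by rewrite h0 lexx.
have h00 : 0 <= (0 : R) <= h by rewrite h0 lexx.
pose H y := G (y + h *: e j) - G y.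
have [|c ch Hc] := @line_mvt R E H (fun y => Gi (y + h *: e j) - Gi y) x (e i) h h0.
  move=> t th.
  have d1 : is_derive (x + t *: e i) (e i) (fun y => G (y + h *: e j)) (Gi (x + t *: e i + h *: e j)).
    have [D1 D2] := dG _ (bx t h th hh).
    have E1 : (fun k : R => k^-1 *: ((G \o shift (x + t *: e i + h *: e j)) (k *: e i) - G (x + t *: e i + h *: e j)))
      = (fun k : R => k^-1 *: (((fun y => G (y + h *: e j)) \o shift (x + t *: e i)) (k *: e i) - G (x + t *: e i + h *: e j))).
      by apply/funext => k; congr (_ *: (G _ - _)); rewrite /= addrA.
    by apply: DeriveDef; rewrite /derivable /derive -E1.
  have d2 := dG _ (bx t 0 th h00); rewrite scale0r addr0 in d2.
  exact: is_deriveB d1 d2.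
have [|c' ch' Hc'] := @line_mvt R E Gi Gji (x + c *: e i) (e j) h h0.
  by move=> t th; apply: dGi; exact: bx.
exists (x + c *: e i + c' *: e j); first exact: bx.
rewrite expr2 mulrA -Hc' -Hc /H opprB addrA; ring.
Qed.

(** One second difference computed in the two orders forces [Gji] and [Gij] to share a value, taken
    at two points as close to [x] as desired; continuity concludes. *)
Lemma schwarz_real (G Gi Gj Gij Gji : E -> R) x i j d : 0 < d ->
  (forall y, box x d y -> is_derive y (e i) G (Gi y)) ->
  (forall y, box x d y -> is_derive y (e j) Gi (Gji y)) ->
  (forall y, box x d y -> is_derive y (e j) G (Gj y)) ->
  (forall y, box x d y -> is_derive y (e i) Gj (Gij y)) ->
  (forall a, 0 < a -> exists2 b, 0 < b & forall y, box x b y -> `|Gij y - Gij x| < a) ->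
  (forall a, 0 < a -> exists2 b, 0 < b & forall y, box x b y -> `|Gji y - Gji x| < a) ->
  Gij x = Gji x.
Proof.
move=> d0 dG dGi dG' dGj cij cji; apply/eqP; rewrite -subr_eq0 -normr_le0.
apply/ler_addgt0Pr => a a0; rewrite add0r.
have a2 : 0 < a / 2 by rewrite divr_gt0.
have [b1 b10 h1] := cij _ a2; have [b2 b20 h2] := cji _ a2.
pose b := Num.min d (Num.min b1 b2).
have b0 : 0 < b by rewrite !lt_min d0 b10.
have bb y : box x b y -> [/\ box x d y, box x b1 y & box x b2 y].
  by move=> xy; split => k; have := xy k; rewrite !lt_min => /and3P[].
pose h := b / 3.
have hp : 0 < h by rewrite divr_gt0.
have hb : h + h < b by rewrite /h; lra.
have [y yb Ey] := second_difference (ltW hp) hb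
  (fun y yb => let: And3 q _ _ := bb y yb in dG y q)
  (fun y yb => let: And3 q _ _ := bb y yb in dGi y q).
have [z zb Ez] := second_difference (ltW hp) hb
  (fun y yb => let: And3 q _ _ := bb y yb in dG' y q)
  (fun y yb => let: And3 q _ _ := bb y yb in dGj y q).
have yz : Gji y = Gij z.
  apply: (@mulIf _ (h ^+ 2)); first by rewrite expf_neq0 ?gt_eqF.
  by rewrite -Ey -Ez (addrAC x); ring.
have [_ _ /h2 ly] := bb _ yb; have [_ /h1 lz _] := bb _ zb.
have -> : Gij x - Gji x = (Gji y - Gji x) - (Gij z - Gij x) by rewrite yz; ring.
by rewrite (le_trans (ler_normB _ _))// (splitr a) ltW// ltrD.
Qed.

Lemma pderiv_comm (U : set E) f i j x : open U -> sm U f -> U x ->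
  pderiv i (pderiv j f) x = pderiv j (pderiv i f) x.
Proof.
move=> oU sf Ux; have [d d0 dU] := open_boxP oU Ux.
have D g k y : sm U g -> box x d y -> cder k g y (pderiv k g y).
  by move=> sg /dU Uy; apply: C1_cder; exact: sm_C1 Uy.
have C k l : forall a, 0 < a -> exists2 b, 0 < b &
    forall y, box x b y -> nc (pderiv k (pderiv l f) y - pderiv k (pderiv l f) x) < a.
  by apply/ccontP; have [] := sm_C1 (sm_Dw [:: k; l] sf) Ux.
have sp k : sm U (pderiv k f) by exact: sm_pderiv.
apply: eq_cplx.
  apply: (@schwarz_real (fun y => Rec (f y)) (fun y => Rec (pderiv i f y))
    (fun y => Rec (pderiv j f y)) (fun y => Rec (pderiv i (pderiv j f) y))
    (fun y => Rec (pderiv j (pderiv i f) y)) x i j d d0).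
  - by move=> y yb; exact: (proj1 (D f i y sf yb)).
  - by move=> y yb; exact: (proj1 (D (pderiv i f) j y (sp i) yb)).
  - by move=> y yb; exact: (proj1 (D f j y sf yb)).
  - by move=> y yb; exact: (proj1 (D (pderiv j f) i y (sp j) yb)).
  - move=> a /(C i j)[b b0 h]; exists b => // y /h; rewrite -ReN -ReD.
    exact: le_lt_trans (Re_le_nc _).
  - move=> a /(C j i)[b b0 h]; exists b => // y /h; rewrite -ReN -ReD.
    exact: le_lt_trans (Re_le_nc _).
apply: (@schwarz_real (fun y => Imc (f y)) (fun y => Imc (pderiv i f y))
  (fun y => Imc (pderiv j f y)) (fun y => Imc (pderiv i (pderiv j f) y))
  (fun y => Imc (pderiv j (pderiv i f) y)) x i j d d0).
- by move=> y yb; exact: (proj2 (D f i y sf yb)).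
- by move=> y yb; exact: (proj2 (D (pderiv i f) j y (sp i) yb)).
- by move=> y yb; exact: (proj2 (D f j y sf yb)).
- by move=> y yb; exact: (proj2 (D (pderiv j f) i y (sp j) yb)).
- move=> a /(C i j)[b b0 h]; exists b => // y /h; rewrite -ImN -ImD.
  exact: le_lt_trans (Im_le_nc _).
- move=> a /(C j i)[b b0 h]; exists b => // y /h; rewrite -ImN -ImD.
  exact: le_lt_trans (Im_le_nc _).
Qed.

Lemma Dw_perm (U : set E) f s t x : open U -> sm U f -> perm_eq s t -> U x ->
  Dw s f x = Dw t f x.
Proof.
move=> oU sf; elim: s t x => [|j s IH] t x.
  by rewrite perm_sym => /perm_nilP ->.
move=> st Ux.
have jt : j \in t by rewrite -(perm_mem st) mem_head.
have move_front t1 t2 y : U y -> Dw (t1 ++ j :: t2) f y = Dw (j :: t1 ++ t2) f y.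
  elim: t1 y => [//|k t1 IHt] y Uy /=.
  rewrite (pderiv_eq k oU IHt Uy) /=.
    exact: (pderiv_comm k j oU (sm_Dw (t1 ++ t2) sf) Uy).
move: st; case/splitPr: jt => t1 t2; rewrite -cat_rcons perm_sym => st.
rewrite cat_rcons (move_front t1 t2 x Ux) /=; apply: (pderiv_eq j oU) Ux => y Uy.
apply: IH Uy; rewrite -(perm_cons j).
by rewrite perm_sym (perm_trans _ st)// cat_rcons -[j :: _]cat1s perm_catCA.
Qed.

End schwarz.

(** * Words of derivatives and the Leibniz formula *)

Section multi_index_words.
Context (R : realType) (n : nat).
Notation E := 'rV[R]_n.
Notation mi := {ffun 'I_n -> nat}.
Implicit Types (a b : mi) (s t : seq 'I_n).

(** Derivatives are indexed by words rather than multi-indices: inductions and the Leibniz rule then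
    avoid binomial coefficients. The order of the letters is the order of composition in [Dmi]. *)
Definition word a : seq 'I_n := flatten [seq nseq (a j) j | j <- enum 'I_n].

Definition wmi s : mi := [ffun j => count_mem j s].

Lemma count_word a j : count_mem j (word a) = a j.
Proof.
rewrite /word count_flatten -map_comp sumnE big_map big_enum /=.
rewrite (bigD1 j)//= count_nseq /= eqxx mul1n big1 ?addn0// => i /negPf ij.
by rewrite count_nseq /= ij mul0n.
Qed.

Lemma size_word a : size (word a) = mabs a.
Proof.
rewrite /word size_flatten /shape -map_comp sumnE big_map big_enum /=.
by apply: eq_bigr => j _; rewrite size_nseq.
Qed.

Lemma perm_wmi s : perm_eq s (word (wmi s)).
Proof. by apply/allP => j _ /=; rewrite count_word ffunE. Qed.

Lemma mabs_wmi s : mabs (wmi s) = size s.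
Proof. by rewrite -size_word (perm_size (perm_wmi s)). Qed.

Lemma iter_DjE U k j m s (f g : E -> R[i]) : open U -> sm U f ->
  (forall x, U x -> g x = (- 'i%C) ^+ m * Dw s f x) ->
  forall x, U x -> iter k (Dj j) g x = (- 'i%C) ^+ (k + m) * Dw (nseq k j ++ s) f x.
Proof.
move=> oU sf gE; elim: k => [//|k IH] x Ux.
rewrite iterS {1}/Dj (pderiv_eq j oU IH)// pderivZ; last by exact: sm_C1 (sm_Dw _ sf) Ux.
by rewrite mulrA addSn exprS.
Qed.

Lemma DmiE U a (f : E -> R[i]) x : open U -> sm U f -> U x ->
  Dmi a f x = (- 'i%C) ^+ mabs a * Dw (word a) f x.
Proof.
move=> oU sf Ux; rewrite /Dmi -size_word /word.
elim: (enum 'I_n) x Ux => [|j r IH] x Ux /=; first by rewrite expr0 mul1r.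
rewrite (iter_DjE (a j) j oU sf IH)//.
by rewrite size_cat size_nseq.
Qed.

Lemma nc_negi k : nc ((- 'i%C : R[i]) ^+ k) = 1.
Proof. by rewrite ncX ncN /= expr0n expr1n add0r sqrtr1 expr1n. Qed.

Lemma nc_Dmi U a (f : E -> R[i]) x : open U -> sm U f -> U x ->
  nc (Dmi a f x) = nc (Dw (word a) f x).
Proof. by move=> oU sf Ux; rewrite (DmiE a oU sf Ux) ncM nc_negi mul1r. Qed.

(** All ways, with multiplicity, of splitting a word into two complementary subwords: each letter is
    a derivative that falls on one of the two factors. *)
Fixpoint splits s : seq (seq 'I_n * seq 'I_n) :=
  if s is j :: s' then
    [seq (j :: p.1, p.2) | p <- splits s'] ++ [seq (p.1, j :: p.2) | p <- splits s']
  else [:: ([::], [::])].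

Lemma Dw_leibniz U (f g : E -> R[i]) s x : open U -> sm U f -> sm U g -> U x ->
  Dw s (fun y => f y * g y) x = \sum_(p <- splits s) Dw p.1 f x * Dw p.2 g x.
Proof.
move=> oU sf sg; elim: s x => [|j s IH] x Ux; first by rewrite big_seq1.
rewrite /= big_cat !big_map /= (pderiv_eq j oU IH Ux) -big_split /=.
have := @Dw_sum R n U _ (splits s) (fun p y => Dw p.1 f y * Dw p.2 g y) [:: j] x oU _ Ux.
move=> /= ->; last by move=> p; apply: smM => //; exact: sm_Dw.
by apply: eq_bigr => p _; rewrite pderivM//; exact: sm_C1 (sm_Dw _ _) Ux.
Qed.

Lemma size_splits s p : p \in splits s -> (size p.1 + size p.2 = size s)%N.
Proof.
elim: s p => [|j s IH] p /=; first by rewrite inE => /eqP ->.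
rewrite mem_cat => /orP[] /mapP[q /IH <- ->] /=; first by rewrite addSn.
by rewrite addnS.
Qed.

(** The binomial theorem in terms of words; it sums the Leibniz formulas. *)
Lemma sum_splits s (a b : R) :
  \sum_(p <- splits s) a ^+ size p.1 * b ^+ size p.2 = (a + b) ^+ size s.
Proof.
elim: s => [|j s IH] /=; first by rewrite big_seq1 !expr0 mulr1.
rewrite big_cat !big_map /= exprS -IH mulrDl !mulr_sumr.
congr (_ + _); apply: eq_bigr => p _; first by rewrite exprS mulrA.
by rewrite exprS mulrCA.
Qed.

(** Bounds that are geometric in the order multiply, their ratios being added. This is the reason
    why the bounds imposed on cutoffs have the form [B ^+ size s]. *)
Lemma Dw_mul_le U k (a b : R) (f g : E -> R[i]) s x : open U -> sm U f -> sm U g -> U x ->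
  (forall t, (size t <= k)%N -> nc (Dw t f x) <= a ^+ size t) ->
  (forall t, (size t <= k)%N -> nc (Dw t g x) <= b ^+ size t) ->
  (size s <= k)%N -> nc (Dw s (fun y => f y * g y) x) <= (a + b) ^+ size s.
Proof.
move=> oU sf sg Ux hf hg sk; rewrite (Dw_leibniz s oU sf sg Ux).
apply: le_trans (nc_sum _ _ _) _; rewrite -sum_splits big_seq [leRHS]big_seq.
apply: ler_sum => p /size_splits ps; rewrite ncM ler_pM ?nc_ge0//.
  by apply: hf; rewrite (leq_trans _ sk)// -ps leq_addr.
by apply: hg; rewrite (leq_trans _ sk)// -ps leq_addl.
Qed.

End multi_index_words.

(** * Limits, sliding humps and series of smooth functions *)

Section complex_limits.
Context (R : realType).
Implicit Types (z : nat -> R[i]) (b : nat -> R).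

Definition clim z (l : R[i]) := forall e : R, 0 < e ->
  exists N, forall p, (N <= p)%N -> nc (z p - l) <= e.

Lemma clim_unique z l l' : clim z l -> clim z l' -> l = l'.
Proof.
move=> h h'; apply/eqP; rewrite -subr_eq0; apply/eqP/nc_eq0/eqP.
rewrite eq_le nc_ge0 andbT; apply/ler_addgt0Pr => e e0; rewrite add0r.
have e2 : 0 < e / 2 by rewrite divr_gt0.
have [N hN] := h _ e2; have [N' hN'] := h' _ e2.
pose p := maxn N N'.
have -> : l - l' = (z p - l') - (z p - l) by ring.
rewrite (le_trans (ncD _ _))// ncN (splitr e) lerD//.
  by apply: hN'; exact: leq_maxr.
by apply: hN; exact: leq_maxl.
Qed.

Lemma climZ z l (c : R[i]) : clim z l -> clim (fun m => c * z m) (c * l).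
Proof.
move=> h e e0; have [|N hN] := h (e / (nc c + 1)).
  by rewrite divr_gt0// ltr_wpDl// nc_ge0.
exists N => p /hN; rewrite -mulrBr ncM ler_pdivlMr ?ltr_wpDl ?nc_ge0// => h1.
by have := nc_ge0 (z p - l); have := nc_ge0 c; nra.
Qed.

Lemma clim_le z l (B : R) : clim z l -> (forall m, nc (z m) <= B) -> nc l <= B.
Proof.
move=> h hB; apply/ler_addgt0Pr => e e0; have [N /(_ N (leqnn N)) hN] := h e e0.
rewrite (_ : l = z N - (z N - l)); last by ring.
by rewrite (le_trans (ncD _ _))// ncN lerD.
Qed.

Lemma clim_eq z z' l : (forall m, z m = z' m) -> clim z l -> clim z' l.
Proof. by move=> e h eps /h[N hN]; exists N => p; rewrite -e; exact: hN. Qed.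

Definition psum b := (forall m, 0 <= b m) /\ has_ubound (range (series b)).

Lemma psum_tail b : psum b -> forall e, 0 < e ->
  exists N, forall K, \sum_(N <= m < K) b m <= e.
Proof.
move=> [b0 ub] e e0.
have nd : nondecreasing_seq (series b) by apply: nondecreasing_series => m _ _.
have cs : series b @ \oo --> sup (range (series b)) by exact: nondecreasing_cvgn.
have /cvgrPdist_le/(_ e e0)[N _ hN] := cs.
exists N => K; have [KN|NK] := leqP K N; first by rewrite big_geq// ltW.
have -> : \sum_(N <= m < K) b m = series b K - series b N.
  by rewrite /series /= (big_cat_nat (leq0n N) (ltnW NK))//= addrAC subrr add0r.
have h1 : series b K <= sup (range (series b)) by apply: ub_le_sup => //; exists K.
have := hN N (leqnn N); have h2 : series b N <= sup (range (series b)).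
  by apply: ub_le_sup => //; exists N.
by rewrite /= ger0_norm ?subr_ge0//; lra.
Qed.

(** The tail clause makes limits of series of functions uniform: the error depends on the majorant
    [b] alone. *)
Lemma csum_ex (c : nat -> R[i]) b : psum b -> (forall m, nc (c m) <= b m) ->
  exists l, clim (fun N => \sum_(m < N) c m) l /\
    forall N e, (forall K, \sum_(N <= m < K) b m <= e) -> nc (l - \sum_(m < N) c m) <= e.
Proof.
move=> pb cb; have [b0 ub] := pb.
have diff N K : (N <= K)%N -> nc (\sum_(m < K) c m - \sum_(m < N) c m) <= \sum_(N <= m < K) b m.
  move=> NK; rewrite -!(big_mkord predT c) (big_cat_nat (leq0n N) NK)//= addrAC subrr add0r.
  by apply: le_trans (nc_sum _ _ _) _; exact: ler_sum.
have cRe : cvgn (fun N => Rec (\sum_(m < N) c m)).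
  apply: (@abs_telescope_cvg _ _ b) => // k; rewrite -ReN -ReD big_ord_recr/= addrAC subrr add0r.
  exact: le_trans (Re_le_nc _) (cb k).
have cIm : cvgn (fun N => Imc (\sum_(m < N) c m)).
  apply: (@abs_telescope_cvg _ _ b) => // k; rewrite -ImN -ImD big_ord_recr/= addrAC subrr add0r.
  exact: le_trans (Im_le_nc _) (cb k).
pose l : R[i] := Complex (limn (fun N => Rec (\sum_(m < N) c m)))
  (limn (fun N => Imc (\sum_(m < N) c m))).
have hl : clim (fun N => \sum_(m < N) c m) l.
  move=> e e0; have e2 : 0 < e / 2 by rewrite divr_gt0.
  have /cvgrPdist_le/(_ _ e2)[N _ hN] := cRe.
  have /cvgrPdist_le/(_ _ e2)[N' _ hN'] := cIm.
  exists (maxn N N') => p; rewrite geq_max => /andP[pN pN'].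
  rewrite (le_trans (nc_le_ReIm _))// ReD ImD ReN ImN (splitr e) lerD//.
    by rewrite distrC; exact: hN.
  by rewrite distrC; exact: hN'.
exists l; split=> // N e hN; apply/ler_addgt0Pr => a a0.
have [K hK] := hl a a0; pose p := maxn K N.
have -> : l - \sum_(m < N) c m =
  (\sum_(m < p) c m - \sum_(m < N) c m) - (\sum_(m < p) c m - l) by ring.
rewrite (le_trans (ncD _ _))// ncN lerD//; last by apply: hK; exact: leq_maxl.
by apply: le_trans (diff _ _ (leq_maxr _ _)) _.
Qed.

Lemma psum_geometric (c : R) : 0 <= c -> psum (fun m => c * 2^-1 ^+ m).
Proof.
move=> c0; split; first by move=> m; rewrite mulr_ge0// exprn_ge0// invr_ge0.
exists (c * 2) => _ [K _ <-]; rewrite /series /= -mulr_sumr ler_wpM2l//.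
suff -> : \sum_(0 <= k < K) (2^-1 : R) ^+ k = 2 - 2 * 2^-1 ^+ K.
  by rewrite gerBl mulr_ge0// exprn_ge0// invr_ge0.
elim: K => [|K IH]; first by rewrite big_geq// expr0; lra.
by rewrite big_nat_recr//= IH exprS; lra.
Qed.

Lemma half_pow_small (e : R) : 0 < e -> exists N, forall p, (N <= p)%N -> 2^-1 ^+ p <= e.
Proof.
move=> /(psum_tail (psum_geometric ler01))[N hN]; exists N => p Np.
have := hN N.+1; rewrite big_nat1 mul1r; apply: le_trans.
by rewrite ler_wiXn2l// ?invr_ge0// invf_le1 ?ler1n.
Qed.

Lemma psum_le b b' : (forall m, 0 <= b m) -> (forall m, b m <= b' m) -> psum b' -> psum b.
Proof.
move=> b0 bb' [_ [B hB]]; split=> //; exists B => _ [K _ <-].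
by apply: le_trans (hB _ (ex_intro2 _ _ K Logic.I erefl)); exact: ler_sum.
Qed.

End complex_limits.

Section gliding_hump.
Context (R : realType) (T I : Type) (l : I -> T -> R[i]) (d : I -> nat).

(* Sliding hump argument: the series [\sum eps_m * l i (x_m)] is built so that at [i = i_m] its
   m-th term dominates the earlier terms (by the choice of [x_m]) and the later ones (by the
   choice of the [eps_k], [k > m]). *)
Lemma gliding_hump :
  (forall i, exists B, forall x, nc (l i x) <= B) ->
  (forall (x : nat -> T) (eps : nat -> R), (forall m, 0 < eps m <= 2^-1 ^+ m) ->
     exists C L : R, [/\ 0 < C, 0 < L & forall i z,
       clim (fun N => \sum_(m < N) (eps m)%:C%C * l i (x m)) z -> nc z <= C * L ^+ d i]) ->
  exists C L : R, [/\ 0 < C, 0 < L & forall i x, nc (l i x) <= C * L ^+ d i].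
Proof.
move=> /choice[B0 hB0] H.
pose B i := `|B0 i|.
have B_ge0 i : 0 <= B i by exact: normr_ge0.
have hB i x : nc (l i x) <= B i by exact: le_trans (hB0 i x) (ler_norm _).
have pk (k : nat) : 0 < (2^-1 : R) ^+ k by rewrite exprn_gt0// invr_gt0.
have geo N : \sum_(m < N) (2^-1 : R) ^+ m = 2 - 2 * 2^-1 ^+ N.
  elim: N => [|N IH]; first by rewrite big_ord0 expr0; lra.
  by rewrite big_ord_recr/= IH exprS; lra.
(* Constant sequences turn the hypothesis into a bound at a single point, with constants depending
   on the point. *)
have single x : exists C, exists L, [/\ 0 < C, 0 < L & forall i, nc (l i x) <= C * L ^+ d i].
  have [|C [L [C0 L0 h]]] := H (fun=> x) (fun m => 2^-1 ^+ m).
    by move=> m; rewrite lexx pk.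
  exists C, L; split=> // i; have l0 := nc_ge0 (l i x).
  have /h : clim (fun N => \sum_(m < N) (2^-1 ^+ m : R)%:C%C * l i x) ((2 : R)%:C%C * l i x).
    move=> e e0; have [|N hN] := @half_pow_small R (e / (2 * nc (l i x) + 1)).
      by rewrite divr_gt0// ltr_wpDl// mulr_ge0.
    exists N => p Np.
    have -> : \sum_(m < p) (2^-1 ^+ m : R)%:C%C * l i x = (2 - 2 * 2^-1 ^+ p : R)%:C%C * l i x.
      by rewrite -mulr_suml -geo rmorph_sum.
    rewrite -mulrBl -rmorphB /= ncM nc_real (_ : 2 - _ - 2 = - (2 * 2^-1 ^+ p)); last by ring.
    rewrite normrN normrM !ger0_norm ?(ltW (pk _))//; have := hN p Np.
    by rewrite ler_pdivlMr ?ltr_wpDl ?mulr_ge0//; have := pk p; nra.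
  by rewrite ncM nc_real ger0_norm//; lra.
apply: contrapT => /forallNP hn.
have fail C L : 0 < C -> 0 < L -> exists p : I * T, C * L ^+ d p.1 < nc (l p.1 p.2).
  move=> C0 L0; apply: contrapT => /forallNP h; apply: (hn C); exists L; split=> // i x.
  by rewrite leNgt; apply/negP => h'; exact: (h (i, x)).
have [Cs hCs] := choice single; have [Ls hLs] := choice hCs.
(* Triples (eps, i, x) admissible after the history [h]. The second clause makes the new term
   negligible at the indices already chosen; the third makes it exceed, at its own index, what the
   hypothesis allows plus all other terms. *)
pose P (h : seq (R * I * T)) (p : R * I * T) :=
  [/\ 0 < p.1.1, p.1.1 * (1 + \sum_(q <- h) B q.1.2) <= 2^-1 ^+ size h &
    (size h).+1%:R ^+ (d p.1.2).+1 + \sum_(q <- h) `|q.1.1| * nc (l p.1.2 q.2) + 2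
      < p.1.1 * nc (l p.1.2 p.2)].
have sumB (h : seq (R * I * T)) : 0 <= \sum_(q <- h) B q.1.2 by exact: sumr_ge0.
have bnd i (h : seq (R * I * T)) L : \sum_(q <- h) Ls q.2 <= L ->
    \sum_(q <- h) `|q.1.1| * nc (l i q.2) <= (\sum_(q <- h) `|q.1.1| * Cs q.2) * L ^+ d i.
  elim: h L => [|q h IH] L; first by rewrite !big_nil mul0r.
  rewrite !big_cons mulrDl => hL; have [Cq Lq hq] := hLs q.2.
  have s0 : 0 <= \sum_(q <- h) Ls q.2.
    by apply: sumr_ge0 => q' _; have [_ /ltW] := hLs q'.2.
  apply: lerD; last by apply: IH; lra.
  rewrite -mulrA ler_wpM2l// (le_trans (hq i))// ler_wpM2l ?(ltW Cq)//.
  by rewrite lerXn2r ?nnegrE//; lra.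
have step h : exists p, P h p.
  pose e := 2^-1 ^+ size h / (1 + \sum_(q <- h) B q.1.2).
  have e0 : 0 < e by rewrite divr_gt0// ltr_pwDl.
  pose m : R := (size h).+1%:R; have m1 : 1 <= m by rewrite ler1n.
  pose S := \sum_(q <- h) `|q.1.1| * Cs q.2.
  have S0 : 0 <= S by apply: sumr_ge0 => q _; rewrite mulr_ge0//; have [/ltW] := hLs q.2.
  pose L := m + \sum_(q <- h) Ls q.2.
  have sL : 0 <= \sum_(q <- h) Ls q.2.
    by apply: sumr_ge0 => q' _; have [_ /ltW] := hLs q'.2.
  have [||[i x] /= hix] := fail ((m + S + 2) / e) L.
  - by rewrite divr_gt0//; lra.
  - by rewrite /L; lra.
  exists (e, i, x); split=> //=.
    by rewrite /e divfK// gt_eqF// ltr_pwDl.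
  have L1 : 1 <= L ^+ d i by rewrite exprn_ege1// /L; lra.
  have mL : m ^+ d i <= L ^+ d i by rewrite lerXn2r ?nnegrE /L//; lra.
  have hb := bnd i h L; rewrite -/S in hb.
  have hb' := hb (_ : \sum_(q <- h) Ls q.2 <= L).
  apply: le_lt_trans (_ : (m + S + 2) * L ^+ d i < _).
    rewrite !mulrDl exprS -/m; apply: lerD; last by lra.
    apply: lerD; last by apply: hb'; rewrite /L; lra.
    by rewrite ler_wpM2l//; lra.
  by move: hix; rewrite mulrAC ltr_pdivrMr// [nc _ * e]mulrC.
have [st hst] := choice step.
pose fix hist m := if m is m'.+1 then rcons (hist m') (st (hist m')) else [::].
pose p m := st (hist m).
have histE m : hist m = [seq p k | k <- iota 0 m].
  by elim: m => [//|m IH]; rewrite -addn1 iotaD map_cat /= -IH addn1 /= cats1.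
have szh m : size (hist m) = m by rewrite histE size_map size_iota.
have sumH (F : R * I * T -> R) m : \sum_(q <- hist m) F q = \sum_(k < m) F (p k).
  by rewrite histE big_map -(big_mkord predT (fun k => F (p k))) /index_iota subn0.
pose eps m := (p m).1.1; pose x m := (p m).2.
have epsP m : 0 < eps m /\ eps m * (1 + \sum_(k < m) B (p k).1.2) <= 2^-1 ^+ m.
  by have [e1 e2 _] := hst (hist m); rewrite sumH szh in e2.
have eps2 m : 0 < eps m <= 2^-1 ^+ m.
  have [e1 e2] := epsP m; rewrite e1 (le_trans _ e2)// ler_pMr// lerDl.
  exact: sumr_ge0.
have [C [L [C0 L0 hCL]]] := H x eps eps2.
have [m hm] : exists m : nat, C + L < m%:R.
  by exists (Num.bound (C + L)); apply: archi_boundP; rewrite addr_ge0 ?ltW.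
have [_ _ h3] := hst (hist m); rewrite sumH szh -/(p m) in h3.
pose i := (p m).1.2; rewrite -/i -/(eps m) -/(x m) in h3.
(* Up to [m] the terms at the index [i] are bounded through the crude constant [B i]; beyond [m] the
   choice of [eps k] gives 2^-k. *)
pose b k : R := if (k <= m)%N then B i * 2^-1 ^+ k else 2^-1 ^+ k.
have pb : psum b.
  apply: psum_le (psum_geometric (_ : 0 <= B i + 1)).
  - by move=> k; have h2 := ltW (pk k); rewrite /b; case: ifP => _ //; exact: mulr_ge0.
  - move=> k; rewrite mulrDl mul1r /b; case: ifP => _; first by rewrite lerDl ltW.
    by rewrite lerDr mulr_ge0// ltW.
  by rewrite addr_ge0.
have cb k : nc ((eps k)%:C%C * l i (x k)) <= b k.
  have [e1 e2] := epsP k; have /andP[_ e3] := eps2 k.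
  rewrite ncM nc_real ger0_norm ?(ltW e1)// /b; case: ifPn => km.
    by rewrite mulrC ler_pM ?nc_ge0 ?(ltW e1).
  rewrite -ltnNge in km; apply: le_trans e2; rewrite ler_pM2l//.
  apply: le_trans (hB i (x k)) _; rewrite (bigD1 (Ordinal km))//= -/i addrCA lerDl.
  by rewrite addr_ge0// sumr_ge0.
have [z [hz htail]] := csum_ex pb cb.
have tail2 K : \sum_(m.+1 <= k < K) b k <= 2.
  have [Km|Km] := leqP K m.+1; first by rewrite big_geq.
  apply: le_trans (_ : \sum_(0 <= k < K) (2^-1 : R) ^+ k <= _); last first.
    by rewrite big_mkord geo gerBl mulr_ge0// ltW.
  rewrite (big_cat_nat (leq0n m.+1) (ltnW Km))//= -[leLHS]add0r lerD//.
    by apply: sumr_ge0 => k _; rewrite ltW.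
  rewrite !big_nat; apply: ler_sum => k /andP[mk _]; rewrite /b.
  by rewrite leqNgt mk.
have nz := htail m.+1 2 tail2.
have hzC := hCL i z hz.
(* As [m] exceeds C + L, the bound C L^d is at most (m+1)^(d+1), the first term in the third clause
   of [P]. *)
have hzm : nc z <= m.+1%:R ^+ (d i).+1.
  apply: le_trans hzC _; rewrite exprS; have m0 : m%:R <= m.+1%:R :> R by rewrite ler_nat.
  rewrite ler_pM ?exprn_ge0 ?(ltW C0) ?(ltW L0)//; first by lra.
  by rewrite lerXn2r ?nnegrE ?(ltW L0)//; lra.
have hc : eps m * nc (l i (x m)) = nc ((eps m)%:C%C * l i (x m)).
  by rewrite ncM nc_real ger0_norm// ltW//; have [] := epsP m.
have dec : (eps m)%:C%C * l i (x m) = z - (z - \sum_(k < m.+1) (eps k)%:C%C * l i (x k))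
    - \sum_(k < m) (eps k)%:C%C * l i (x k) by rewrite big_ord_recr /=; ring.
have : nc ((eps m)%:C%C * l i (x m)) <= nc z + 2 + \sum_(k < m) `|eps k| * nc (l i (x k)).
  rewrite dec (le_trans (ncD _ _))// ncN lerD//.
    by rewrite (le_trans (ncD _ _))// ncN lerD.
  by apply: le_trans (nc_sum _ _ _) _; apply: ler_sum => k _; rewrite ncM nc_real.
rewrite -hc; move: h3; rewrite /eps /x; lra.
Qed.

End gliding_hump.

Section approximation.
Context (R : realType).

(** Differentiability passes to the limit because the increments of the error [G - g] from [x] are
    small compared with those of the variable; smallness of the error alone would not suffice. *)
Lemma is_derive_approx (V : normedModType R) (G : V -> R) x v l :
  (forall e, 0 < e -> exists g lg, [/\ is_derive x v g lg, `|lg - l| <= e &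
     forall h, `|(G (x + h *: v) - g (x + h *: v)) - (G x - g x)| <= e * `|h|]) ->
  is_derive x v G l.
Proof.
move=> H.
have cv : (fun h : R => h^-1 *: ((G \o shift x) (h *: v) - G x)) @ 0^' --> l.
  apply/cvgrPdist_le => e e0; have e3 : 0 < e / 3 by rewrite divr_gt0.
  have [g [lg [dg hl hL]]] := H _ e3.
  have cg : (fun h : R => h^-1 *: ((g \o shift x) (h *: v) - g x)) @ 0^' --> lg.
    by have [D <-] := dg; exact: D.
  have := cg; move=> /cvgrPdist_le/(_ _ e3) ng.
  near=> h.
  have h0 : h != 0 by near: h; exact: nbhs_dnbhs_neq.
  have hg : `|lg - h^-1 *: ((g \o shift x) (h *: v) - g x)| <= e / 3 by near: h.
  rewrite (_ : l - _ = - (lg - l) + (lg - h^-1 *: ((g \o shift x) (h *: v) - g x))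
    - h^-1 * ((G (x + h *: v) - g (x + h *: v)) - (G x - g x))); last first.
    by rewrite /GRing.scale /= ![h *: v + x]addrC; ring.
  rewrite (_ : e = e / 3 + e / 3 + e / 3); last by lra.
  rewrite (le_trans (ler_normB _ _))// lerD//.
    by rewrite (le_trans (ler_normD _ _))// normrN lerD.
  by rewrite normrM normfV ler_pdivrMl ?normr_gt0// mulrC.
by apply: DeriveDef; [apply: cvgP cv|exact: cvg_lim cv].
Unshelve. all: by end_near. Qed.

Context (n : nat).
Notation E := 'rV[R]_n.
Notation fct := (E -> R[i]).
Implicit Types (f g : fct).

Lemma cder_approx j f x l :
  (forall e, 0 < e -> exists g lg, [/\ cder j g x lg, nc (lg - l) <= e &
     forall h : R, nc ((f (x + h *: basis_vec R j) - g (x + h *: basis_vec R j)) - (f x - g x)) <= e * `|h|]) ->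
  cder j f x l.
Proof.
move=> H; split; apply: is_derive_approx => e /H[g [lg [[d1 d2] hl hL]]].
  exists (fun y => Rec (g y)), (Rec lg); split=> //.
    by rewrite -ReN -ReD; exact: le_trans (Re_le_nc _) hl.
  by move=> h; rewrite -!ReN -!ReD -!ReN -!ReD; exact: le_trans (Re_le_nc _) (hL h).
exists (fun y => Imc (g y)), (Imc lg); split=> //.
  by rewrite -ImN -ImD; exact: le_trans (Im_le_nc _) hl.
by move=> h; rewrite -!ImN -!ImD -!ImN -!ImD; exact: le_trans (Im_le_nc _) (hL h).
Qed.

Lemma ccont_approx f x : (forall e, 0 < e -> exists2 g, ccont g x &
  forall y, nc (f y - g y) <= e) -> ccont f x.
Proof.
move=> H; apply/ccontP => e e0; have e3 : 0 < e / 3 by rewrite divr_gt0.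
have [g /ccontP/(_ _ e3)[d d0 hd] hg] := H _ e3; exists d => // y /hd hy.
have -> : f y - f x = (f y - g y) + (g y - g x) - (f x - g x) by ring.
rewrite (_ : e = e / 3 + e / 3 + e / 3); last by lra.
rewrite (le_lt_trans (ncD _ _))// ncN ltr_leD//.
by rewrite (le_lt_trans (ncD _ _))// ler_ltD.
Qed.

Lemma real_mvt_le (V : normedModType R) (G G' : V -> R) x v h B :
  (forall y, is_derive y v G (G' y)) -> (forall y, `|G' y| <= B) ->
  `|G (x + h *: v) - G x| <= B * `|h|.
Proof.
move=> dG hB; have [h0|h0] := leP 0 h.
  have [c _ ->] := @line_mvt R V G G' x v h h0 (fun t _ => dG _).
  by rewrite normrM ler_wpM2r.
have h0' : 0 <= - h by rewrite oppr_ge0 ltW.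
have [c _] := @line_mvt R V G G' (x + h *: v) v (- h) h0' (fun t _ => dG _).
rewrite scaleNr addrK distrC => ->.
by rewrite normrM normrN ler_wpM2r.
Qed.

(** The mean value theorem fails for complex values; the real and imaginary parts are treated
    separately, whence the factor 2. *)
Lemma nc_mvt_le j f (f' : fct) x h B : (forall y, cder j f y (f' y)) ->
  (forall y, nc (f' y) <= B) -> nc (f (x + h *: basis_vec R j) - f x) <= 2 * B * `|h|.
Proof.
move=> df hB; apply: le_trans (nc_le_ReIm _) _.
rewrite ReD ImD ReN ImN mulrAC mulr_natl mulr2n mulrDl -mulrDr.
rewrite mulrDr [_ * B]mulrC; apply: lerD.
  apply: (@real_mvt_le _ (fun y => Rec (f y)) (fun y => Rec (f' y))) => y.
    by have [] := df y.
  exact: le_trans (Re_le_nc _) (hB y).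
apply: (@real_mvt_le _ (fun y => Imc (f y)) (fun y => Imc (f' y))) => y.
  by have [] := df y.
exact: le_trans (Im_le_nc _) (hB y).
Qed.

End approximation.

Section smooth_series.
Context (R : realType) (n : nat).
Notation E := 'rV[R]_n.
Notation fct := (E -> R[i]).

Lemma sm_series (F : nat -> fct) : (forall m, sm setT (F m)) ->
  (forall s, exists2 b, psum b & forall m x, nc (Dw s (F m) x) <= b m) ->
  exists G : seq 'I_n -> fct,
    [/\ forall s x, clim (fun N => \sum_(m < N) Dw s (F m) x) (G s x),
        sm setT (G [::]) & forall s x, Dw s (G [::]) x = G s x].
Proof.
move=> sF hF.
have /choice[b hb0] : forall s, exists b, psum b /\ forall m x, nc (Dw s (F m) x) <= b m.
  by move=> s; have [b] := hF s; exists b.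
have pb s : psum (b s) by case: (hb0 s).
have hb s m x : nc (Dw s (F m) x) <= b s m by case: (hb0 s) => _; exact.
have [G hG] := choice (fun p : seq 'I_n * E =>
  csum_ex (pb p.1) (fun m => hb p.1 m p.2)).
have oT : open [set: E] by exact: openT.
have cG s x : ccont (fun y => G (s, y)) x.
  apply: ccont_approx => e e0; have [N hN] := psum_tail (pb s) e0.
  exists (fun y => \sum_(m < N) Dw s (F m) y).
    by have [] := sm_C1 (sm_sum (index_enum 'I_N) oT (fun m : 'I_N => sm_Dw s (sF m))) (Logic.I : setT x).
  by move=> y; have [_ h] := hG (s, y); exact: h.
have dG s j x : cder j (fun y => G (s, y)) x (G (j :: s, x)).
  apply: cder_approx => e e0; have e4 : 0 < e / 4 by rewrite divr_gt0.
  have [N hN] := psum_tail (pb (j :: s)) e4.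
  pose g y := \sum_(m < N) Dw s (F m) y.
  have sg K : sm setT (fun y => \sum_(m < K) Dw s (F m) y).
    exact: (sm_sum (index_enum 'I_K) oT (fun m : 'I_K => sm_Dw s (sF m))).
  have dg K y : cder j (fun y => \sum_(m < K) Dw s (F m) y) y (\sum_(m < K) Dw (j :: s) (F m) y).
    have <- : pderiv j (fun y => \sum_(m < K) Dw s (F m) y) y = \sum_(m < K) Dw (j :: s) (F m) y.
      have := @Dw_sum R n setT _ (index_enum 'I_K) (fun m y => Dw s (F m) y) [:: j] y oT
        (fun m => sm_Dw s (sF m)) Logic.I.
      by [].
    by apply: C1_cder; exact: sm_C1 (sg K) _.
  exists g, (\sum_(m < N) Dw (j :: s) (F m) x); split; first exact: dg.
    have [_ h] := hG (j :: s, x); rewrite ncB (le_trans (h N (e / 4) hN))//; lra.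
  move=> h; set x' := x + _.
  have [c1 _] := hG (s, x'); have [c0 _] := hG (s, x).
  (* The difference of two partial sums has a derivative bounded by a tail, hence a small Lipschitz
     constant; letting [K] grow gives the same for [G]. *)
  have key K : (N <= K)%N -> nc ((\sum_(m < K) Dw s (F m) x' - g x') - (\sum_(m < K) Dw s (F m) x - g x))
      <= e / 2 * `|h|.
    move=> NK.
    pose t y := \sum_(m < K) Dw s (F m) y + -1 * g y.
    have dt y : cder j t y (\sum_(m < K) Dw (j :: s) (F m) y + -1 * \sum_(m < N) Dw (j :: s) (F m) y).
      apply: cderD (dg K y) _.
      have := cderM (cder_cst j (-1) y) (dg N y); rewrite mul0r add0r; exact.
    have -> : \sum_(m < K) Dw s (F m) x' - g x' - (\sum_(m < K) Dw s (F m) x - g x) = t x' - t x.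
      by rewrite /t /g; ring.
    rewrite (_ : e / 2 = 2 * (e / 4)); last by lra.
    apply: nc_mvt_le dt _ => y; rewrite mulN1r -!(big_mkord predT (fun m => Dw (j :: s) (F m) y)).
    rewrite (big_cat_nat (leq0n N) NK)//= addrAC subrr add0r.
    apply: le_trans (nc_sum _ _ _) (le_trans _ (hN K)); apply: ler_sum => m _.
    exact: (hb (j :: s) m y).
  apply/ler_addgt0Pr => a a0; have a2 : 0 < a / 2 by rewrite divr_gt0.
  have [K1 h1] := c1 _ a2; have [K0 h0] := c0 _ a2.
  pose K := maxn N (maxn K0 K1).
  have k1 : (K1 <= K)%N by rewrite /K !leq_max leqnn !orbT.
  have k0 : (K0 <= K)%N by rewrite /K !leq_max leqnn !orbT.
  have -> : G (s, x') - g x' - (G (s, x) - g x) =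
    (\sum_(m < K) Dw s (F m) x' - g x') - (\sum_(m < K) Dw s (F m) x - g x)
    + ((\sum_(m < K) Dw s (F m) x - G (s, x)) - (\sum_(m < K) Dw s (F m) x' - G (s, x'))) by ring.
  rewrite (le_trans (ncD _ _))// lerD//.
    apply: le_trans (key K (leq_maxl _ _)) _; rewrite ler_wpM2r//; lra.
  by rewrite (le_trans (ncD _ _))// ncN (splitr a) lerD//; [exact: h0|exact: h1].
exists (fun s x => G (s, x)); split.
- by move=> s x; have [] := hG (s, x).
- apply: (@sm_coind R n setT [set f | exists s, f = fun y => G (s, y)]) => //.
  + move=> _ [s ->] x _; split; first exact: cG.
    by move=> j; exists (G (j :: s, x)); exact: dG.
  + move=> _ [s ->] j; exists (fun y => G (j :: s, y)); first by exists (j :: s).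
    by move=> x _; exact/cder_pderiv/dG.
  by exists [::].
elim=> [//|j s IH] x /=.
by rewrite (pderiv_eq j oT (fun y _ => IH y) (Logic.I : setT x)); exact/cder_pderiv/dG.
Qed.

End smooth_series.

(** * Weight sequences *)

Section weight_sequence_theory.
Context (R : realType) (M : nat -> R).
Hypothesis wM : weight_seq M.

Let M_gt0 k : 0 < M k. Proof. by case: wM. Qed.
Let M0 : M 0%N = 1. Proof. by case: wM. Qed.

(** By log-convexity these quotients increase, and r^l / M_l is maximal where they pass [r]; they
    are the frequencies at which the best order changes. *)
Definition mu_ k := M k.+1 / M k.

Lemma mu_gt0 k : 0 < mu_ k. Proof. exact: divr_gt0. Qed.

Lemma M_succ k : M k.+1 = mu_ k * M k. Proof. by rewrite /mu_ divfK// gt_eqF. Qed.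

Lemma mu_homo j k : (j <= k)%N -> mu_ j <= mu_ k.
Proof.
elim: k => [|k IH]; first by rewrite leqn0 => /eqP ->.
rewrite leq_eqVlt ltnS => /predU1P[->//|/IH h]; apply: le_trans h _.
rewrite /mu_ ler_pdivrMr// mulrAC ler_pdivlMr// -expr2 mulrC.
by case: wM.
Qed.

Lemma mu_ge1 k : 1 <= mu_ k.
Proof.
apply: le_trans (mu_homo (leq0n k)); rewrite /mu_ M0 divr1.
by case: wM.
Qed.

Lemma M_homo j k : (j <= k)%N -> M j <= M k.
Proof.
elim: k => [|k IH]; first by rewrite leqn0 => /eqP ->.
rewrite leq_eqVlt ltnS => /predU1P[->//|/IH h]; apply: le_trans h _.
by rewrite M_succ ler_peMl// ?mu_ge1// ltW.
Qed.

Lemma M_ge1 k : 1 <= M k. Proof. by rewrite -M0 M_homo. Qed.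

Lemma M_supmul p q : M p * M q <= M (p + q)%N.
Proof.
elim: p => [|p IH]; first by rewrite M0 mul1r.
rewrite addSn !M_succ -mulrA ler_pM// ?(ltW (mu_gt0 _))// ?mu_homo ?leq_addr//.
by rewrite mulr_ge0// ltW.
Qed.

Lemma M_le_mu p q k : (p + k <= q.+1)%N -> M (p + k)%N <= mu_ q ^+ k * M p.
Proof.
elim: k => [|k IH] pk; first by rewrite addn0 expr0 mul1r.
rewrite addnS M_succ exprS -mulrA ler_pM ?(ltW (mu_gt0 _)) ?(ltW (M_gt0 _))//.
  by apply: mu_homo; rewrite addnS ltnS in pk.
by apply: IH; apply: leq_trans pk; rewrite leq_add2l.
Qed.

Lemma mu_le_M p q k : (q <= p)%N -> mu_ q ^+ k * M p <= M (p + k)%N.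
Proof.
move=> qp; elim: k => [|k IH]; first by rewrite addn0 expr0 mul1r.
rewrite addnS M_succ exprS -mulrA ler_pM ?(ltW (mu_gt0 _))//.
  by rewrite mulr_ge0 ?exprn_ge0 ?(ltW (mu_gt0 _)) ?(ltW (M_gt0 _)).
by apply: mu_homo; rewrite (leq_trans qp)// leq_addr.
Qed.

Lemma LambdaX k : Lambda M k ^+ k = M k.
Proof.
case: k => [|k]; first by rewrite expr0 M0.
rewrite /Lambda -powR_mulrn ?powR_ge0// -powRrM mulVf ?pnatr_eq0// powRr1//.
exact: ltW.
Qed.

Lemma Lambda_gt0 k : 0 < Lambda M k. Proof. exact: powR_gt0. Qed.

(** [Lambda M k.+1] is the geometric mean of the quotients up to [mu_ k], the last of which is the
    largest. *)
Lemma Lambda_le_mu k : Lambda M k.+1 <= mu_ k.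
Proof.
rewrite -(@ler_pXn2r _ k.+1) ?nnegrE ?(ltW (Lambda_gt0 _)) ?(ltW (mu_gt0 _))//.
by rewrite LambdaX -[X in _ <= X]mulr1 -M0 -[k.+1 in leLHS]add0n M_le_mu.
Qed.

Lemma Lambda_le_mu' k : Lambda M k <= mu_ k.
Proof.
case: k => [|k]; last by apply: le_trans (Lambda_le_mu k) (mu_homo _).
by rewrite /Lambda M0 powR1 mu_ge1.
Qed.

Lemma Lambda_homo j k : (0 < j)%N -> (j <= k)%N -> Lambda M j <= Lambda M k.
Proof.
move=> j0; elim: k => [|k IH]; first by rewrite leqNgt j0.
rewrite leq_eqVlt ltnS => /predU1P[->//|jk]; apply: le_trans (IH jk) _.
have k0 : (0 < k)%N by exact: leq_trans jk.
rewrite -(@ler_pXn2r _ (k * k.+1)) ?nnegrE ?(ltW (Lambda_gt0 _)) ?muln_gt0 ?k0//.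
rewrite exprM LambdaX mulnC exprM LambdaX exprSr M_succ exprMn mulrC.
rewrite ler_pM2r ?exprn_gt0//; have := M_le_mu (p := 0) (q := k) (k := k).
by rewrite add0n M0 mulr1; apply.
Qed.

Lemma Lambda_ge1 k : 1 <= Lambda M k.
Proof.
case: k => [|k]; first by rewrite /Lambda M0 powR1.
rewrite -(@ler_pXn2r _ k.+1) ?nnegrE ?(ltW (Lambda_gt0 _))//.
by rewrite expr1n LambdaX M_ge1.
Qed.

Lemma mu_unbounded (r : R) : exists k, r < mu_ k.
Proof.
have [_ _ _ _ /cvgryPgt/(_ r)[N _ hN]] := wM.
by exists N; apply: lt_le_trans (hN N (leqnn N)) (Lambda_le_mu' N).
Qed.

(** Take the first [l] whose quotient exceeds [r]: the sequence r^p / M_p does not decrease before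
    [l] and decreases after it. The assumption [M 1%N <= r] gives l > 0. *)
Lemma M_optimum (r : R) : M 1%N <= r -> exists l, [/\ (0 < l)%N, r <= mu_ l,
  forall k, mu_ k <= r -> (k < l)%N & forall p, r ^+ p * M l <= r ^+ l * M p].
Proof.
move=> M1r; have hex : exists k, r < mu_ k := mu_unbounded r.
pose l := ex_minn hex.
have [rl lmin] : r < mu_ l /\ forall k, r < mu_ k -> (l <= k)%N.
  by rewrite /l; case: ex_minnP.
have r0 : 0 <= r by apply: le_trans M1r; exact: ltW.
have kl k : mu_ k <= r -> (k < l)%N.
  by move=> h; rewrite ltnNge; apply/negP => /mu_homo h'; lra.
exists l; split=> //; first by apply: kl; rewrite /mu_ M0 divr1.
  exact: ltW.
move=> p; case: (leqP l p) => [lp|pl].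
  rewrite -(subnKC lp) exprD -mulrA ler_wpM2l ?exprn_ge0//.
  apply: le_trans (mu_le_M (p - l) (leqnn l)).
  by rewrite ler_wpM2r ?(ltW (M_gt0 _))// lerXn2r ?nnegrE ?(ltW (mu_gt0 _))// ltW.
rewrite -(subnKC (ltnW pl)) exprD -mulrA ler_wpM2l ?exprn_ge0//.
have h : mu_ l.-1 <= r.
  by rewrite leNgt; apply/negP => /lmin; rewrite leqNgt prednK ?leqnn//; exact: leq_trans pl.
apply: le_trans (M_le_mu (q := l.-1) _) _; first by rewrite subnKC ?prednK//; [exact: leq_trans pl|exact: ltnW].
by rewrite ler_wpM2r ?(ltW (M_gt0 _))// lerXn2r ?nnegrE ?(ltW (mu_gt0 _)).
Qed.

Section moderate_growth.
Context (A : R) (A1 : 1 <= A).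
Hypothesis mg : forall j k, M (j + k)%N <= A ^+ (j + k) * M j * M k.

(** Since the quotients from k on are at least [mu_ k], one has mu_k^k M_k <= M_(2k) <= A^(2k)
    M_k^2. *)
Lemma mu_le_Lambda k : (0 < k)%N -> mu_ k <= A ^+ 2 * Lambda M k.
Proof.
move=> k0; rewrite -(@ler_pXn2r _ k) ?nnegrE ?(ltW (mu_gt0 _))//; last first.
  by rewrite mulr_ge0 ?sqr_ge0 ?(ltW (Lambda_gt0 _)).
rewrite [in leRHS]exprMn LambdaX -exprM -(ler_pM2r (M_gt0 k)).
by apply: le_trans (mu_le_M k (leqnn k)) _; rewrite mulnC muln2 -addnn mg.
Qed.

(** It suffices to treat p = l, the index that maximizes Lambda_k^p / M_p. If l > k, then Lambda_k
    <= Lambda_l and the quotient is at most 1; if l <= k, then Lambda_k <= mu_l <= A^2 Lambda_l. *)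
Lemma Lambda_low k p : (0 < k)%N -> Lambda M k ^+ p <= A ^+ (2 * k) * M p.
Proof.
move=> k0; have L1 : M 1%N <= Lambda M k.
  by rewrite -(LambdaX 1) expr1; exact: Lambda_homo.
have [l [l0 Ll _ opt]] := M_optimum L1.
rewrite -(ler_pM2r (M_gt0 l)); apply: le_trans (opt p) _.
rewrite -mulrA [M p * _]mulrC mulrA ler_pM2r//.
have [lk|kl] := leqP l k; last first.
  apply: le_trans (_ : M l <= _); last by rewrite ler_peMl ?(ltW (M_gt0 _))// exprn_ege1.
  rewrite -(LambdaX l) lerXn2r ?nnegrE ?(ltW (Lambda_gt0 _))//.
  by apply: Lambda_homo; rewrite // ltnW.
apply: le_trans (_ : A ^+ (2 * l) * M l <= _); last first.
  by rewrite ler_pM2r// ler_weXn2l// leq_mul2l lk orbT.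
rewrite exprM -(LambdaX l) -exprMn lerXn2r ?nnegrE ?(ltW (Lambda_gt0 _))//.
  by rewrite mulr_ge0 ?sqr_ge0 ?(ltW (Lambda_gt0 _)).
by apply: le_trans Ll (mu_le_Lambda l0).
Qed.

End moderate_growth.

Lemma bin_le_pow2 m k : ('C(m, k) <= 2 ^ m)%N.
Proof.
elim: m k => [|m IH] [|k]; rewrite ?bin0 ?bin0n// ?expn_gt0//.
by rewrite binS expnS mul2n -addnn leq_add.
Qed.

Lemma pow_le_ffact l p : (l ^ p <= (l + p) ^_ p)%N.
Proof.
elim: p => [|p IH]; first by rewrite ffactn0.
by rewrite addnS ffactSS expnS leq_mul// (leq_trans (leq_addr p l)).
Qed.

(** l^p is at most (l+p)! / l!, that is the binomial coefficient of l + p over p times p!, and this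
    coefficient is at most 2^(2l). *)
Lemma pow_le_fact l p : (p <= l)%N -> (l ^ p <= 4 ^ l * p`!)%N.
Proof.
move=> pl; apply: leq_trans (pow_le_ffact l p) _; rewrite -bin_ffact leq_mul2r.
apply/orP; right; apply: leq_trans (bin_le_pow2 _ _) _.
by rewrite -[4%N]/(2 ^ 2)%N -expnM leq_exp2l// mul2n -addnn leq_add2l.
Qed.

Section factorial_bound.
Context (C h : R) (C0 : 0 < C) (h1 : 1 <= h).
Hypothesis hfact : forall k, k`!%:R <= C * h ^+ k * M k.

Lemma pow_le_M l p : (p <= l)%N -> l%:R ^+ p <= C * (4 * h) ^+ l * M p.
Proof.
move=> pl; apply: le_trans (_ : 4 ^+ l * p`!%:R <= _).
  by rewrite -!natrX -natrM ler_nat pow_le_fact.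
rewrite exprMn [C * _]mulrCA -mulrA ler_pM2l ?exprn_gt0//.
apply: le_trans (hfact p) _; rewrite ler_pM2r// ler_pM2l//.
by rewrite ler_weXn2l.
Qed.

(** The exchange rate for cutoffs: p derivatives that fall on a cutoff of order [l] cost l^p, and
    leave M_(l-p) for the other factor. *)
Lemma pow_M_le l p : (p <= l)%N -> l%:R ^+ p * M (l - p)%N <= C * (4 * h) ^+ l * M l.
Proof.
move=> pl; apply: le_trans (_ : C * (4 * h) ^+ l * M p * M (l - p)%N <= _).
  by rewrite ler_pM2r// pow_le_M.
rewrite -mulrA ler_pM2l; first by have := M_supmul p (l - p)%N; rewrite subnKC.
by rewrite mulr_gt0// exprn_gt0// mulr_gt0// (lt_le_trans _ h1).
Qed.

Lemma pow_le_Lambda k q : (q <= k)%N -> k%:R ^+ q <= C * (4 * h) ^+ k * Lambda M k ^+ q.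
Proof.
move=> qk; apply: le_trans (pow_le_M qk) _; rewrite ler_pM2l; last first.
  by rewrite mulr_gt0// exprn_gt0// mulr_gt0// (lt_le_trans _ h1).
case: q qk => [_|q qk]; first by rewrite M0 expr0.
rewrite -(LambdaX q.+1) lerXn2r ?nnegrE ?(ltW (Lambda_gt0 _))//.
exact: Lambda_homo.
Qed.

End factorial_bound.

End weight_sequence_theory.

(** * Lebesgue measure and test functions *)

Section cut.
Context (R : realType) (n : nat).
Notation E := 'rV[R]_n.
Notation fct := (E -> R[i]).
Notation mu := (@lebesgue_rV R n).
Implicit Types (U K : set E) (f g : fct).

(* Functions on U are extended by zero, and all integrals are over the whole space. *)
Definition cut U f : fct := fun x => if `[< U x >] then f x else 0.

Lemma cutT U f x : U x -> cut U f x = f x.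
Proof. by move=> Ux; rewrite /cut asboolT. Qed.

Lemma cutF U f x : ~ U x -> cut U f x = 0.
Proof. by move=> Ux; rewrite /cut asboolF. Qed.

Lemma cutD U f g : cut U (fun x => f x + g x) = (fun x => cut U f x + cut U g x).
Proof. by apply/funext => x; rewrite /cut; case: asboolP => // _; rewrite addr0. Qed.

Lemma cutZ U (c : R[i]) f : cut U (fun x => c * f x) = (fun x => c * cut U f x).
Proof. by apply/funext => x; rewrite /cut; case: asboolP => // _; rewrite mulr0. Qed.

Lemma cut_cut U V f : cut U (cut V f) = cut (U `&` V) f.
Proof.
apply/funext => x; rewrite /cut; case: (asboolP (U x)) => Ux; case: (asboolP (V x)) => Vx;
  by case: asboolP => //= -[].
Qed.

Lemma cut_sub U V f : U `<=` V -> cut U (cut V f) = cut U f.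
Proof. by move=> UV; rewrite cut_cut (setIidl UV). Qed.

Lemma open_preim_measurable U (g : E -> R) : open U ->
  (forall x, U x -> g y @[y --> x] --> g x) -> forall r, open (U `&` [set x | r < g x]).
Proof.
move=> oU cg r; rewrite openE => x [Ux rx]; apply/nbhs_boxP.
have gr : 0 < g x - r by rewrite subr_gt0.
have /(@cvgrPdist_lt _ _ _ _ (nbhs_filter x))/(_ _ gr)/nbhs_boxP[d d0 hd] := cg x Ux.
have [d' d'0 hd'] := open_boxP oU Ux.
exists (Num.min d d'); first by rewrite lt_min d0.
move=> y xy; split; first by apply: hd' => i; have := xy i; rewrite lt_min => /andP[].
have : `|g x - g y| < g x - r by apply: hd => i; have := xy i; rewrite lt_min => /andP[].
by rewrite /= ltr_norml => /andP[]; lra.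
Qed.

Lemma measurable_cont_cut U (g : E -> R) : open U ->
  (forall x, U x -> g y @[y --> x] --> g x) ->
  measurable_fun setT (fun x => if `[< U x >] then g x else 0).
Proof.
move=> oU cg; apply: (@measurability _ _ _ _ _ _ (@RGenOInfty.G R)).
  exact: RGenOInfty.measurableE.
move=> _ [_ [r ->] <-].
rewrite setTI (_ : _ @^-1` _ = (U `&` [set x | r < g x]) `|` (if r < 0 then ~` U else set0)).
  apply: measurableU; first by apply: open_measurable_rV; exact: open_preim_measurable.
  by case: ifP => // _; apply: measurableC; exact: open_measurable_rV.
apply/seteqP; split => x /=; rewrite in_itv/= andbT.
  by case: asboolP => Ux rx; [left|right; rewrite rx].
case=> [[Ux rx]|]; first by rewrite asboolT.
by case: ifPn => // r0 nU; rewrite asboolF.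
Qed.

Lemma cmeas_cut U f : open U -> (forall x, U x -> ccont f x) -> cmeas (cut U f).
Proof.
move=> oU cf; split.
  rewrite (_ : _ \o _ = (fun x => if `[< U x >] then Rec (f x) else 0)).
    by apply: measurable_cont_cut => // x /cf[].
  by apply/funext => x /=; rewrite /cut; case: asboolP.
rewrite (_ : _ \o _ = (fun x => if `[< U x >] then Imc (f x) else 0)).
  by apply: measurable_cont_cut => // x /cf[].
by apply/funext => x /=; rewrite /cut; case: asboolP.
Qed.

Lemma cutTE f : cut setT f = f.
Proof. by apply/funext => x; rewrite cutT. Qed.

Lemma cmeas_cont f : (forall x, ccont f x) -> cmeas f.
Proof. by move=> cf; rewrite -(cutTE f); apply: cmeas_cut => //; exact: openT. Qed.

Lemma measurable_if_set U (g : E -> R) : measurable U -> measurable_fun U g ->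
  measurable_fun setT (fun x => if `[< U x >] then g x else 0).
Proof.
move=> mU mg; have /(measurable_restrictT _ mU) := mg; congr measurable_fun.
Qed.

Lemma cmeas_cut_meas U f : measurable U -> cmeas f -> cmeas (cut U f).
Proof.
move=> mU [f1 f2]; split.
  rewrite (_ : _ \o _ = (fun x => if `[< U x >] then Rec (f x) else 0)).
    by apply: measurable_if_set => //; exact: measurable_funTS.
  by apply/funext => x /=; rewrite /cut; case: asboolP.
rewrite (_ : _ \o _ = (fun x => if `[< U x >] then Imc (f x) else 0)).
  by apply: measurable_if_set => //; exact: measurable_funTS.
by apply/funext => x /=; rewrite /cut; case: asboolP.
Qed.

Lemma bounded_on_compact K f : compact K -> (forall x, K x -> ccont f x) ->
  exists2 B, 0 < B & forall x, K x -> nc (f x) <= B.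
Proof.
move=> cK cf; have [->|/set0P K0] := eqVneq K set0; first by exists 1.
have cn : {within K, continuous (fun x => nc (f x))}.
  apply: continuous_in_subspaceT => x /[!inE] Kx.
  apply/(@cvgrPdist_lt _ _ _ _ (nbhs_filter x)) => e e0; apply/nbhs_boxP.
  have /ccontP/(_ _ e0)[d d0 hd] := cf x Kx; exists d => // y /hd; apply: le_lt_trans.
  rewrite ler_norml; apply/andP; split.
    by have := ncD (f x) (f y - f x); rewrite addrC subrK; lra.
  by have := ncD (f y) (f x - f y); rewrite addrC subrK ncB; lra.
have [c cK' hc] := EVT_max_rV K0 cK cn.
exists (nc (f c) + 1); first by rewrite ltr_wpDl ?nc_ge0.
by move=> x Kx; apply: le_trans (hc x _) _; rewrite ?inE// lerDl.
Qed.

Definition cube (a : E) (r : R) : set E := [set x | forall i, `|x ord0 i - a ord0 i| <= r].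

Lemma coord_le_norm (x : E) i : `|x ord0 i| <= `|x|.
Proof.
rewrite [leRHS]/Num.norm /= mx_normrE; apply/bigmax_geP; right => /=.
by exists (ord0, i).
Qed.

Lemma compact_cube K : compact K -> exists2 r, 0 < r & K `<=` cube 0 r.
Proof.
move=> /compact_bounded[r [_ hr]]; exists (`|r| + 1); first by rewrite ltr_wpDl.
move=> x Kx i; rewrite mxE subr0; apply: le_trans (coord_le_norm x i) _.
by apply: hr => //; rewrite (le_lt_trans (ler_norm r))// ltrDl.
Qed.

Lemma cube_bigI a r : cube a r = \big[setI/setT]_(j < n)
  ((fun x : E => x ord0 j : measurableTypeR R) @^-1` `[a ord0 j - r, a ord0 j + r]%classic).
Proof.
apply/seteqP; split => x; rewrite -bigcap_seq.
  by move=> h i _ /=; rewrite in_itv/= -ler_distlC distrC; exact: h.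
move=> h i; have := h i (mem_index_enum i).
by rewrite /= in_itv/= -ler_distlC distrC.
Qed.

Lemma measurable_cube a r : measurable (cube a r).
Proof.
rewrite cube_bigI; apply: bigsetI_measurable => j _.
rewrite -[X in measurable X]setTI; apply: measurable_coor => //.
Qed.

Lemma closed_cube a r : closed (cube a r).
Proof.
rewrite -openC openE => x /= /existsNP[i /negP]; rewrite -ltNge => hi.
apply/nbhs_boxP; exists (`|x ord0 i - a ord0 i| - r); first by rewrite subr_gt0.
move=> y xy h; have := xy i; have := h i.
have := ler_normD (y ord0 i - a ord0 i) (x ord0 i - y ord0 i).
rewrite (_ : _ - _ + _ = x ord0 i - a ord0 i); last by ring.
by rewrite (distrC (x ord0 i) (y ord0 i)); lra.
Qed.

Lemma cube_compact a r : compact (cube a r).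
Proof.
apply: bounded_closed_compact; last exact: closed_cube.
exists (`|a| + `|r|); split; first exact: num_real.
move=> M hM x xa; rewrite /Num.norm /= mx_normrE; apply/bigmax_leP; split.
  by rewrite ltW// (le_lt_trans _ hM)// addr_ge0.
move=> [i j] _ /=; rewrite ord1; apply: le_trans (ltW hM).
rewrite -(subrK (a ord0 j) (x ord0 j)) addrC (le_trans (ler_normD _ _))// lerD//.
  exact: coord_le_norm.
by apply: le_trans (xa j) _; exact: ler_norm.
Qed.

End cut.

(** * Fubini, the measure of cubes and the integral of a derivative *)

Section fubini_rV.
Context (R : realType) (n : nat).
Local Open Scope ereal_scope.

Local Notation P := ((@lebesgue_measure R) \x (@lebesgue_rV R n)).
Local Notation cm := (measure_function_pushforward__canonical__measure_function_Measure
  P (@measurable_cons_rV R n)).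

Lemma cons_rV0 (p : measurableTypeR R * 'rV[R]_n) : cons_rV p ord0 ord0 = p.1.
Proof. by rewrite /cons_rV mxE; case: splitP => // j j0; rewrite mxE. Qed.

Lemma cons_rVS (p : measurableTypeR R * 'rV[R]_n) j : cons_rV p ord0 (lift ord0 j) = p.2 ord0 j.
Proof.
rewrite /cons_rV mxE; case: splitP => k /=; first by case: k => -[].
by move=> [jk]; congr (_ _ _); exact/val_inj.
Qed.

Lemma rV_fubini (g : 'rV[R]_n.+1 -> \bar R) : (@lebesgue_rV R n.+1).-integrable setT g ->
  \int[@lebesgue_rV R n.+1]_x g x =
    \int[@lebesgue_measure R]_t \int[@lebesgue_rV R n]_y g (cons_rV (t, y)) /\
  \int[@lebesgue_rV R n.+1]_x g x =
    \int[@lebesgue_rV R n]_y \int[@lebesgue_measure R]_t g (cons_rV (t, y)).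
Proof.
move=> ig; have mg := measurable_int _ ig.
have mphi := @measurable_cons_rV R n.
(* At n.+1 [lebesgue_rV] unfolds to the pushforward; [cm] is the same set function with the measure
   structure that the pushforward lemmas expect. *)
have eqm (h : 'rV[R]_n.+1 -> \bar R) : \int[@lebesgue_rV R n.+1]_x h x = \int[cm]_x h x.
  by apply: eq_measure_integral.
have igp : P.-integrable setT (g \o @cons_rV R n).
  apply/integrableP; split; first exact: measurableT_comp.
  have /integrableP[_] := ig; rewrite eqm (ge0_integral_pushforward mphi)//.
  exact: measurableT_comp.
rewrite !eqm (integral_pushforward mphi)// preimage_setT; split.
  by rewrite (integral12_prod_meas1 igp).
by rewrite (integral21_prod_meas1 igp).
Qed.

Lemma mu_cube_cons (a : 'rV[R]_n.+1) r :
  (@lebesgue_rV R n.+1 (cube a r) =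
  lebesgue_measure `[(a ord0 ord0 - r)%R, (a ord0 ord0 + r)%R]%classic *
  @lebesgue_rV R n (cube (\row_j a ord0 (lift ord0 j)) r)).
Proof.
rewrite -product_measure1E//; last exact: measurable_cube.
rewrite /= /pushforward; congr (_ _); apply/seteqP; split => -[t y] /=.
  move=> h; split.
    by have := h ord0; rewrite cons_rV0 in_itv/= -ler_distlC distrC.
  by move=> j; have := h (lift ord0 j); rewrite cons_rVS mxE.
rewrite in_itv/= -ler_distlC distrC => -[h1 h2] j.
have [j' ->|->] := unliftP ord0 j; last by rewrite cons_rV0.
by rewrite cons_rVS; have := h2 j'; rewrite mxE.
Qed.

End fubini_rV.

Section measure_of_cubes.
Context (R : realType).

Lemma mu_cube n (a : 'rV[R]_n) (r : R) : 0 <= r ->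
  @lebesgue_rV R n (cube a r) = ((2 * r) ^+ n)%:E.
Proof.
move=> r0; elim: n a => [|n IH] a.
  rewrite expr0 /= diracE mem_set// => i; by case: i.
rewrite mu_cube_cons IH lebesgue_measure_itv /= lte_fin -EFinD.
have -> : a ord0 ord0 + r - (a ord0 ord0 - r) = 2 * r by ring.
case: ifPn => [_|]; first by rewrite -EFinM exprS.
rewrite -leNgt => h; have -> : r = 0 by lra.
by rewrite mul0e mulr0 expr0n.
Qed.

Lemma mu_cube_fin n (a : 'rV[R]_n) (r : R) : (@lebesgue_rV R n (cube a r) < +oo)%E.
Proof.
have [r0|r0] := leP 0 r; first by rewrite mu_cube// ltry.
apply: le_lt_trans (_ : (@lebesgue_rV R n (cube a 0) < +oo)%E); last by rewrite mu_cube// ltry.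
apply: le_measure; rewrite ?inE; try exact: measurable_cube.
by move=> x h i; apply: le_trans (h i) _; exact: ltW.
Qed.

End measure_of_cubes.

Section derivative_has_zero_integral.
Context (R : realType).

Lemma is_derive_transport (V W : normedModType R) (c : V -> W) (G : W -> R) x v w l :
  (forall h : R, c (h *: v + x) = h *: w + c x) ->
  is_derive (c x) w G l -> is_derive x v (fun y => G (c y)) l.
Proof.
move=> hc [d <-].
have e : (fun h : R => h^-1 *: ((G \o shift (c x)) (h *: w) - G (c x))) =
    (fun h : R => h^-1 *: (((fun y => G (c y)) \o shift x) (h *: v) - G (c x))).
  by apply/funext => h; congr (_ *: (G _ - _)); rewrite /= hc.
by apply: DeriveDef; rewrite /derivable /derive -e.
Qed.

Lemma integral_derive_compact (g g' : R -> R) (r : R) : 0 < r ->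
  (forall t, is_derive t (1 : R) g (g' t)) -> continuous g' ->
  (forall t, r < `|t| -> g t = 0) ->
  (\int[@lebesgue_measure R]_t (g' t)%:E = 0)%E.
Proof.
move=> r0 dg cg' g0.
have g'0 t : r < `|t| -> g' t = 0.
  move=> rt; have [_ <-] := dg t.
  rewrite -[RHS](derive_cst (0 : R) t (1 : R)); apply: near_eq_derive.
  near=> s; rewrite g0//; near: s.
  apply: open_nbhs_nbhs; split => //.
  apply: (@open_comp _ _ (fun x : R => `|x|) [set x | r < x]); last exact: open_gt.
  by move=> x _; exact: norm_continuous.
pose b := r + 1; have rb : r < `|b| by rewrite ger0_norm /b; lra.
have rb' : r < `|- b| by rewrite normrN.
have bb : - b < b by rewrite /b; lra.
have := @continuous_FTC2 R g' g (- b) b bb.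
rewrite !g0// subee// => <-.
- rewrite [RHS]integral_mkcond; apply: eq_integral => t _; rewrite patchE.
  case: ifPn => // /negP; rewrite inE /= in_itv/= => tb; rewrite g'0//.
  rewrite ltNge; apply/negP => tr; apply: tb; rewrite /b.
  by move: tr; rewrite ler_norml => /andP[]; lra.
- exact: continuous_subspaceT.
- have cg : continuous g.
    move=> t; apply: differentiable_continuous; apply/derivable1_diffP.
    by have [] := dg t.
  split; first by move=> t _; have [] := dg t.
    exact/cvg_at_right_filter/cg.
  exact/cvg_at_left_filter/cg.
- by move=> t _; rewrite derive1E; have [_] := dg t.
Unshelve. all: by end_near. Qed.

Lemma cons_rV_shift0 n (t h : R) (y : 'rV[R]_n) :
  cons_rV (h + t, y) = h *: basis_vec R ord0 + cons_rV (t, y).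
Proof.
apply/rowP => j.
have -> : (h *: basis_vec R ord0 + cons_rV (t, y)) ord0 j =
    h * (j == ord0)%:R + cons_rV (t, y) ord0 j.
  by rewrite [LHS]mxE; congr (_ + _); rewrite !mxE.
have [j' ->|->] := unliftP ord0 j; first by rewrite !cons_rVS mulr0 add0r.
by rewrite !cons_rV0 /= mulr1.
Qed.

Lemma cons_rV_shiftS n (t h : R) (y : 'rV[R]_n) j :
  cons_rV (t, h *: basis_vec R j + y) = h *: basis_vec R (lift ord0 j) + cons_rV (t, y).
Proof.
apply/rowP => i.
have -> : (h *: basis_vec R (lift ord0 j) + cons_rV (t, y)) ord0 i =
    h * (i == lift ord0 j)%:R + cons_rV (t, y) ord0 i.
  by rewrite [LHS]mxE; congr (_ + _); rewrite !mxE.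
have [i' ->|->] := unliftP ord0 i; last by rewrite !cons_rV0 /= mulr0 add0r.
by rewrite !cons_rVS !mxE /= (inj_eq lift_inj).
Qed.

Lemma sm_cons n (f : 'rV[R]_n.+1 -> R[i]) (t : R) : sm setT f ->
  sm setT (fun y => f (cons_rV (t, y))) /\
  forall j y, pderiv j (fun y => f (cons_rV (t, y))) y = pderiv (lift ord0 j) f (cons_rV (t, y)).
Proof.
move=> sf.
have cd g j y : sm setT g -> cder j (fun y => g (cons_rV (t, y))) y
    (pderiv (lift ord0 j) g (cons_rV (t, y))).
  move=> sg; have [d1 d2] := C1_cder (lift ord0 j) (sm_C1 sg (Logic.I : setT (cons_rV (t, y)))).
  have tr h : cons_rV (t, h *: basis_vec R j + y) =
    h *: basis_vec R (lift ord0 j) + cons_rV (t, y) by exact: cons_rV_shiftS.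
  split.
    exact: (@is_derive_transport _ _ (fun y => cons_rV (t, y)) (fun z => Rec (g z)) y _ _ _ tr d1).
  exact: (@is_derive_transport _ _ (fun y => cons_rV (t, y)) (fun z => Imc (g z)) y _ _ _ tr d2).
split; last by move=> j y; apply: cder_pderiv; exact: cd.
apply: (@sm_coind R n setT [set h | exists2 g, sm setT g & h = fun y => g (cons_rV (t, y))]).
- exact: openT.
- move=> _ [g sg ->] y _; split; last by move=> j; eexists; exact: cd.
  apply/ccontP => e e0.
  have [/ccontP/(_ _ e0)[d d0 hd] _] := sm_C1 sg (Logic.I : setT (cons_rV (t, y))).
  exists d => // z yz; apply: hd => j; have [j' ->|->] := unliftP ord0 j.
    by rewrite !cons_rVS; exact: yz.
  by rewrite !cons_rV0 subrr normr0.
- move=> _ [g sg ->] j; exists (fun y => pderiv (lift ord0 j) g (cons_rV (t, y))).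
    by exists (pderiv (lift ord0 j) g) => //; exact: sm_pderiv.
  by move=> y _; apply: cder_pderiv; exact: cd.
- by exists f.
Qed.

Lemma cbounded_integrable n (f : 'rV[R]_n -> R[i]) (r : R) : (forall x, ccont f x) ->
  (forall x, ~ cube 0 r x -> f x = 0) ->
  L2 (@lebesgue_rV R n) f /\ cintegrable (@lebesgue_rV R n) f.
Proof.
move=> cf f0; have [B B0 hB] := bounded_on_compact (@cube_compact R n 0 r) (fun x _ => cf x).
have mf := cmeas_cont cf.
split.
  by have [] := L2_bounded (measurable_cube 0 r) (mu_cube_fin 0 r) mf hB f0.
apply: (cintegrable_le mf (integrableZR B (integrable_indicR (measurable_cube 0 r) (mu_cube_fin 0 r)))).
move=> x; rewrite indicE; have [/[!inE]/hB|/negP] := boolP (x \in _); first by rewrite mulr1.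
by rewrite inE => /f0 ->; rewrite nc0 mulr0.
Qed.

Lemma pderiv_supp n (f : 'rV[R]_n -> R[i]) (K : set 'rV[R]_n) j : closed K ->
  (forall x, ~ K x -> f x = 0) -> forall x, ~ K x -> pderiv j f x = 0.
Proof.
move=> cK f0 x Kx; have oK : open (~` K) by exact: closed_openC.
by rewrite (pderiv_eq j oK f0 Kx) pderiv_cst.
Qed.

(** Induction on the dimension through Fubini. If the direction is not the first one, the slices at
    fixed first coordinate have integral zero by induction; otherwise the first coordinate is
    integrated first, by the fundamental theorem of calculus. *)
Lemma integral_pderiv n (f : 'rV[R]_n -> R[i]) (r : R) j : 0 < r -> sm setT f ->
  (forall x, ~ cube 0 r x -> f x = 0) ->
  (\int[@lebesgue_rV R n]_x (Rec (pderiv j f x))%:E = 0 /\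
   \int[@lebesgue_rV R n]_x (Imc (pderiv j f x))%:E = 0)%E.
Proof.
move=> r0; elim: n f j => [|n IH] f j sf f0; first by case: j.
have f0' x : ~ cube 0 r x -> pderiv j f x = 0 by apply: pderiv_supp => //; exact: closed_cube.
have sd := sm_pderiv j sf.
have [_ [i1 i2]] := cbounded_integrable (fun x => (sm_C1 sd (Logic.I : setT x)).1) f0'.
have [j' jE|jE] := unliftP ord0 j.
  have key t : (\int[@lebesgue_rV R n]_y (Rec (pderiv j f (cons_rV (t, y))))%:E = 0 /\
      \int[@lebesgue_rV R n]_y (Imc (pderiv j f (cons_rV (t, y))))%:E = 0)%E.
    have [sc dc] := sm_cons t sf.
    have z y : ~ cube 0 r y -> f (cons_rV (t, y)) = 0.
      move=> hy; apply: f0 => h; apply: hy => i.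
      by have := h (lift ord0 i); rewrite cons_rVS !mxE.
    have [h1 h2] := IH _ j' sc z.
    split; [rewrite -[RHS]h1|rewrite -[RHS]h2]; apply: eq_integral => y _;
      by rewrite dc -jE.
  have [F1 _] := rV_fubini i1; have [F2 _] := rV_fubini i2.
  split; [rewrite F1|rewrite F2]; apply: integral0_eq => t _.
    exact: (key t).1.
  exact: (key t).2.
have key y : (\int[@lebesgue_measure R]_t (Rec (pderiv j f (cons_rV (t, y))))%:E = 0 /\
    \int[@lebesgue_measure R]_t (Imc (pderiv j f (cons_rV (t, y))))%:E = 0)%E.
  have cd (t : R) := C1_cder j (sm_C1 sf (Logic.I : setT (cons_rV (t, y)))).
  have tr (t h : R) : cons_rV (h *: (1 : R) + t, y) = h *: basis_vec R j + cons_rV (t, y).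
    by rewrite [h%:A]mulr1 jE cons_rV_shift0.
  have cc : forall t : R, forall e : R, 0 < e -> \forall s \near t,
      nc (pderiv j f (cons_rV (s, y)) - pderiv j f (cons_rV (t, y))) < e.
    move=> t e e0.
    have [/ccontP/(_ _ e0)[d d0 hd] _] := sm_C1 sd (Logic.I : setT (cons_rV (t, y))).
    apply/nbhs_ballP; exists d => // s ts; apply: hd => i.
    have [i' ->|->] := unliftP ord0 i; first by rewrite !cons_rVS subrr normr0.
    by rewrite !cons_rV0 distrC.
  have z t : r < `|t| -> f (cons_rV (t, y)) = 0.
    move=> rt; apply: f0 => /(_ ord0); rewrite cons_rV0 mxE subr0; lra.
  split.
    apply: (@integral_derive_compact (fun t => Rec (f (cons_rV (t, y)))) _ r r0).
    - move=> t; have [d1 _] := cd t.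
      exact: (@is_derive_transport _ _ (fun t : R => cons_rV (t, y)) (fun z => Rec (f z)) t _ _ _ (tr t) d1).
    - move=> t; apply/cvgrPdist_lt => e e0; apply: filterS (cc t e e0) => s.
      by rewrite distrC -ReN -ReD; exact: le_lt_trans (Re_le_nc _).
    - by move=> t /z ->.
  apply: (@integral_derive_compact (fun t => Imc (f (cons_rV (t, y)))) _ r r0).
  - move=> t; have [_ d2] := cd t.
    exact: (@is_derive_transport _ _ (fun t : R => cons_rV (t, y)) (fun z => Imc (f z)) t _ _ _ (tr t) d2).
  - move=> t; apply/cvgrPdist_lt => e e0; apply: filterS (cc t e e0) => s.
    by rewrite distrC -ImN -ImD; exact: le_lt_trans (Im_le_nc _).
  - by move=> t /z ->.
have [_ F1] := rV_fubini i1; have [_ F2] := rV_fubini i2.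
split; [rewrite F1|rewrite F2]; apply: integral0_eq => y _.
  exact: (key y).1.
exact: (key y).2.
Qed.

End derivative_has_zero_integral.

(** * Test functions and integration by parts *)

Section test_functions.
Context (R : realType) (n : nat).
Notation E := 'rV[R]_n.
Notation fct := (E -> R[i]).
Notation mu := (@lebesgue_rV R n).
Implicit Types (U V K : set E) (f g phi psi : fct).

(** [K] is any compact set outside which [phi] vanishes, rather than its support: sums, products and
    derivatives then involve no closures. *)
Record tst U phi : Prop := Tst { tst_sm : sm setT phi;
  tst_supp : exists2 K, compact K & K `<=` U /\ forall x, ~ K x -> phi x = 0 }.

Lemma compact_closed_rV K : compact K -> closed K.
Proof. by apply: compact_closed; exact: norm_hausdorff. Qed.

Lemma tstP U phi : test_fun U phi <-> tst U phi.
Proof.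
split=> [[s c sU]|[[s] [K cK [KU K0]]]].
  split; first by split.
  exists (supp phi) => //; split=> // x nx; apply: contrapT => /eqP h.
  by apply: nx; apply: subset_closure.
have sK : supp phi `<=` K.
  have /closure_id -> := compact_closed_rV cK; apply: closure_subset => x /= /eqP h.
  by apply: contrapT => /K0.
split=> //; last exact: subset_trans KU.
by apply: subclosed_compact sK => //; exact: closed_closure.
Qed.

Lemma tst_sub U V phi : U `<=` V -> tst U phi -> tst V phi.
Proof.
by move=> UV [s [K cK [KU K0]]]; split => //; exists K => //; split=> //; exact: subset_trans UV.
Qed.

Lemma tst_out U phi x : tst U phi -> ~ U x -> phi x = 0.
Proof. by move=> [_ [K _ [KU K0]]] Ux; apply: K0 => /KU. Qed.

Lemma Dw_supp K f s : closed K -> (forall x, ~ K x -> f x = 0) ->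
  forall x, ~ K x -> Dw s f x = 0.
Proof. by move=> cK f0; elim: s => [//|j s IH]; exact: pderiv_supp. Qed.

Lemma tst_Dw U phi s : tst U phi -> tst U (Dw s phi).
Proof.
move=> [sp [K cK [KU K0]]]; split; first exact: sm_Dw.
exists K => //; split => //; apply: Dw_supp => //; exact: compact_closed_rV.
Qed.

Lemma tst_pderiv U phi j : tst U phi -> tst U (pderiv j phi).
Proof. exact: (@tst_Dw U phi [:: j]). Qed.

Lemma tstM U f phi : open U -> sm U f -> tst U phi -> tst U (fun x => f x * phi x).
Proof.
move=> oU sf [sp [K cK [KU K0]]]; split; last first.
  by exists K => //; split=> // x /K0 ->; rewrite mulr0.
have oK : open (~` K) by apply: closed_openC; exact: compact_closed_rV.
apply: sm_local => x _; have [Kx|nKx] := pselect (K x).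
  by exists U; [exact: KU|apply: smM => //; apply: sm_sub sp].
exists (~` K) => //; apply: (sm_eq oK) (sm_cst 0 oK) => y Ky.
by rewrite K0// mulr0.
Qed.

Lemma tstD U phi psi : tst U phi -> tst U psi -> tst U (fun x => phi x + psi x).
Proof.
move=> [sp [K cK [KU K0]]] [sq [L cL [LU L0]]]; split.
  by apply: smD => //; exact: openT.
exists (K `|` L); first exact: compactU.
split; first by rewrite subUset.
by move=> x /not_orP[/K0 -> /L0 ->]; rewrite addr0.
Qed.

Lemma tstZ U (c : R[i]) phi : tst U phi -> tst U (fun x => c * phi x).
Proof.
move=> [sp [K cK [KU K0]]]; split; first by apply: smZ => //; exact: openT.
by exists K => //; split=> // x /K0 ->; rewrite mulr0.
Qed.

Lemma tst0 U : tst U (fun=> 0).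
Proof.
split; first by apply: sm_cst; exact: openT.
by exists set0; [exact: compact0|split].
Qed.

Lemma tst_sum U I (r : seq I) (F : I -> fct) : (forall i, tst U (F i)) ->
  tst U (fun x => \sum_(i <- r) F i x).
Proof.
move=> tF; elim: r => [|i r IH].
  by under eq_fun do rewrite big_nil; exact: tst0.
by under eq_fun do rewrite big_cons; exact: tstD.
Qed.

Lemma tstJ U phi : tst U phi -> tst U (fun x => conjc (phi x)).
Proof.
move=> [sp [K cK [KU K0]]]; split; first by apply: smJ => //; exact: openT.
by exists K => //; split=> // x /K0 ->; rewrite conjc0.
Qed.

Lemma tst_cube U phi : tst U phi -> exists2 r, 0 < r & forall x, ~ cube 0 r x -> phi x = 0.
Proof.
move=> [_ [K cK [_ K0]]]; have [r r0 Kr] := compact_cube cK.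
by exists r => // x hx; apply: K0 => /Kr.
Qed.

Lemma tst_cont U phi x : tst U phi -> ccont phi x.
Proof. by move=> [sp _]; have [] := sm_C1 sp (Logic.I : setT x). Qed.

Lemma tst_L2 U phi : tst U phi -> L2 mu phi.
Proof.
move=> tp; have [r _ h] := tst_cube tp.
by have [] := cbounded_integrable (fun x => tst_cont x tp) h.
Qed.

Lemma tst_int U phi : tst U phi -> cintegrable mu phi.
Proof.
move=> tp; have [r _ h] := tst_cube tp.
by have [] := cbounded_integrable (fun x => tst_cont x tp) h.
Qed.

Lemma tst_bounded U phi : tst U phi -> exists2 B, 0 < B & forall x, nc (phi x) <= B.
Proof.
move=> tp; have [_ [K cK [KU K0]]] := tp.
have [B B0 hB] := bounded_on_compact cK (fun x _ => tst_cont x tp).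
exists B => // x; have [Kx|nK] := pselect (K x); first exact: hB.
by rewrite K0// nc0 ltW.
Qed.

Lemma cint_pderiv U phi j : tst U phi -> cint mu (pderiv j phi) = 0.
Proof.
move=> tp; have [r r0 h] := tst_cube tp.
have [h1 h2] := integral_pderiv j r0 (tst_sm tp) h.
by apply: eq_cplx; rewrite /= /Rintegral ?h1 ?h2.
Qed.

Lemma cut_tst U f phi : tst U phi -> (fun x => cut U f x * phi x) = (fun x => f x * phi x).
Proof.
move=> tp; apply/funext => x; have [Ux|Ux] := pselect (U x); first by rewrite cutT.
by rewrite (tst_out tp Ux) !mulr0.
Qed.

(** Although [f] is smooth only on [U], its products with [phi] are smooth everywhere, and outside
    [U] the product rule is an identity between zeros. *)
Lemma ibp1 U f phi j : open U -> sm U f -> tst U phi ->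
  cint mu (fun x => pderiv j f x * phi x) = - cint mu (fun x => f x * pderiv j phi x).
Proof.
move=> oU sf tp; have tfp := tstM oU sf tp.
have t1 := tstM oU (sm_pderiv j sf) tp.
have t2 := tstM oU sf (tst_pderiv j tp).
apply/eqP; rewrite -addr_eq0 -cintD; [|exact: tst_int t1|exact: tst_int t2].
rewrite -(cint_pderiv j tfp); apply/eqP; congr cint; apply/funext => x.
have [Ux|nUx] := pselect (U x).
  rewrite pderivM//; first exact: sm_C1 sf Ux.
  exact: sm_C1 (tst_sm tp) _.
rewrite (tst_out tp nUx) mulr0 add0r.
rewrite (tst_out (tst_pderiv j tp) nUx) mulr0.
by rewrite (tst_out (tst_pderiv j tfp) nUx).
Qed.

Lemma ibp U f phi s : open U -> sm U f -> tst U phi ->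
  cint mu (fun x => Dw s f x * phi x) = (-1) ^+ size s * cint mu (fun x => f x * Dw s phi x).
Proof.
move=> oU sf; elim: s phi => [|j s IH] phi tp; first by rewrite expr0 mul1r.
rewrite /= (ibp1 j oU (sm_Dw s sf) tp) IH; last exact: tst_pderiv.
rewrite exprS mulN1r mulNr; congr (- (_ * cint _ _)); apply/funext => x; congr (_ * _).
have oT : open [set: E] by exact: openT.
rewrite -[Dw s _ x]/(Dw s (Dw [:: j] phi) x) -Dw_cat.
rewrite -[RHS]/(Dw (j :: s) phi x).
by apply: (Dw_perm oT (tst_sm tp)) => //; rewrite perm_catC.
Qed.

End test_functions.

(** * Distributions and square integrable functions *)

Section links.
Context (R : realType) (n : nat).
Notation E := 'rV[R]_n.
Notation fct := (E -> R[i]).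
Notation mu := (@lebesgue_rV R n).
Implicit Types (U V W K : set E) (f g phi psi : fct).

Lemma cmeas_cutP U f : measurable U ->
  (measurable_fun U (fun x => Rec (f x) : measurableTypeR R) /\
   measurable_fun U (fun x => Imc (f x) : measurableTypeR R)) <-> cmeas (cut U f).
Proof.
move=> mU; split=> [[m1 m2]|[m1 m2]].
  split.
    rewrite (_ : _ \o _ = (fun x => if `[< U x >] then Rec (f x) else 0)).
      exact: measurable_if_set.
    by apply/funext => x /=; rewrite /cut; case: asboolP.
  rewrite (_ : _ \o _ = (fun x => if `[< U x >] then Imc (f x) else 0)).
    exact: measurable_if_set.
  by apply/funext => x /=; rewrite /cut; case: asboolP.
split.
  apply: (@eq_measurable_fun _ _ _ _ U (Rec \o cut U f)); last exact: measurable_funTS.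
  by move=> x /[!inE] Ux; rewrite /= cutT.
apply: (@eq_measurable_fun _ _ _ _ U (Imc \o cut U f)); last exact: measurable_funTS.
by move=> x /[!inE] Ux; rewrite /= cutT.
Qed.

Lemma L2norm_sqr U f : (L2norm U f `^ 2 = \int[mu]_x (nc (cut U f x) ^+ 2)%:E)%E.
Proof.
rewrite /L2norm powR_Lnorm//; apply: eq_integral => x _; rewrite patchE /cut.
case: ifPn; rewrite ?inE ?notin_setE => Ux.
  rewrite asboolT// abse_EFin poweR_EFin ger0_norm ?nc_ge0//.
  by rewrite -powR_mulrn ?nc_ge0.
by rewrite asboolF// nc0 expr0n abse0 poweR0r.
Qed.

Lemma L2funP U f : measurable U -> L2fun U f <-> L2 mu (cut U f).
Proof.
move=> mU; have mP := cmeas_cutP f mU; split=> [[m1 m2 fin]|[m fin]].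
  have m : cmeas (cut U f) by apply/mP.
  split=> //; apply/integrableP; split; first exact/measurable_EFinP/measurable_funX/cmeas_nc.
  under eq_integral do rewrite /= ger0_norm ?sqr_ge0//.
  by rewrite -L2norm_sqr poweR_lty.
have /mP[m1 m2] := m; split=> //.
have /integrableP[_] := fin; under eq_integral do rewrite /= ger0_norm ?sqr_ge0//.
rewrite -L2norm_sqr; case: (L2norm U f) => [r| |]//; by rewrite ?ltry// poweRyr.
Qed.

Lemma L2normE U f : L2 mu (cut U f) -> L2norm U f = (l2 mu (cut U f))%:E.
Proof.
move=> [m fin]; have fin' := integrable_fin_num measurableT fin.
have E2 : (L2norm U f `^ 2 = (l2 mu (cut U f) ^+ 2)%:E)%E.
  by rewrite L2norm_sqr l2_sqr /Rintegral fineK//; exact: fin'.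
have := Lnorm_ge0 mu 2%:E ((fun x => (nc (f x))%:E) \_ U); rewrite -/(L2norm U f).
case: (L2norm U f) E2 => [r| |] //; last by rewrite poweRyr.
rewrite poweR_EFin lee_fin => e r0; have h : r ^+ 2 = l2 mu (cut U f) ^+ 2.
  by move: e => [<-]; rewrite powR_mulrn.
by congr (_%:E); apply/eqP; rewrite -(@eqrXn2 _ 2)// ?l2_ge0// h.
Qed.

Lemma distr_ofE U f phi : distr_of U f phi = cint mu (fun x => cut U f x * phi x).
Proof.
rewrite /distr_of /cintegral; apply: eq_cplx => /=.
  rewrite Rintegral_mkcond; apply: eq_Rintegral => x _; rewrite patchE /cut.
  by case: ifPn; rewrite ?inE ?notin_setE => Ux; [rewrite asboolT|rewrite asboolF ?mul0r].
rewrite Rintegral_mkcond; apply: eq_Rintegral => x _; rewrite patchE /cut.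
by case: ifPn; rewrite ?inE ?notin_setE => Ux; [rewrite asboolT|rewrite asboolF ?mul0r].
Qed.

Lemma L2_cut_sub U V f : measurable U -> measurable V -> U `<=` V -> L2 mu (cut V f) ->
  L2 mu (cut U f) /\ l2 mu (cut U f) <= l2 mu (cut V f).
Proof.
move=> mU mV UV LV; have [mf _] := LV.
have h x : nc (cut U f x) <= nc (cut V f x).
  rewrite {1}/cut; case: asboolP => [/UV Vx|_]; first by rewrite cutT.
  by rewrite nc0 nc_ge0.
have LU : L2 mu (cut U f).
  by apply: L2_le LV h; rewrite -(cut_sub f UV); exact: cmeas_cut_meas.
by split=> //; exact: l2_le.
Qed.

Lemma L2_cut U f : measurable U -> L2 mu f -> L2 mu (cut U f) /\ l2 mu (cut U f) <= l2 mu f.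
Proof.
move=> mU; have := @L2_cut_sub U setT f mU measurableT (fun _ _ => Logic.I).
by rewrite !cutTE; exact.
Qed.

Definition linear_on U (u : fct -> R[i]) :=
  forall (c : R[i]) phi psi, tst U phi -> tst U psi ->
     u (fun x => c * phi x + psi x) = c * u phi + u psi.

Lemma is_distr_linear U u : is_distr U u -> linear_on U u.
Proof. by move=> [h _] c phi psi /tstP tp /tstP tq; exact: h. Qed.

Lemma linear_on0 U u : linear_on U u -> u (fun=> 0) = 0.
Proof.
move=> h; have := h 1 _ _ (tst0 U) (tst0 U).
rewrite (_ : (fun _ => _) = (fun=> 0)); last by apply/funext => x; rewrite mulr0 addr0.
by rewrite mul1r => /eqP; rewrite -subr_eq0 opprD addrA subrr sub0r oppr_eq0 => /eqP.
Qed.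

Lemma linear_on_sum U u I (r : seq I) (c : I -> R[i]) (F : I -> fct) : linear_on U u ->
  (forall i, tst U (F i)) ->
  u (fun x => \sum_(i <- r) c i * F i x) = \sum_(i <- r) c i * u (F i).
Proof.
move=> h tF; elim: r => [|i r IH].
  by under [X in u X]eq_fun do rewrite big_nil; rewrite big_nil (linear_on0 h).
under [X in u X]eq_fun do rewrite big_cons; rewrite big_cons -IH h//.
by apply: tst_sum => k; apply: tstZ.
Qed.

Lemma tst_Dmi U a phi : open U -> tst U phi -> tst U (Dmi a phi).
Proof.
move=> oU tp; have e : Dmi a phi = fun x => (- 'i%C) ^+ mabs a * Dw (word a) phi x.
  by apply/funext => x; apply: (DmiE a (@openT _) (tst_sm tp)).
by rewrite e; apply: tstZ; exact: tst_Dw.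
Qed.

(** The formal transpose of [P]: by [pdo_appE], testing [P u] on [phi] is testing [u] on
    [Pt P phi]. *)
Definition Pt (P : pdo R n) phi : fct := fun x =>
  \sum_(a <- midx n (pdo_order P)) (-1) ^+ mabs a * Dmi a (fun y => pdo_coef P a y * phi y) x.

Definition smooth_coefs (P : pdo R n) U :=
  forall a, (mabs a <= pdo_order P)%N -> sm U (pdo_coef P a).

(** Coefficients beyond the order of [P], of which nothing is known, are set to zero because the
    lemmas on sums quantify over all indices. *)
Let coef0 (P : pdo R n) (a : {ffun 'I_n -> nat}) : fct :=
  if (mabs a <= pdo_order P)%N then pdo_coef P a else fun=> 0.

Let PtE P phi : Pt P phi = fun x =>
  \sum_(a <- midx n (pdo_order P)) (-1) ^+ mabs a * Dmi a (fun y => coef0 P a y * phi y) x.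
Proof.
apply/funext => x; apply: eq_big_seq => a; rewrite mem_midx => am.
by rewrite /coef0 am.
Qed.

Lemma tst_Pt P U phi : open U -> smooth_coefs P U -> tst U phi -> tst U (Pt P phi).
Proof.
move=> oU sP tp; rewrite PtE; apply: tst_sum => a; apply: tstZ; apply: tst_Dmi => //.
apply: tstM => //; rewrite /coef0; case: ifP => h; first exact: sP.
exact: sm_cst.
Qed.

Lemma pdo_appE P U u phi : open U -> smooth_coefs P U -> linear_on U u -> tst U phi ->
  pdo_app P u phi = u (Pt P phi).
Proof.
move=> oU sP lu tp; rewrite PtE (linear_on_sum _ _ lu).
  apply: eq_big_seq => a; rewrite mem_midx => am.
  by rewrite /Mdistr /Ddistr /coef0 am.
move=> a; apply: tst_Dmi => //; apply: tstM => //; rewrite /coef0; case: ifP => h.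
  exact: sP.
exact: sm_cst.
Qed.

Lemma linear_on_cint U v : (forall phi, tst U phi -> cintegrable mu (fun x => v x * phi x)) ->
  linear_on U (fun phi => cint mu (fun x => v x * phi x)).
Proof.
move=> iv c phi psi tp tq; rewrite -cintZ; last exact: iv.
rewrite -cintD; [|by apply: cintegrableZ; exact: iv|exact: iv].
by congr cint; apply/funext => x; rewrite mulrDr mulrCA.
Qed.

Lemma L2_tst U v phi : L2 mu v -> tst U phi -> cintegrable mu (fun x => v x * phi x).
Proof. by move=> Lv tp; apply: L2_cintegrableM Lv (tst_L2 tp). Qed.

Lemma sup_ge phi a U : tst U phi -> open U ->
  forall x, nc (Dmi a phi x) <= sup (range (fun x => nc (Dmi a phi x))).
Proof.
move=> tp oU x; apply: ub_le_sup; last by exists x.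
have [B _ hB] := tst_bounded (tst_Dmi a oU tp).
by exists B => _ [y _ <-].
Qed.

Definition Cnorm m phi : R :=
  \sum_(a <- midx n m) sup (range (fun x => nc (Dmi a phi x))).

Lemma le_Cnorm m phi U s x : open U -> tst U phi -> (size s <= m)%N ->
  nc (Dw s phi x) <= Cnorm m phi.
Proof.
move=> oU tp sm_; have oT : open [set: E] by exact: openT.
have -> : nc (Dw s phi x) = nc (Dmi (wmi s) phi x).
  rewrite (nc_Dmi _ oT (tst_sm tp) Logic.I); congr nc.
  by apply: (Dw_perm oT (tst_sm tp)) => //; exact: perm_wmi.
apply: le_trans (sup_ge (wmi s) tp oU x) _.
have h : wmi s \in midx n m by rewrite mem_midx mabs_wmi.
rewrite /Cnorm (bigD1_seq _ h (midx_uniq n m))//= lerDl sumr_ge0// => a _.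
by apply: le_trans (nc_ge0 _) (sup_ge a tp oU x).
Qed.

Lemma Cnorm_le m phi (B : R) : (forall s x, (size s <= m)%N -> nc (Dw s phi x) <= B) ->
  sm setT phi -> Cnorm m phi <= (size (midx n m))%:R * B.
Proof.
move=> h sp; have oT : open [set: E] by exact: openT.
rewrite /Cnorm -[_%:R]/((size (midx n m))%:R) -sum1_size natr_sum mulr_suml.
rewrite big_seq [leRHS]big_seq; apply: ler_sum => a; rewrite mem_midx => am.
rewrite mul1r; apply: ge_sup; first by exists (nc (Dmi a phi 0)); exists 0.
by move=> _ [x _ <-]; rewrite (nc_Dmi _ oT sp Logic.I); apply: h; rewrite size_word.
Qed.

Lemma is_distr_L2 U v : open U -> L2 mu v -> is_distr U (fun phi => cint mu (fun x => v x * phi x)).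
Proof.
move=> oU Lv; split.
  move=> c phi psi /tstP tp /tstP tq; apply: (@linear_on_cint U) => // f.
  exact: L2_tst.
move=> K cK KU; have [r r0 Kr] := compact_cube cK.
exists (l2 mu v * Num.sqrt (fine (mu (cube 0 r)))), 0%N => phi /tstP tp sK.
apply: le_trans (cauchy_schwarz Lv (tst_L2 tp)) _.
rewrite -mulrA ler_wpM2l ?l2_ge0// mulrC.
have [] // := @L2_bounded _ _ _ mu phi (Cnorm 0 phi) (cube 0 r) (measurable_cube 0 r)
  (mu_cube_fin 0 r) (proj1 (tst_L2 tp)).
  by move=> x _; exact: (@le_Cnorm 0 phi U [::]).
move=> x nx; apply: contrapT => /eqP h; apply: nx; apply: Kr; apply: sK.
exact: subset_closure.
Qed.

(** Multiplication by a cutoff extends [u] by zero, so the product is a distribution on any open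
    [U0]. Hypoellipticity in [U0] concerns distributions on all of [U0], while the estimates concern
    distributions on smaller sets. *)
Lemma is_distr_mul U U0 u chi : open U -> open U0 -> is_distr U u -> tst U chi ->
  is_distr U0 (fun phi => u (fun x => chi x * phi x)).
Proof.
move=> oU oU0 [lu cu] tc; have oT : open [set: E] by exact: openT.
have tm phi : sm setT phi -> tst U (fun x => chi x * phi x).
  move=> sp; rewrite (_ : (fun _ => _) = (fun x => phi x * chi x)); last first.
    by apply/funext => x; rewrite mulrC.
  by apply: tstM => //; exact: sm_sub sp.
split.
  move=> c phi psi /tstP tp /tstP tq; rewrite -lu; [|by apply/tstP; apply: tm; exact: tst_sm tp|by apply/tstP; apply: tm; exact: tst_sm tq].
  by congr u; apply/funext => x; rewrite mulrDr mulrCA.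
move=> K' _ _; have [_ [K cK [KU K0]]] := tc.
have [C [m hC]] := cu K cK KU.
exists (`|C| * ((size (midx n m))%:R * (2 ^+ m * Cnorm m chi))), m => phi /tstP tp _.
have t1 := tm _ (tst_sm tp).
apply: le_trans (hC _ _ _) _; [exact/tstP| |].
  have /closure_id -> := compact_closed_rV cK; apply: closure_subset => x /= h.
  by apply: contrapT => /K0 e; move: h; rewrite e mul0r eqxx.
rewrite -!/(Cnorm m _) -!mulrA; apply: le_trans (_ : `|C| * Cnorm m (fun x => chi x * phi x) <= _).
  rewrite ler_wpM2r ?ler_norm//; apply: le_trans (le_Cnorm (s := [::]) 0 oU t1 _) => //.
  exact: nc_ge0.
rewrite ler_wpM2l//; apply: Cnorm_le (tst_sm t1) => s x sm_.
rewrite (Dw_leibniz s oT (tst_sm tc) (tst_sm tp) Logic.I).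
apply: le_trans (nc_sum _ _ _) _.
have c0 : 0 <= Cnorm m chi by apply: le_trans (nc_ge0 _) (le_Cnorm (s := [::]) 0 oU tc _).
have p0 : 0 <= Cnorm m phi by apply: le_trans (nc_ge0 _) (le_Cnorm (s := [::]) 0 oU0 tp _).
apply: le_trans (_ : \sum_(p <- splits s) 1 ^+ size p.1 * 1 ^+ size p.2 * (Cnorm m chi * Cnorm m phi) <= _).
  rewrite big_seq [leRHS]big_seq; apply: ler_sum => p /size_splits ps.
  rewrite !expr1n !mul1r ncM ler_pM ?nc_ge0//.
    by apply: le_Cnorm oU tc _; rewrite (leq_trans _ sm_)// -ps leq_addr.
  by apply: le_Cnorm oU0 tp _; rewrite (leq_trans _ sm_)// -ps leq_addl.
by rewrite -mulr_suml sum_splits ler_wpM2r ?mulr_ge0// (_ : 1 + 1 = 2)// ler_weXn2l// ler1n.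
Qed.

Lemma is_distrB U u v : is_distr U u -> is_distr U v -> is_distr U (fun phi => u phi - v phi).
Proof.
move=> [lu cu] [lv cv]; split.
  by move=> c phi psi tp tq; rewrite lu// lv//; ring.
move=> K cK KU; have [C [m hC]] := cu K cK KU; have [C' [m' hC']] := cv K cK KU.
exists (`|C| + `|C'|), (m + m')%N => phi tp sK.
have tp' := (tstP U phi).1 tp.
have mono k l : (k <= l)%N -> Cnorm k phi <= Cnorm l phi.
  move=> kl; rewrite /Cnorm.
  have s0 a : 0 <= sup (range (fun x => nc (Dmi a phi x))).
    have [B _ hB] := tst_bounded (tst_Dw (word a) tp').
    apply: le_trans (nc_ge0 (Dmi a phi 0)) _; apply: ub_le_sup; last by exists 0.
    exists B => _ [y _ <-]; rewrite (nc_Dmi _ (@openT _) (tst_sm tp') Logic.I); exact: hB.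
  rewrite [leRHS](bigID (mem (midx n k)))/= -[leLHS]addr0 lerD ?sumr_ge0//.
  have pe : perm_eq (midx n k) [seq a <- midx n l | a \in midx n k].
    apply: uniq_perm; [exact: midx_uniq|exact/filter_uniq/midx_uniq|].
    by move=> a; rewrite mem_filter !mem_midx andb_idr// => /leq_trans; apply.
  by rewrite (perm_big _ pe) big_filter.
have c0 k : 0 <= Cnorm k phi.
  rewrite sumr_ge0// => a _.
  have [B _ hB] := tst_bounded (tst_Dw (word a) tp').
  apply: le_trans (nc_ge0 (Dmi a phi 0)) _; apply: ub_le_sup; last by exists 0.
  exists B => _ [y _ <-]; rewrite (nc_Dmi _ (@openT _) (tst_sm tp') Logic.I); exact: hB.
rewrite (le_trans (ncD _ _))// ncN mulrDl lerD//.
  apply: le_trans (hC phi tp sK) _; rewrite -!/(Cnorm _ phi).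
  apply: le_trans (_ : `|C| * Cnorm m phi <= _); first by rewrite ler_wpM2r// ler_norm.
  by rewrite ler_wpM2l// mono// leq_addr.
apply: le_trans (hC' phi tp sK) _; rewrite -!/(Cnorm _ phi).
apply: le_trans (_ : `|C'| * Cnorm m' phi <= _); first by rewrite ler_wpM2r// ler_norm.
by rewrite ler_wpM2l// mono// leq_addl.
Qed.

End links.

(** * Cutoff functions *)

Section smooth_one_variable.
Context (R : realType).
Implicit Types (F G : nat -> R -> R).

(** A smooth function of one variable together with its successive derivatives, so that bounds on
    derivatives are bounds on [F k]. *)
Definition dseq F := forall k t, is_derive t (1 : R) (F k) (F k.+1 t).

Lemma dseq_continuous F k : dseq F -> continuous (F k).
Proof.
move=> dF t; apply: differentiable_continuous; apply/derivable1_diffP.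
by have [] := dF k t.
Qed.

Lemma is_derive_affine (f : R -> R) (a b t l : R) : is_derive (a * t + b) (1 : R) f l ->
  is_derive t (1 : R) (fun s => f (a * s + b)) (a * l).
Proof.
move=> df.
have d1 : is_derive t (1 : R) (fun s : R => a * s + b) a.
  have h := @is_deriveD R R R (fun s : R => a * s) (cst b) t 1 _ _
    (@is_deriveZ R R R id a t 1 _ (@is_derive_id R R t 1)) (@is_derive_cst R R R b t 1).
  by apply: is_derive_eq h _; rewrite addr0 /GRing.scale /= mulr1.
have h := @is_derive1_comp R f (fun s : R => a * s + b) t l a df d1.
by apply: is_derive_eq h _; rewrite mulrC.
Qed.

Lemma dseq_affine F (a b : R) : dseq F -> dseq (fun k t => a ^+ k * F k (a * t + b)).
Proof.
move=> dF k t; have := is_derive_affine (dF k (a * t + b)).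
move=> /(@is_deriveZ _ _ _ _ (a ^+ k)); rewrite /GRing.scale /= => h.
by apply: is_derive_eq h _; rewrite mulrA -exprSr.
Qed.

Lemma dseqZ F (c : R) : dseq F -> dseq (fun k t => c * F k t).
Proof. by move=> dF k t; exact: (@is_deriveZ _ _ _ _ c _ _ _ (dF k t)). Qed.

Fixpoint pairs (k : nat) : seq (nat * nat) :=
  if k is k'.+1 then
    [seq (p.1.+1, p.2) | p <- pairs k'] ++ [seq (p.1, p.2.+1) | p <- pairs k']
  else [:: (0, 0)]%N.

Lemma dseqM F G : dseq F -> dseq G ->
  dseq (fun k t => \sum_(p <- pairs k) F p.1 t * G p.2 t).
Proof.
move=> dF dG k t /=; rewrite big_cat !big_map /= -big_split /=.
elim: (pairs k) => [|p r IH].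
  under eq_fun do rewrite big_nil; rewrite big_nil; exact: is_derive_cst.
under eq_fun do rewrite big_cons; rewrite big_cons.
apply: is_deriveD => //; apply: is_derive_eq (is_deriveM (dF p.1 t) (dG p.2 t)) _.
by rewrite /GRing.scale /= addrC [G _ _ * _]mulrC.
Qed.

Lemma is_derive_diff (f f' : R -> R) s t : s <= t -> (forall t, is_derive t (1 : R) f (f' t)) ->
  exists2 c, s <= c <= t & f t - f s = f' c * (t - s).
Proof.
move=> st df; have ts : 0 <= t - s by rewrite subr_ge0.
have [c ch E] := @line_mvt R R f f' s (1 : R) (t - s) ts (fun x _ => df _).
exists (s + c); first by move: ch; lra.
rewrite -{1}(_ : s + (t - s)%:A = t); last by rewrite [_%:A]mulr1 addrC subrK.
by rewrite E [c%:A]mulr1.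
Qed.

Lemma is_derive0_sqr (f : R -> R) (C : R) : 0 < C ->
  (forall h, `|h| <= 1 -> `|f h - f 0| <= C * h ^+ 2) -> is_derive (0 : R) (1 : R) f 0.
Proof.
move=> C0 hf.
have cv : (fun h : R => h^-1 *: ((f \o shift 0) (h *: (1 : R)) - f 0)) @ 0^' --> (0 : R).
  apply/cvgrPdist_le => e e0; near=> h.
  have h0 : h != 0 by near: h; exact: nbhs_dnbhs_neq.
  rewrite sub0r normrN /= addr0 [h%:A]mulr1 /GRing.scale /= normrM normfV.
  rewrite mulrC ler_pdivrMr ?normr_gt0//.
  apply: le_trans (hf h _) _; first by near: h; apply: dnbhs0_le.
  rewrite -real_normK ?num_real// expr2 mulrA ler_wpM2r// -ler_pdivlMl// mulrC.
  by near: h; apply: dnbhs0_le; rewrite divr_gt0.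
by apply: DeriveDef; [apply/cvg_ex; exists 0|exact: cvg_lim cv].
Unshelve. all: by end_near.
Qed.

(** With y = 1/t, the derivative of p(y) exp(-y) with respect to t is y^2 (p - p')(y) exp(-y). *)
Definition flat_poly (p : {poly R}) : {poly R} := 'X^2 * (p - p^`()).

(* The k-th derivative of exp (-1/t), extended by 0 to t <= 0. *)
Definition flat (k : nat) (t : R) : R :=
  if 0 < t then (iter k flat_poly 1%:P).[t^-1] * expR (- t^-1) else 0.

Lemma poly_bound (p : {poly R}) : exists (C : R) (m : nat), 0 < C /\
  forall y, 1 <= y -> `|p.[y]| <= C * y ^+ m.
Proof.
exists (1 + \sum_(i < size p) `|p`_i|), (size p); split.
  by rewrite ltr_pwDl// sumr_ge0.
move=> y y1; rewrite horner_coef (le_trans (ler_norm_sum _ _ _))//.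
apply: le_trans (_ : (\sum_(i < size p) `|p`_i|) * y ^+ size p <= _); last first.
  by rewrite ler_wpM2r ?lerDr// exprn_ge0// (le_trans ler01).
rewrite mulr_suml; apply: ler_sum => i _; rewrite normrM ler_wpM2l//.
rewrite normrX ger0_norm ?(le_trans ler01)//.
by rewrite ler_weXn2l// ltnW.
Qed.

Lemma expR_ge_pow (N : nat) (y : R) : (0 < N)%N -> 0 <= y -> (y / N%:R) ^+ N <= expR y.
Proof.
move=> N0 y0; have Np : (0 : R) < N%:R by rewrite ltr0n.
have e : expR y = expR (y / N%:R) ^+ N.
  have h k z : expR (k%:R * z) = expR z ^+ k.
    by elim: k => [|k IH]; rewrite ?mul0r ?expR0// exprS -IH -expRD -natr1; congr expR; ring.
  by rewrite -h; congr expR; field; rewrite lt0r_neq0.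
rewrite e lerXn2r ?nnegrE ?expR_ge0 ?divr_ge0// ?(ltW Np)//.
by apply: le_trans (expR_ge1Dx _); rewrite lerDr.
Qed.

Lemma flat_small (p : {poly R}) : exists2 C : R, 0 < C &
  forall t, 0 < t -> t <= 1 -> `|p.[t^-1] * expR (- t^-1)| <= C * t ^+ 2.
Proof.
(* The exponent m + 2 beats the growth of order m of the polynomial and leaves t^2. *)
have [C [m [C0 hC]]] := poly_bound p; have [N NE] : exists N, N = m.+2 by exists m.+2.
have N0 : (0 < N)%N by rewrite NE.
exists (C * N%:R ^+ N); first by rewrite mulr_gt0// exprn_gt0// ltr0n.
move=> t t0 t1; have y1 : 1 <= t^-1 by rewrite invf_ge1.
have yp : 0 < t^-1 by rewrite invr_gt0.
rewrite normrM (ger0_norm (expR_ge0 _)) expRN.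
have hN := @expR_ge_pow N t^-1 N0 (ltW yp).
have ep : 0 < (t^-1 / N%:R) ^+ N by rewrite exprn_gt0// divr_gt0// ltr0n.
apply: le_trans (_ : (C * t^-1 ^+ m) * ((t^-1 / N%:R) ^+ N)^-1 <= _).
  rewrite ler_pM ?invr_ge0 ?expR_ge0// ?hC//.
  by rewrite lef_pV2 ?posrE// ?expR_gt0.
rewrite -exprVn invfM !invrK exprMn [t ^+ N * _]mulrC -!mulrA ler_wpM2l ?(ltW C0)//.
rewrite mulrCA ler_wpM2l ?exprn_ge0//.
by rewrite NE -addn2 exprD mulrA -exprMn mulVf ?gt_eqF// expr1n mul1r.
Qed.

Lemma dseq_flat : dseq flat.
Proof.
move=> k t; pose p := iter k flat_poly 1%:P.
have [t0|t0|t0] := ltgtP t 0.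
- rewrite [flat k.+1 t]/flat ltNge (ltW t0) /=.
  apply: (near_eq_is_derive _ (is_derive_cst (0 : R) t (1 : R))).
  near=> s; rewrite /flat ifN//= -leNgt ltW//; near: s.
  by apply: open_nbhs_nbhs; split => //; exact: open_lt.
- have ft : flat k.+1 t = (t^-1) ^+ 2 * (p.[t^-1] - p^`().[t^-1]) * expR (- t^-1).
    by rewrite /flat t0 /= -/p /flat_poly hornerM hornerXn hornerD hornerN.
  have tn0 : t != 0 by rewrite gt_eqF.
  have dinv : is_derive t (1 : R) (fun s : R => s^-1) (- (t ^- 2)).
    have h := @is_deriveV R id t 1 1 tn0 (@is_derive_id R R t 1).
    by apply: is_derive_eq h _; rewrite /GRing.scale /= mulr1.
  have dp : is_derive t (1 : R) (fun s => p.[s^-1]) (p^`().[t^-1] * - (t ^- 2)).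
    exact: (@is_derive1_comp R (horner p) (fun s : R => s^-1) t _ _ (is_derive_poly p t^-1) dinv).
  have dninv : is_derive t (1 : R) (fun s : R => - s^-1) (t ^- 2).
    by have h := is_deriveN dinv; apply: is_derive_eq h _; rewrite opprK.
  have de : is_derive t (1 : R) (fun s : R => expR (- s^-1)) (expR (- t^-1) * t ^- 2).
    exact: (@is_derive1_comp R expR (fun s : R => - s^-1) t _ _ (is_derive_expR _) dninv).
  apply: (@near_eq_is_derive R R R (fun s => p.[s^-1] * expR (- s^-1)) (flat k) t 1).
    near=> s; rewrite /flat ifT// ; near: s.
    by apply: open_nbhs_nbhs; split => //; exact: open_gt.
  rewrite ft; apply: is_derive_eq (is_deriveM dp de) _.
  by rewrite /GRing.scale /= exprVn; ring.
- rewrite t0 [flat k.+1 0]/flat ltxx.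
  have [C C0 hC] := flat_small p.
  apply: (is_derive0_sqr C0) => h h1.
  rewrite [flat k 0]/flat ltxx subr0 /flat; case: ifP => h0.
    by apply: hC => //; exact: le_trans (ler_norm h) h1.
  by rewrite normr0 mulr_ge0 ?(ltW C0) ?sqr_ge0.
Unshelve. all: by end_near.
Qed.

Lemma flat_le0 k t : t <= 0 -> flat k t = 0.
Proof. by move=> t0; rewrite /flat ltNge t0. Qed.

Lemma antiderivative (f : R -> R) : continuous f -> (forall t, t <= 0 -> f t = 0) ->
  exists2 F : R -> R, forall t, is_derive t (1 : R) F (f t) & forall t, t <= 0 -> F t = 0.
Proof.
move=> cf f0; have mf : measurable_fun setT f by exact: continuous_measurable_fun.
pose F x := (\int[@lebesgue_measure R]_(t in [set` Interval (BInfty _ true) (BRight x)]) (f t))%R.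
exists F; last first.
  move=> t t0; rewrite /F (_ : (\int[_]_(t in _) _)%R = (\int[@lebesgue_measure R]_(t in [set` Interval (BInfty _ true) (BRight t)]) 0)%R).
    by rewrite Rintegral_cst ?mul0r.
  apply: eq_Rintegral => s; rewrite inE /= in_itv /= => st; apply: f0; exact: le_trans st t0.
move=> x.
have fi : (@lebesgue_measure R).-integrable [set` Interval (BInfty _ true) (BRight (`|x| + 1))] (EFin \o f).
  rewrite integrable_mkcond//.
  have e : ((EFin \o f) \_ [set` Interval (BInfty _ true) (BRight (`|x| + 1))] =
     (EFin \o f) \_ `[0%R, (`|x| + 1)%R]).
    apply/funext => t; rewrite !patchE !mem_setE !in_itv /=.
    have [t0|t0] := leP 0 t; first by [].
    by case: ifP => //= _; rewrite f0// ltW.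
  rewrite e -integrable_mkcond//; apply: continuous_compact_integrable.
    exact: segment_compact.
  exact: continuous_subspaceT.
have xu : x < `|x| + 1 by rewrite (le_lt_trans (ler_norm x))// ltrDl.
have [|d e] := @continuous_FTC1 R f (BInfty _ true) x (`|x| + 1) xu fi _ (cf x).
  exact: ltNyr.
by apply: DeriveDef; [exact: d|rewrite -e derive1E].
Qed.

Definition step (a : R) F := [/\ dseq F, forall k t, t <= 0 -> F k t = 0,
  forall t, a <= t -> F 0%N t = 1 & forall t, 0 <= F 0%N t <= 1].

Lemma step1 : exists F, step 1 F.
Proof.
(* [B 0] is a bump that vanishes off (0, 1); the step is its normalized antiderivative. *)
pose B k t := \sum_(p <- pairs k) flat p.1 t * ((-1) ^+ p.2 * flat p.2 (-1 * t + 1)).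
have dB : dseq B by exact: dseqM dseq_flat (dseq_affine (-1) 1 dseq_flat).
have B0 k t : t <= 0 -> B k t = 0.
  by move=> t0; rewrite /B big1// => p _; rewrite flat_le0// mul0r.
have B1 t : 1 <= t -> B 0%N t = 0.
  by move=> t1; rewrite /B big_seq1 /= (@flat_le0 _ (-1 * t + 1)) ?mulr0//; lra.
have fl t : 0 <= flat 0 t by rewrite /flat; case: ifP => //= _; rewrite hornerC mul1r expR_ge0.
have Bp t : 0 <= B 0%N t by rewrite /B big_seq1 /= expr0 mul1r mulr_ge0.
have flp t : 0 < t -> 0 < flat 0 t by move=> t0; rewrite /flat t0 /= hornerC mul1r expR_gt0.
have Bpp t : 0 < t < 1 -> 0 < B 0%N t.
  by move=> t01; rewrite /B big_seq1 /= expr0 mul1r mulr_gt0// flp//; lra.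
have [G dG G0] := antiderivative (@dseq_continuous _ 0 dB) (B0 0%N).
have mono s t : s <= t -> G s <= G t.
  move=> st; have [c _ E] := is_derive_diff st dG.
  by rewrite -subr_ge0 E mulr_ge0// subr_ge0.
have G1 t : 1 <= t -> G t = G 1.
  move=> t1; have [c /andP[c1 _] E] := is_derive_diff t1 dG.
  by apply/eqP; rewrite -subr_eq0 E B1// mul0r.
have Gp : 0 < G 1.
  have G34 : G (1/4) < G (3/4).
    have [|c ch E] := @is_derive_diff G (B 0%N) (1/4) (3/4) _ dG; first lra.
    by rewrite -subr_gt0 E mulr_gt0//; [apply: Bpp; lra|lra].
  apply: le_lt_trans (_ : G (1/4) < _); first by rewrite -(G0 0 (lexx _)) mono//; lra.
  by apply: lt_le_trans G34 _; apply: mono; lra.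
exists (fun k t => (G 1)^-1 * (if k is k'.+1 then B k' t else G t)); split.
- by apply: dseqZ; case=> [|k] t; [exact: dG|exact: dB].
- by case=> [|k] t t0; rewrite ?(G0 t t0) ?(B0 k t t0) mulr0.
- by move=> t t1; rewrite G1// mulVf// gt_eqF.
- move=> t; rewrite mulr_ge0 ?invr_ge0 ?(ltW Gp)//=; last first.
    by have [t0|/ltW t0] := leP t 0; [rewrite G0|rewrite -(G0 0 (lexx _)) mono].
  rewrite ler_pdivrMl// mulr1.
  by have [t1|/ltW t1] := leP t 1; [exact: mono|rewrite G1].
Qed.

(* Averaging over [t - h, t] gains the control of one more derivative. *)
Lemma step_average (a h : R) F m : 0 < h -> step a F ->
  (forall j t, (j <= m)%N -> `|F j t| <= (2 / h) ^+ j) ->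
  exists2 F', step (a + h) F' & forall j t, (j <= m.+1)%N -> `|F' j t| <= (2 / h) ^+ j.
Proof.
move=> h0 [dF F0 Fa F01] Fm.
have [G dG G0] := antiderivative (@dseq_continuous _ 0 dF) (F0 0%N).
pose H k t := if k is k'.+1 then F k' t else G t.
have dH : dseq H by case=> [|k] t; [exact: dG|exact: dF].
have H0 k t : t <= 0 -> H k t = 0 by case: k => [|k] t0; [exact: G0|exact: F0].
have hn : h != 0 by rewrite gt_eqF.
(* By the mean value theorem an average of [F k] is one of its values, so all bounds already known
   are inherited. *)
have key k t : exists2 c, t - h <= c <= t & h^-1 * (H k t - H k (t - h)) = F k c.
  have th : t - h <= t by rewrite gerBl ltW.
  have [c ch E] := is_derive_diff th (dH k).
  by exists c => //; rewrite E /=; field.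
exists (fun k t => h^-1 * (H k t - H k (t - h))).
  split.
  - apply: dseqZ => k t; apply: is_deriveB (dH k t) _.
    have := @is_derive_affine (H k) 1 (- h) t (H k.+1 (t - h)).
    by rewrite !mul1r => /(_ (dH k _)); under eq_fun do rewrite mul1r.
  - by move=> k t t0; rewrite !H0 ?subr0 ?mulr0//; lra.
  - by move=> t ta; have [c ch ->] := key 0%N t; apply: Fa; lra.
  - by move=> t; have [c ch ->] := key 0%N t; apply: F01.
move=> j t; rewrite leq_eqVlt ltnS => /orP[/eqP ->|jm]; last first.
  by have [c _ ->] := key j t; exact: Fm.
rewrite /= normrM ger0_norm ?invr_ge0 ?(ltW h0)// exprS [2 / h]mulrC -mulrA.
rewrite ler_wpM2l ?invr_ge0 ?(ltW h0)//.
by apply: le_trans (ler_normB _ _) _; rewrite mulrDl mul1r [h^-1 * 2]mulrC lerD// Fm.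
Qed.

(* Ehrenpreis: average [step1] k times over intervals of length 1 / (k + 1), then rescale. *)
Lemma step_seq (k : nat) : exists2 F, step 1 F &
  forall j t, (j <= k)%N -> `|F j t| <= (4 * k.+1%:R) ^+ j.
Proof.
have k0 : (0 : R) < k.+1%:R by rewrite ltr0n.
have h0 : (0 : R) < k.+1%:R^-1 by rewrite invr_gt0.
have H m : exists2 F, step (1 + m%:R / k.+1%:R) F &
    forall j t, (j <= m)%N -> `|F j t| <= (2 / k.+1%:R^-1) ^+ j.
  elim: m => [|m [F sF Fm]].
    have [F sF] := step1; exists F; first by rewrite mul0r addr0.
    move=> j t; rewrite leqn0 => /eqP ->; have [_ _ _ /(_ t)] := sF.
    by rewrite expr0 => /andP[F0 F1]; rewrite ger0_norm.
  have [F' sF' Fm'] := step_average h0 sF Fm; exists F' => //.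
  by rewrite (_ : 1 + m.+1%:R / k.+1%:R = 1 + m%:R / k.+1%:R + k.+1%:R^-1)// -natr1; ring.
have [F [dF F0 F1 F01] Fm] := H k.
(* After k averages the step is complete at 1 + k/(k+1) < 2; compressing by 2 doubles the constant
   of the bound 2 (k+1), whence 4. *)
exists (fun j t => 2 ^+ j * F j (2 * t + 0)).
  split.
  - exact: dseq_affine.
  - by move=> j t t0; rewrite F0 ?mulr0//; lra.
  - move=> t t1; rewrite expr0 mul1r F1//.
    have : k%:R / k.+1%:R <= (1 : R) by rewrite ler_pdivrMr// mul1r ler_nat.
    by move: t1; set q := (_ / _) => t1 q1; lra.
  - by move=> t; rewrite expr0 mul1r.
move=> j t jk; rewrite normrM ger0_norm ?exprn_ge0//.
apply: le_trans (ler_wpM2l _ (Fm j _ jk)) _; first by rewrite exprn_ge0.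
by rewrite -exprMn invrK mulrA (_ : 2 * 2 = 4)//; ring.
Qed.

End smooth_one_variable.

Section cutoffs.
Context (R : realType) (n : nat).
Notation E := 'rV[R]_n.
Notation fct := (E -> R[i]).
Implicit Types (F : nat -> R -> R) (i j : 'I_n) (s : seq 'I_n) (th : E -> R).

Let oT : open [set: E] := @openT _.

Definition ofcoord i (H : R -> R) : fct := fun x => (H (x ord0 i))%:C%C.

Lemma C1_ofcoord F i k j x : dseq F ->
  ccont (ofcoord i (F k)) x /\
  cder j (ofcoord i (F k)) x (((i == j)%:R * F k.+1 (x ord0 i))%:C%C).
Proof.
move=> dF; split.
  apply/ccontP => e e0.
  have /(@cvgrPdist_lt _ _ _ _ (nbhs_filter (x ord0 i)))/(_ _ e0)/nbhs_ballP[d d0 hd] :=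
    @dseq_continuous _ _ k dF (x ord0 i).
  exists d; [exact: d0|move=> y xy].
  rewrite (_ : _ - _ = (F k (y ord0 i) - F k (x ord0 i))%:C%C); last by rewrite rmorphB.
  rewrite nc_real distrC; apply: hd.
  by rewrite /ball /= distrC; exact: xy.
have d1 : is_derive x (basis_vec R j) (fun y : E => F k (y ord0 i)) ((i == j)%:R * F k.+1 (x ord0 i)).
  have tr (h : R) : (h *: basis_vec R j + x) ord0 i = h *: ((i == j)%:R : R) + x ord0 i.
    by rewrite !mxE.
  apply: (@is_derive_transport R _ _ (fun y : E => y ord0 i) (F k) x _ ((i == j)%:R : R) _ tr).
  have [ij|ij] := eqVneq i j; first by rewrite mul1r; exact: dF.
  have e : (fun h : R => h^-1 *: ((F k \o shift (x ord0 i)) (h *: (0 : R)) - F k (x ord0 i))) = cst (0 : R).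
    by apply/funext => h; rewrite /= scaler0 add0r subrr scaler0.
  rewrite mul0r; apply: DeriveDef; rewrite /derivable /derive e; first exact: is_cvg_cst.
  exact: lim_cst.
by split=> //=; exact: is_derive_cst.
Qed.

Lemma sm_ofcoord F i : dseq F -> sm setT (ofcoord i (F 0%N)).
Proof.
move=> dF; apply: (@sm_coind R n setT [set f | exists c k, f = fun x => c * ofcoord i (F k) x]) => //.
- move=> _ [c [k ->]] x _; apply: C1M; first exact: C1_cst.
  split; first exact: (C1_ofcoord i k (i : 'I_n) x dF).1.
  by move=> j; eexists; exact: (C1_ofcoord i k j x dF).2.
- move=> _ [c [k ->]] j; exists (fun x => (c * (i == j)%:R) * ofcoord i (F k.+1) x).
    by exists (c * (i == j)%:R), k.+1.
  move=> x _; apply: cder_pderiv; have [_ d] := C1_ofcoord i k j x dF.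
  have := cderM (cder_cst j c x) d.
  by rewrite mul0r add0r /ofcoord rmorphM rmorph_nat mulrA.
- by exists 1, 0%N; apply/funext => x; rewrite mul1r.
Qed.

Lemma Dw_ofcoord F i s : dseq F -> exists b : bool, forall x,
  Dw s (ofcoord i (F 0%N)) x = b%:R * ofcoord i (F (size s)) x.
Proof.
move=> dF; elim: s => [|j s [b IH]]; first by exists true => x; rewrite mul1r.
exists (b && (i == j)) => x; rewrite /= (pderiv_eq j oT (fun y _ => IH y) Logic.I).
apply: cder_pderiv; have [_ d] := C1_ofcoord i (size s) j x dF.
have := cderM (cder_cst j b%:R x) d.
by rewrite mul0r add0r /ofcoord rmorphM rmorph_nat mulrA -natrM mulnb.
Qed.

Definition rc th : fct := fun x => (th x)%:C%C.

(** A nonzero function of compact support cannot satisfy such bounds at all orders, as it would be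
    analytic; hence the restriction to orders up to [k], with [B] proportional to k + 1 in the
    applications. *)
Definition cutoff k (B : R) th := [/\ sm setT (rc th), forall x, 0 <= th x <= 1 &
  forall s x, (size s <= k)%N -> nc (Dw s (rc th) x) <= B ^+ size s].

Lemma cutoff_cst k B (b : bool) : 0 <= B -> cutoff k B (fun=> b%:R).
Proof.
move=> B0; split; [exact: sm_cst|by move=> x; case: b; rewrite ?lexx ?ler01|].
move=> [|j s] x _.
  by rewrite expr0 (_ : Dw [::] _ x = (b%:R : R)%:C%C)// nc_real; case: b; rewrite ?normr1 ?normr0.
rewrite (_ : Dw (j :: s) (rc (fun=> b%:R)) x = 0) ?nc0 ?exprn_ge0//.
elim: s j x => [|i s IH] j x /=; first exact: pderiv_cst.
by rewrite (pderiv_eq j oT (fun y _ => IH i y) Logic.I) pderiv_cst.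
Qed.

Lemma cutoffM k B C th th' : cutoff k B th -> cutoff k C th' ->
  cutoff k (B + C) (fun x => th x * th' x).
Proof.
move=> [s1 b1 d1] [s2 b2 d2].
have e : rc (fun x => th x * th' x) = fun x => rc th x * rc th' x.
  by apply/funext => x; rewrite /rc rmorphM.
split; first by rewrite e; exact: smM.
  by move=> x; have /andP[? ?] := b1 x; have /andP[? ?] := b2 x; rewrite mulr_ge0// mulr_ile1.
move=> s x sk; rewrite e; apply: (@Dw_mul_le R n setT k) sk => // t tk; [exact: d1|exact: d2].
Qed.

Lemma cutoff_compl k B th : cutoff k B th -> cutoff k B (fun x => 1 - th x).
Proof.
move=> [s1 b1 d1].
have e : rc (fun x => 1 - th x) = fun x => 1 + (-1) * rc th x.
  by apply/funext => x; rewrite /rc rmorphB mulN1r.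
have s2 : sm setT (fun x => (-1) * rc th x) by exact: smZ.
split; first by rewrite e; apply: smD => //; exact: sm_cst.
  by move=> x; have := b1 x; lra.
move=> s x sk; case: s sk => [|j s] sk.
  by rewrite expr0 /rc nc_real; have := b1 x => h; rewrite ger0_norm; lra.
apply: le_trans (d1 (j :: s) x sk); rewrite e (DwD _ oT (sm_cst 1 oT) s2 Logic.I).
rewrite (DwZ _ _ oT s1 Logic.I) mulN1r (_ : Dw (j :: s) (fun=> 1) x = 0) ?add0r ?ncN//.
elim: s j x {sk} => [|i s IH] j x /=; first exact: pderiv_cst.
by rewrite (pderiv_eq j oT (fun y _ => IH i y) Logic.I) pderiv_cst.
Qed.

Lemma cutoff_prod (I : Type) (r : seq I) k B (th : I -> E -> R) : 0 <= B ->
  (forall a, cutoff k B (th a)) -> cutoff k ((size r)%:R * B) (fun x => \prod_(a <- r) th a x).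
Proof.
move=> B0 h; elim: r => [|a r IH].
  have := @cutoff_cst k (0%:R * B) true; rewrite mul0r => /(_ (lexx 0)).
  by rewrite (_ : (fun=> true%:R) = (fun x => \prod_(a <- [::]) th a x))//; apply/funext => x; rewrite big_nil.
rewrite (_ : (fun x => _) = (fun x => th a x * \prod_(a <- r) th a x)); last first.
  by apply/funext => x; rewrite big_cons.
by rewrite /= -natr1 mulrDl mul1r addrC; exact: cutoffM.
Qed.

Lemma cutoff_ofcoord k c F i (a b : R) : 0 <= c -> step 1 F ->
  (forall q t, (q <= k)%N -> `|F q t| <= c ^+ q) ->
  cutoff k (`|a| * c) (fun x => F 0%N (a * x ord0 i + b)).
Proof.
move=> c0 [dF F0 F1 F01] Fc; have dG := dseq_affine a b dF.
have e : rc (fun x => F 0%N (a * x ord0 i + b)) = ofcoord i (fun t => a ^+ 0 * F 0%N (a * t + b)).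
  by apply/funext => x; rewrite /rc /ofcoord expr0 mul1r.
split; [by rewrite e; exact: (sm_ofcoord i dG)|by []|].
move=> s x sk; rewrite e; have [d ->] := Dw_ofcoord i s dG.
rewrite ncM; apply: le_trans (_ : 1 * nc (ofcoord i (fun t => a ^+ size s * F (size s) (a * t + b)) x) <= _).
  by rewrite ler_wpM2r ?nc_ge0//; case: d; rewrite ?nc1 ?nc0.
rewrite mul1r /ofcoord nc_real normrM normrX exprMn ler_wpM2l ?exprn_ge0//.
exact: Fc.
Qed.

Lemma cutoff_cube (y : E) (d : R) : 0 < d -> exists2 B, 0 < B &
  forall k, exists th, [/\ cutoff k (B * k.+1%:R) th, forall x, cube y (d / 2) x -> th x = 1 &
    forall x, ~ cube y d x -> th x = 0].
Proof.
move=> d0; exists (n%:R * (16 / d) + 1).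
  by rewrite ltr_wpDl// mulr_ge0// divr_ge0// ltW.
move=> k; have [F sF Fk] := step_seq R k; have [dF F0 F1 F01] := sF.
pose a := 2 / d; have a0 : 0 <= a by rewrite divr_ge0// ltW.
have ad : a * d = 2 by rewrite /a divfK// gt_eqF.
have c0 : 0 <= 4 * k.+1%:R :> R by rewrite mulr_ge0.
(* A rising step that reaches 1 at y - d/2 times a falling one that leaves 1 at y + d/2; the product
   vanishes from distance d on. *)
pose g (i : 'I_n) (x : E) := F 0%N (a * x ord0 i + (2 - a * y ord0 i)) * F 0%N (- a * x ord0 i + (2 + a * y ord0 i)).
have cg i : cutoff k (16 / d * k.+1%:R) (g i).
  have h1 := @cutoff_ofcoord k _ F i a (2 - a * y ord0 i) c0 sF Fk.
  have h2 := @cutoff_ofcoord k _ F i (- a) (2 + a * y ord0 i) c0 sF Fk.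
  have := cutoffM h1 h2; rewrite normrN ger0_norm//.
  by rewrite (_ : _ + _ = 16 / d * k.+1%:R)//; rewrite /a; ring.
have B0 : 0 <= 16 / d * k.+1%:R by rewrite mulr_ge0// divr_ge0// ltW.
exists (fun x => \prod_(i <- enum 'I_n) g i x); split.
- have [s1 b1 d1] := cutoff_prod (enum 'I_n) B0 cg; split=> // s x sk.
  apply: le_trans (d1 s x sk) _; have q0 : 0 <= 16 / d by rewrite divr_ge0// ltW.
  have q1 : 0 <= n%:R * (16 / d) by exact: mulr_ge0.
  have q2 : 0 <= n%:R * (16 / d) + 1 by exact: addr_ge0.
  rewrite lerXn2r ?nnegrE //; [exact: mulr_ge0|exact: mulr_ge0|].
  have -> : (n%:R * (16 / d) + 1) * k.+1%:R = n%:R * (16 / d * k.+1%:R) + k.+1%:R by ring.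
  by rewrite size_enum_ord lerDl.
- move=> x hx; apply: big1 => i _; have := hx i; rewrite ler_norml => /andP[h1 h2].
  have e1 : a * (d / 2) = 1 by rewrite mulrA ad divff.
  rewrite /g !F1 ?mulr1//.
    by have := ler_wpM2l a0 h2; rewrite e1; move: (x ord0 i) (y ord0 i) => p q; rewrite mulrBr; lra.
  by have := ler_wpM2l a0 h1; rewrite mulrN e1; move: (x ord0 i) (y ord0 i) => p q; rewrite mulrBr; lra.
- move=> x /existsNP[i /negP]; rewrite -ltNge => hi.
  rewrite (bigD1_seq i) ?mem_enum ?enum_uniq//= (_ : g i x = 0) ?mul0r//.
  rewrite /g; have [xy|xy] := leP (y ord0 i) (x ord0 i).
    rewrite [X in _ * X]F0 ?mulr0//; move: hi; rewrite ger0_norm ?subr_ge0// => /ltW/(ler_wpM2l a0).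
    by rewrite ad; move: (x ord0 i) (y ord0 i) => p q; rewrite mulrBr; lra.
  rewrite F0 ?mul0r//; move: hi; rewrite ltr0_norm ?subr_lt0// => /ltW/(ler_wpM2l a0).
  by rewrite ad; move: (x ord0 i) (y ord0 i) => p q; rewrite mulrN mulrBr; lra.
Qed.

Lemma finite_box_cover (K : set E) (d : E -> R) : compact K -> (forall x, K x -> 0 < d x) ->
  exists2 r : seq E, (forall y, y \in r -> K y) & forall x, K x -> exists2 y, y \in r & box y (d y) x.
Proof.
move=> cK dp; move: (cK); rewrite compact_cover => /(_ E K (fun y => box y (d y)))[].
- by move=> y _; exact: open_box.
- by move=> x Kx; exists x => //; apply: box_refl; exact: dp.
move=> D DK KD; exists (finmap.enum_fset D).
  by move=> y yD; have := DK y yD; rewrite inE.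
by move=> x /KD[y /= yD xy]; exists y.
Qed.

Lemma box_cube (y : E) d : box y d `<=` cube y d.
Proof. by move=> x h i; exact: ltW. Qed.

Lemma cube_box (y : E) d d' : d < d' -> cube y d `<=` box y d'.
Proof. by move=> dd x h i; exact: le_lt_trans (h i) dd. Qed.

(** The function is 1 - prod (1 - th_y) over a finite cover of [K] by small cubes. The cover, and
    with it [B], is fixed before [k]. *)
Lemma cutoff_between (K O : set E) : compact K -> open O -> K `<=` O ->
  exists (O' K' : set E) (B : R), [/\ open O', compact K', K `<=` O', O' `<=` K' & K' `<=` O] /\
    0 < B /\ forall k, exists th, [/\ cutoff k (B * k.+1%:R) th, forall x, O' x -> th x = 1 &
      forall x, ~ K' x -> th x = 0].
Proof.
move=> cK oO KO.
have /choice[d hd] : forall x, exists d, 0 < d /\ (K x -> box x d `<=` O).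
  move=> x; have [Kx|nKx] := pselect (K x); last by exists 1.
  by have [d d0 dO] := open_boxP oO (KO x Kx); exists d.
have d0 x : 0 < d x by case: (hd x).
have [r rK hr] := finite_box_cover cK (d := fun x => d x / 4) (fun x _ => divr_gt0 (d0 x) (ltr0n _ 4)).
have /choice[B hB] : forall y, exists B, 0 < B /\ forall k, exists th,
    [/\ cutoff k (B * k.+1%:R) th, forall x, cube y (d y / 2 / 2) x -> th x = 1 &
      forall x, ~ cube y (d y / 2) x -> th x = 0].
  by move=> y; have [B B0 h] := cutoff_cube y (divr_gt0 (d0 y) (ltr0n _ 2)); exists B.
have B0 y : 0 < B y by case: (hB y).
pose Bm := \sum_(y <- r) B y.
exists (\bigcup_(y in [set` r]) box y (d y / 4)), (\bigcup_(y in [set` r]) cube y (d y / 2)),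
  ((size r)%:R * Bm + 1).
have Bm0 : 0 <= Bm by apply: sumr_ge0 => y _; exact: ltW.
split; first split.
- by apply: bigcup_open => y _; exact: open_box.
- rewrite bigcup_seq; elim: r {rK hr Bm Bm0} => [|y r IH]; first by rewrite big_nil; exact: compact0.
  by rewrite big_cons; apply: compactU => //; exact: cube_compact.
- by move=> x /hr[y yr xy]; exists y.
- move=> x [y yr xy]; exists y => //; apply: box_cube; apply: cube_box (box_cube xy).
  by have := d0 y; lra.
- move=> x [y yr xy]; have [_ /(_ (rK y yr))] := hd y; apply; apply: cube_box xy.
  by have := d0 y; lra.
split; first by rewrite ltr_wpDl// mulr_ge0.
move=> k; have /choice[th hth] : forall y, exists th,
    [/\ cutoff k (B y * k.+1%:R) th, forall x, cube y (d y / 2 / 2) x -> th x = 1 &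
      forall x, ~ cube y (d y / 2) x -> th x = 0] by move=> y; case: (hB y) => _.
(* Off the cover the constant 0 is substituted, since [cutoff_prod] asks for the bound at every
   index. *)
pose th' y := if y \in r then th y else fun=> false%:R.
have k0 : 0 <= Bm * k.+1%:R by rewrite mulr_ge0.
have ct y : cutoff k (Bm * k.+1%:R) (fun x => 1 - th' y x).
  apply: cutoff_compl; rewrite /th'; case: ifPn => yr; last exact: cutoff_cst.
  have [[s1 b1 d1] _ _] := hth y; split=> // s x sk; apply: le_trans (d1 s x sk) _.
  rewrite lerXn2r ?nnegrE ?mulr_ge0 ?(ltW (B0 y))// ler_wpM2r// /Bm.
  have [s' [t' ->]] : exists s' t' : seq E, r = s' ++ y :: t'.
    by have /splitPr[p1 p2] := yr; exists p1, p2.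
  by rewrite big_cat big_cons /= addrCA lerDl addr_ge0// sumr_ge0// => z _; exact: ltW.
exists (fun x => 1 - \prod_(y <- r) (1 - th' y x)); split.
- have [s1 b1 d1] := cutoff_compl (cutoff_prod r k0 ct); split=> // s x sk.
  apply: le_trans (d1 s x sk) _; rewrite lerXn2r ?nnegrE ?mulr_ge0 ?addr_ge0 ?mulr_ge0//.
  by rewrite mulrA mulrDl lerDl mul1r.
- move=> x [y /= yr xy]; have /splitPr[p1 p2] := yr.
  rewrite big_cat big_cons /= (_ : th' y x = 1) ?subrr ?mul0r ?mulr0 ?subr0//.
  rewrite /th' yr; have [_ h1 _] := hth y; apply: h1.
  by rewrite (_ : d y / 2 / 2 = d y / 4); [exact: box_cube|field].
- move=> x nx; rewrite big1_seq ?subrr// => y /andP[_ yr].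
  rewrite /th' yr; have [_ _ h0] := hth y; rewrite h0 ?subr0// => xy; apply: nx.
  by exists y.
Qed.

Lemma rcJ th x : conjc (rc th x) = rc th x.
Proof. by rewrite /rc conjc_real. Qed.

Lemma cutoff_tst k B th (K O : set E) : compact K -> K `<=` O -> cutoff k B th ->
  (forall x, ~ K x -> th x = 0) -> tst O (rc th).
Proof.
move=> cK KO [s _ _] h; split=> //; exists K => //; split=> // x /h e.
by rewrite /rc e.
Qed.

Lemma cutoff_nc k B th x : cutoff k B th -> nc (rc th x) <= 1.
Proof. by move=> [_ /(_ x) h _]; rewrite /rc nc_real ger0_norm; lra. Qed.

End cutoffs.

(** * Fourier series *)

Section characters.
Context (R : realType).

Definition cis (t : R) : R[i] := Complex (cos t) (sin t).

Lemma cis0 : cis 0 = 1.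
Proof. by rewrite /cis cos0 sin0. Qed.

Lemma cisD s t : cis (s + t) = cis s * cis t.
Proof. by apply: eq_cplx; rewrite ?cReM ?cImM /= ?cosD ?sinD// addrC [sin s * _]mulrC; ring. Qed.

Lemma cisJ t : conjc (cis t) = cis (- t).
Proof. by rewrite /cis cosN sinN. Qed.

Lemma nc_cis t : nc (cis t) = 1.
Proof. by rewrite /cis /= cos2Dsin2 sqrtr1. Qed.

Lemma cis_2pi (k : int) t : cis (t + k%:~R * (pi *+ 2)) = cis t.
Proof.
have nat_case (m : nat) s : cis (s + m%:R * (pi *+ 2)) = cis s.
  by rewrite /cis mulr_natl (periodicn (@cosD2pi R)) (periodicn (@sinD2pi R)).
case: k => m; first exact: nat_case.
rewrite NegzE -(nat_case m.+1 (t + _)); congr cis.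
by rewrite mulrNz mulNr -[(Posz m.+1)%:~R]/(m.+1%:R) addrNK.
Qed.

Definition icis (a : R) (k : int) : measurableTypeR R -> R[i] :=
  fun t => if `|t - a| <= pi then cis (k%:~R * t) else 0.

Lemma continuous_cis_re (k : R) : continuous (fun t => cos (k * t)).
Proof.
move=> t; apply: (@continuous_comp _ _ _ (fun s : R => k * s) cos); last exact: continuous_cos.
exact: mulrl_continuous.
Qed.

Lemma continuous_cis_im (k : R) : continuous (fun t => sin (k * t)).
Proof.
move=> t; apply: (@continuous_comp _ _ _ (fun s : R => k * s) sin); last exact: continuous_sin.
exact: mulrl_continuous.
Qed.

Let Ipi (a : R) : set (measurableTypeR R) := `[a - pi, a + pi]%classic.

Let mI a : measurable (Ipi a). Proof. exact: measurable_itv. Qed.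

Let IpiP (a t : R) : (`|t - a| <= (@pi R)) = (t \in `[a - pi, a + pi]).
Proof. by rewrite in_itv /= -ler_distlC distrC. Qed.

Let restrE a (g : R -> R) : (fun t : R => (if `|t - a| <= (@pi R) then g t else 0)%:E) =
  (EFin \o g) \_ (Ipi a).
Proof.
apply/funext => t; rewrite patchE /Ipi IpiP mem_setE.
by case: ifP.
Qed.

Let ReI a k : (fun t => (Rec (icis a k t))%:E) = (EFin \o (fun t => cos (k%:~R * t))) \_ (Ipi a).
Proof. by rewrite -restrE; apply/funext => t; rewrite /icis; case: ifP. Qed.

Let ImI a k : (fun t => (Imc (icis a k t))%:E) = (EFin \o (fun t => sin (k%:~R * t))) \_ (Ipi a).
Proof. by rewrite -restrE; apply/funext => t; rewrite /icis; case: ifP. Qed.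

Lemma icis_integrable a k : cintegrable (@lebesgue_measure R) (icis a k).
Proof.
split.
  rewrite (_ : EFin \o _ = (fun t => (Rec (icis a k t))%:E))// ReI -integrable_mkcond//.
  apply: continuous_compact_integrable; first exact: segment_compact.
  by apply: continuous_subspaceT; exact: continuous_cis_re.
rewrite (_ : EFin \o _ = (fun t => (Imc (icis a k t))%:E))// ImI -integrable_mkcond//.
apply: continuous_compact_integrable; first exact: segment_compact.
by apply: continuous_subspaceT; exact: continuous_cis_im.
Qed.

Let ftc a (F f : R -> R) : (forall t, is_derive t (1 : R) F (f t)) -> continuous f ->
  F (a + pi) = F (a - pi) ->
  (\int[@lebesgue_measure R]_t ((EFin \o f) \_ (Ipi a)) t = 0)%E.
Proof.
move=> dF cf E; rewrite -integral_mkcond.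
have ab : a - pi < a + pi by have := @pi_gt0 R; lra.
have cF : continuous F.
  by move=> t; apply: differentiable_continuous; apply/derivable1_diffP; have [] := dF t.
rewrite (@continuous_FTC2 R f F (a - pi) (a + pi) ab); first by rewrite E subee.
- exact: continuous_subspaceT.
- split; first by move=> t _; have [] := dF t.
    exact/cvg_at_right_filter/cF.
  exact/cvg_at_left_filter/cF.
- by move=> t _; rewrite derive1E; have [_] := dF t.
Qed.

Lemma cint_icis a k : cint (@lebesgue_measure R) (icis a k) = if k == 0 then (2 * pi)%:C%C else 0.
Proof.
have [->|k0] := eqVneq k 0.
  apply: eq_cplx; rewrite /= /Rintegral ?ReI ?ImI -integral_mkcond.
    under eq_integral do rewrite /= mul0r cos0.
    rewrite integral_cst; last exact: mI.
    have := @lebesgue_measure_itv R `[a - pi, a + pi].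
    rewrite /= lte_fin ifT; last by have := @pi_gt0 R; lra.
    by rewrite /Ipi => ->; rewrite mul1e -EFinD /=; ring.
  under eq_integral do rewrite /= mul0r sin0.
  by rewrite integral0.
have kR : (k%:~R : R) != 0 by rewrite intr_eq0.
have per : cis (k%:~R * (a + pi)) = cis (k%:~R * (a - pi)).
  by rewrite -(cis_2pi k (_ * (a - pi))); congr cis; rewrite mulr2n; ring.
have dl (t : R) : k%:~R * t = k%:~R * t + 0 :> R by rewrite addr0.
apply: eq_cplx; rewrite /= /Rintegral ?ReI ?ImI; apply: (@congr1 _ _ fine _ 0%E).
  apply: (@ftc a (fun t => (k%:~R)^-1 * sin (k%:~R * t))).
  - move=> t; have h := @is_derive_affine R sin k%:~R 0 t (cos (k%:~R * t)).
    rewrite -dl in h; have h' := @is_deriveZ _ _ _ _ (k%:~R)^-1 _ _ _ (h (is_derive_sin _)).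
    rewrite (_ : (fun s => _) = (fun s : R => k%:~R^-1 *: sin (k%:~R * s + 0))); last first.
      by apply/funext => s; rewrite -dl.
    by apply: is_derive_eq h' _; rewrite /GRing.scale /= mulrA mulVf// mul1r.
  - exact: continuous_cis_re.
  - by have /(congr1 Imc) /= -> := per.
apply: (@ftc a (fun t => - (k%:~R)^-1 * cos (k%:~R * t))).
- move=> t; have h := @is_derive_affine R cos k%:~R 0 t (- sin (k%:~R * t)).
  rewrite -dl in h; have h' := @is_deriveZ _ _ _ _ (- (k%:~R)^-1) _ _ _ (h (is_derive_cos _)).
  rewrite (_ : (fun s => _) = (fun s : R => - k%:~R^-1 *: cos (k%:~R * s + 0))); last first.
    by apply/funext => s; rewrite -dl.
  by apply: is_derive_eq h' _; rewrite /GRing.scale /= !mulrN mulNr opprK mulrA mulVf// mul1r.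
- exact: continuous_cis_im.
- by have /(congr1 Rec) /= -> := per.
Qed.

Lemma cint_cons n (g : measurableTypeR R -> R[i]) (h : 'rV[R]_n -> R[i]) (f : 'rV[R]_n.+1 -> R[i]) :
  cintegrable (@lebesgue_measure R) g -> cintegrable (@lebesgue_rV R n) h ->
  cintegrable (@lebesgue_rV R n.+1) f -> (forall t y, f (cons_rV (t, y)) = g t * h y) ->
  cint (@lebesgue_rV R n.+1) f = cint (@lebesgue_measure R) g * cint (@lebesgue_rV R n) h.
Proof.
move=> ig ih [if1 if2] fE; rewrite mulrC -cintZ//.
have ig1 t := cintegrableZ (g t) ih.
apply: eq_cplx; rewrite /= /Rintegral.
  have [-> _] := rV_fubini if1; congr fine; apply: eq_integral => t _.
  under eq_integral do rewrite /= fE.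
  rewrite mulrC -cintZ// /cint /= /Rintegral fineK//.
  by apply: integrable_fin_num => //; have [] := ig1 t.
have [-> _] := rV_fubini if2; congr fine; apply: eq_integral => t _.
under eq_integral do rewrite /= fE.
rewrite mulrC -cintZ// /cint /= /Rintegral fineK//.
by apply: integrable_fin_num => //; have [] := ig1 t.
Qed.

End characters.

Section exponentials.
Context (R : realType) (n : nat).
Notation E := 'rV[R]_n.
Notation fct := (E -> R[i]).
Notation mu := (@lebesgue_rV R n).
Notation freq := {ffun 'I_n -> int}.
Implicit Types (xi eta : freq) (s : seq 'I_n).

Let oT : open [set: E] := @openT _.

Definition dot xi (x : E) : R := \sum_i (xi i)%:~R * x ord0 i.

Definition ex xi : fct := fun x => cis (dot xi x).

Definition fr xi (j : 'I_n) : R[i] := Complex 0 (xi j)%:~R.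

Lemma nc_ex xi x : nc (ex xi x) = 1. Proof. exact: nc_cis. Qed.

Lemma exD xi eta x : ex (xi + eta) x = ex xi x * ex eta x.
Proof.
rewrite /ex -cisD /dot -big_split /=; congr cis; apply: eq_bigr => i _.
by rewrite ffunE intrD mulrDl.
Qed.

Lemma exN xi x : ex (- xi) x = conjc (ex xi x).
Proof.
rewrite /ex cisJ /dot -sumrN; congr cis; apply: eq_bigr => i _.
by rewrite ffunE mulrNz mulNr.
Qed.

Lemma ex0 x : ex 0 x = 1.
Proof. by rewrite /ex /dot big1 ?cis0// => i _; rewrite ffunE mul0r. Qed.

Lemma exB xi x y : ex xi (x - y) = ex xi x * ex (- xi) y.
Proof.
rewrite exN /ex cisJ -cisD /dot -sumrN -big_split /=; congr cis; apply: eq_bigr => i _.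
by rewrite !mxE mulrBr.
Qed.

Lemma is_derive_of_line (V : normedModType R) (G : V -> R) (a v : V) l :
  is_derive (0 : R) (1 : R) (fun t : R => G (a + t *: v)) l -> is_derive a v G l.
Proof.
move=> [d <-].
have e : (fun h : R => h^-1 *: ((G \o shift a) (h *: v) - G a)) =
    (fun h : R => h^-1 *: (((fun t : R => G (a + t *: v)) \o shift 0) (h *: (1 : R)) - G (a + 0 *: v))).
  apply/funext => h; rewrite /= scale0r !addr0 [h%:A]mulr1 [h *: v + a]addrC.
  by [].
by apply: DeriveDef; rewrite /derivable /derive e.
Qed.

Lemma dot_line xi x (h : R) j : dot xi (x + h *: basis_vec R j) = (xi j)%:~R * h + dot xi x.
Proof.
rewrite /dot (bigD1 j)//= [in RHS](bigD1 j)//= !mxE !eqxx /= mulr1 mulrDr addrA.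
rewrite [_ * h + _]addrC; congr (_ + _); apply: eq_bigr => i /negPf ij.
by rewrite !mxE ij mulr0 addr0.
Qed.

Lemma cder_ex xi j x : cder j (ex xi) x (fr xi j * ex xi x).
Proof.
split; apply: is_derive_of_line.
  rewrite (_ : (fun t : R => _) = (fun s : R => cos ((xi j)%:~R * s + dot xi x))); last first.
    by apply/funext => s; rewrite /ex dot_line.
  apply: is_derive_eq (is_derive_affine (is_derive_cos _)) _.
  by rewrite cReM /= mulr0 add0r mul0r sub0r mulrN.
rewrite (_ : (fun t : R => _) = (fun s : R => sin ((xi j)%:~R * s + dot xi x))); last first.
  by apply/funext => s; rewrite /ex dot_line.
apply: is_derive_eq (is_derive_affine (is_derive_sin _)) _.
by rewrite cImM /= mulr0 add0r mul0r add0r.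
Qed.

Lemma ccont_ex xi x : ccont (ex xi) x.
Proof.
have cd : continuous (dot xi).
  rewrite /dot; elim: (index_enum _) => [|i r IH].
    rewrite (_ : (fun _ => _) = cst 0); first exact: cst_continuous.
    by apply/funext => y; rewrite big_nil.
  rewrite (_ : (fun _ => _) = (fun y : E => (xi i)%:~R * y ord0 i + \sum_(i <- r) (xi i)%:~R * y ord0 i)).
    move=> y; apply: (@cvgD _ _ _ _ (nbhs_filter y)); last exact: IH.
    apply: (@cvgM _ _ _ (nbhs_filter y)); first exact: (@cvg_cst _ _ _ _ (nbhs_filter y)).
    exact: coord_continuous.
  by apply/funext => y; rewrite big_cons.
split; rewrite /ex /=.
  by apply: (@continuous_comp _ _ _ (dot xi) (@cos R)); [exact: cd|exact: continuous_cos].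
by apply: (@continuous_comp _ _ _ (dot xi) (@sin R)); [exact: cd|exact: continuous_sin].
Qed.

Lemma sm_ex xi : sm setT (ex xi).
Proof.
have C1e x : C1 (ex xi) x.
  by split; [exact: ccont_ex|move=> j; exists (fr xi j * ex xi x); exact: cder_ex].
apply: (@sm_coind R n setT [set f | exists c, f = fun x => c * ex xi x]) => //.
- by move=> _ [c ->] x _; apply: C1M; [exact: C1_cst|exact: C1e].
- move=> _ [c ->] j; exists (fun x => c * fr xi j * ex xi x); first by exists (c * fr xi j).
  by move=> x _; rewrite pderivZ// (cder_pderiv (cder_ex xi j x)) mulrA.
- by exists 1; apply/funext => x; rewrite mul1r.
Qed.

Lemma Dw_ex xi s x : Dw s (ex xi) x = (\prod_(j <- s) fr xi j) * ex xi x.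
Proof.
elim: s x => [|j s IH] x; first by rewrite big_nil mul1r.
rewrite /= (pderiv_eq j oT (fun y _ => IH y) Logic.I) pderivZ.
  by rewrite (cder_pderiv (cder_ex xi j x)) big_cons mulrCA mulrA.
exact: sm_C1 (sm_ex xi) Logic.I.
Qed.

Definition fmax xi : R := \big[Num.max/0]_i `|(xi i)%:~R|.

Lemma fmax_ge0 xi : 0 <= fmax xi.
Proof. by apply/bigmax_geP; left. Qed.

Lemma fmax_attained xi : (exists m, fmax xi = `|(xi m)%:~R|) \/ fmax xi = 0.
Proof.
rewrite /fmax; elim/big_ind: _ => [|a b|m _]; [by right| |by left; exists m].
by rewrite /Num.max; case: ifP.
Qed.

Lemma nc_fr xi j : nc (fr xi j) = `|(xi j)%:~R|.
Proof. by rewrite /= expr0n /= add0r sqrtr_sqr. Qed.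

Lemma nc_fr_le xi j : nc (fr xi j) <= fmax xi.
Proof. by rewrite nc_fr; apply/bigmax_geP; right; exists j. Qed.

Lemma nc_Dw_ex xi s x : nc (Dw s (ex xi) x) <= fmax xi ^+ size s.
Proof.
rewrite Dw_ex ncM nc_ex mulr1 nc_prod; elim: s => [|j s IH]; first by rewrite big_nil.
by rewrite big_cons exprS ler_pM ?nc_ge0 ?nc_fr_le// prodr_ge0// => i _; exact: nc_ge0.
Qed.

Lemma cint_cut_ex_integrable (a : E) (r : R) xi : cintegrable mu (cut (cube a r) (ex xi)).
Proof.
apply: (@cintegrable_le _ _ _ mu _ (fun x => 1 * \1_(cube a r) x)).
- apply: cmeas_cut_meas; first exact: measurable_cube.
  by apply: cmeas_cont => x; exact: ccont_ex.
- by apply: integrableZR; apply: integrable_indicR; [exact: measurable_cube|exact: mu_cube_fin].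
- move=> x; rewrite mul1r /cut indicE; case: asboolP => h; first by rewrite nc_ex mem_set.
  by rewrite nc0 memNset.
Qed.

End exponentials.

Lemma cint_ex_prod (R : realType) (n : nat) (a : 'rV[R]_n) (xi : {ffun 'I_n -> int}) :
  cint (@lebesgue_rV R n) (cut (cube a pi) (ex xi)) =
  \prod_i cint (@lebesgue_measure R) (icis (a ord0 i) (xi i)).
Proof.
elim: n a xi => [|n IH] a xi.
  rewrite big_ord0; have e : cut (cube a pi) (ex xi) = fun=> 1.
    apply/funext => x; rewrite cutT; first by rewrite /ex /dot big_ord0 cis0.
    by move=> i; case: i.
  have h0 : (cube 0 0 : set 'rV[R]_0) = setT by apply/seteqP; split=> // x _; case.
  have h1 : (\int[@lebesgue_rV R 0]_x 1 = 1)%E.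
    have h2 : @lebesgue_rV R 0 setT = 1%E by rewrite -h0 mu_cube// expr0.
    by rewrite integral_cst// mul1e; exact: h2.
  rewrite e; apply: eq_cplx; first exact: (congr1 fine h1).
  by rewrite /= /Rintegral integral0.
pose a' : 'rV[R]_n := \row_j a ord0 (lift ord0 j).
pose xi' : {ffun 'I_n -> int} := [ffun j => xi (lift ord0 j)].
rewrite (@cint_cons R n (icis (a ord0 ord0) (xi ord0)) (cut (cube a' pi) (ex xi'))).
- rewrite IH big_ord_recl; congr (_ * _); apply: eq_bigr => j _.
  by rewrite mxE ffunE.
- exact: icis_integrable.
- exact: cint_cut_ex_integrable.
- exact: cint_cut_ex_integrable.
move=> t y; have exE : ex xi (cons_rV (t, y)) = cis ((xi ord0)%:~R * t) * ex xi' y.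
  rewrite /ex -cisD /dot big_ord_recl cons_rV0; congr (cis (_ + _)).
  by apply: eq_bigr => j _; rewrite cons_rVS ffunE.
rewrite /icis /cut; case: asboolP => [h|h].
  have := h ord0; rewrite cons_rV0 /= => ->; rewrite asboolT ?exE// => j.
  by have := h (lift ord0 j); rewrite cons_rVS mxE.
case: ifP => h0; last by rewrite mul0r.
rewrite asboolF ?mulr0// => h1; apply: h => i; have [j ->|->] := unliftP ord0 i.
  by rewrite cons_rVS; have := h1 j; rewrite mxE.
by rewrite cons_rV0.
Qed.

Lemma cint_ex (R : realType) (n : nat) (a : 'rV[R]_n) (xi : {ffun 'I_n -> int}) :
  cint (@lebesgue_rV R n) (cut (cube a pi) (ex xi)) = if xi == 0 then ((2 * pi) ^+ n)%:C%C else 0.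
Proof.
rewrite cint_ex_prod; have [->|xi0] := eqVneq xi 0.
  rewrite (eq_bigr (fun=> (2 * pi)%:C%C)); last by move=> i _; rewrite cint_icis ffunE eqxx.
  by rewrite prodr_const card_ord rmorphXn.
have [i xi_i] : exists i, xi i != 0.
  apply: contrapT => h; move/eqP: xi0; apply; apply/ffunP => i; rewrite ffunE.
  by apply: contrapT => /eqP hi; apply: h; exists i.
by rewrite (bigD1 i)//= cint_icis (negPf xi_i) mul0r.
Qed.

(** * Fourier coefficients in L^2 and trigonometric approximation *)

Section fourier_L2.
Context (R : realType) (n : nat) (x0 : 'rV[R]_n).
Notation E := 'rV[R]_n.
Notation fct := (E -> R[i]).
Notation mu := (@lebesgue_rV R n).
Notation freq := {ffun 'I_n -> int}.
Notation Q := (cube x0 pi).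
Implicit Types (xi eta : freq) (f g h phi : fct) (r : seq freq) (l : seq (freq * R[i])).

Definition ip f g : R[i] := cint mu (fun x => f x * conjc (g x)).

Lemma ip_int f g : L2 mu f -> L2 mu g -> cintegrable mu (fun x => f x * conjc (g x)).
Proof. by move=> Lf Lg; apply: L2_cintegrableM Lf (L2J Lg). Qed.

Lemma ip_l2 f : ip f f = (l2 mu f ^+ 2)%:C%C.
Proof.
rewrite l2_sqr -cint_real /ip; congr cint; apply/funext => x; exact: mulcJ.
Qed.

Lemma ipDl f g h : L2 mu f -> L2 mu g -> L2 mu h -> ip (fun x => f x + g x) h = ip f h + ip g h.
Proof.
move=> Lf Lg Lh; rewrite -cintD; [|exact: ip_int|exact: ip_int].
by congr cint; apply/funext => x; rewrite mulrDl.
Qed.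

Lemma ipZl (c : R[i]) f g : L2 mu f -> L2 mu g -> ip (fun x => c * f x) g = c * ip f g.
Proof.
move=> Lf Lg; rewrite -cintZ; last exact: ip_int.
by congr cint; apply/funext => x; rewrite mulrA.
Qed.

Lemma ipJ f g : L2 mu f -> L2 mu g -> ip g f = conjc (ip f g).
Proof.
move=> Lf Lg; rewrite -cintJ; last exact: ip_int.
by congr cint; apply/funext => x; rewrite rmorphM /= conjcK mulrC.
Qed.

Lemma ipBl f g h : L2 mu f -> L2 mu g -> L2 mu h -> ip (fun x => f x - g x) h = ip f h - ip g h.
Proof.
move=> Lf Lg Lh; rewrite -cintB; [|exact: ip_int|exact: ip_int].
by congr cint; apply/funext => x; rewrite mulrBl.
Qed.

Lemma ip_suml I (s : seq I) (c : I -> R[i]) (F : I -> fct) g : (forall a, L2 mu (F a)) -> L2 mu g ->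
  ip (fun x => \sum_(a <- s) c a * F a x) g = \sum_(a <- s) c a * ip (F a) g.
Proof.
move=> LF Lg; rewrite /ip.
rewrite (_ : (fun x => _) = (fun x => \sum_(a <- s) c a * (F a x * conjc (g x)))); last first.
  by apply/funext => x; rewrite mulr_suml; apply: eq_bigr => a _; rewrite mulrA.
rewrite cint_sum => [|a]; last by apply: cintegrableZ; exact: ip_int.
by apply: eq_bigr => a _; rewrite cintZ//; exact: ip_int.
Qed.

Lemma l2_orth f h : L2 mu f -> L2 mu h -> ip f h = 0 ->
  l2 mu (fun x => f x + h x) ^+ 2 = l2 mu f ^+ 2 + l2 mu h ^+ 2.
Proof.
move=> Lf Lh fh; have Ls := L2D Lf Lh; have hf : ip h f = 0 by rewrite (ipJ Lf Lh) fh conjc0.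
have : ip (fun x => f x + h x) (fun x => f x + h x) = ip f f + ip h h.
  rewrite (ipDl Lf Lh Ls) (ipJ Ls Lf) (ipJ Ls Lh) !(ipDl Lf Lh) ?(ipDl Lf Lh Lf)//.
  by rewrite fh hf add0r addr0 -!ipJ.
by rewrite !ip_l2 -rmorphD => /(congr1 (@complex.Re R)).
Qed.

Definition eQ xi : fct := cut Q (ex xi).

Lemma L2_eQ xi : L2 mu (eQ xi).
Proof.
have [] // := @L2_bounded _ _ _ mu (eQ xi) 1 Q (measurable_cube _ _) (mu_cube_fin _ _).
- apply: cmeas_cut_meas; first exact: measurable_cube.
  by apply: cmeas_cont => x; exact: ccont_ex.
- by move=> x Qx; rewrite /eQ cutT// nc_ex.
- by move=> x Qx; rewrite /eQ cutF.
Qed.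

Let V : R := (2 * pi) ^+ n.
Let V0 : 0 < V. Proof. by rewrite exprn_gt0// mulr_gt0// pi_gt0. Qed.

Lemma ip_eQ xi eta : ip (eQ xi) (eQ eta) = if xi == eta then V%:C%C else 0.
Proof.
rewrite -subr_eq0 -(cint_ex x0) /ip; congr cint; apply/funext => x; rewrite /eQ /cut.
by case: asboolP => _; rewrite ?mul0r// exD exN.
Qed.

Definition trg l : fct := fun x => \sum_(q <- l) q.2 * eQ q.1 x.

Lemma L2_trg l : L2 mu (trg l).
Proof. by apply: L2_sum => q; apply: L2Z; exact: L2_eQ. Qed.

Definition fc g xi : R[i] := (V^-1)%:C%C * ip g (eQ xi).

Definition SF r g : fct := fun x => \sum_(xi <- r) fc g xi * eQ xi x.

Lemma L2_SF r g : L2 mu (SF r g).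
Proof. by apply: L2_sum => xi; apply: L2Z; exact: L2_eQ. Qed.

Lemma residual_orth r g xi : uniq r -> L2 mu g -> xi \in r ->
  ip (fun x => g x - SF r g x) (eQ xi) = 0.
Proof.
move=> ur Lg xr; rewrite ipBl//; [|exact: L2_SF|exact: L2_eQ].
rewrite ip_suml; [|exact: L2_eQ|exact: L2_eQ].
rewrite (bigD1_seq xi)//= ip_eQ eqxx big1 ?addr0; last first.
  by move=> eta /negPf h; rewrite ip_eQ h mulr0.
by rewrite /fc mulrAC -rmorphM mulVf ?gt_eqF// mul1r subrr.
Qed.

Lemma residual_trg r g l : uniq r -> L2 mu g -> (forall q, q \in l -> q.1 \in r) ->
  ip (fun x => g x - SF r g x) (trg l) = 0.
Proof.
move=> ur Lg lr; have Ld := L2B Lg (L2_SF r g).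
rewrite (ipJ (L2_trg l) Ld) ip_suml//; last by move=> q; exact: L2_eQ.
rewrite big_seq big1 ?conjc0// => q ql.
by rewrite (ipJ Ld (L2_eQ _)) residual_orth ?conjc0 ?mulr0//; exact: lr.
Qed.

Lemma SF_trg r g : SF r g = trg [seq (xi, fc g xi) | xi <- r].
Proof. by apply/funext => x; rewrite /trg big_map. Qed.

(** The residual is orthogonal to the trigonometric polynomials with frequencies in [r], so
    Pythagoras applies to g - trg l = (g - SF r g) + (SF r g - trg l). *)
Lemma best_approximation r g l : uniq r -> L2 mu g -> (forall q, q \in l -> q.1 \in r) ->
  l2 mu (fun x => g x - SF r g x) <= l2 mu (fun x => g x - trg l x).
Proof.
move=> ur Lg lr; have Ld := L2B Lg (L2_SF r g).
have [l' l'r l'E] : exists2 l', (forall q, q \in l' -> q.1 \in r) &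
    (fun x => SF r g x - trg l x) = trg l'.
  exists ([seq (xi, fc g xi) | xi <- r] ++ [seq (q.1, - q.2) | q <- l]).
    by move=> q; rewrite mem_cat => /orP[/mapP[xi xr ->]|/mapP[p pl ->]] //=; exact: lr.
  apply/funext => x; rewrite /trg big_cat !big_map /=; congr (_ + _).
  by rewrite -sumrN; apply: eq_bigr => q _; rewrite mulNr.
have := l2_orth Ld (L2_trg l') (residual_trg ur Lg l'r).
rewrite -l'E (_ : (fun x => (g x - SF r g x) + (SF r g x - trg l x)) = (fun x => g x - trg l x)); last first.
  by apply/funext => x; rewrite addrA subrK.
by move=> e; rewrite -(@ler_pXn2r _ 2) ?nnegrE ?l2_ge0// e lerDl sqr_ge0.
Qed.

Lemma l2_trig r (c : freq -> R[i]) : uniq r ->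
  l2 mu (fun x => \sum_(xi <- r) c xi * eQ xi x) ^+ 2 = V * \sum_(xi <- r) nc (c xi) ^+ 2.
Proof.
elim: r => [_|xi r IH] /=.
  by under [X in l2 _ X]eq_fun do rewrite big_nil; rewrite l2_0 big_nil mulr0 expr0n.
move=> /andP[xr ur]; under [X in l2 _ X]eq_fun do rewrite big_cons.
have Lr : L2 mu (fun x => \sum_(xi <- r) c xi * eQ xi x).
  by apply: L2_sum => a; apply: L2Z; exact: L2_eQ.
rewrite l2_orth//; last 2 first.
- by apply: L2Z; exact: L2_eQ.
- rewrite ipZl//; last exact: L2_eQ.
  rewrite (ipJ Lr (L2_eQ _)) ip_suml; [|exact: L2_eQ|exact: L2_eQ].
  rewrite big_seq big1 ?conjc0 ?mulr0// => eta er; rewrite ip_eQ ifN ?mulr0//.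
  by apply: contraNneq xr => <-.
rewrite IH// big_cons mulrDr l2Z; last exact: L2_eQ.
congr (_ + _); rewrite exprMn mulrC; congr (_ * _).
by have := ip_l2 (eQ xi); rewrite ip_eQ eqxx => -[].
Qed.

Lemma bessel r g : uniq r -> L2 mu g -> V * \sum_(xi <- r) nc (fc g xi) ^+ 2 <= l2 mu g ^+ 2 /\
  l2 mu (fun x => g x - SF r g x) <= l2 mu g.
Proof.
move=> ur Lg; have Ld := L2B Lg (L2_SF r g).
have o : ip (fun x => g x - SF r g x) (SF r g) = 0.
  rewrite {2}SF_trg; apply: residual_trg => //.
  by move=> q /mapP[xi xr ->].
have := l2_orth Ld (L2_SF r g) o.
rewrite (_ : (fun x => _ + _) = g); last by apply/funext => x; rewrite subrK.
move=> e; rewrite -(l2_trig (fc g) ur) e lerDr sqr_ge0; split=> //.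
by rewrite -(@ler_pXn2r _ 2) ?nnegrE ?l2_ge0// e lerDl sqr_ge0.
Qed.

Definition trig (p : fct) := exists l, forall x, p x = \sum_(q <- l) q.2 * ex q.1 x.

Lemma trig_cst (c : R[i]) : trig (fun=> c).
Proof. by exists [:: (0, c)] => x; rewrite big_seq1 ex0 mulr1. Qed.

Lemma trig_ex xi : trig (ex xi).
Proof. by exists [:: (xi, 1)] => x; rewrite big_seq1 mul1r. Qed.

Lemma trigD p p' : trig p -> trig p' -> trig (fun x => p x + p' x).
Proof. by move=> [l h] [l' h']; exists (l ++ l') => x; rewrite h h' big_cat. Qed.

Lemma trigM p p' : trig p -> trig p' -> trig (fun x => p x * p' x).
Proof.
move=> [l h] [l' h']; exists [seq (q.1 + q'.1, q.2 * q'.2) | q <- l, q' <- l'] => x.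
rewrite h h' big_allpairs_dep mulr_suml; apply: eq_bigr => q _.
by rewrite mulr_sumr; apply: eq_bigr => q' _; rewrite /= exD; ring.
Qed.

Lemma trigX p k : trig p -> trig (fun x => p x ^+ k).
Proof.
move=> tp; elim: k => [|k IH]; first by rewrite (_ : (fun _ => _) = fun=> 1)//; exact: trig_cst.
rewrite (_ : (fun _ => _) = (fun x => p x * p x ^+ k)); first exact: trigM.
by apply/funext => x; rewrite exprS.
Qed.

Lemma trig_prod I (s : seq I) (p : I -> fct) : (forall a, trig (p a)) ->
  trig (fun x => \prod_(a <- s) p a x).
Proof.
move=> tp; elim: s => [|a s IH].
  by under eq_fun do rewrite big_nil; exact: trig_cst.
by under eq_fun do rewrite big_cons; exact: trigM.
Qed.

(* The kernel is large only near 0 and its translates by the lattice of periods. *)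
Definition kap (t : R) : R := (1 + cos t) / 2.

Lemma kap01 t : 0 <= kap t <= 1.
Proof. by have := cos_geN1 t; have := cos_le1 t; rewrite /kap; lra. Qed.

Definition ker N (x : E) : R := \prod_i kap (x ord0 i) ^+ N.

Lemma ker01 N x : 0 <= ker N x <= 1.
Proof.
have h i : 0 <= kap (x ord0 i) ^+ N <= 1.
  by have /andP[a b] := kap01 (x ord0 i); rewrite exprn_ge0// exprn_ile1.
rewrite /ker prodr_ge0 => [|i _]; last by have /andP[] := h i.
by apply: prodr_ile1 => i _; exact: h.
Qed.

Lemma trig_ker N : trig (fun x => (ker N x)%:C%C).
Proof.
rewrite (_ : (fun _ => _) = (fun x : E => \prod_(i <- index_enum 'I_n) ((kap (x ord0 i))%:C%C ^+ N))).
  apply: trig_prod => i; apply: trigX.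
  pose d : freq := [ffun j => if j == i then 1 else 0].
  have dE (x : E) : dot d x = x ord0 i.
    rewrite /dot (bigD1 i)//= ffunE eqxx mul1r big1 ?addr0// => j /negPf ji.
    by rewrite ffunE ji mul0r.
  rewrite (_ : (fun _ => _) = (fun x => 2^-1 + (4^-1 * ex d x + 4^-1 * ex (- d) x))).
    apply: trigD; first exact: trig_cst.
    by apply: trigD; apply: trigM; [exact: trig_cst|exact: trig_ex|exact: trig_cst|exact: trig_ex].
  apply/funext => x; rewrite exN -mulrDr /ex dE /kap.
  have -> : cis (x ord0 i) + conjc (cis (x ord0 i)) = 2 * (cos (x ord0 i))%:C%C.
    by apply: eq_cplx; rewrite ?cReM ?cImM /=; ring.
  have e4 : (4 : R[i]) = 2 * 2 by ring.
  rewrite rmorphM rmorphD rmorph1 fmorphV rmorph_nat e4.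
  by field.
by apply/funext => x; rewrite /ker rmorph_prod; apply: eq_bigr => i _; rewrite rmorphXn.
Qed.

Lemma continuous_kap : continuous kap.
Proof.
move=> t; rewrite /kap; apply: cvgM; last exact: cvg_cst.
by apply: cvgD; [exact: cvg_cst|exact: continuous_cos].
Qed.

(** Between pi and pi + 1 the cosine is still nonpositive, as 1 <= pi/2, whereas cos d >= 0. This
    range covers the difference of a coordinate between a point of [Q] and a point of the support of
    the test function. *)
Lemma kap_far (d t : R) : 0 < d -> d <= 1 -> d <= `|t| -> `|t| <= pi + 1 -> kap t <= kap d.
Proof.
move=> d0 d1 dt tp; rewrite /kap ler_pM2r// lerD2l -(cos_norm t).
have p2 := @pi_ge2 R; have [tpi|pit] := leP `|t| pi.
  rewrite leNgt; apply/negP; rewrite ltr_cos ?in_itv /= ?normr_ge0//; last by lra.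
  by rewrite ltNge dt.
have : 0 <= cos (`|t| - pi) by apply: cos_ge0_pihalf; lra.
have : 0 <= cos d by apply: cos_ge0_pihalf; lra.
have : cos (`|t| - pi + pi) = - cos (`|t| - pi) by exact: cosDpi.
by rewrite subrK; lra.
Qed.

Lemma kap_lt1 (d : R) : 0 < d -> d <= 1 -> kap d < 1.
Proof.
move=> d0 d1; have p2 := @pi_ge2 R.
have : cos d < cos 0 by rewrite ltr_cos ?in_itv /=; lra.
by rewrite cos0 /kap; lra.
Qed.

Lemma uniform_continuity phi (K : set E) e : compact K -> (forall x, ccont phi x) -> 0 < e ->
  exists2 d, 0 < d <= 1 & forall x y, K x -> box x d y -> nc (phi x - phi y) <= e.
Proof.
move=> cK cp e0; have e2 : 0 < e / 2 by rewrite divr_gt0.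
have /choice[d hd] : forall x, exists d, 0 < d /\ forall y, box x (2 * d) y -> nc (phi y - phi x) < e / 2.
  move=> x; have /ccontP/(_ _ e2)[d d0 h] := cp x; exists (d / 2); rewrite divr_gt0//.
  by split=> // y; rewrite mulrC divfK//; exact: h.
have d0 x : 0 < d x by case: (hd x).
have [s _ hs] := finite_box_cover cK (fun x _ => d0 x).
pose m := \big[Num.min/1]_(y <- s) d y; exists m.
  rewrite /m; elim: s {hs m} => [|y s IH]; first by rewrite big_nil lexx ltr01.
  by rewrite big_cons lt_min d0 ge_min; case/andP: IH => -> ->; rewrite orbT.
have md y : y \in s -> m <= d y.
  rewrite /m; elim: (s) => [//|z t IH]; rewrite inE big_cons ge_min => /predU1P[->|/IH ->].
    by rewrite lexx.
  by rewrite orbT.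
move=> x y Kx xy; have [z zs zx] := hs x Kx; have [_ hz] := hd z.
have h1 : nc (phi x - phi z) < e / 2.
  by apply: hz => i; apply: lt_le_trans (zx i) _; have := d0 z; lra.
have h2 : nc (phi y - phi z) < e / 2.
  apply: hz => i; have := zx i; have := lt_le_trans (xy i) (md z zs).
  have := ler_normD (y ord0 i - x ord0 i) (x ord0 i - z ord0 i).
  by rewrite addrA subrK; lra.
have -> : phi x - phi y = (phi x - phi z) + (phi z - phi y) by ring.
by have := ncD (phi x - phi z) (phi z - phi y); rewrite [nc (phi z - _)]ncB; lra.
Qed.

Lemma pow_small (q a : R) : 0 <= q -> q < 1 -> 0 < a -> exists N, q ^+ N <= a.
Proof.
move=> q0 q1 a0; have := @cvg_geometric R 1 q; rewrite ger0_norm// => /(_ q1).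
move=> /cvgrPdist_le/(_ a a0)[N _ /(_ N (leqnn N))].
by rewrite sub0r normrN /geometric /= mul1r ger0_norm ?exprn_ge0// => h; exists N.
Qed.

(** [phi] is averaged over [Q] against the kernel divided by its mass, which gives a trigonometric
    polynomial since the kernel is one. Away from the diagonal the kernel is at most (kap d)^N,
    while its mass is at least a constant times (kap rho)^(n N); a small [rho] makes the quotient
    decay geometrically in N. *)
Lemma trig_density phi e : tst (box x0 1) phi -> 0 < e ->
  exists l, forall x, Q x -> nc (phi x - \sum_(q <- l) q.2 * ex q.1 x) <= e.
Proof.
move=> tp e0; have p2 := @pi_ge2 R; have e2 : 0 < e / 2 by rewrite divr_gt0.
have [d /andP[d0 d1] hd] := uniform_continuity (@cube_compact R n x0 pi) (fun x => tst_cont x tp) e2.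
have [B B0 hB] := tst_bounded tp.
(* Near the diagonal each of the [n] factors of the kernel is at least [kap rho]; away from it only
   one factor is known to be small. Hence the power [n]. *)
have [rho [rho0 rho1 hrho]] : exists rho, [/\ 0 < rho, rho <= 1 & kap d < kap rho ^+ n].
  have ck : (fun t => kap t ^+ n) @ 0 --> kap 0 ^+ n.
    elim: (n) => [|m IH]; first exact: cvg_cst.
    under eq_fun do rewrite exprS; rewrite exprS; apply: cvgM => //; exact: continuous_kap.
  have k0 : kap 0 ^+ n = 1 by rewrite /kap cos0 (_ : (1 + 1) / 2 = 1) ?expr1n//; lra.
  have dk : 0 < 1 - kap d by rewrite subr_gt0 kap_lt1.
  move: ck => /cvgrPdist_lt/(_ _ dk)/nbhs_ballP[a a0 ha].
  have m0 : 0 < Num.min a 1 by rewrite lt_min; apply/andP; split.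
  have ma : Num.min a 1 <= a by rewrite ge_min lexx.
  have m1 : Num.min a 1 <= 1 by rewrite ge_min lexx orbT.
  exists (Num.min a 1 / 2); split; [by lra|by lra|].
  have := ha (Num.min a 1 / 2); rewrite /ball /= sub0r normrN ger0_norm; last by lra.
  move=> h; have {}h := h ltac:(lra); move: h; rewrite k0 ltr_norml => /andP[_].
  by lra.
have kr0 : 0 < kap rho ^+ n by apply: le_lt_trans hrho; have /andP[] := kap01 d.
pose q := kap d / kap rho ^+ n.
have q0 : 0 <= q by rewrite divr_ge0 ?(ltW kr0)//; have /andP[] := kap01 d.
have q1 : q < 1 by rewrite ltr_pdivrMr// mul1r.
have cst0 : 0 < 2 * B * V / (2 * rho) ^+ n.
  have h : 0 < (2 * rho) ^+ n by rewrite exprn_gt0// mulr_gt0.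
  by rewrite divr_gt0// mulr_gt0// mulr_gt0.
have [N hN] := pow_small q0 q1 (divr_gt0 e2 cst0).
have [lk hlk] := trig_ker N.
pose kR (x y : E) : R := (if `[< Q y >] then 1 else 0) * ker N (x - y).
have ckE x : (fun y => (kR x y)%:C%C) =
    (fun y => \sum_(p <- lk) (p.2 * ex p.1 x) * eQ (- p.1) y).
  apply/funext => y; rewrite /kR rmorphM /= hlk /eQ.
  transitivity (\sum_(p <- lk) (p.2 * ex p.1 x) * ((if `[< Q y >] then 1 else 0) * ex (- p.1) y)).
    rewrite mulr_sumr; apply: eq_bigr => p _; rewrite exB.
    by case: asboolP => _; rewrite ?rmorph1 ?rmorph0; ring.
  by apply: eq_bigr => p _; rewrite /cut; case: asboolP => _; rewrite ?mul1r ?mul0r.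
have LK x : L2 mu (fun y => (kR x y)%:C%C).
  by rewrite ckE; apply: L2_sum => p; apply: L2Z; exact: L2_eQ.
have iK x : cintegrable mu (fun y => (kR x y)%:C%C).
  rewrite ckE; apply: cintegrable_sum => p; apply: cintegrableZ.
  exact: cint_cut_ex_integrable.
have iKR x : mu.-integrable setT (EFin \o kR x) by have [h _] := iK x.
have kR0 x y : 0 <= kR x y.
  by rewrite /kR mulr_ge0//; [case: ifP|have /andP[] := ker01 N (x - y)].
pose m x : R := \int[mu]_y kR x y.
(* Integration over one period keeps only the zero frequency of the kernel, so the mass does not
   depend on [x]. *)
have mE x : (m x)%:C%C = (m x0)%:C%C.
  have h z : (m z)%:C%C = \sum_(p <- lk) p.2 * ex p.1 z * (if p.1 == 0 then V%:C%C else 0).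
    rewrite -cint_real ckE cint_sum => [|p]; last by apply: cintegrableZ; exact: cint_cut_ex_integrable.
    apply: eq_bigr => p _; rewrite cintZ; last exact: cint_cut_ex_integrable.
    by rewrite /eQ cint_ex oppr_eq0.
  rewrite !h; apply: eq_bigr => p _; have [->|] := eqVneq p.1 0; last by rewrite !mulr0.
  by rewrite !ex0.
have {}mE x : m x = m x0 by have := mE x => -[].
have m_low : (2 * rho) ^+ n * (kap rho ^+ n) ^+ N <= m x0.
  have -> : (2 * rho) ^+ n * (kap rho ^+ n) ^+ N =
      \int[mu]_y ((kap rho ^+ n) ^+ N * \1_(cube x0 rho) y).
    rewrite RintegralZl//; last first.
      by apply: integrable_indicR; [exact: measurable_cube|exact: mu_cube_fin].
    rewrite mulrC; congr (_ * _); rewrite /Rintegral integral_indic//; last exact: measurable_cube.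
    by rewrite setIT [X in fine X](_ : _ = ((2 * rho) ^+ n)%:E)//; exact: mu_cube (ltW rho0).
  apply: le_Rintegral => //.
    by apply: integrableZR; apply: integrable_indicR; [exact: measurable_cube|exact: mu_cube_fin].
  move=> y _; rewrite indicE; have [yr|yr] := boolP (y \in cube x0 rho); last by rewrite mulr0.
  have {}yr : cube x0 rho y by move: yr; rewrite inE.
  rewrite mulr1 /kR asboolT; last by move=> i; apply: le_trans (yr i) _; lra.
  rewrite mul1r /ker prodrXl lerXn2r ?nnegrE ?(ltW kr0)//.
    by apply: prodr_ge0 => i _; have /andP[] := kap01 ((x0 - y) ord0 i).
  have -> : kap rho ^+ n = \prod_(i < n) kap rho by rewrite prodr_const card_ord.
  apply: ler_prod => i _; have /andP[-> _] := kap01 rho; rewrite /= /kap ler_pM2r// lerD2l.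
  rewrite !mxE -(cos_norm (_ - _)) leNgt; apply/negP; have := yr i; rewrite distrC => h.
  by rewrite ltr_cos ?in_itv /= ?normr_ge0 ?ltNge ?h//; lra.
have mp : 0 < m x0.
  have h : 0 < (2 * rho) ^+ n by rewrite exprn_gt0// mulr_gt0.
  by apply: lt_le_trans m_low; rewrite mulr_gt0// exprn_gt0.
have ipK x y : (phi y * (kR x y)%:C%C) = \sum_(p <- lk) (p.2 * ex p.1 x) * (phi y * eQ (- p.1) y).
  have /(congr1 (fun f => f y)) /= -> := ckE x.
  by rewrite mulr_sumr; apply: eq_bigr => p _; ring.
have iphi x : cintegrable mu (fun y => phi y * (kR x y)%:C%C).
  by apply: L2_cintegrableM (tst_L2 tp) (LK x).
exists [seq (p.1, ((m x0)^-1)%:C%C * (p.2 * cint mu (fun y => phi y * eQ (- p.1) y))) | p <- lk] => x Qx.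
have JE : \sum_(p <- [seq (p.1, ((m x0)^-1)%:C%C * (p.2 * cint mu (fun y => phi y * eQ (- p.1) y))) | p <- lk])
    p.2 * ex p.1 x = ((m x0)^-1)%:C%C * cint mu (fun y => phi y * (kR x y)%:C%C).
  under [X in cint _ X]eq_fun do rewrite ipK.
  rewrite cint_sum => [|p]; last first.
    by apply: cintegrableZ; apply: L2_cintegrableM (tst_L2 tp) (L2_eQ _).
  rewrite big_map mulr_sumr; apply: eq_bigr => p _ /=.
  by rewrite cintZ; [ring|apply: L2_cintegrableM (tst_L2 tp) (L2_eQ _)].
rewrite JE.
have -> : phi x = ((m x0)^-1)%:C%C * cint mu (fun y => phi x * (kR x y)%:C%C).
  by rewrite cintZ// cint_real -/(m x) mE mulrCA -rmorphM mulVf ?gt_eqF// mulr1.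
rewrite -mulrBr -cintB//; last exact: cintegrableZ.
rewrite ncM nc_real ger0_norm ?invr_ge0 ?(ltW mp)// ler_pdivrMl//.
have bound y : nc (phi x * (kR x y)%:C%C - phi y * (kR x y)%:C%C) <=
    e / 2 * kR x y + 2 * B * kap d ^+ N * \1_Q y.
  rewrite -mulrBl ncM nc_real ger0_norm//.
  have [Qy|nQy] := pselect (Q y); last first.
    by rewrite /kR asboolF// mul0r !mulr0 add0r mulr_ge0// ?mulr_ge0// ?(ltW B0)// ?exprn_ge0//; case/andP: (kap01 d).
  have kd0 : 0 <= kap d by case/andP: (kap01 d).
  rewrite indicE mem_set// mulr1.
  have [xy|/existsNP[i /negP]] := pselect (box x d y).
    apply: le_trans (_ : e / 2 * kR x y <= _); first by rewrite ler_wpM2r// hd.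
    by rewrite lerDl mulr_ge0// ?mulr_ge0// ?(ltW B0)// exprn_ge0.
  rewrite -leNgt distrC => xy.
  (* Two points of [Q] that are this far apart both lie outside the support of [phi]. *)
  have [big|small] := ltP (pi + 1) `|x ord0 i - y ord0 i|.
    have z (a b : E) : `|a ord0 i - b ord0 i| > pi + 1 -> Q b -> phi a = 0.
      move=> ab Qb; apply: (tst_out tp) => h; have := h i; have := Qb i; move: ab.
      have := ler_normD (a ord0 i - x0 ord0 i) (x0 ord0 i - b ord0 i).
      by rewrite addrA subrK [`|x0 ord0 i - b ord0 i|]distrC; lra.
    rewrite (z x y)// (z y x)// ?subrr ?nc0 ?mul0r; last by rewrite distrC.
    by rewrite addr_ge0// mulr_ge0// ?(ltW e2)// ?mulr_ge0// ?(ltW B0)// exprn_ge0.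
  apply: le_trans (_ : 2 * B * kap d ^+ N <= _); last by rewrite lerDr mulr_ge0// ltW.
  rewrite ler_pM ?nc_ge0//.
    by apply: le_trans (ncD _ _) _; rewrite ncN mulr_natl mulr2n lerD.
  rewrite /kR asboolT// mul1r /ker (bigD1 i)//= -[leRHS]mulr1 ler_pM ?exprn_ge0//.
  - by case/andP: (kap01 ((x - y) ord0 i)).
  - by apply: prodr_ge0 => j _; rewrite exprn_ge0//; case/andP: (kap01 ((x - y) ord0 j)).
  - rewrite lerXn2r ?nnegrE//; first by case/andP: (kap01 ((x - y) ord0 i)).
    by rewrite !mxE; exact: kap_far.
  - apply: prodr_ile1 => j _; case/andP: (kap01 ((x - y) ord0 j)) => a b.
    by rewrite exprn_ge0// exprn_ile1.
have iQ : mu.-integrable setT (EFin \o (fun y => 2 * B * kap d ^+ N * \1_Q y)).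
  by apply: integrableZR; apply: integrable_indicR; [exact: measurable_cube|exact: mu_cube_fin].
have iB : mu.-integrable setT (EFin \o (fun y => e / 2 * kR x y + 2 * B * kap d ^+ N * \1_Q y)).
  by apply: integrableDR => //; apply: integrableZR.
have iD : cintegrable mu (fun y => phi x * (kR x y)%:C%C - phi y * (kR x y)%:C%C).
  by apply: cintegrableD; [exact: cintegrableZ|exact: cintegrableN].
apply: le_trans (nc_cint iD) _.
apply: le_trans (le_Rintegral measurableT (cintegrable_nc iD) iB (fun y _ => bound y)) _.
rewrite RintegralD//; last by apply: integrableZR.
rewrite !RintegralZl//; last by apply: integrable_indicR; [exact: measurable_cube|exact: mu_cube_fin].
rewrite -/(m x) mE.
have -> : \int[mu]_y \1_Q y = V.
  rewrite /Rintegral integral_indic//; last exact: measurable_cube.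
  by rewrite setIT [X in fine X](_ : _ = V%:E)//; exact: (mu_cube x0 (@pi_ge0 R)).
have -> : m x0 * e = e / 2 * m x0 + e / 2 * m x0 by field.
rewrite lerD2l.
have := ler_wpM2l (ltW e2) m_low; apply: le_trans.
move: hN; rewrite /q expr_div_n ler_pdivlMr// ler_pdivlMr ?exprn_gt0//.
have r0 : 0 < (2 * rho) ^+ n by rewrite exprn_gt0// mulr_gt0.
have D0 : 0 < (kap rho ^+ n) ^+ N by rewrite exprn_gt0.
rewrite mulrA mulrAC ler_pdivrMr// => h.
have := ler_wpM2r (ltW D0) h.
rewrite -{2}(divfK (lt0r_neq0 D0) (kap d ^+ N)).
move: ((2 * rho) ^+ n) ((kap rho ^+ n) ^+ N) (_ / (kap rho ^+ n) ^+ N) => W D t.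
by lra.
Qed.

(* Only weak convergence against test functions is needed: by best approximation it reduces to
   the density of trigonometric polynomials. *)
Lemma fourier_weak g phi e : L2 mu g -> tst (box x0 1) phi -> 0 < e ->
  exists r0 : seq freq, forall r, uniq r -> {subset r0 <= r} ->
    nc (cint mu (fun x => g x * phi x) - \sum_(xi <- r) fc g xi * cint mu (fun x => eQ xi x * phi x)) <= e.
Proof.
move=> Lg tp e0.
have sV : 0 < Num.sqrt V * (l2 mu g + 1) by rewrite mulr_gt0 ?sqrtr_gt0// ltr_wpDl// l2_ge0.
have [l hl] := trig_density (tstJ tp) (divr_gt0 e0 sV).
exists [seq q.1 | q <- l] => r ur lr.
pose psi x := conjc (phi x); have Lp : L2 mu psi by apply: L2J; exact: tst_L2 tp.
have psiQ x : ~ Q x -> psi x = 0.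
  move=> nQ; rewrite /psi (tst_out tp) ?conjc0// => h; apply: nQ => i; apply: ltW.
  by apply: lt_le_trans (h i) _; have := @pi_ge2 R; lra.
have near_ : l2 mu (fun x => psi x - SF r psi x) <= e / (l2 mu g + 1).
  apply: le_trans (best_approximation ur Lp (l := l) _) _.
    by move=> q ql; apply: lr; apply/mapP; exists q.
  have [] := @L2_bounded _ _ _ mu (fun x => psi x - trg l x) (e / (Num.sqrt V * (l2 mu g + 1))) Q
      (measurable_cube _ _) (mu_cube_fin _ _).
  - by have [] := L2B Lp (L2_trg l).
  - move=> x Qx; have := hl x Qx; rewrite /trg; congr (nc (_ - _) <= _).
    by apply: eq_bigr => q _; rewrite /eQ cutT.
  - move=> x nQ; rewrite psiQ// /trg big1 ?subrr// => q _.
    by rewrite /eQ cutF// mulr0.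
  move=> _; move/le_trans; apply.
  rewrite [X in Num.sqrt (fine X)](_ : _ = V%:E); last exact: (mu_cube x0 (@pi_ge0 R)).
  by rewrite /= invfM mulrA mulrAC divfK// gt_eqF// sqrtr_gt0.
(* Since g - SF r g is orthogonal to SF r psi, the error is the inner product of two residuals: that
   of [g] is bounded by Bessel, that of [psi] is small. *)
have -> : cint mu (fun x => g x * phi x) - \sum_(xi <- r) fc g xi * cint mu (fun x => eQ xi x * phi x) =
    ip (fun x => g x - SF r g x) (fun x => psi x - SF r psi x).
  have pK f : ip f psi = cint mu (fun x => f x * phi x).
    by rewrite /ip; congr cint; apply/funext => x; rewrite conjcK.
  have Ld := L2B Lg (L2_SF r g).
  have := residual_trg ur Lg (l := [seq (xi, fc psi xi) | xi <- r]).
  rewrite -SF_trg => o; rewrite (ipJ (L2B Lp (L2_SF r psi)) Ld) (ipBl Lp (L2_SF r psi) Ld).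
  rewrite (ipJ Ld (L2_SF r psi)) o; last by move=> q /mapP[xi xr ->].
  rewrite conjc0 subr0 -(ipJ Lp Ld) (ipBl Lg (L2_SF r g) Lp) pK ip_suml//; last exact: L2_eQ.
  by congr (_ - _); apply: eq_bigr => xi _; rewrite pK.
have := cauchy_schwarz (L2B Lg (L2_SF r g)) (L2J (L2B Lp (L2_SF r psi))).
rewrite l2J => h; apply: le_trans h _.
have [_ h2] := bessel ur Lg; have g1 : 0 < l2 mu g + 1 by rewrite ltr_wpDl// l2_ge0.
apply: le_trans (ler_pM (l2_ge0 _ _) (l2_ge0 _ _) h2 near_) _.
rewrite mulrA ler_pdivrMr// mulrC ler_wpM2l ?(ltW e0)//.
by rewrite lerDl.
Qed.

End fourier_L2.

(** * Uniform regularity of solutions *)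

Section regularity.
Context (R : realType) (n : nat).
Notation E := 'rV[R]_n.
Notation fct := (E -> R[i]).
Notation mu := (@lebesgue_rV R n).
Notation freq := {ffun 'I_n -> int}.
Implicit Types (U V W K O : set E) (f g v w phi : fct) (s : seq 'I_n) (l : seq (freq * R[i])).

Let oT : open [set: E] := @openT _.

(** The weak form of [P v = g] on [W]; [v] and [g] are functions on the whole space, of which only
    the values on [W] matter. *)
Definition weq (P : pdo R n) W v g :=
  forall phi, tst W phi -> cint mu (fun x => v x * Pt P phi x) = cint mu (fun x => g x * phi x).

Definition rep W v w := forall phi, tst W phi ->
  cint mu (fun x => v x * phi x) = cint mu (fun x => w x * phi x).

Lemma DC_classP (M : nat -> R) W f : open W -> DC_class M W f <->
  sm W f /\ forall K, compact K -> K `<=` W -> exists C h : R, [/\ 0 < C, 0 < h &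
      forall x s, K x -> nc (Dw s f x) <= C * h ^+ size s * M (size s)].
Proof.
move=> oW; split=> [[/Sm sf h]|[sf h]]; split=> //; try exact: sm_smooth.
  move=> K cK KW; have [C [a [C0 a0 H]]] := h K cK KW; exists C, a; split=> // x s Kx.
  rewrite (Dw_perm oW sf (perm_wmi s) (KW x Kx)) -(nc_Dmi _ oW sf (KW x Kx)).
  by rewrite -(mabs_wmi s); exact: H.
move=> K cK KW; have [C [a [C0 a0 H]]] := h K cK KW; exists C, a; split=> // x b Kx.
by rewrite (nc_Dmi _ oW sf (KW x Kx)) -size_word; exact: H.
Qed.

Lemma weak_smooth (M : nat -> R) P U0 W v g : open U0 -> smooth_coefs P U0 ->
  hypoelliptic M P U0 -> open W -> W `<=` U0 -> L2 mu v -> weq P W v g -> DC_class M W g ->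
  exists2 w, DC_class M W w & rep W v w.
Proof.
move=> oU0 sP hyp oW WU Lv vg dg.
have dv := is_distr_L2 oU0 Lv.
have [|w dw vw] := hyp _ dv W oW WU.
  exists g => // phi /tstP tp.
  rewrite (pdo_appE oU0 sP (is_distr_linear dv) (tst_sub WU tp)).
  by rewrite distr_ofE (cut_tst _ tp); exact: vg.
exists w => // phi tp; have /vw : test_fun W phi by apply/tstP.
by rewrite distr_ofE (cut_tst _ tp).
Qed.

Definition esum l : fct := fun x => \sum_(q <- l) q.2 * ex q.1 x.

Lemma sm_esum l : sm setT (esum l).
Proof. by apply: sm_sum => // q; apply: smZ => //; exact: sm_ex. Qed.

Lemma nc_Dw_esum l s x : nc (Dw s (esum l) x) <= \sum_(q <- l) nc q.2 * fmax R q.1 ^+ size s.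
Proof.
rewrite (@Dw_sum _ _ _ _ l (fun q y => q.2 * ex q.1 y) s x oT _ Logic.I) => [|q]; last by apply: smZ => //; exact: sm_ex.
apply: le_trans (nc_sum _ _ _) _; apply: ler_sum => q _.
rewrite (DwZ _ _ oT (sm_ex R q.1) Logic.I) ncM ler_wpM2l ?nc_ge0//.
exact: nc_Dw_ex.
Qed.

Lemma esum_DC (M : nat -> R) l (t h : R) W : open W -> 0 < t -> 0 < h ->
  (forall p, \sum_(q <- l) nc q.2 * fmax R q.1 ^+ p <= t * h ^+ p * M p) -> DC_class M W (esum l).
Proof.
move=> oW t0 h0 H; apply/DC_classP => //; split; first exact: sm_sub (sm_esum l).
by move=> K _ _; exists t, h; split=> // x s _; apply: le_trans (nc_Dw_esum l s x) (H _).
Qed.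

Lemma L2_approx_clim (vN : nat -> fct) v phi : (forall N, L2 mu (vN N)) -> L2 mu v -> L2 mu phi ->
  (forall e, 0 < e -> exists N, forall p, (N <= p)%N -> l2 mu (fun x => vN p x - v x) <= e) ->
  clim (fun N => cint mu (fun x => vN N x * phi x)) (cint mu (fun x => v x * phi x)).
Proof.
move=> LN Lv Lp h e e0; have b0 : 0 < l2 mu phi + 1 by rewrite ltr_wpDl// l2_ge0.
have [N hN] := h _ (divr_gt0 e0 b0); exists N => p Np.
rewrite -cintB; [|exact: L2_cintegrableM|exact: L2_cintegrableM].
under [X in cint _ X]eq_fun do rewrite -mulrBl.
apply: le_trans (cauchy_schwarz (L2B (LN p) Lv) Lp) _.
apply: le_trans (ler_wpM2r (l2_ge0 _ _) (hN p Np)) _.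
by rewrite mulrAC ler_pdivrMr// ler_wpM2l ?(ltW e0)// lerDl.
Qed.

Lemma geo_sum N N' : (N <= N')%N -> \sum_(N <= m < N') (2^-1 : R) ^+ m <= 2 * 2^-1 ^+ N.
Proof.
move=> NN; suff -> : \sum_(N <= m < N') (2^-1 : R) ^+ m = 2 * 2^-1 ^+ N - 2 * 2^-1 ^+ N'.
  by rewrite gerBl mulr_ge0// exprn_ge0// invr_ge0.
elim: N' NN => [|N' IH]; first by rewrite leqn0 => /eqP ->; rewrite big_geq// subrr.
rewrite leq_eqVlt ltnS => /predU1P[->|NN]; first by rewrite big_geq// subrr.
by rewrite big_nat_recr//= IH// exprS; field.
Qed.

Lemma sum_ordB (V : zmodType) (F : nat -> V) N N' : (N <= N')%N ->
  \sum_(m < N') F m - \sum_(m < N) F m = \sum_(N <= m < N') F m.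
Proof.
by move=> NN; rewrite -!(big_mkord xpredT) (big_cat_nat (n := N))//= addrAC subrr add0r.
Qed.

Lemma L2_series (F : nat -> fct) : (forall m, L2 mu (F m)) -> (forall m, l2 mu (F m) <= 2^-1 ^+ m) ->
  exists2 v, L2 mu v & forall e, 0 < e -> exists N, forall p, (N <= p)%N ->
    l2 mu (fun x => \sum_(m < p) F m x - v x) <= e.
Proof.
move=> LF hF; apply: l2_complete => [m|e e0]; first exact: L2_sum.
have [N hN] := half_pow_small (divr_gt0 e0 (ltr0n R 2)); exists N.
have key p q : (N <= p)%N -> (p <= q)%N -> l2 mu (fun x => \sum_(m < q) F m x - \sum_(m < p) F m x) <= e.
  move=> Np pq; under [X in l2 _ X]eq_fun do rewrite (sum_ordB (fun m => F m _) pq).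
  apply: le_trans (l2_sum _ LF) _.
  apply: le_trans (ler_sum _ (fun m _ => hF m)) _.
  by apply: le_trans (geo_sum pq) _; have := hN p Np; lra.
move=> p q Np Nq; have [pq|/ltnW qp] := leqP p q; last exact: key.
rewrite -l2N; under [X in l2 _ X]eq_fun do rewrite opprB.
exact: key.
Qed.

Lemma cauchy_schwarz_cut A v phi (B : R) : measurable A -> L2 mu phi ->
  (forall x, ~ A x -> phi x = 0) -> L2 mu (cut A v) -> l2 mu (cut A v) <= B ->
  nc (cint mu (fun x => v x * phi x)) <= B * l2 mu phi.
Proof.
move=> mA Lp p0 Lv vB.
have -> : (fun x => v x * phi x) = (fun x => cut A v x * phi x).
  apply/funext => x; have [Ax|nA] := pselect (A x); first by rewrite cutT.
  by rewrite p0// !mulr0.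
by apply: le_trans (cauchy_schwarz Lv Lp) _; rewrite ler_wpM2r ?l2_ge0.
Qed.

Lemma closed_measurable_rV K : closed K -> measurable K.
Proof.
by move=> cK; rewrite -(setCK K); apply: measurableC; apply: open_measurable_rV; exact: closed_openC.
Qed.

Lemma compact_L2 K : compact K -> exists2 r : R, 0 < r & forall A f (B : R), measurable A ->
  A `<=` K -> cmeas (cut A f) -> 0 <= B -> (forall x, A x -> nc (f x) <= B) ->
  L2 mu (cut A f) /\ l2 mu (cut A f) <= B * r.
Proof.
move=> cK; have [r r0 Kr] := compact_cube cK.
exists (Num.sqrt (fine (mu (cube 0 r))) + 1); first by rewrite ltr_wpDl// sqrtr_ge0.
move=> A f B mA AK mf B0 fB.
have [] := @L2_bounded _ _ _ mu (cut A f) B _ (measurable_cube 0 r) (mu_cube_fin 0 r) mf.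
- by move=> x _; rewrite /cut; case: asboolP => [/fB//|_]; rewrite nc0.
- by move=> x nx; rewrite cutF// => /AK/Kr.
by move=> Lf lf; split=> //; apply: le_trans lf _; rewrite ler_wpM2l// lerDl.
Qed.

Lemma L2_cut_Dw O K s w : open O -> compact K -> K `<=` O -> sm O w -> L2 mu (cut K (Dw s w)).
Proof.
move=> oO cK KO sw; have [rr _ hrr] := compact_L2 cK.
have mK : measurable K by apply: closed_measurable_rV; exact: compact_closed_rV.
have cD x : O x -> ccont (Dw s w) x by move=> Ox; exact: (sm_C1 (sm_Dw s sw) Ox).1.
have [B B0 hB] : exists2 B, 0 < B & forall x, K x -> nc (Dw s w x) <= B.
  by apply: bounded_on_compact => // x /KO; exact: cD.
have [] // := hrr K (Dw s w) B mK _ _ (ltW B0) hB.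
by rewrite -(cut_sub _ KO); apply: cmeas_cut_meas => //; exact: cmeas_cut.
Qed.

Lemma rep_sub O W v w : O `<=` W -> rep W v w -> rep O v w.
Proof. by move=> OW vw phi tp; apply: vw; exact: tst_sub tp. Qed.

Lemma rep_Dw O v w s phi : open O -> sm O w -> rep O v w -> tst O phi ->
  cint mu (fun x => v x * Dw s phi x) = (-1) ^+ size s * cint mu (fun x => Dw s w x * phi x).
Proof.
move=> oO sw vw tp; rewrite (vw _ (tst_Dw s tp)) (ibp s oO sw tp) mulrA -exprD addnn -mul2n.
by rewrite exprM sqrrN !expr1n mul1r.
Qed.

Lemma nc_sign k z : nc ((-1) ^+ k * z : R[i]) = nc z.
Proof. by rewrite ncM ncX ncN nc1 expr1n mul1r. Qed.

(* Testing against theta times the conjugate of D^s w. *)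
Lemma dual_bound (O K : set E) v w s (B : R) : open O -> compact K -> K `<=` O -> 0 <= B ->
  sm O w -> rep O v w ->
  (forall phi, tst O phi -> l2 mu phi <= 1 -> nc (cint mu (fun x => v x * Dw s phi x)) <= B) ->
  L2 mu (cut K (Dw s w)) /\ l2 mu (cut K (Dw s w)) <= B.
Proof.
move=> oO cK KO B0 sw vw H; have sDw := sm_Dw s sw.
(* Scaling to unit norm; the term e / (B + 1) avoids a division by a norm that may vanish. *)
have {}H phi : tst O phi -> nc (cint mu (fun x => Dw s w x * phi x)) <= B * l2 mu phi.
  move=> tp; apply/ler_addgt0Pr => e e0; have B1 : 0 < B + 1 by rewrite ltr_wpDl.
  pose N := l2 mu phi + e / (B + 1).
  have N0 : 0 < N by rewrite ltr_wpDl ?l2_ge0// divr_gt0.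
  have t1 := tstZ (N^-1)%:C%C tp.
  have n1 : l2 mu (fun x => (N^-1)%:C%C * phi x) <= 1.
    rewrite l2Z; last exact: tst_L2 tp.
    rewrite nc_real ger0_norm ?invr_ge0 ?(ltW N0)// ler_pdivrMl// mulr1 lerDl.
    by rewrite divr_ge0 ?(ltW e0)// ltW.
  have := H _ t1 n1; rewrite (rep_Dw s oO sw vw t1) nc_sign.
  under [X in cint _ X]eq_fun do rewrite mulrCA.
  rewrite cintZ; last by have := tst_int (tstM oO sDw tp).
  rewrite ncM nc_real ger0_norm ?invr_ge0 ?(ltW N0)// ler_pdivrMl// => /le_trans; apply.
  rewrite /N mulrDl mulrC lerD2l mulrAC ler_pdivrMr// ler_wpM2l ?(ltW e0)//.
  by rewrite lerDl.
have [ O' [K' [B1 [[oO' cK' KO' OK' K'O] [B10 hth]]]]] := cutoff_between cK oO KO.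
have [th [cth th1 th0]] := hth 0%N.
pose phi x := conjc (Dw s w x) * rc th x.
have tphi : tst O phi by apply: tstM => //; [exact: smJ|exact: cutoff_tst cth th0].
have Lphi := tst_L2 tphi.
have prodE x : Dw s w x * phi x = (nc (Dw s w x) ^+ 2 * th x)%:C%C.
  by rewrite /phi mulrA mulcJ /rc -rmorphM.
have th01 x : 0 <= th x <= 1 by case: cth.
have ia : mu.-integrable setT (EFin \o (fun x => nc (Dw s w x) ^+ 2 * th x)).
  have [h _] := tst_int (tstM oO sDw tphi).
  rewrite (_ : EFin \o _ = EFin \o (@complex.Re R \o (fun x => Dw s w x * phi x)))//.
  by apply/funext => x; rewrite /comp prodE.
(* Since th^2 <= th, the squared norm of [phi] is at most its pairing with D^s w, itself at most B
   times the norm; so the norm is at most B. *)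
have h1 : l2 mu phi ^+ 2 <= nc (cint mu (fun x => Dw s w x * phi x)).
  under [X in cint _ X]eq_fun do rewrite prodE.
  rewrite cint_real nc_real l2_sqr; apply: le_trans (ler_norm _).
  apply: le_Rintegral => //; first by case: Lphi.
  move=> x _; rewrite /phi ncM ncJ nc_real exprMn ger0_norm; last by case/andP: (th01 x).
  rewrite ler_wpM2l ?sqr_ge0// expr2 -[leRHS]mulr1 ler_wpM2l//; by case/andP: (th01 x).
have N0 := l2_ge0 mu phi.
have NB : l2 mu phi <= B.
  have := le_trans h1 (H _ tphi); rewrite expr2.
  have [->|Nn] := eqVneq (l2 mu phi) 0; first by [].
  by rewrite ler_pM2r// lt_neqAle eq_sym Nn.
have hK x : nc (cut K (Dw s w) x) <= nc (phi x).
  rewrite /cut; case: asboolP => [Kx|_]; last by rewrite nc0 nc_ge0.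
  by rewrite /phi ncM ncJ /rc th1 ?nc1 ?mulr1//; exact: KO'.
have mK : measurable K by apply: closed_measurable_rV; exact: compact_closed_rV.
have LK : L2 mu (cut K (Dw s w)).
  apply: L2_le Lphi hK; rewrite -(cut_sub _ KO); apply: cmeas_cut_meas => //.
  by apply: cmeas_cut => // x Ox; have [] := sm_C1 sDw Ox.
by split=> //; apply: le_trans NB; exact: l2_le.
Qed.

End regularity.

(** * Class bounds with constants independent of the solution *)

Section uniform_regularity.
Context (R : realType) (n : nat) (M : nat -> R) (P : pdo R n) (U0 : set 'rV[R]_n).
Notation E := 'rV[R]_n.
Notation fct := (E -> R[i]).
Notation mu := (@lebesgue_rV R n).
Notation freq := {ffun 'I_n -> int}.
Hypotheses (M0 : forall k, 0 < M k) (oU0 : open U0) (sP : smooth_coefs P U0)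
  (hyp : hypoelliptic M P U0).

Let oT : open [set: E] := @openT _.

(** For one fixed trigonometric polynomial membership in the class is free, since its derivatives
    grow geometrically and M k >= 1. This provides the smooth function whose derivatives are then
    estimated with uniform constants. *)
Lemma smooth_rep (W : set E) (v : fct) (l : seq (freq * R[i])) : (forall k, 1 <= M k) -> open W ->
  W `<=` U0 -> L2 mu v -> weq P W v (esum l) -> exists2 w, sm W w & rep W v w.
Proof.
move=> M1 oW WU Lv vl.
pose h : R := 1 + \sum_(q <- l) fmax R q.1; pose t : R := 1 + \sum_(q <- l) nc q.2.
have f0 (r : seq (freq * R[i])) : 0 <= \sum_(q <- r) fmax R q.1.
  by apply: sumr_ge0 => q _; exact: fmax_ge0.
have c0 (r : seq (freq * R[i])) : 0 <= \sum_(q <- r) nc q.2.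
  by apply: sumr_ge0 => q _; exact: nc_ge0.
have h0 : 0 < h by rewrite ltr_pwDl.
have t0 : 0 < t by rewrite ltr_pwDl.
have dg : DC_class M W (esum l).
  apply: (esum_DC (t := t) (h := h)) => // p.
  apply: le_trans (_ : \sum_(q <- l) nc q.2 * h ^+ p <= _).
    rewrite !big_seq; apply: ler_sum => q ql; rewrite ler_wpM2l ?nc_ge0//.
    rewrite lerXn2r ?nnegrE ?fmax_ge0 ?(ltW h0)// /h.
    have /splitPr[r1 r2] := ql; have := f0 r1; have := f0 r2.
    by rewrite big_cat big_cons /=; lra.
  rewrite -mulr_suml; apply: le_trans (_ : t * h ^+ p * 1 <= _).
    by rewrite mulr1 ler_wpM2r ?exprn_ge0 ?(ltW h0)// lerDr.
  by rewrite ler_wpM2l ?mulr_ge0 ?exprn_ge0 ?(ltW h0) ?(ltW t0).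
have [w dw vw] := weak_smooth oU0 sP hyp oW WU Lv vl dg.
by exists w => //; have [sw _] := (DC_classP M w oW).1 dw.
Qed.

(* The constants do not depend on v: sum a sequence of counterexamples with rapidly decreasing
   coefficients (sliding hump) and apply hypoellipticity to the sum. *)
Lemma uniform_regularity (W K : set E) (h : R) : 0 < h -> open W -> W `<=` U0 ->
  compact K -> K `<=` W -> exists C L : R, [/\ 0 < C, 0 < L &
    forall (v : fct) (l : seq (freq * R[i])) (t : R), 0 < t -> L2 mu v -> l2 mu v <= t ->
      weq P W v (esum l) ->
      (forall p, \sum_(q <- l) nc q.2 * fmax R q.1 ^+ p <= t * h ^+ p * M p) ->
      forall w, sm W w -> rep W v w -> forall s, L2 mu (cut K (Dw s w)) /\
        l2 mu (cut K (Dw s w)) <= C * L ^+ size s * M (size s) * t].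
Proof.
move=> h0 oW WU cK KW.
(* The test functions live in the intermediate set [O], inside the compact [K'] on which the
   solution obtained from the summed series has class bounds. *)
have [ O [K' [_ [[oO cK' KO OK' K'W] _]]]] := cutoff_between cK oW KW.
have OW : O `<=` W by exact: subset_trans OK' K'W.
pose good (x : fct * seq (freq * R[i])) := [/\ L2 mu x.1, l2 mu x.1 <= 1, weq P W x.1 (esum x.2) &
  forall p, \sum_(q <- x.2) nc q.2 * fmax R q.1 ^+ p <= 1 * h ^+ p * M p].
(* The points are normalized solutions with their data; the functionals test D^s against a
   normalized function and divide by M_|s|. The conclusion of [gliding_hump] is then the bound C
   L^|s|. *)
pose T := {x | good x}.
pose I := {i : seq 'I_n * fct | tst O i.2 /\ l2 mu i.2 <= 1}.
pose d (i : I) := size (sval i).1.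
pose lam (i : I) (x : T) : R[i] := ((M (d i))^-1)%:C%C *
  cint mu (fun y => (sval x).1 y * Dw (sval i).1 (sval i).2 y).
have lamE i x : nc (lam i x) = (M (d i))^-1 * nc (cint mu (fun y => (sval x).1 y * Dw (sval i).1 (sval i).2 y)).
  by rewrite ncM nc_real ger0_norm ?invr_ge0 ?(ltW (M0 _)).
have [||C [L [C0 L0 CL]]] := @gliding_hump R T I lam d.
- move=> [[s phi] [tp p1]]; exists ((M (size s))^-1 * l2 mu (Dw s phi)) => -[[v l] [Lv v1 eq_v hl_v]].
  rewrite lamE; apply: ler_wpM2l; first by rewrite invr_ge0 ltW.
  apply: le_trans (cauchy_schwarz Lv (tst_L2 (tst_Dw s tp))) _.
  by rewrite -[leRHS]mul1r ler_wpM2r ?l2_ge0.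
- move=> x eps he.
  have e0 m : 0 < eps m by case/andP: (he m).
  have e1 m : eps m <= 2^-1 ^+ m by case/andP: (he m).
  pose v m := (sval (x m)).1; pose l m := (sval (x m)).2.
  have [Lv v1 vl hl] : [/\ forall m, L2 mu (v m), forall m, l2 mu (v m) <= 1,
      forall m, weq P W (v m) (esum (l m)) &
      forall m p, \sum_(q <- l m) nc q.2 * fmax R q.1 ^+ p <= 1 * h ^+ p * M p].
    by split=> m; rewrite /v /l; case: (x m) => -[? ?] [].
  pose F m y := (eps m)%:C%C * v m y; pose G m y := (eps m)%:C%C * esum (l m) y.
  have LF m : L2 mu (F m) by exact: L2Z.
  have [|V LV hV] := L2_series LF.
    move=> m; rewrite l2Z// nc_real ger0_norm ?(ltW (e0 m))// -[leRHS]mulr1.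
    by rewrite ler_pM ?l2_ge0 ?(ltW (e0 m)).
  have LN N : L2 mu (fun x => \sum_(m < N) F m x) by exact: L2_sum.
  have approx := @L2_approx_clim R n (fun N x => \sum_(m < N) F m x) V.
  have sG m : sm setT (G m) by apply: smZ => //; exact: sm_esum.
  have bG s m y : nc (Dw s (G m) y) <= (h ^+ size s * M (size s)) * 2^-1 ^+ m.
    rewrite (DwZ _ _ oT (sm_esum _) Logic.I) ncM nc_real ger0_norm ?(ltW (e0 m))// mulrC.
    apply: ler_pM; rewrite ?nc_ge0 ?(ltW (e0 m))//.
    by apply: le_trans (nc_Dw_esum _ s y) _; rewrite -(mul1r (h ^+ _)); exact: hl.
  have hM s : 0 <= h ^+ size s * M (size s) by rewrite mulr_ge0 ?exprn_ge0 ?(ltW h0) ?(ltW (M0 _)).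
  have [|g [gl sg gD]] := sm_series sG.
    by move=> s; exists (fun m => (h ^+ size s * M (size s)) * 2^-1 ^+ m); [exact: psum_geometric|].
  pose g0 := g [::].
  have dg : DC_class M W g0.
    apply/DC_classP => //; split; first exact: sm_sub sg.
    move=> K1 _ _; exists 2, h; split=> // y s _; rewrite gD.
    apply: clim_le (gl s y) _ => N; apply: le_trans (nc_sum _ _ _) _.
    apply: le_trans (_ : \sum_(m < N) (h ^+ size s * M (size s)) * 2^-1 ^+ m <= _).
      by apply: ler_sum => m _; exact: bG.
    rewrite -mulr_sumr -(big_mkord xpredT (fun m => 2^-1 ^+ m)).
    have := ler_wpM2l (hM _ s) (@geo_sum R 0 N (leq0n N)); rewrite expr0 mulr1 => /le_trans; apply.
    by rewrite mulrC mulrA.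
  (* Both sides are limits of those for the partial sums: in L^2 for the solutions, uniformly for
     the data. *)
  have Vg : weq P W V g0.
    move=> phi tp; have tP := tst_Pt oW (fun a ha => sm_sub WU (sP ha)) tp.
    have c1 := approx _ LN LV (tst_L2 tP) hV.
    apply: clim_unique c1 _.
    have c2 : clim (fun N => cint mu (fun y => (\sum_(m < N) G m y) * phi y)) (cint mu (fun y => g0 y * phi y)).
      have Lp := tst_L2 tp; have ip_ := tst_int tp.
      have iN N : cintegrable mu (fun y => (\sum_(m < N) G m y) * phi y).
        by apply: (tst_int (U := W)); apply: tstM => //; apply: sm_sum => // m; exact: sm_sub (sG m).
      have ig : cintegrable mu (fun y => g0 y * phi y).
        by apply: (tst_int (U := W)); apply: tstM => //; exact: sm_sub sg.
      pose J := \int[mu]_y nc (phi y).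
      have J0 : 0 <= J by apply: Rintegral_ge0 => y _; exact: nc_ge0.
      have M1 := M0 0%N.
      have tail N y : nc (\sum_(m < N) G m y - g0 y) <= 2 * M 0%N * 2^-1 ^+ N.
        apply/ler_addgt0Pr => e e_0; have [N' hN'] := gl [::] y e e_0.
        pose p := maxn N N'; have := hN' p (leq_maxr _ _).
        have : nc (\sum_(m < N) G m y - \sum_(m < p) G m y) <= 2 * M 0%N * 2^-1 ^+ N.
          rewrite ncB (sum_ordB (fun m => G m y) (leq_maxl _ _)).
          apply: le_trans (nc_sum _ _ _) _.
          apply: le_trans (ler_sum _ (fun m _ => bG [::] m y)) _; rewrite -mulr_sumr mul1r.
          by have := ler_wpM2l (ltW M1) (@geo_sum R N p (leq_maxl _ _)); rewrite mulrCA mulrA.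
        have -> : \sum_(m < N) G m y - g0 y = (\sum_(m < N) G m y - \sum_(m < p) G m y) + (\sum_(m < p) G m y - g0 y) by rewrite addrA subrK.
        by move=> a b; apply: le_trans (ncD _ _) _; exact: lerD.
      move=> e e_0; have q0 : 0 < e / (2 * M 0%N * (J + 1)) by rewrite divr_gt0// mulr_gt0 ?mulr_gt0// ltr_wpDl.
      have [N hN] := half_pow_small q0; exists N => p Np.
      rewrite -cintB//; under [X in cint _ X]eq_fun do rewrite -mulrBl.
      have iD : cintegrable mu (fun y => (\sum_(m < p) G m y - g0 y) * phi y).
        by under eq_fun do rewrite mulrBl; apply: cintegrableD => //; exact: cintegrableN.
      apply: le_trans (nc_cint iD) _.
      apply: le_trans (_ : \int[mu]_y (2 * M 0%N * 2^-1 ^+ p * nc (phi y)) <= _).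
        apply: le_Rintegral => //; [exact: cintegrable_nc|apply: integrableZR; exact: cintegrable_nc|].
        by move=> y _; rewrite ncM ler_wpM2r ?nc_ge0.
      rewrite RintegralZl//; last exact: cintegrable_nc.
      have := hN p Np; rewrite ler_pdivlMr; last by rewrite mulr_gt0 ?mulr_gt0// ltr_wpDl.
      have p2 : 0 <= (2^-1 : R) ^+ p by rewrite exprn_ge0// invr_ge0.
      rewrite -/J => /(le_trans _); apply.
      rewrite mulrDr mulr1 mulrDr mulrA [2^-1 ^+ p * _]mulrC lerDl.
      by rewrite mulr_ge0// mulr_ge0// ltW.
    apply: clim_eq c2 => N.
    under [X in cint _ X = _]eq_fun do rewrite mulr_suml.
    under [X in _ = cint _ X]eq_fun do rewrite mulr_suml.
    rewrite !cint_sum => [| m|m]; last 2 first.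
    - by apply: L2_cintegrableM (LF m) (tst_L2 tP).
    - by apply: (tst_int (U := W)); apply: tstM => //; exact: sm_sub (sG m).
    apply: eq_bigr => m _; rewrite /F /G.
    under [X in cint _ X = _]eq_fun do rewrite -mulrA.
    under [X in _ = cint _ X]eq_fun do rewrite -mulrA.
    rewrite !cintZ ?vl//; first by apply: L2_cintegrableM (Lv m) (tst_L2 tP).
    by apply: (tst_int (U := W)); apply: tstM => //; exact: sm_sub (sm_esum _).
  have [w dw Vw] := weak_smooth oU0 sP hyp oW WU LV Vg dg.
  have [sw bw] := (DC_classP M w oW).1 dw.
  have [C [L [C0 L0 hCL]]] := bw K' cK' K'W.
  have [r r0 hr] := compact_L2 cK'.
  exists (C * r), L; split=> //; first exact: mulr_gt0.
  move=> [[s phi] [tp p1]] z hz; rewrite [d _]/(size s).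
  have tpW := tst_sub OW tp; have tD := tst_Dw s tp.
  have zE : z = ((M (size s))^-1)%:C%C * cint mu (fun y => V y * Dw s phi y).
    apply: clim_unique hz _.
    have := climZ ((M (size s))^-1)%:C%C (approx _ LN LV (tst_L2 tD) hV).
    apply: clim_eq => N.
    under [X in cint _ X]eq_fun do rewrite mulr_suml.
    rewrite cint_sum => [|m]; last by apply: L2_cintegrableM (LF m) (tst_L2 tD).
    rewrite mulr_sumr; apply: eq_bigr => m _.
    have -> : cint mu (fun y => F m y * Dw s phi y) = (eps m)%:C%C * cint mu (fun y => v m y * Dw s phi y).
      rewrite /F; under [X in cint _ X]eq_fun do rewrite -mulrA.
      by rewrite cintZ//; apply: L2_cintegrableM (Lv m) (tst_L2 tD).
    by rewrite mulrCA.
  have sOw := sm_sub OW sw.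
  rewrite zE ncM nc_real ger0_norm ?invr_ge0 ?(ltW (M0 _))// ler_pdivrMl//.
  rewrite (rep_Dw s oO sOw (rep_sub OW Vw) tp) nc_sign.
  have B0 : 0 <= C * L ^+ size s * M (size s).
    by rewrite mulr_ge0 ?(ltW (M0 _))// mulr_ge0 ?(ltW C0)// exprn_ge0 ?(ltW L0).
  have mO := open_measurable_rV oO.
  have [] := hr O (Dw s w) (C * L ^+ size s * M (size s)) mO OK' _ B0.
  - by apply: cmeas_cut => // y Oy; have [] := sm_C1 (sm_Dw s sOw) Oy.
  - by move=> y /OK'; exact: hCL.
  move=> LO lO; apply: le_trans (cauchy_schwarz_cut mO (tst_L2 tp) (fun y => tst_out tp) LO lO) _.
  apply: le_trans (_ : C * L ^+ size s * M (size s) * r * 1 <= _).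
    by rewrite ler_wpM2l// mulr_ge0// ltW.
  by rewrite mulr1 le_eqVlt; apply/orP; left; apply/eqP; ring.
exists C, L; split=> // v l t t0 Lv vt vl hl w sw vw s.
have tn : t != 0 by rewrite gt_eqF.
(* Homogeneity reduces the general case to t = 1. *)
pose v1 y := (t^-1)%:C%C * v y; pose l1 : seq (freq * R[i]) := [seq (q.1, (t^-1)%:C%C * q.2) | q <- l].
have esumE : esum l1 = fun y => (t^-1)%:C%C * esum l y.
  by apply/funext => y; rewrite /esum big_map mulr_sumr; apply: eq_bigr => q _; rewrite mulrA.
have g1 : good (v1, l1).
  split=> /=.
  - exact: L2Z.
  - by rewrite l2Z// nc_real ger0_norm ?invr_ge0 ?(ltW t0)// ler_pdivrMl// mulr1.
  - move=> phi tp; have tP := tst_Pt oW (fun a ha => sm_sub WU (sP ha)) tp.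
    rewrite esumE /v1; under [X in cint _ X = _]eq_fun do rewrite -mulrA.
    under [X in _ = cint _ X]eq_fun do rewrite -mulrA.
    rewrite !cintZ ?vl//; last by apply: L2_cintegrableM Lv (tst_L2 tP).
    by apply: (tst_int (U := W)); apply: tstM => //; exact: sm_sub (sm_esum _).
  - move=> p; rewrite big_map /=.
    under eq_bigr do rewrite ncM nc_real ger0_norm ?invr_ge0 ?(ltW t0)// -mulrA.
    by rewrite -mulr_sumr ler_pdivrMl// mul1r mulrA.
have B0 : 0 <= C * L ^+ size s * M (size s) * t.
  by rewrite mulr_ge0 ?(ltW t0)// mulr_ge0 ?(ltW (M0 _))// mulr_ge0 ?(ltW C0)// exprn_ge0 ?(ltW L0).
apply: (dual_bound (O := O) (v := v)) => //; [exact: sm_sub sw|exact: rep_sub vw|].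
move=> phi tp p1; have := CL (exist _ (s, phi) (conj tp p1)) (exist _ (v1, l1) g1).
rewrite lamE => h1.
have {h1} : (M (size s))^-1 * nc (cint mu (fun y => v1 y * Dw s phi y)) <= C * L ^+ size s by exact: h1.
rewrite /v1; under [X in cint _ X]eq_fun do rewrite -mulrA.
rewrite cintZ; last by apply: L2_cintegrableM Lv (tst_L2 (tst_Dw s tp)).
rewrite !ncM !nc_real !ger0_norm ?invr_ge0 ?(ltW t0)// ler_pdivrMl// ler_pdivrMl//.
by move=> h1; apply: le_trans h1 _; rewrite le_eqVlt; apply/orP; left; apply/eqP; ring.
Qed.

End uniform_regularity.

(** * Boxes of frequencies and solutions with exponential data *)

Section frequency_boxes.
Context (R : realType) (n : nat).
Notation freq := {ffun 'I_n -> int}.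
Implicit Types (xi : freq) (N : nat).

Definition fbox N : seq freq :=
  [seq [ffun i => (val (g i))%:Z - N%:Z] | g : {ffun 'I_n -> 'I_(N + N).+1}].

Lemma fbox_uniq N : uniq (fbox N).
Proof.
rewrite map_inj_uniq ?enum_uniq// => g g' /ffunP h; apply/ffunP => i.
by have := h i; rewrite !ffunE => /addIr[] /val_inj.
Qed.

Lemma size_fbox N : size (fbox N) = ((N + N).+1 ^ n)%N.
Proof. by rewrite size_map -cardE card_ffun !card_ord. Qed.

Lemma mem_fbox N xi : (xi \in fbox N) = (fmax R xi <= N%:R).
Proof.
apply/idP/idP => [/mapP[g _ ->]|h].
  apply/bigmax_leP; split=> // i _; rewrite ffunE.
  have -> : ((val (g i))%:Z - N%:Z)%:~R = (val (g i))%:R - N%:R :> R by rewrite rmorphB.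
  have hm : (val (g i) <= N + N)%N by have := ltn_ord (g i); rewrite ltnS.
  move: (val (g i)) hm => m hm; rewrite ler_norml.
  have : (m%:R : R) <= (N + N)%:R by rewrite ler_nat.
  by rewrite natrD; have : (0 : R) <= m%:R by []; move=> *; apply/andP; split; lra.
have hi i : (`|xi i| <= N)%N.
  have /bigmax_leP[_ /(_ i isT)] := h.
  by rewrite -intr_norm -(abszE (xi i)) -[(Posz _)%:~R]/((`|xi i|%N)%:R) ler_nat.
have hb i : (`|(xi i + N%:Z)%R| < (N + N).+1)%N by have := hi i; lia.
apply/mapP; exists [ffun i => Ordinal (hb i)]; first by rewrite mem_enum.
apply/ffunP => i; rewrite !ffunE /=; have := hi i; lia.
Qed.

Lemma fbox_homo N N' : (N <= N')%N -> {subset fbox N <= fbox N'}.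
Proof. by move=> NN xi; rewrite !mem_fbox => /le_trans; apply; rewrite ler_nat. Qed.

Lemma fbox_exhaust (r : seq freq) : exists N, {subset r <= fbox N}.
Proof.
elim: r => [|xi r [N IH]]; first by exists 0%N.
have [N' hN'] : exists N', fmax R xi <= N'%:R.
  by exists (Num.bound (fmax R xi)); apply: ltW; apply: archi_boundP; exact: fmax_ge0.
exists (maxn N N') => eta; rewrite inE => /predU1P[->|/IH]; last exact: fbox_homo (leq_maxl _ _) _.
by apply: (fbox_homo (leq_maxr N N')); rewrite mem_fbox.
Qed.

(** Each coefficient is at most [b] and the box has at most (3N)^n points. The crude loss N^n is
    absorbed later by the moderate growth of [M]. *)
Lemma sum_nc_fbox N (F : seq freq) (c : freq -> R[i]) (b : R) : (0 < N)%N -> uniq F ->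
  {subset F <= fbox N} -> 0 <= b -> \sum_(xi <- F) nc (c xi) ^+ 2 <= b ^+ 2 ->
  \sum_(xi <- F) nc (c xi) <= (3 * N%:R) ^+ n * b.
Proof.
move=> N0 uF FN b0 hb.
apply: le_trans (_ : \sum_(xi <- F) b <= _).
  rewrite big_seq [leRHS]big_seq; apply: ler_sum => xi xF.
  rewrite -(@ler_pXn2r _ 2) ?nnegrE ?nc_ge0//; apply: le_trans hb.
  by rewrite (bigD1_seq xi)//= lerDl sumr_ge0// => *; exact: sqr_ge0.
have -> : \sum_(xi <- F) b = (size F)%:R * b.
  by rewrite big_const_seq count_predT iter_addr_0 mulr_natl.
rewrite ler_wpM2r//.
apply: le_trans (_ : (size (fbox N))%:R <= _); first by rewrite ler_nat uniq_leq_size.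
rewrite size_fbox natrX lerXn2r ?nnegrE ?mulr_ge0//.
by rewrite -natrM ler_nat; lia.
Qed.

End frequency_boxes.

Section right_inverse.
Context (R : realType) (n : nat) (P : pdo R n) (Om W : set 'rV[R]_n) (x0 : 'rV[R]_n).
Context (T : ('rV[R]_n -> R[i]) -> ('rV[R]_n -> R[i])).
Notation E := 'rV[R]_n.
Notation fct := (E -> R[i]).
Notation mu := (@lebesgue_rV R n).
Notation freq := {ffun 'I_n -> int}.
Hypotheses (oOm : open Om) (sP : smooth_coefs P Om) (oT : L2_operator Om T)
  (PT : pdo_right_inverse P Om T) (WOm : W `<=` Om) (Wx : W `<=` box x0 1).

Let mOm : measurable Om := open_measurable_rV oOm.

Lemma l2_ae0 (f : fct) : {ae mu, forall x, f x = 0} -> cmeas f -> l2 mu f = 0.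
Proof.
move=> f0 mf; rewrite /l2 (_ : \int[mu]_x (nc (f x) ^+ 2) = 0) ?sqrtr0//.
rewrite /Rintegral.
have -> : (\int[mu]_x (nc (f x) ^+ 2)%:E = \int[mu]_x 0)%E.
  apply: ae_eq_integral => //.
    exact/measurable_EFinP/measurable_funX/cmeas_nc.
  by apply: filterS f0 => x /= -> _; rewrite nc0 expr0n.
by rewrite integral0.
Qed.

Let fe xi : fct := eQ x0 xi.

Let L2T f : L2 mu (cut Om f) -> L2 mu (cut Om (T f)).
Proof. by move=> /(L2funP f mOm) Lf; apply/(L2funP _ mOm); have [h _ _] := oT; exact: h. Qed.

(** The right inverse is applied to exponentials truncated to a cube of one period, where they are
    orthogonal: the norm of a superposition is then controlled by the l^2 norm of the coefficients.
    The truncation is not seen on [W], which lies in the unit box. *)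
Lemma exponential_solutions : exists (r : freq -> fct) (C : R),
  [/\ 0 < C, forall xi, L2 mu (r xi), forall xi, weq P W (r xi) (ex xi) &
    forall (F : seq freq) (c : freq -> R[i]), uniq F ->
      l2 mu (fun x => \sum_(xi <- F) c xi * r xi x) <=
        C * Num.sqrt (\sum_(xi <- F) nc (c xi) ^+ 2)].
Proof.
have [_ lin [C hC]] := oT.
have {}hC f : L2 mu (cut Om f) -> l2 mu (cut Om (T f)) <= C * l2 mu (cut Om f).
  move=> Lf; have Lf' := (L2funP f mOm).2 Lf.
  by have := hC f Lf'; rewrite (L2normE Lf) (L2normE (L2T Lf)) -EFinM lee_fin.
pose r xi := cut Om (T (fe xi)).
have Lf xi : L2 mu (cut Om (fe xi)) by have [] := L2_cut mOm (L2_eQ x0 xi).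
have Lr xi : L2 mu (r xi) by exact: L2T.
pose SFe F (c : freq -> R[i]) : fct := fun x => \sum_(xi <- F) c xi * fe xi x.
have LS F c : L2 mu (SFe F c) by apply: L2_sum => xi; apply: L2Z; exact: L2_eQ.
have LS' F c : L2 mu (cut Om (SFe F c)) by have [] := L2_cut mOm (LS F c).
(* [T] is linear only almost everywhere, so the superposition and the image of the sum are compared
   in L^2 norm; boundedness of [T] settles the empty sum. *)
have key F c : l2 mu (fun x => \sum_(xi <- F) c xi * r xi x - cut Om (T (SFe F c)) x) = 0.
  elim: F => [|xi F IH].
    under [X in l2 _ X]eq_fun do rewrite big_nil sub0r.
    rewrite l2N; apply/eqP; rewrite eq_le l2_ge0 andbT.
    apply: le_trans (hC _ (LS' [::] c)) _.
    rewrite (_ : cut Om (SFe [::] c) = fun=> 0) ?l2_0 ?mulr0//.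
    by apply/funext => x; rewrite /cut /SFe big_nil; case: asboolP.
  have Ls : L2 mu (fun x => \sum_(xi <- F) c xi * r xi x) by apply: L2_sum => eta; exact: L2Z.
  have LD := L2B Ls (L2T (LS' F c)).
  pose g x := c xi * r xi x + cut Om (T (SFe F c)) x - cut Om (T (SFe (xi :: F) c)) x.
  have Lg : L2 mu g by apply: L2B (L2T (LS' _ _)); apply: L2D (L2T (LS' _ _)); exact: L2Z.
  have g0 : l2 mu g = 0.
    apply: l2_ae0; last by case: Lg.
    have := lin (c xi) (fe xi) (SFe F c) ((L2funP _ mOm).2 (Lf xi)) ((L2funP _ mOm).2 (LS' F c)).
    apply: filterS => x h; rewrite /g /r /cut; case: asboolP => Ox; last by rewrite mulr0 addr0 subrr.
    rewrite -h// (_ : (fun y => c xi * fe xi y + SFe F c y) = SFe (xi :: F) c) ?subrr//.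
    by apply/funext => y; rewrite /SFe big_cons.
  apply/eqP; rewrite eq_le l2_ge0 andbT.
  rewrite (_ : (fun x => _) = (fun x => (\sum_(xi <- F) c xi * r xi x - cut Om (T (SFe F c)) x) + g x)).
    by apply: le_trans (l2D LD Lg) _; rewrite IH g0 addr0.
  by apply/funext => x; rewrite big_cons /g; ring.
exists r, (`|C| * Num.sqrt ((2 * pi) ^+ n) + 1); split=> //.
- move=> xi phi tp; have tpO := tst_sub WOm tp.
  have l1 : linear_on Om (distr_of Om (T (fe xi))).
    have h := @linear_on_cint R n Om (r xi) (fun phi tp => L2_tst (Lr xi) tp).
    move=> a f1 f2 t1 t2; rewrite !distr_ofE; exact: h.
  have := PT ((L2funP _ mOm).2 (Lf xi)) ((tstP _ _).2 tpO).
  rewrite (pdo_appE oOm sP l1 tpO) !distr_ofE -/(r xi) => ->.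
  congr cint; apply/funext => x; have [Wx'|nW] := pselect (W x); last by rewrite (tst_out tp nW) !mulr0.
  rewrite cutT; last exact: WOm.
  rewrite /fe /eQ cutT// => i; apply: ltW; apply: lt_le_trans (Wx Wx' i) _.
  by have := @pi_ge2 R; lra.
- move=> F c uF; have Ls : L2 mu (fun x => \sum_(xi <- F) c xi * r xi x) by apply: L2_sum => eta; exact: L2Z.
  apply: le_trans (l2_dist Ls (L2T (LS' F c))) _; rewrite key addr0.
  apply: le_trans (hC _ (LS' F c)) _.
  apply: le_trans (_ : `|C| * l2 mu (SFe F c) <= _).
    apply: le_trans (ler_wpM2r (l2_ge0 _ _) (ler_norm C)) _.
    by rewrite ler_wpM2l//; have [] := L2_cut mOm (LS F c).
  rewrite mulrDl mul1r ler_wpDr ?sqrtr_ge0// -mulrA ler_wpM2l//.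
  have e := l2_trig x0 c uF.
  rewrite -sqrtrM ?exprn_ge0 ?mulr_ge0 ?pi_ge0// -e sqrtr_sqr; exact: ler_norm.
Qed.

End right_inverse.

(** * Derivatives of dyadic blocks *)

Ltac pos_with h := repeat first [assumption | (apply: ltW; assumption) | exact: h |
  (apply: ltW; exact: h) | apply: mulr_gt0 | apply: mulr_ge0 | apply: exprn_gt0 | apply: exprn_ge0 |
  apply: addr_gt0 | apply: addr_ge0 | exact: ler0n | exact: ltr0Sn | done].

Section interpolation.
Context (R : realType).

(** After division by a b^j, a log-convex sequence that is at most 1 at both ends has to be at most
    1 in between. Since terms may vanish, powers replace logarithms: [key] compares neighbours, and
    a descent from [l] concludes. *)
Lemma log_convex_le (A : nat -> R) l (a b : R) : 0 < a -> 0 < b -> (forall j, 0 <= A j) ->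
  (forall j, (j.+1 < l)%N -> A j.+1 ^+ 2 <= A j * A j.+2) -> A 0%N <= a -> A l <= a * b ^+ l ->
  forall j, (j <= l)%N -> A j <= a * b ^+ j.
Proof.
move=> a0 b0 A0 cA Aa Al.
have d0 j : 0 < a * b ^+ j by rewrite mulr_gt0// exprn_gt0.
pose B j := A j / (a * b ^+ j).
have B0 j : 0 <= B j by rewrite divr_ge0// ltW.
have BE j : (A j <= a * b ^+ j) = (B j <= 1) by rewrite /B ler_pdivrMr// mul1r.
have cB j : (j.+1 < l)%N -> B j.+1 ^+ 2 <= B j * B j.+2.
  move=> jl; have e : (a * b ^+ j.+1) ^+ 2 = (a * b ^+ j) * (a * b ^+ j.+2) by rewrite !exprS; ring.
  rewrite /B expr_div_n e [leRHS]mulrACA -invfM ler_pM2r ?cA//.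
  by rewrite invr_gt0 mulr_gt0.
have B00 : B 0%N <= 1 by rewrite -BE expr0 mulr1.
have key j : (j.+1 <= l)%N -> B j ^+ j.+1 <= B 0%N * B j.+1 ^+ j.
  elim: j => [|j IH] jl; first by rewrite expr1 expr0 mulr1.
  have [->|Bn] := eqVneq (B j.+1) 0.
    by rewrite expr0n /= mulr_ge0// exprn_ge0.
  have Bp : 0 < B j.+1 ^+ j by rewrite exprn_gt0// lt_neqAle eq_sym Bn B0.
  rewrite -(ler_pM2l Bp) -exprD (_ : (j + j.+2 = 2 * j.+1)%N); last by lia.
  rewrite exprM.
  apply: le_trans (_ : (B j * B j.+2) ^+ j.+1 <= _).
    by apply: lerXn2r; rewrite ?nnegrE ?sqr_ge0//; [exact: mulr_ge0|exact: cB].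
  rewrite exprMn mulrA ler_wpM2r ?exprn_ge0//.
  by rewrite mulrC; apply: IH; exact: ltnW.
have down d : (d <= l)%N -> B (l - d)%N <= 1.
  elim: d => [|d IH] dl; first by rewrite subn0 -BE.
  have e : (l - d)%N = (l - d.+1).+1 by lia.
  have := key (l - d.+1)%N; rewrite -e leq_subr => /(_ isT) h.
  rewrite leNgt; apply/negP => B1; move: h; apply/negP; rewrite -ltNge.
  apply: le_lt_trans (_ : 1 < _); last by rewrite exprn_egt1// e.
  by rewrite -[leRHS]mul1r ler_pM ?exprn_ge0// exprn_ile1// IH// ltnW.
by move=> j jl; rewrite BE -(subKn jl); apply: down; exact: leq_subr.
Qed.

End interpolation.

Section derivative_norms.
Context (R : realType) (n : nat).
Notation E := 'rV[R]_n.
Notation fct := (E -> R[i]).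
Notation mu := (@lebesgue_rV R n).
Implicit Types (f g phi : fct) (s : seq 'I_n).

Lemma l2_pderiv_sqr U f i : tst U f ->
  l2 mu (pderiv i f) ^+ 2 <= l2 mu f * l2 mu (pderiv i (pderiv i f)).
Proof.
move=> tf; have tf' := tst_pderiv i tf; have tT := tst_sub (@subsetT _ U) tf'.
have sf := tst_sm tf.
have e : cint mu (fun x => pderiv i (fun y => conjc (f y)) x * pderiv i f x) = (l2 mu (pderiv i f) ^+ 2)%:C%C.
  rewrite -ip_l2 /ip; congr cint; apply/funext => x.
  by rewrite (pderivJ _ (sm_C1 sf Logic.I)) mulrC.
have := ibp1 i (@openT _) (smJ (@openT _) sf) tT; rewrite e => h.
have -> : l2 mu (pderiv i f) ^+ 2 = nc ((l2 mu (pderiv i f) ^+ 2)%:C%C) by rewrite nc_real ger0_norm ?sqr_ge0.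
rewrite h ncN -(l2J mu f).
exact: cauchy_schwarz (L2J (tst_L2 tf)) (tst_L2 (tst_pderiv i tf')).
Qed.

(** Integration by parts compares the words s, i s and i i s; the maximum over all words of a given
    length turns this into log-convexity in the order. *)
Definition dmax f (j : nat) : R := \big[Num.max/0]_(s : j.-tuple 'I_n) l2 mu (Dw s f).

Lemma dmax_ge0 f j : 0 <= dmax f j.
Proof. by apply/bigmax_geP; left. Qed.

Lemma le_dmax f s : l2 mu (Dw s f) <= dmax f (size s).
Proof. by apply/bigmax_geP; right; exists (in_tuple s). Qed.

Lemma dmax_le f j (b : R) : 0 <= b -> (forall s, size s = j -> l2 mu (Dw s f) <= b) -> dmax f j <= b.
Proof. by move=> b0 h; apply/bigmax_leP; split=> // s _; apply: h; rewrite size_tuple. Qed.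

Lemma dmax_log_convex U f j : tst U f -> dmax f j.+1 ^+ 2 <= dmax f j * dmax f j.+2.
Proof.
move=> tf; have p0 : 0 <= dmax f j * dmax f j.+2 by rewrite mulr_ge0 ?dmax_ge0.
rewrite -(sqr_sqrtr p0) lerXn2r ?nnegrE ?sqrtr_ge0 ?dmax_ge0//.
apply: dmax_le; first exact: sqrtr_ge0.
move=> [//|i s] [sj]; rewrite -(@ler_pXn2r _ 2) ?nnegrE ?sqrtr_ge0 ?l2_ge0// [leRHS]sqr_sqrtr//.
apply: le_trans (l2_pderiv_sqr i (tst_Dw s tf)) _.
rewrite ler_pM ?l2_ge0//; first by rewrite -sj; exact: le_dmax.
by rewrite -sj; exact: (le_dmax f (i :: i :: s)).
Qed.

End derivative_norms.

(** * Bounds for the low block and for the high blocks *)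

Section blocks.
Context (R : realType) (n : nat) (M : nat -> R) (P : pdo R n) (U0 W K : set 'rV[R]_n).
Context (A C1 h1 CT : R) (r : {ffun 'I_n -> int} -> 'rV[R]_n -> R[i]).
Notation E := 'rV[R]_n.
Notation fct := (E -> R[i]).
Notation mu := (@lebesgue_rV R n).
Notation freq := {ffun 'I_n -> int}.
Hypotheses (wM : weight_seq M) (A1 : 1 <= A)
  (mg : forall j k, M (j + k)%N <= A ^+ (j + k) * M j * M k)
  (C10 : 0 < C1) (h11 : 1 <= h1) (hfact : forall k, k`!%:R <= C1 * h1 ^+ k * M k).
Hypotheses (oU0 : open U0) (sP : smooth_coefs P U0) (hyp : hypoelliptic M P U0)
  (oW : open W) (WU : W `<=` U0) (cK : compact K) (KW : K `<=` W).
Hypotheses (CT0 : 0 < CT) (Lr : forall xi, L2 mu (r xi))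
  (rW : forall xi, weq P W (r xi) (ex xi))
  (rC : forall (F : seq freq) (c : freq -> R[i]), uniq F ->
      l2 mu (fun x => \sum_(xi <- F) c xi * r xi x) <=
        CT * Num.sqrt (\sum_(xi <- F) nc (c xi) ^+ 2)).

Let oT : open [set: E] := @openT _.
Let M0 k : 0 < M k. Proof. exact: lt_le_trans (M_ge1 wM k). Qed.
Let A0 : 0 < A. Proof. exact: lt_le_trans A1. Qed.

Definition usum (F : seq freq) (c : freq -> R[i]) : fct := fun x => \sum_(xi <- F) c xi * r xi x.

Lemma L2_usum F c : L2 mu (usum F c).
Proof. by apply: L2_sum => xi; exact: L2Z. Qed.

Lemma weq_usum F c : weq P W (usum F c) (esum [seq (xi, c xi) | xi <- F]).
Proof.
move=> phi tp; have tP := tst_Pt oW (fun a ha => sm_sub WU (sP ha)) tp.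
rewrite (_ : (fun x => usum F c x * _) = (fun x => \sum_(xi <- F) c xi * (r xi x * Pt P phi x))); last first.
  by apply/funext => x; rewrite /usum mulr_suml; apply: eq_bigr => xi _; rewrite mulrA.
rewrite (_ : (fun x => esum _ x * _) = (fun x => \sum_(xi <- F) c xi * (ex xi x * phi x))); last first.
  by apply/funext => x; rewrite /esum big_map mulr_suml; apply: eq_bigr => xi _; rewrite mulrA.
have i1 xi : cintegrable mu (fun x => r xi x * Pt P phi x) by apply: L2_cintegrableM (tst_L2 tP).
have i2 xi : cintegrable mu (fun x => ex xi x * phi x).
  by apply: (tst_int (U := W)); apply: tstM => //; exact: sm_sub (sm_ex R xi).
rewrite !cint_sum => [|xi|xi]; [|exact: cintegrableZ|exact: cintegrableZ].
by apply: eq_bigr => xi _; rewrite !cintZ// rW.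
Qed.

Lemma l2_usum F c b : uniq F -> 0 <= b -> \sum_(xi <- F) nc (c xi) ^+ 2 <= b ^+ 2 ->
  l2 mu (usum F c) <= CT * b.
Proof.
move=> uF b0 hb; apply: le_trans (rC c uF) _; rewrite ler_wpM2l ?(ltW CT0)//.
by rewrite -[leRHS]ger0_norm// -sqrtr_sqr ler_wsqrtr.
Qed.

Lemma sum_freq_pow F c b N p : (0 < N)%N -> uniq F -> {subset F <= fbox n N} -> 0 <= b ->
  \sum_(xi <- F) nc (c xi) ^+ 2 <= b ^+ 2 ->
  \sum_(q <- [seq (xi, c xi) | xi <- F]) nc q.2 * fmax R q.1 ^+ p <= 3 ^+ n * N%:R ^+ (p + n) * b.
Proof.
move=> N0 uF FN b0 hb; rewrite big_map /=.
apply: le_trans (_ : \sum_(xi <- F) nc (c xi) * N%:R ^+ p <= _).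
  rewrite big_seq [leRHS]big_seq; apply: ler_sum => xi xF; rewrite ler_wpM2l ?nc_ge0//.
  by rewrite lerXn2r ?nnegrE ?fmax_ge0//; have := FN _ xF; rewrite (mem_fbox R).
rewrite -mulr_suml.
apply: le_trans (ler_wpM2r _ (sum_nc_fbox N0 uF FN b0 hb)) _; first exact: exprn_ge0.
by rewrite exprMn exprD le_eqVlt; apply/orP; left; apply/eqP; ring.
Qed.

(** [uniform_regularity] wants a positive size [t], while the bound [b] on the coefficients may
    vanish. *)
Lemma limit_in_eps (x a b : R) : 0 <= a -> (forall e, 0 < e -> x <= a * (b + e)) -> x <= a * b.
Proof.
move=> a0 h; apply/ler_addgt0Pr => e e0; have a1 : 0 < a + 1 by rewrite ltr_wpDl.
apply: le_trans (h (e / (a + 1)) (divr_gt0 e0 a1)) _; rewrite mulrDr lerD2l.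
by rewrite mulrA ler_pdivrMr// mulrC ler_wpM2l ?(ltW e0)// lerDl.
Qed.

(** The loss in passing from the l^2 norm of the coefficients to the hypotheses of
    [uniform_regularity]: (3 D A)^n M_n for the number of frequencies, and CT + 1 so that the L^2
    norm of the solution is dominated as well. *)
Let low_const (D : R) : R := (3 * D * A) ^+ n * M n * (CT + 1).

(* Below Lambda_k one has |xi|^p <= C A^(2k) M_p for all p, so uniform regularity applies. *)
Lemma low_block (D : R) : 1 <= D -> exists C L : R, [/\ 0 < C, 1 <= L &
  forall N k F c b w, (0 < k)%N -> (0 < N)%N -> N%:R <= D * Lambda M k -> uniq F ->
    {subset F <= fbox n N} -> 0 <= b -> \sum_(xi <- F) nc (c xi) ^+ 2 <= b ^+ 2 ->
    sm W w -> rep W (usum F c) w -> forall s, (size s <= k.+1)%N ->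
    L2 mu (cut K (Dw s w)) /\ ((size s <= k)%N -> l2 mu (cut K (Dw s w)) <= C * L ^+ k * M k * b)].
Proof.
move=> D1; have D0 : 0 < D by exact: lt_le_trans D1.
have [C [L [C0 L0 H]]] := uniform_regularity M0 oU0 sP hyp (mulr_gt0 D0 A0) oW WU cK KW.
have lc0 : 0 < low_const D.
  by rewrite /low_const !mulr_gt0 ?exprn_gt0 ?mulr_gt0// ltr_wpDl// ltW.
exists (C * low_const D), ((L + 1) * A ^+ 2); split; first exact: mulr_gt0.
  by rewrite -[leLHS]mulr1 ler_pM// ?lerDr ?(ltW L0)// exprn_ege1.
move=> N k F c b w k0 N0 ND uF FN b0 hb sw rw s sk.
have key e : 0 < e -> forall s, L2 mu (cut K (Dw s w)) /\
    l2 mu (cut K (Dw s w)) <= C * L ^+ size s * M (size s) * (low_const D * A ^+ (2 * k) * (b + e)).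
  move=> e0; have be0 : 0 < b + e by rewrite ltr_wpDl.
  have Ak : 1 <= A ^+ (2 * k) by exact: exprn_ege1.
  apply: (H (usum F c) [seq (xi, c xi) | xi <- F]) => //.
  - by rewrite mulr_gt0// mulr_gt0// exprn_gt0.
  - exact: L2_usum.
  - apply: le_trans (l2_usum uF b0 hb) _; apply: ler_pM; rewrite ?(ltW CT0)//; last by rewrite lerDl ltW.
    rewrite -[leLHS]mulr1; apply: ler_pM; rewrite ?(ltW CT0)//.
    rewrite /low_const -[leLHS]mul1r; apply: ler_pM; rewrite ?(ltW CT0) ?lerDl//.
    rewrite -[leLHS]mulr1; apply: ler_pM; rewrite ?(M_ge1 wM)//.
    apply: exprn_ege1; rewrite -[leLHS]mulr1 ler_pM// -[leLHS]mulr1 ler_pM//.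
    by rewrite ler1n.
  - exact: weq_usum.
  - move=> p; apply: le_trans (sum_freq_pow p N0 uF FN b0 hb) _.
    have hN : N%:R ^+ (p + n) <= D ^+ (p + n) * (A ^+ (2 * k) * (A ^+ (p + n) * M p * M n)).
      apply: le_trans (_ : (D * Lambda M k) ^+ (p + n) <= _).
        by rewrite lerXn2r ?nnegrE ?mulr_ge0 ?(ltW D0) ?(ltW (Lambda_gt0 wM k)).
      rewrite exprMn ler_wpM2l ?exprn_ge0 ?(ltW D0)//.
      apply: le_trans (Lambda_low wM A1 mg (p + n) k0) _.
      by rewrite ler_wpM2l ?exprn_ge0 ?(ltW A0).
    apply: le_trans (_ : 3 ^+ n * (D ^+ (p + n) * (A ^+ (2 * k) * (A ^+ (p + n) * M p * M n))) * b <= _).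
      by rewrite ler_wpM2r// ler_wpM2l ?exprn_ge0.
    rewrite /low_const; set X := (X in _ <= X).
    have -> : X = 3 ^+ n * (D ^+ (p + n) * (A ^+ (2 * k) * (A ^+ (p + n) * M p * M n))) * ((CT + 1) * (b + e)).
      by rewrite /X !exprMn !exprD; ring.
    rewrite ler_wpM2l//; last by rewrite -[leLHS]mul1r ler_pM// ?lerDr ?lerDl ltW.
    by pos_with M0.
split; first by have [] := key 1 ltr01 s.
move=> sk'; apply: limit_in_eps.
  by pos_with M0.
move=> e e0; have [_ h] := key e e0 s; apply: le_trans h _.
have be0 : 0 < b + e by rewrite ltr_wpDl.
rewrite exprMn -exprM.
have -> : C * low_const D * ((L + 1) ^+ k * A ^+ (2 * k)) * M k * (b + e) =
  C * (L + 1) ^+ k * M k * (low_const D * A ^+ (2 * k) * (b + e)) by ring.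
apply: ler_wpM2r; first by pos_with M0.
apply: ler_pM; rewrite ?(ltW (M0 _)) ?(M_homo wM)// ?mulr_ge0 ?exprn_ge0 ?(ltW L0) ?(ltW C0)//.
rewrite ler_wpM2l ?(ltW C0)//.
apply: le_trans (_ : (L + 1) ^+ size s <= _).
  by rewrite lerXn2r ?nnegrE ?addr_ge0 ?(ltW L0)// lerDl.
by rewrite ler_weXn2l// lerDr ltW.
Qed.

(* Uniform regularity is applied at the order l where N^l / M_l is maximal; the orders between 0
   and l follow from log-convexity of the norms of the derivatives. *)
Lemma high_block : exists C L : R, [/\ 0 < C, 1 <= L &
  forall N k F c b w, (0 < N)%N -> mu_ M k <= N%:R -> uniq F -> {subset F <= fbox n N} ->
    0 <= b -> \sum_(xi <- F) nc (c xi) ^+ 2 <= b ^+ 2 -> sm W w -> rep W (usum F c) w ->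
    forall s, (size s <= k.+1)%N -> L2 mu (cut K (Dw s w)) /\
      l2 mu (cut K (Dw s w)) <= C * (L * N%:R) ^+ size s * b].
Proof.
have [ O' [K1 [B [[oO' cK1 KO' OK1 K1W] [B0 hth]]]]] := cutoff_between cK oW KW.
have [C [L [C0 L0 H]]] := uniform_regularity M0 oU0 sP hyp A0 oW WU cK1 K1W.
pose kap0 := low_const 1.
have lc0 : 0 < kap0 by rewrite /kap0 /low_const !mulr_gt0 ?exprn_gt0 ?mulr_gt0// ltr_wpDl// ltW.
(* 4 h1 comes from [pow_M_le] and 2 B + L from summing the Leibniz formula; the term 1 makes the
   constant at least 1. *)
pose beta := 4 * h1 * (2 * B + L) + 1.
have h10 : 0 < h1 by exact: lt_le_trans h11.
have beta0 : 0 < 4 * h1 * (2 * B + L) by rewrite !mulr_gt0// addr_gt0 ?mulr_gt0.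
exists (CT + C * C1 * kap0), beta; split; first by pos_with M0.
  by rewrite lerDr ltW.
move=> N k F c b w N0 muN uF FN b0 hb sw rw s sk.
have M1N : M 1%N <= N%:R.
  apply: le_trans (le_trans (mu_homo wM (leq0n k)) muN).
  by rewrite /mu_ (_ : M 0%N = 1) ?divr1//; case: wM.
have [l [l0 Nl ml opt]] := M_optimum wM M1N.
(* Interpolation between 0 and [l] therefore covers the orders up to k + 1. *)
have kl : (k < l)%N by exact: ml.
have NR : (0 : R) < N%:R by rewrite ltr0n.
(* The maximum of N^p / M_p: up to constants the data of the block are bounded by tau A^p M_p at
   every order p, while at the order [l] nothing is lost, as tau M_l = N^l. *)
pose tau := N%:R ^+ l / M l.
have tau0 : 0 < tau by rewrite divr_gt0// exprn_gt0.
have tauM : tau * M l = N%:R ^+ l by rewrite /tau divfK// gt_eqF.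
have htau p : N%:R ^+ p <= tau * M p.
  by rewrite /tau mulrAC ler_pdivlMr//; exact: opt.
have tau1 : 1 <= tau by have := htau 0%N; rewrite expr0 (_ : M 0%N = 1) ?mulr1//; case: wM.
have key e : 0 < e -> forall s, L2 mu (cut K1 (Dw s w)) /\
    l2 mu (cut K1 (Dw s w)) <= C * L ^+ size s * M (size s) * (kap0 * tau * (b + e)).
  move=> e0; have be0 : 0 < b + e by rewrite ltr_wpDl.
  apply: (H (usum F c) [seq (xi, c xi) | xi <- F]) => //.
  - by pos_with M0.
  - exact: L2_usum.
  - apply: le_trans (l2_usum uF b0 hb) _; apply: ler_pM; rewrite ?(ltW CT0)//; last by rewrite lerDl ltW.
    rewrite -[leLHS]mulr1; apply: ler_pM; rewrite ?(ltW CT0)//.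
    rewrite /kap0 /low_const -[leLHS]mul1r; apply: ler_pM; rewrite ?(ltW CT0) ?lerDl//.
    rewrite -[leLHS]mulr1; apply: ler_pM; rewrite ?(M_ge1 wM)//.
    apply: exprn_ege1; rewrite mulr1 -[leLHS]mulr1 ler_pM//.
    by rewrite ler1n.
  - exact: weq_usum.
  - move=> p; apply: le_trans (sum_freq_pow p N0 uF FN b0 hb) _.
    have hN : N%:R ^+ (p + n) <= tau * (A ^+ (p + n) * M p * M n).
      by apply: le_trans (htau _) _; rewrite ler_wpM2l ?(ltW tau0).
    apply: le_trans (_ : 3 ^+ n * (tau * (A ^+ (p + n) * M p * M n)) * b <= _).
      by rewrite ler_wpM2r// ler_wpM2l ?exprn_ge0.
    rewrite /kap0 /low_const; set X := (X in _ <= X).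
    have -> : X = 3 ^+ n * (tau * (A ^+ (p + n) * M p * M n)) * ((CT + 1) * (b + e)).
      by rewrite /X mulr1 !exprMn !exprD; ring.
    rewrite ler_wpM2l//; last by rewrite -[leLHS]mul1r ler_pM// ?lerDr ?lerDl ltW.
    by pos_with M0.
have LK1 s' : L2 mu (cut K1 (Dw s' w)) by have [] := key 1 ltr01 s'.
(* The cutoff is adapted to the order [l] of the interpolation, not to k. *)
have [th [cth th1 th0]] := hth l; have [sth th01 dth] := cth.
have tth := cutoff_tst cK1 K1W cth th0.
pose f x := rc th x * w x.
have tf : tst W f.
  rewrite (_ : f = fun x => w x * rc th x); first exact: tstM.
  by apply/funext => x; rewrite /f mulrC.
have clK1 := compact_closed_rV cK1.
have f0 x : ~ K1 x -> f x = 0 by move=> /th0 e; rewrite /f /rc e mul0r.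
have fE s' : Dw s' f = fun x => \sum_(p <- splits s') Dw p.1 (rc th) x * cut K1 (Dw p.2 w) x.
  apply/funext => x; have [Kx|nK] := pselect (K1 x).
    rewrite /f (Dw_leibniz s' oW (sm_sub (@subsetT _ W) sth) sw (K1W x Kx)).
    by apply: eq_bigr => p _; rewrite cutT.
  rewrite (Dw_supp s' clK1 f0 nK) big1// => p _; by rewrite cutF// mulr0.
have bth p : exists Bp, forall x, nc (Dw p (rc th) x) <= Bp.
  by have [Bp _ hBp] := tst_bounded (tst_Dw p tth); exists Bp.
have mth p : cmeas (Dw p (rc th)) by apply: cmeas_cont => x; exact: tst_cont (tst_Dw p tth).
have cutf s' x : nc (cut K (Dw s' w) x) <= nc (Dw s' f x).
  rewrite /cut; case: asboolP => [Kx|_]; last by rewrite nc0 nc_ge0.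
  rewrite (@Dw_eq R n O' f w s' oO' _ x (KO' x Kx))// => y Oy.
  by rewrite /f /rc th1// mul1r.
have Lf s' : L2 mu (Dw s' f) by exact: tst_L2 (tst_Dw s' tf).
have KK1 : K `<=` K1 by exact: subset_trans OK1.
have mK : measurable K by apply: closed_measurable_rV; exact: compact_closed_rV.
have mK1 : measurable K1 by apply: closed_measurable_rV; exact: compact_closed_rV.
have LK : L2 mu (cut K (Dw s w)) by have [] := L2_cut_sub mK mK1 KK1 (LK1 s).
split=> //.
apply: limit_in_eps.
  by pos_with M0.
move=> e e0; have be0 : 0 < b + e by rewrite ltr_wpDl.
apply: le_trans (l2_le LK (Lf s) (cutf s)) _; apply: le_trans (le_dmax f s) _.
rewrite mulrAC.
have a0 : 0 < (CT + C * C1 * kap0) * (b + e) by pos_with M0.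
apply: (log_convex_le (A := dmax f) (l := l) a0).
- by pos_with M0.
- exact: dmax_ge0.
- by move=> j _; exact: dmax_log_convex tf.
(* Order 0: the L^2 bound for superpositions, transferred to [w] by duality. *)
- apply: dmax_le; first exact: ltW.
  move=> [|//] _; rewrite /=.
  have [] := @dual_bound R n W K1 (usum F c) w [::] (l2 mu (usum F c)) oW cK1 K1W (l2_ge0 _ _) sw rw.
    move=> phi tp p1; apply: le_trans (cauchy_schwarz (L2_usum F c) (tst_L2 tp)) _.
    by rewrite -[leRHS]mulr1 ler_wpM2l ?l2_ge0.
  move=> _ hu.
  have Lw := LK1 [::].
  have [|_ h] := @L2_mulb _ _ _ mu (cut K1 w) (rc th) 1 (mth [::]) _ Lw.
    by move=> x; exact: cutoff_nc cth.
  have -> : f = fun x => rc th x * cut K1 w x by have := fE [::]; rewrite /= => ->; apply/funext => x; rewrite big_seq1.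
  apply: le_trans h _; rewrite mul1r; apply: le_trans hu _; apply: le_trans (l2_usum uF b0 hb) _.
  by apply: ler_pM; rewrite ?lerDl ?lerDr; pos_with M0.
(* Order l: in each Leibniz term (l+1)^j M_(l-j) is traded for M_l, and tau M_l = N^l. *)
- apply: dmax_le; first by pos_with M0.
  move=> s' s'l; rewrite fE.
  have Lp p : L2 mu (fun x => Dw p.1 (rc th) x * cut K1 (Dw p.2 w) x).
    by have [Bp hBp] := bth p.1; have [] := L2_mulb (mth p.1) hBp (LK1 p.2).
  apply: le_trans (l2_sum _ Lp) _.
  apply: le_trans (_ : \sum_(p <- splits s') (2 * B) ^+ size p.1 * L ^+ size p.2 *
     (C * C1 * (4 * h1) ^+ l * kap0 * N%:R ^+ l * (b + e)) <= _).
    rewrite big_seq [leRHS]big_seq; apply: ler_sum => p /size_splits; rewrite s'l => ps.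
    have pl : (size p.1 <= l)%N by rewrite -ps leq_addr.
    have [_ h] := L2_mulb (mth p.1) (fun x => dth p.1 x pl) (LK1 p.2).
    apply: le_trans h _; have [_ hk] := key e e0 p.2.
    apply: le_trans (ler_wpM2l _ hk) _; first by rewrite exprn_ge0// mulr_ge0// ltW.
    have lM : l.+1%:R ^+ size p.1 * M (size p.2) <= 2 ^+ size p.1 * (C1 * (4 * h1) ^+ l * M l).
      have := pow_M_le wM C10 h11 hfact pl; rewrite (_ : (l - size p.1)%N = size p.2); last first.
        by rewrite -ps addKn.
      move=> hl; apply: le_trans (ler_wpM2l _ hl); last exact: exprn_ge0.
      rewrite mulrA -exprMn ler_wpM2r ?(ltW (M0 _))// lerXn2r ?nnegrE ?mulr_ge0//.
      by rewrite -natrM ler_nat mul2n -addnn -addn1 leq_add2l.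
    rewrite -tauM.
    set X := (X in X <= _); set Y := (Y in _ <= Y).
    have -> : X = (l.+1%:R ^+ size p.1 * M (size p.2)) * (B ^+ size p.1 * C * L ^+ size p.2 * kap0 * tau * (b + e)).
      by rewrite /X exprMn; ring.
    have -> : Y = (2 ^+ size p.1 * (C1 * (4 * h1) ^+ l * M l)) * (B ^+ size p.1 * C * L ^+ size p.2 * kap0 * tau * (b + e)).
      by rewrite /Y [(2 * B) ^+ _]exprMn; ring.
    by apply: ler_wpM2r lM; pos_with M0.
  rewrite -mulr_suml sum_splits s'l.
  set X := (X in X <= _).
  have -> : X = (C * C1 * kap0) * (b + e) * (4 * h1 * (2 * B + L) * N%:R) ^+ l.
    by rewrite /X !exprMn; ring.
  apply: ler_pM.
  + by pos_with M0.
  + by pos_with M0.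
  + by apply: ler_wpM2r; rewrite ?lerDr; pos_with M0.
  + apply: lerXn2r; rewrite ?nnegrE; [by pos_with M0|by pos_with M0|].
    by rewrite ler_wpM2r// lerDl.
- exact: leq_trans sk kl.
Qed.

End blocks.

(** * Synthesis of a solution from its dyadic blocks *)

Section almost_orthogonality.
Context (R : realType) (n : nat).
Notation E := 'rV[R]_n.
Notation fct := (E -> R[i]).
Notation mu := (@lebesgue_rV R n).

Lemma l2_subC (f g : fct) : l2 mu (fun x => f x - g x) = l2 mu (fun x => g x - f x).
Proof. by rewrite -l2N; congr l2; apply/funext => x; rewrite opprB. Qed.

Lemma half_sum I J : (I <= J)%N -> \sum_(I <= i < J) (2^-1 : R) ^+ (J - i) <= 1.
Proof.
elim: J => [|J IH]; first by rewrite leqn0 => /eqP ->; rewrite big_geq.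
rewrite leq_eqVlt ltnS => /predU1P[->|IJ]; first by rewrite big_geq.
rewrite big_nat_recr//= subSn// subnn expr1.
have -> : \sum_(I <= i < J) (2^-1 : R) ^+ (J.+1 - i) = 2^-1 * \sum_(I <= i < J) 2^-1 ^+ (J - i).
  rewrite mulr_sumr; apply: eq_big_nat => i /andP[_ iJ].
  by rewrite subSn ?exprS// ltnW.
by have := IH IJ; lra.
Qed.

(** Evaluation of the bound of [block_interaction]. Orders t + 1 on both blocks would give no gain;
    with t + 2 on the low block and t on the high one the factor li / lj = H appears. *)
Lemma interaction_arith (Ch Lh B1 li lj H bi bj X0 X1 X2 : R) t :
  li = H * lj -> 1 <= Lh * li -> X2 <= Ch * (Lh * li) ^+ t.+2 * bi ->
  X1 <= Ch * (Lh * li) ^+ t.+1 * bi -> X0 <= Ch * (Lh * lj) ^+ t * bj ->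
  0 <= Ch -> 0 <= B1 -> 0 <= bi -> 0 <= X0 -> 0 <= X2 + B1 * X1 ->
  (X2 + B1 * X1) * X0 <= Ch ^+ 2 * (1 + B1) * Lh ^+ (2 * t.+1) * H * (li ^+ t.+1 * bi * (lj ^+ t.+1 * bj)).
Proof.
move=> lij h1 h2 h3 h4 Ch0 B10 bi0 X00 X0'; have u0 : 0 <= Lh * li by lra.
have h5 : X2 + B1 * X1 <= (1 + B1) * (Ch * (Lh * li) ^+ t.+2 * bi).
  rewrite mulrDl mul1r; apply: lerD => //; apply: ler_wpM2l => //.
  apply: le_trans h3 _; apply: ler_wpM2r => //; apply: ler_wpM2l => //.
  by rewrite [leRHS]exprS ler_peMl// exprn_ge0.
apply: le_trans (ler_pM X0' X00 h5 h4) _.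
rewrite le_eqVlt; apply/orP; left; apply/eqP.
rewrite mul2n -addnn exprD !exprMn !exprS; set X := Lh ^+ t; set Z := lj ^+ t.
by rewrite {1}lij; set Y := li ^+ t; ring.
Qed.

Context (th : E -> R) (f : nat -> fct) (a : nat -> R) (kappa : R).
Hypotheses (mth : cmeas (rc th)) (th01 : forall x, 0 <= th x <= 1) (Lf : forall i, L2 mu (f i))
  (kappa0 : 0 <= kappa)
  (hf : forall i j, (i <= j)%N ->
     nc (ip (fun x => rc th x * f i x) (f j)) <= kappa * 2^-1 ^+ (j - i) * (a i * a j)).

Let Lth g : L2 mu g -> L2 mu (fun x => rc th x * g x).
Proof.
move=> Lg; have [] // := @L2_mulb _ _ _ mu g (rc th) 1 mth _ Lg.
by move=> x; rewrite /rc nc_real; have := th01 x => h; rewrite ger0_norm; lra.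
Qed.

(** The smooth weight [th] stands for a sharp restriction to a set, which would leave boundary terms
    in the integration by parts. *)
Let Qf g : R := Rec (ip (fun x => rc th x * g x) g).

Let QfD g h : L2 mu g -> L2 mu h ->
  Qf (fun x => g x + h x) <= Qf g + Qf h + 2 * nc (ip (fun x => rc th x * g x) h).
Proof.
move=> Lg Lh; have Ls := L2D Lg Lh; rewrite /Qf.
have -> : ip (fun x => rc th x * (g x + h x)) (fun x => g x + h x) =
   ip (fun x => rc th x * g x) (fun x => g x + h x) + ip (fun x => rc th x * h x) (fun x => g x + h x).
  rewrite -(ipDl (Lth Lg) (Lth Lh) Ls); congr (ip _ _).
  by apply/funext => x; rewrite mulrDr.
rewrite (ipJ Ls (Lth Lg)) (ipJ Ls (Lth Lh)) (ipDl Lg Lh (Lth Lg)) (ipDl Lg Lh (Lth Lh)).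
have sw u v : ip u (fun x => rc th x * v x) = ip (fun x => rc th x * u x) v.
  rewrite /ip; congr cint; apply/funext => x.
  have -> : conjc (rc th x * v x) = rc th x * conjc (v x) by rewrite rmorphM; congr (_ * _); exact: rcJ.
  by ring.
rewrite !sw.
have e : ip (fun x => rc th x * h x) g = conjc (ip (fun x => rc th x * g x) h).
  by rewrite -(ipJ (Lth Lg) Lh) sw.
rewrite e ReD !ReJ !ReD ReJ; set z := ip (fun x => rc th x * g x) h.
have := Re_le_nc z; rewrite ler_norml => /andP[_]; lra.
Qed.

Lemma almost_orthogonal I J : (I <= J)%N ->
  Rec (ip (fun x => rc th x * \sum_(I <= i < J) f i x) (fun x => \sum_(I <= i < J) f i x)) <=
    3 * kappa * \sum_(I <= i < J) a i ^+ 2.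
Proof.
(* Strengthened for the induction. From J to J + 1 the weight of a_i^2 grows by 2^-(J-i), which pays
   for one half of its cross term with the new block; the weight 2 of the new block pays for its
   diagonal term and for the other halves. *)
move=> IJ; suff : Qf (fun x => \sum_(I <= i < J) f i x) <=
    kappa * \sum_(I <= i < J) (3 - 2 * 2^-1 ^+ (J - i)) * a i ^+ 2.
  move=> h; apply: le_trans h _; rewrite -mulrA [leRHS]mulrCA ler_wpM2l//.
  rewrite mulr_sumr; apply: ler_sum => i _; rewrite ler_wpM2r ?sqr_ge0//.
  by rewrite gerBl mulr_ge0// exprn_ge0// invr_ge0.
elim: J IJ => [|J IH].
  rewrite leqn0 => /eqP ->; rewrite (_ : (fun x => _) = fun=> 0); last first.
    by apply/funext => x; rewrite big_geq.
  rewrite big_geq// mulr0 /Qf /ip (_ : (fun x => _) = fun=> 0) ?cint0//.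
  by apply/funext => x; rewrite mulr0 mul0r.
rewrite leq_eqVlt ltnS => /predU1P[->|IJ].
  rewrite (_ : (fun x => _) = fun=> 0); last by apply/funext => x; rewrite big_geq.
  rewrite big_geq// mulr0 /Qf /ip (_ : (fun x => _) = fun=> 0) ?cint0//.
  by apply/funext => x; rewrite mulr0 mul0r.
under [X in Qf X]eq_fun do rewrite big_nat_recr//=.
have LS : L2 mu (fun x => \sum_(I <= i < J) f i x) by exact: L2_sum.
apply: le_trans (QfD LS (Lf J)) _.
have h1 := IH IJ.
have h2 : Qf (f J) <= kappa * a J ^+ 2.
  have := hf (leqnn J); rewrite subnn expr0 mulr1 -expr2; apply: le_trans.
  by apply: le_trans (Re_le_nc _); exact: ler_norm.
have h3 : nc (ip (fun x => rc th x * \sum_(I <= i < J) f i x) (f J)) <=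
    \sum_(I <= i < J) kappa * 2^-1 ^+ (J - i) * (a i * a J).
  have -> : (fun x => rc th x * \sum_(I <= i < J) f i x) =
      (fun x => \sum_(I <= i < J) 1 * (rc th x * f i x)).
    by apply/funext => x; rewrite mulr_sumr; apply: eq_bigr => i _; rewrite mul1r.
  rewrite (ip_suml _ _ (fun i => Lth (Lf i)) (Lf J)).
  apply: le_trans (nc_sum _ _ _) _; rewrite big_nat_cond [leRHS]big_nat_cond.
  apply: ler_sum => i /andP[/andP[_ iJ] _]; rewrite mul1r; apply: hf; exact: ltnW.
apply: le_trans (lerD (lerD h1 h2) (ler_wpM2l (ler0n R 2) h3)) _.
rewrite big_nat_recr//= subSn// subnn expr1.
have e3 : \sum_(I <= i < J) (3 - 2 * 2^-1 ^+ (J.+1 - i)) * a i ^+ 2 =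
    \sum_(I <= i < J) ((3 - 2 * 2^-1 ^+ (J - i)) * a i ^+ 2 + 2^-1 ^+ (J - i) * a i ^+ 2).
  by apply: eq_big_nat => i /andP[_ iJ]; rewrite subSn ?exprS; [field|exact: ltnW].
rewrite e3 big_split /= !mulrDr -!addrA lerD2l addrC.
have -> : \sum_(I <= i < J) kappa * 2^-1 ^+ (J - i) * (a i * a J) =
    kappa * \sum_(I <= i < J) 2^-1 ^+ (J - i) * (a i * a J).
  by rewrite mulr_sumr; apply: eq_bigr => i _; rewrite [RHS]mulrA.
have key : 2 * \sum_(I <= i < J) 2^-1 ^+ (J - i) * (a i * a J) <=
    \sum_(I <= i < J) 2^-1 ^+ (J - i) * a i ^+ 2 + a J ^+ 2.
  apply: le_trans (_ : \sum_(I <= i < J) (2^-1 ^+ (J - i) * a i ^+ 2 + 2^-1 ^+ (J - i) * a J ^+ 2) <= _).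
    rewrite mulr_sumr; apply: ler_sum => i _; rewrite -mulrDr mulrCA ler_wpM2l ?exprn_ge0 ?invr_ge0//.
    by have := sqr_ge0 (a i - a J); rewrite sqrrB -mulr_natr; lra.
  rewrite big_split /= lerD2l -mulr_suml -[leRHS]mul1r ler_wpM2r ?sqr_ge0//.
  exact: half_sum.
have := ler_wpM2l kappa0 key; rewrite mulrDr mulrCA.
have -> : kappa * ((1 + (1 + (1 - 2 / 2))) * a J ^+ 2) = 2 * (kappa * a J ^+ 2) by field.
move: (kappa * \sum_(I <= i < J) _ * (a i * a J)) (kappa * \sum_(I <= i < J) _ * a i ^+ 2) (kappa * a J ^+ 2) => X Y Z.
lra.
Qed.

Lemma l2_cut_ip (K : set E) g : measurable K -> (forall x, K x -> th x = 1) -> L2 mu g ->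
  L2 mu (cut K g) /\ l2 mu (cut K g) ^+ 2 <= Rec (ip (fun x => rc th x * g x) g).
Proof.
move=> mK th1 Lg; have [LK _] := L2_cut mK Lg; split=> //.
have e : (fun x => rc th x * g x * conjc (g x)) = (fun x => (th x * nc (g x) ^+ 2)%:C%C).
  by apply/funext => x; rewrite -mulrA mulcJ /rc -rmorphM.
have [i1 _] := ip_int (Lth Lg) Lg.
rewrite l2_sqr /ip e cint_real; apply: le_Rintegral => //; first by case: LK.
  by move: i1; congr (_.-integrable _ _); apply/funext => x; rewrite /comp -mulrA mulcJ /rc -rmorphM.
move=> x _; rewrite /cut; case: asboolP => [Kx|_]; first by rewrite th1// mul1r.
by rewrite nc0 expr0n /= mulr_ge0 ?sqr_ge0//; case/andP: (th01 x).
Qed.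

(** Only the squares of [a] are summable; the bound of [almost_orthogonal] on sums of consecutive
    blocks makes the partial sums a Cauchy sequence nevertheless. *)
Lemma l2_block_series (K : set E) (g0 : fct) (T : R) : measurable K -> (forall x, K x -> th x = 1) ->
  L2 mu g0 -> 0 <= T -> (forall I, \sum_(0 <= i < I) a i ^+ 2 <= T ^+ 2) ->
  exists h, [/\ L2 mu h, l2 mu (cut K h) <= l2 mu g0 + Num.sqrt (3 * kappa) * T &
    forall e, 0 < e -> exists N, forall p, (N <= p)%N ->
      l2 mu (fun x => cut K (fun x => g0 x + \sum_(0 <= i < p) f i x) x - h x) <= e].
Proof.
move=> mK th1 L0 T0 aT; have k30 : 0 <= 3 * kappa by rewrite mulr_ge0.
pose F p := cut K (fun x => g0 x + \sum_(0 <= i < p) f i x).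
have LS p q : L2 mu (fun x => \sum_(p <= i < q) f i x) by exact: L2_sum.
have LF p : L2 mu (F p) by have [] := L2_cut mK (L2D L0 (LS 0%N p)).
have bS p q : (p <= q)%N -> l2 mu (cut K (fun x => \sum_(p <= i < q) f i x)) ^+ 2 <=
    3 * kappa * \sum_(p <= i < q) a i ^+ 2.
  by move=> pq; have [_ h] := l2_cut_ip mK th1 (LS p q); apply: le_trans h (almost_orthogonal pq).
have FB p q : (p <= q)%N -> (fun x => F q x - F p x) = cut K (fun x => \sum_(p <= i < q) f i x).
  move=> pq; apply/funext => x; have [Kx|nK] := pselect (K x); last by rewrite /F !cutF// subr0.
  by rewrite /F !cutT// (big_cat_nat (n := p))//=; ring.
have ps : psum (fun i => a i ^+ 2).
  split; first by move=> i; exact: sqr_ge0.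
  by exists (T ^+ 2) => _ [N _ <-]; exact: aT.
have [|h Lh hh] := l2_complete LF.
  move=> e e0; have eK : 0 < e ^+ 2 / (3 * kappa + 1) by rewrite divr_gt0 ?exprn_gt0// ltr_wpDl.
  have [N hN] := psum_tail ps eK; exists N.
  have key p q : (N <= p)%N -> (p <= q)%N -> l2 mu (fun x => F q x - F p x) <= e.
    move=> Np pq; rewrite FB// -(@ler_pXn2r _ 2) ?nnegrE ?l2_ge0 ?(ltW e0)//.
    apply: le_trans (bS _ _ pq) _; apply: le_trans (_ : (3 * kappa + 1) * (e ^+ 2 / (3 * kappa + 1)) <= _).
      apply: ler_pM => //; first by apply: sumr_ge0 => i _; exact: sqr_ge0.
        by rewrite lerDl.
      apply: le_trans (hN q); rewrite (big_cat_nat Np pq)/= lerDr.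
      by apply: sumr_ge0 => i _; exact: sqr_ge0.
    by rewrite mulrC divfK// gt_eqF// ltr_wpDl.
  move=> p q Np Nq; have [pq|/ltnW qp] := leqP p q; last exact: key.
  by rewrite l2_subC; exact: key.
exists h; split=> //; apply/ler_addgt0Pr => e e0; have [N /(_ N (leqnn N)) hN] := hh e e0.
apply: le_trans (L2_cut mK Lh).2 _.
have := l2_dist Lh (LF N); rewrite l2_subC => /le_trans; apply; apply: lerD => //.
have [LK0 lK0] := L2_cut mK L0; have [LKS _] := L2_cut mK (LS 0%N N).
rewrite /F cutD; apply: le_trans (l2D LK0 LKS) _; apply: lerD => //.
rewrite -(@ler_pXn2r _ 2) ?nnegrE ?l2_ge0 ?mulr_ge0 ?sqrtr_ge0//.
apply: le_trans (bS _ _ (leq0n N)) _; rewrite exprMn sqr_sqrtr// ler_wpM2l//.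
Qed.

End almost_orthogonality.

(** * Summation of the blocks *)

Section synthesis.
Context (R : realType) (n : nat) (M : nat -> R) (P : pdo R n) (U0 W : set 'rV[R]_n) (x0 : 'rV[R]_n).
Context (A C1 h1 CT : R) (r : {ffun 'I_n -> int} -> 'rV[R]_n -> R[i]).
Notation E := 'rV[R]_n.
Notation fct := (E -> R[i]).
Notation mu := (@lebesgue_rV R n).
Notation freq := {ffun 'I_n -> int}.
Hypotheses (wM : weight_seq M) (A1 : 1 <= A)
  (mg : forall j k, M (j + k)%N <= A ^+ (j + k) * M j * M k)
  (C10 : 0 < C1) (h11 : 1 <= h1) (hfact : forall k, k`!%:R <= C1 * h1 ^+ k * M k).
Hypotheses (oU0 : open U0) (sP : smooth_coefs P U0) (hyp : hypoelliptic M P U0)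
  (oW : open W) (WU : W `<=` U0) (Wx : W `<=` box x0 1).
Hypotheses (CT0 : 0 < CT) (Lr : forall xi, L2 mu (r xi))
  (rW : forall xi, weq P W (r xi) (ex xi))
  (rC : forall (F : seq freq) (c : freq -> R[i]), uniq F ->
      l2 mu (fun x => \sum_(xi <- F) c xi * r xi x) <=
        CT * Num.sqrt (\sum_(xi <- F) nc (c xi) ^+ 2)).

Let oT : open [set: E] := @openT _.
Let M0 k : 0 < M k. Proof. exact: lt_le_trans (M_ge1 wM k). Qed.
Let A0 : 0 < A. Proof. exact: lt_le_trans A1. Qed.
Let V : R := (2 * pi) ^+ n.
Let V1 : 1 <= V.
Proof. by apply: exprn_ege1; have := @pi_ge2 R; lra. Qed.
Let V0 : 0 < V. Proof. exact: lt_le_trans V1. Qed.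

Notation fb N0 := (fun I => fbox n (2 ^ I * N0)).

Definition dbox N0 p q : seq freq := [seq xi <- fbox n (2 ^ q * N0) | xi \notin fbox n (2 ^ p * N0)].

Lemma dbox_uniq N0 p q : uniq (dbox N0 p q).
Proof. exact/filter_uniq/fbox_uniq. Qed.

Lemma sum_dbox (Z : zmodType) N0 p q (F : freq -> Z) : (p <= q)%N ->
  \sum_(xi <- dbox N0 p q) F xi = \sum_(xi <- fbox n (2 ^ q * N0)) F xi - \sum_(xi <- fbox n (2 ^ p * N0)) F xi.
Proof.
move=> pq; rewrite big_filter [in RHS](bigID (mem (fbox n (2 ^ p * N0))))/=.
have sub : {subset fbox n (2 ^ p * N0) <= fbox n (2 ^ q * N0)}.
  by apply: (fbox_homo R); rewrite leq_mul2r leq_exp2l// pq orbT.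
have pe : perm_eq [seq xi <- fbox n (2 ^ q * N0) | xi \in fbox n (2 ^ p * N0)] (fbox n (2 ^ p * N0)).
  apply: uniq_perm; [exact/filter_uniq/fbox_uniq|exact: fbox_uniq|].
  by move=> xi; rewrite mem_filter andb_idr// => /sub.
have -> : \sum_(xi <- fbox n (2 ^ q * N0) | xi \in fbox n (2 ^ p * N0)) F xi = \sum_(xi <- fbox n (2 ^ p * N0)) F xi.
  by rewrite -big_filter; exact: perm_big.
by rewrite addrAC subrr add0r.
Qed.

Let coef_sum g F : uniq F -> L2 mu g -> \sum_(xi <- F) nc (fc x0 g xi) ^+ 2 <= l2 mu g ^+ 2.
Proof.
move=> uF Lg; have [h _] := bessel x0 uF Lg; apply: le_trans h.
rewrite -[leLHS]mul1r ler_wpM2r//; first by apply: sumr_ge0 => *; exact: sqr_ge0.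
Qed.

Lemma l2_usum_le F c : uniq F -> l2 mu (usum r F c) <= CT * Num.sqrt (\sum_(xi <- F) nc (c xi) ^+ 2).
Proof. exact: rC. Qed.

(** The partial sums over growing boxes converge in L^2 by the superposition bound and Bessel, for
    any square integrable [g]; the equation passes to the limit through [fourier_weak]. *)
Lemma synthesis_L2 N0 g : (0 < N0)%N -> L2 mu g -> exists2 u, L2 mu u &
  [/\ weq P W u g, l2 mu u <= CT * l2 mu g &
    forall e, 0 < e -> exists N, forall p, (N <= p)%N ->
      l2 mu (fun x => usum r (fbox n (2 ^ p * N0)) (fc x0 g) x - u x) <= e].
Proof.
move=> N00 Lg; set c := fc x0 g.
pose sig I := \sum_(xi <- fbox n (2 ^ I * N0)) nc (c xi) ^+ 2.
have LU I : L2 mu (usum r (fbox n (2 ^ I * N0)) c) by apply: L2_usum.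
have bU I : l2 mu (usum r (fbox n (2 ^ I * N0)) c) <= CT * l2 mu g.
  apply: le_trans (l2_usum_le c (fbox_uniq _ _)) _; rewrite ler_wpM2l ?(ltW CT0)//.
  rewrite -[leRHS]ger0_norm ?l2_ge0// -sqrtr_sqr ler_wsqrtr//.
  exact: coef_sum (fbox_uniq _ _) Lg.
have sigD p q : (p <= q)%N -> \sum_(xi <- dbox N0 p q) nc (c xi) ^+ 2 = sig q - sig p.
  by move=> pq; rewrite sum_dbox.
have ps : psum (fun i => sig i.+1 - sig i).
  split; first by move=> m; rewrite -sigD//; apply: sumr_ge0 => *; exact: sqr_ge0.
  exists (l2 mu g ^+ 2) => _ [K _ <-]; rewrite /series /= telescope_sumr//.
  apply: le_trans (coef_sum (fbox_uniq n (2 ^ K * N0)) Lg).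
  by rewrite gerBl; apply: sumr_ge0 => *; exact: sqr_ge0.
have diff p q : (p <= q)%N -> (fun x => usum r (fbox n (2 ^ q * N0)) c x - usum r (fbox n (2 ^ p * N0)) c x) =
    usum r (dbox N0 p q) c.
  by move=> pq; apply/funext => x; rewrite /usum sum_dbox.
have [|u Lu hu] := l2_complete LU.
  move=> e e0; have eC : 0 < (e / CT) ^+ 2 by rewrite exprn_gt0// divr_gt0.
  have [N hN] := psum_tail ps eC; exists N.
  have key p q : (N <= p)%N -> (p <= q)%N ->
      l2 mu (fun x => usum r (fbox n (2 ^ q * N0)) c x - usum r (fbox n (2 ^ p * N0)) c x) <= e.
    move=> Np pq; rewrite diff//; apply: le_trans (l2_usum_le c (dbox_uniq _ _ _)) _.
    rewrite -ler_pdivlMl// mulrC -[leRHS]ger0_norm ?divr_ge0 ?(ltW e0) ?(ltW CT0)// -sqrtr_sqr ler_wsqrtr//.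
    rewrite sigD//; have := hN q; rewrite telescope_sumr ?(leq_trans Np)//; apply: le_trans.
    rewrite lerD2l lerN2 -subr_ge0 -sigD//; apply: sumr_ge0 => *; exact: sqr_ge0.
  move=> p q Np Nq; have [pq|/ltnW qp] := leqP p q; last exact: key.
  by rewrite l2_subC; exact: key.
exists u => //; split=> //; last first.
  apply/ler_addgt0Pr => e e0; have [N /(_ N (leqnn N)) hN] := hu e e0.
  have h := l2_dist Lu (LU N); rewrite l2_subC in h.
  by apply: le_trans h _; exact: lerD.
move=> phi tp; have tP := tst_Pt oW (fun a ha => sm_sub WU (sP ha)) tp.
apply: clim_unique (L2_approx_clim LU Lu (tst_L2 tP) hu) _.
move=> e e0; have [r0 hr0] := fourier_weak Lg (tst_sub Wx tp) e0.
have [N1 hN1] := fbox_exhaust R r0.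
exists N1 => p Np; rewrite (weq_usum sP oW WU Lr rW _ _ tp).
have sub : {subset r0 <= fbox n (2 ^ p * N0)}.
  move=> xi /hN1; apply: (fbox_homo R); apply: leq_trans Np _.
  by apply: leq_trans (leq_pmulr _ N00); exact: ltnW (ltn_expl _ _).
rewrite ncB; have := hr0 _ (fbox_uniq _ _) sub; congr (nc (_ - _) <= _).
rewrite (_ : (fun x => esum _ x * _) =
   (fun x => \sum_(xi <- fbox n (2 ^ p * N0)) c xi * (ex xi x * phi x))); last first.
  by apply/funext => x; rewrite /esum big_map mulr_suml; apply: eq_bigr => xi _; rewrite mulrA.
have i2 xi : cintegrable mu (fun x => ex xi x * phi x).
  by apply: (tst_int (U := W)); apply: tstM => //; exact: sm_sub (sm_ex R xi).
rewrite cint_sum => [|xi]; last exact: cintegrableZ.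
apply: eq_bigr => xi _; rewrite cintZ//; congr (_ * cint _ _).
apply/funext => x; have [Wx'|nW] := pselect (W x); last by rewrite (tst_out tp nW) !mulr0.
rewrite /eQ cutT// => i; apply: ltW; apply: lt_le_trans (Wx Wx' i) _.
by have := @pi_ge2 R; lra.
Qed.

(* Distinct dyadic blocks interact weakly: one derivative is moved from the high block to the
   low one. *)
Lemma block_interaction (K1 : set E) (th : E -> R) (B1 : R) (w w' : fct) m s :
  compact K1 -> K1 `<=` W -> sm setT (rc th) -> (forall x, 0 <= th x <= 1) ->
  (forall x, ~ K1 x -> th x = 0) -> (forall x, nc (pderiv m (rc th) x) <= B1) ->
  sm W w -> sm W w' -> (forall s, L2 mu (cut K1 (Dw s w))) -> (forall s, L2 mu (cut K1 (Dw s w'))) ->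
  nc (ip (fun x => rc th x * cut K1 (Dw (m :: s) w) x) (cut K1 (Dw (m :: s) w'))) <=
  (l2 mu (cut K1 (Dw (m :: m :: s) w)) + B1 * l2 mu (cut K1 (Dw (m :: s) w))) *
    l2 mu (cut K1 (Dw s w')).
Proof.
move=> cK1 K1W sth th01 th0 hB sw sw' Lw Lw'.
have tth : tst W (rc th).
  by split=> //; exists K1 => //; split=> // x /th0 e; rewrite /rc e.
pose phi x := Dw (m :: s) w x * rc th x.
have tphi : tst W phi by apply: tstM => //; exact: sm_Dw.
pose F x := conjc (Dw s w' x); have sF : sm W F by apply: smJ => //; exact: sm_Dw.
have rc0 x : ~ K1 x -> rc th x = 0 by move=> /th0 e; rewrite /rc e.
have -> : ip (fun x => rc th x * cut K1 (Dw (m :: s) w) x) (cut K1 (Dw (m :: s) w')) =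
    cint mu (fun x => pderiv m F x * phi x).
  rewrite /ip; congr cint; apply/funext => x; have [Kx|nK] := pselect (K1 x).
    rewrite !cutT// /phi (pderivJ _ (sm_C1 (sm_Dw s sw') (K1W x Kx))) /=; ring.
  by rewrite /phi rc0// mulr0 !mul0r mulr0.
rewrite (ibp1 m oW sF tphi) ncN.
pose psi x := cut K1 (Dw (m :: m :: s) w) x * rc th x + cut K1 (Dw (m :: s) w) x * pderiv m (rc th) x.
have clK := compact_closed_rV cK1.
have e x : F x * pderiv m phi x = cut K1 F x * psi x.
  have [Kx|nK] := pselect (K1 x).
    rewrite /psi !cutT// /phi pderivM//; first exact: sm_C1 (sm_Dw _ sw) (K1W x Kx).
    exact: sm_C1 sth Logic.I.
  rewrite cutF// mul0r (pderiv_supp m clK _ nK) ?mulr0// => y ny.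
  by rewrite /phi rc0// mulr0.
under [X in cint _ X]eq_fun do rewrite e.
have [mth mdth] : cmeas (rc th) /\ cmeas (pderiv m (rc th)).
  by split; apply: cmeas_cont => x; [exact: tst_cont tth|exact: tst_cont (tst_pderiv m tth)].
have L1 : L2 mu (fun x => cut K1 (Dw (m :: m :: s) w) x * rc th x) /\
    l2 mu (fun x => cut K1 (Dw (m :: m :: s) w) x * rc th x) <= 1 * l2 mu (cut K1 (Dw (m :: m :: s) w)).
  under [X in L2 _ X]eq_fun do rewrite mulrC.
  under [X in l2 _ X]eq_fun do rewrite mulrC.
  by apply: L2_mulb => // x; rewrite /rc nc_real; have := th01 x => h; rewrite ger0_norm; lra.
have L2' : L2 mu (fun x => cut K1 (Dw (m :: s) w) x * pderiv m (rc th) x) /\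
    l2 mu (fun x => cut K1 (Dw (m :: s) w) x * pderiv m (rc th) x) <= B1 * l2 mu (cut K1 (Dw (m :: s) w)).
  under [X in L2 _ X]eq_fun do rewrite mulrC.
  under [X in l2 _ X]eq_fun do rewrite mulrC.
  exact: L2_mulb.
have cF : cut K1 F = fun x => conjc (cut K1 (Dw s w') x).
  by apply/funext => x; rewrite /F /cut; case: asboolP => // _; rewrite conjc0.
have LF : L2 mu (cut K1 F) by rewrite cF; exact: L2J.
apply: le_trans (cauchy_schwarz LF (L2D L1.1 L2'.1)) _.
rewrite cF l2J mulrC ler_wpM2r ?l2_ge0//.
apply: le_trans (l2D L1.1 L2'.1) _; apply: lerD; last exact: L2'.2.
by have := L1.2; rewrite mul1r.
Qed.

Let pownE (a : nat) : (2 ^ a)%:R = 2 ^+ a :> R. Proof. by rewrite natrX. Qed.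

(** [S] measures k derivatives of [g] on the Fourier side. The low block, up to about A^2 Lambda_k,
    costs M_k times the L^2 norm of [g]; the dyadic blocks above it cost [S]. As [u] is only a limit
    in L^2, its derivatives are returned as L^2 functions [h] that represent them on open subsets of
    [K0]. *)
Lemma synthesis (K0 : set E) : compact K0 -> K0 `<=` W -> exists C L : R, [/\ 0 < C, 1 <= L &
  forall k g S, L2 mu g -> 0 <= S ->
    (forall F, uniq F -> \sum_(xi <- F) nc (fc x0 g xi) ^+ 2 * fmax R xi ^+ (2 * k) <= S ^+ 2) ->
    exists u, [/\ L2 mu u, weq P W u g, l2 mu u <= C * l2 mu g &
      forall s, (size s <= k)%N -> exists h, [/\ L2 mu h,
        l2 mu (cut K0 h) <= C * L ^+ k * (M k * l2 mu g + S) &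
        forall O phi, O `<=` K0 -> tst O phi -> cint mu (fun x => u x * Dw s phi x) =
          (-1) ^+ size s * cint mu (fun x => h x * phi x)]]].
Proof.
move=> cK0 K0W.
have [ O' [K1 [B [[oO' cK1 K0O' OK1 K1W] [B0 hth]]]]] := cutoff_between cK0 oW K0W.
have [th [cth th1 th0]] := hth 1%N; have [sth th01 dth] := cth.
pose B1 := B * 2; have B10 : 0 < B1 by rewrite mulr_gt0.
pose D := A ^+ 2 + 1; have D1 : 1 <= D by rewrite lerDr sqr_ge0.
have [Cl [Ll [Cl0 Ll1 low]]] := low_block wM A1 mg oU0 sP hyp oW WU cK1 K1W CT0 Lr rW rC D1.
have [Ch [Lh [Ch0 Lh1 high]]] := high_block wM A1 mg C10 h11 hfact oU0 sP hyp oW WU cK1 K1W CT0 Lr rW rC.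
have Ll0 : 0 < Ll by exact: lt_le_trans Ll1.
have Lh0 : 0 < Lh by exact: lt_le_trans Lh1.
pose kap1 := 3 * (Ch ^+ 2 * (1 + B1)); have kap10 : 0 < kap1 by pos_with M0.
exists (CT + Cl + Num.sqrt kap1), (Ll + 2 * Lh); split.
- by rewrite ltr_pwDl ?sqrtr_ge0// addr_gt0.
- by apply: le_trans Ll1 _; rewrite lerDl mulr_ge0// ltW.
move=> k g S Lg S0 hS; set c := fc x0 g.
have Ctot : 1 <= (Ll + 2 * Lh) ^+ k.
  by apply: exprn_ege1; apply: le_trans Ll1 _; rewrite lerDl mulr_ge0// ltW.
have mK0 : measurable K0 by apply: closed_measurable_rV; exact: compact_closed_rV.
have CTC : CT <= CT + Cl + Num.sqrt kap1 by rewrite -addrA lerDl addr_ge0 ?sqrtr_ge0// ltW.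
have zero u : L2 mu u -> l2 mu u <= CT * l2 mu g -> exists h, [/\ L2 mu h,
    l2 mu (cut K0 h) <= (CT + Cl + Num.sqrt kap1) * (Ll + 2 * Lh) ^+ k * (M k * l2 mu g + S) &
    forall O phi, O `<=` K0 -> tst O phi -> cint mu (fun x => u x * Dw [::] phi x) =
      (-1) ^+ 0 * cint mu (fun x => h x * phi x)].
  move=> Lu ul; exists u; split=> //; last by move=> O phi _ _; rewrite expr0 mul1r.
  apply: le_trans (L2_cut mK0 Lu).2 _; apply: le_trans ul _.
  apply: ler_pM; rewrite ?l2_ge0 ?(ltW CT0)//.
    by apply: (le_trans CTC); rewrite ler_peMr//; exact: le_trans (ltW CT0) CTC.
  apply: le_trans (_ : M k * l2 mu g <= _); last by rewrite lerDl.
  by rewrite ler_peMl ?l2_ge0// M_ge1.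
(* The comparison of mu_k with Lambda_k requires k > 0; at k = 0 the L^2 bound suffices. *)
have [k0|k0] := posnP k.
  have [u Lu [uP ul _]] := synthesis_L2 (isT : (0 < 1)%N) Lg.
  exists u; split=> //; first by apply: le_trans ul _; rewrite ler_wpM2r ?l2_ge0.
  by rewrite {1}k0 => -[_|//]; exact: zero.
pose N0 := (Num.truncn (A ^+ 2 * Lambda M k)).+1.
have AL0 : 0 <= A ^+ 2 * Lambda M k by rewrite mulr_ge0 ?sqr_ge0// ltW// Lambda_gt0.
have [N0l N0u] : (Num.truncn (A ^+ 2 * Lambda M k))%:R <= A ^+ 2 * Lambda M k /\ A ^+ 2 * Lambda M k < N0%:R.
  by have /andP[] := truncn_itv AL0.
have muN : mu_ M k <= N0%:R by apply: le_trans (mu_le_Lambda wM mg k0) (ltW N0u).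
have N0D : N0%:R <= D * Lambda M k.
  by rewrite /D mulrDl mul1r -natr1 lerD// Lambda_ge1.
have [u Lu [uP ul hu]] := synthesis_L2 (isT : (0 < N0)%N) Lg.
pose lam i : R := 2 ^+ i.+1 * N0%:R.
have lam1 i : 1 <= lam i.
  by rewrite /lam -[leLHS]mulr1 ler_pM// ?exprn_ege1 ?ler1n// ler1n.
have smooth F : exists w, sm W w /\ rep W (usum r F c) w.
  have [w sw rw] := smooth_rep oU0 sP hyp (M_ge1 wM) oW WU (L2_usum Lr F c)
    (weq_usum sP oW WU Lr rW F c).
  by exists w.
have [w0 [sw0 rw0]] := smooth (fbox n (2 ^ 0 * N0)).
have /choice[w hw] : forall i, exists w, sm W w /\ rep W (usum r (dbox N0 i i.+1) c) w.
  by move=> i; exact: smooth.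
have sw i : sm W (w i) by case: (hw i).
have rw i : rep W (usum r (dbox N0 i i.+1) c) (w i) by case: (hw i).
pose b i := Num.sqrt (\sum_(xi <- dbox N0 i i.+1) nc (c xi) ^+ 2).
have bsq i : b i ^+ 2 = \sum_(xi <- dbox N0 i i.+1) nc (c xi) ^+ 2.
  by rewrite sqr_sqrtr//; apply: sumr_ge0 => *; exact: sqr_ge0.
have b0 i : 0 <= b i by exact: sqrtr_ge0.
have hi i s : (size s <= k.+1)%N -> L2 mu (cut K1 (Dw s (w i))) /\
    l2 mu (cut K1 (Dw s (w i))) <= Ch * (Lh * lam i) ^+ size s * b i.
  move=> sk; have := high (2 ^ i.+1 * N0)%N k (dbox N0 i i.+1) c (b i) (w i).
  rewrite natrM pownE; apply=> //.
  - by rewrite muln_gt0 expn_gt0.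
  - by apply: le_trans muN _; rewrite -[leLHS]mul1r ler_wpM2r// exprn_ege1// ler1n.
  - exact: dbox_uniq.
  - by move=> xi; rewrite mem_filter => /andP[].
  - by rewrite bsq.
have lo s : (size s <= k)%N -> L2 mu (cut K1 (Dw s w0)) /\
    l2 mu (cut K1 (Dw s w0)) <= Cl * Ll ^+ k * M k * l2 mu g.
  move=> sk; have [] := low (2 ^ 0 * N0)%N k (fbox n (2 ^ 0 * N0)) c (l2 mu g) w0 k0 _ _ _ _ _ _ sw0 rw0 s (leqW sk).
  - by rewrite mul1n.
  - by rewrite mul1n.
  - exact: fbox_uniq.
  - by [].
  - exact: l2_ge0.
  - exact: coef_sum (fbox_uniq _ _) Lg.
  - by move=> ? h; split=> //; exact: h.
exists u; split=> //.
  by apply: le_trans ul _; rewrite ler_wpM2r ?l2_ge0// -addrA lerDl addr_ge0 ?sqrtr_ge0// ltW.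
have X0 : 0 <= M k * l2 mu g by rewrite mulr_ge0 ?l2_ge0// ltW.
have mK1 : measurable K1 by apply: closed_measurable_rV; exact: compact_closed_rV.
(* In a nonempty word the first letter [m] is the derivative moved from one block to the other. *)
move=> [_|m s sk]; first exact: zero.
have Lall v s' : sm W v -> L2 mu (cut K1 (Dw s' v)) by exact: L2_cut_Dw.
pose f i := cut K1 (Dw (m :: s) (w i)).
have Lf i : L2 mu (f i) by exact: Lall.
set q := size (m :: s) in sk *.
pose a i := lam i ^+ q * b i.
pose kap2 := Ch ^+ 2 * (1 + B1) * Lh ^+ (2 * q).
have kap20 : 0 <= kap2 by rewrite /kap2; pos_with M0.
have mth : cmeas (rc th) by apply: cmeas_cont => x; exact: (sm_C1 sth (Logic.I : setT x)).1.
have lam0 i : 0 < lam i by apply: lt_le_trans (lam1 i).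
have lamij i j : (i < j)%N -> lam i = 2^-1 ^+ (j - i) * lam j.
  move=> ij; rewrite /lam -{2}(subnK (ltnW ij)) -addnS exprD exprVn !mulrA mulVf ?mul1r// expf_neq0.
have dfx i xi : xi \in dbox N0 i i.+1 -> lam i <= 2 * fmax R xi.
  rewrite mem_filter (mem_fbox R) -ltNge => /andP[/ltW + _].
  by rewrite natrM pownE /lam exprS -mulrA => h; rewrite ler_wpM2l.
clearbody lam.
have inter i j : (i <= j)%N -> nc (ip (fun x => rc th x * f i x) (f j)) <= kap2 * 2^-1 ^+ (j - i) * (a i * a j).
  rewrite leq_eqVlt => /predU1P[->|ij].
    rewrite subnn expr0 mulr1.
    have [Lt lt] : L2 mu (fun x => rc th x * f j x) /\ l2 mu (fun x => rc th x * f j x) <= 1 * l2 mu (f j).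
      by apply: L2_mulb => // x; exact: cutoff_nc cth.
    apply: le_trans (cauchy_schwarz Lt (L2J (Lf j))) _; rewrite l2J.
    have [_ hj] := hi j (m :: s) (leqW sk).
    apply: le_trans (ler_pM (l2_ge0 _ _) (l2_ge0 _ _) (le_trans lt _) hj) _.
      by rewrite mul1r; exact: hj.
    rewrite /kap2 /a !exprMn mul2n -addnn exprD -/q.
    set X := Lh ^+ _; set Y := lam j ^+ _.
    have -> : Ch * (X * Y) * b j * (Ch * (X * Y) * b j) = Ch ^+ 2 * 1 * (X * X) * (Y * b j * (Y * b j)) by ring.
    apply: ler_wpM2r; first by rewrite -expr2 sqr_ge0.
    apply: ler_wpM2r; first by rewrite -expr2 sqr_ge0.
    by rewrite ler_wpM2l ?sqr_ge0// lerDl ltW.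
  have dB x : nc (pderiv m (rc th) x) <= B1.
    by have := dth [:: m] x isT; rewrite expr1.
  have bi := @block_interaction K1 th B1 (w i) (w j) m s cK1 K1W sth th01 th0 dB (sw i) (sw j).
  apply: le_trans (bi (fun s' => Lall _ s' (sw i)) (fun s' => Lall _ s' (sw j))) _.
  (* The place where a block is differentiated once more than the word, possibly k + 1 times. *)
  have [_ h2] := hi i (m :: m :: s) sk.
  have [_ h1'] := hi i (m :: s) (leqW sk).
  have [_ h0] := hi j s (leqW (ltnW sk)).
  have lij := lamij _ _ ij.
  have X1 : 1 <= Lh * lam i by rewrite -[leLHS]mulr1 ler_pM.
  by rewrite /kap2 /a; apply: (interaction_arith lij X1 h2 h1' h0); rewrite ?addr_ge0 ?mulr_ge0 ?l2_ge0// ltW.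
(* The frequencies of the block i are at least lam i / 2, whence the factor 2^k. *)
have aT I : \sum_(0 <= i < I) a i ^+ 2 <= (2 ^+ k * S) ^+ 2.
  pose tau I := \sum_(xi <- fbox n (2 ^ I * N0)) nc (c xi) ^+ 2 * fmax R xi ^+ (2 * k).
  have ai i : a i ^+ 2 <= (2 ^+ k) ^+ 2 * (tau i.+1 - tau i).
    rewrite -sum_dbox// /a exprMn bsq !mulr_sumr big_seq [leRHS]big_seq.
    apply: ler_sum => xi /dfx hx; rewrite [leRHS]mulrCA [leLHS]mulrC; apply: ler_wpM2l; first exact: sqr_ge0.
    apply: le_trans (_ : lam i ^+ (2 * k) <= _).
      by rewrite -exprM mulnC ler_weXn2l// leq_mul2l sk.
    rewrite -[in leRHS]exprM [X in 2 ^+ X]mulnC -exprMn.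
    by rewrite lerXn2r ?nnegrE ?(ltW (lam0 i)) ?mulr_ge0 ?fmax_ge0.
  apply: le_trans (ler_sum_nat (fun i _ => ai i)) _.
  rewrite -mulr_sumr telescope_sumr// exprMn ler_wpM2l ?sqr_ge0//.
  apply: le_trans (hS _ (fbox_uniq n (2 ^ I * N0))); rewrite gerBl.
  by apply: sumr_ge0 => xi _; rewrite mulr_ge0 ?sqr_ge0// exprn_ge0// fmax_ge0.
have T0 : 0 <= 2 ^+ k * S by rewrite mulr_ge0// exprn_ge0.
have [h [Lh' lh hh]] := l2_block_series mth th01 Lf kap20 inter mK0 (fun x Kx => th1 x (K0O' x Kx))
  (Lall w0 (m :: s) sw0) T0 aT.
exists h; split=> //.
  apply: le_trans lh _; rewrite mulrDr; apply: lerD.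
    apply: le_trans (lo (m :: s) sk).2 _; rewrite -mulrA; apply: ler_wpM2r => //.
    apply: ler_pM; rewrite ?(ltW Cl0) ?exprn_ge0 ?(ltW Ll0)//.
      by rewrite addrAC lerDr addr_ge0 ?sqrtr_ge0// ltW.
    by rewrite lerXn2r ?nnegrE ?addr_ge0 ?mulr_ge0 ?(ltW Ll0) ?(ltW Lh0)// lerDl mulr_ge0// ltW.
  have -> : Num.sqrt (3 * kap2) = Num.sqrt kap1 * Lh ^+ q.
    rewrite /kap2 mulrA -/kap1 sqrtrM ?(ltW kap10)//; congr (_ * _).
    by rewrite mulnC exprM sqrtr_sqr ger0_norm// exprn_ge0// ltW.
  rewrite mulrA; apply: ler_wpM2r => //; rewrite -mulrA; apply: ler_pM.
  - exact: sqrtr_ge0.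
  - by rewrite mulr_ge0// exprn_ge0// ltW.
  - by rewrite lerDr addr_ge0// ltW.
  apply: le_trans (_ : (2 * Lh) ^+ k <= _).
    by rewrite exprMn mulrC ler_wpM2l ?exprn_ge0// ler_weXn2l.
  by rewrite lerXn2r ?nnegrE ?addr_ge0 ?mulr_ge0 ?(ltW Ll0) ?(ltW Lh0)// lerDr ltW.
move=> O phi OK0 tph.
(* With finitely many blocks the solution has a smooth representative, for which the weak derivative
   is computed by integration by parts; both sides then converge in L^2. *)
pose Ws I x := w0 x + \sum_(0 <= i < I) w i x.
have sWs I : sm W (Ws I) by apply: smD => //; exact: sm_sum.
pose UI I := usum r (fbox n (2 ^ I * N0)) c.
have LUI I : L2 mu (UI I) by exact: L2_usum.
have repI I : rep W (UI I) (Ws I).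
  elim: I => [|I IH] psi tpsi.
    by rewrite rw0//; congr cint; apply/funext => x; rewrite /Ws big_geq// addr0.
  have -> : (fun x => UI I.+1 x * psi x) = (fun x => UI I x * psi x + usum r (dbox N0 I I.+1) c x * psi x).
    by apply/funext => x; rewrite -mulrDl /UI /usum sum_dbox//; congr (_ * _); ring.
  rewrite cintD ?IH ?rw//; [|exact: L2_tst tpsi|exact: L2_tst (L2_usum Lr _ c) tpsi].
  rewrite -cintD; [|exact: tst_int (tstM oW (sWs I) tpsi)|exact: tst_int (tstM oW (sw I) tpsi)].
  by congr cint; apply/funext => x; rewrite /Ws big_nat_recr//=; ring.
have tphW : tst W phi by apply: tst_sub tph => x /OK0; exact: K0W.
apply: clim_unique (L2_approx_clim LUI Lu (tst_L2 (tst_Dw (m :: s) tphW)) hu) _.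
pose FI p := cut K0 (fun x => cut K1 (Dw (m :: s) w0) x + \sum_(0 <= i < p) f i x).
have LFI p : L2 mu (FI p).
  by have [] := L2_cut mK0 (L2D (Lall w0 (m :: s) sw0) (L2_sum (index_iota 0 p) Lf)).
apply: clim_eq (climZ ((-1) ^+ size (m :: s)) (L2_approx_clim LFI Lh' (tst_L2 tph) hh)) => I.
rewrite (rep_Dw (m :: s) oW (sWs I) (repI I) tphW); congr (_ * cint _ _); apply/funext => x.
have [Ox|nO] := pselect (O x); last by rewrite (tst_out tph nO) !mulr0.
have Wx' := K0W _ (OK0 _ Ox); have K1x := OK1 _ (K0O' _ (OK0 _ Ox)).
rewrite /FI cutT; last exact: OK0.
rewrite cutT// (DwD _ oW sw0 _ Wx'); last exact: sm_sum.
rewrite (Dw_sum _ _ oW sw Wx'); congr ((_ + _) * _); apply: eq_bigr => i _.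
by rewrite /f cutT.
Qed.

End synthesis.

(** * Necessity of the estimates *)

Section localized_data.
Context (R : realType) (n : nat) (M : nat -> R) (x0 : 'rV[R]_n) (U : set 'rV[R]_n).
Context (k : nat) (fw : seq 'I_n -> 'rV[R]_n -> R[i]) (C1 h1 : R).
Notation E := 'rV[R]_n.
Notation fct := (E -> R[i]).
Notation mu := (@lebesgue_rV R n).
Notation freq := {ffun 'I_n -> int}.
Hypotheses (wM : weight_seq M) (C10 : 0 < C1) (h11 : 1 <= h1)
  (hfact : forall k, k`!%:R <= C1 * h1 ^+ k * M k).
Hypotheses (oU : open U) (Ux : U `<=` box x0 1) (Lfw : forall s, L2 mu (fw s))
  (step : forall t j phi, (size t < k)%N -> tst U phi ->
     cint mu (fun x => fw t x * pderiv j phi x) = - cint mu (fun x => fw (j :: t) x * phi x)).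

Let oT : open [set: E] := @openT _.

(* [fw s] stands for the weak derivative D^s of [fw [::]]. *)
Definition leibniz (chi : fct) s : fct := fun x => \sum_(p <- splits s) Dw p.1 chi x * fw p.2 x.

Lemma L2_dtst (chi : fct) p : tst U chi -> L2 mu (fun x => Dw p.1 chi x * fw p.2 x).
Proof.
move=> tc; have [B B0 hB] := tst_bounded (tst_Dw p.1 tc).
have mc : cmeas (Dw p.1 chi) by apply: cmeas_cont => x; exact: tst_cont (tst_Dw p.1 tc).
by have [] := L2_mulb mc hB (Lfw p.2).
Qed.

Lemma L2_leibniz (chi : fct) s : tst U chi -> L2 mu (leibniz chi s).
Proof.
by move=> tc; apply: (@L2_sum _ _ _ _ _ _ (fun p x => Dw p.1 chi x * fw p.2 x)) => p; exact: L2_dtst.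
Qed.

(** The support of the cutoff allows any smooth [psi] here, in particular exponentials. *)
Lemma leibniz_pderiv (chi psi : fct) j t : tst U chi -> sm setT psi -> (size t < k)%N ->
  cint mu (fun x => leibniz chi t x * pderiv j psi x) = - cint mu (fun x => leibniz chi (j :: t) x * psi x).
Proof.
move=> tc spsi tk.
pose phi (p : seq 'I_n * seq 'I_n) x := psi x * Dw p.1 chi x.
have tphi p : tst U (phi p) by apply: tstM => //; [exact: sm_sub spsi|exact: tst_Dw].
pose F (p : seq 'I_n * seq 'I_n) x := fw p.2 x * (pderiv j psi x * Dw p.1 chi x).
pose G (p : seq 'I_n * seq 'I_n) x :=
  fw p.2 x * (psi x * Dw (j :: p.1) chi x) + fw (j :: p.2) x * phi p x.
have i1 p : cintegrable mu (F p).
  apply: L2_tst (Lfw _) _; apply: (tstM (U := U)) (tst_Dw _ tc) => //.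
  by apply: sm_sub (sm_pderiv j spsi).
have i2 p : cintegrable mu (fun x => fw p.2 x * (psi x * Dw (j :: p.1) chi x)).
  apply: L2_tst (Lfw _) _; apply: (tstM (U := U)) (tst_Dw _ tc) => //.
  exact: sm_sub spsi.
have i3 p : cintegrable mu (fun x => fw (j :: p.2) x * phi p x) by exact: L2_tst (Lfw _) (tphi p).
have i4 p : cintegrable mu (G p) by exact: cintegrableD.
have -> : (fun x => leibniz chi t x * pderiv j psi x) = (fun x => \sum_(p <- splits t) F p x).
  by apply/funext => x; rewrite mulr_suml; apply: eq_bigr => p _; rewrite /F; ring.
have -> : (fun x => leibniz chi (j :: t) x * psi x) = (fun x => \sum_(p <- splits t) G p x).
  apply/funext => x; rewrite /leibniz big_cat !big_map/= -big_split mulr_suml.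
  by apply: eq_bigr => p _; rewrite /G /phi /=; ring.
rewrite !cint_sum// -sumrN; apply: eq_big_seq => p /size_splits sp.
have := step j (leq_ltn_trans _ tk) (tphi p); rewrite -sp => /(_ p.2 (leq_addl _ _)).
have -> : (fun x => fw p.2 x * pderiv j (phi p) x) =
    (fun x => F p x + fw p.2 x * (psi x * Dw (j :: p.1) chi x)).
  apply/funext => x; rewrite pderivM; [|exact: sm_C1 spsi Logic.I|exact: sm_C1 (tst_sm (tst_Dw p.1 tc)) Logic.I].
  by rewrite /F mulrDr.
rewrite cintD// /G cintD// => h; rewrite opprD -h; ring.
Qed.

Lemma leibniz_int (chi psi : fct) s : tst U chi -> sm setT psi ->
  cintegrable mu (fun x => leibniz chi s x * psi x).
Proof.
move=> tc sp; have -> : (fun x => leibniz chi s x * psi x) =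
    (fun x => \sum_(p <- splits s) fw p.2 x * (psi x * Dw p.1 chi x)).
  by apply/funext => x; rewrite mulr_suml; apply: eq_bigr => p _; ring.
apply: cintegrable_sum => p; apply: L2_tst (Lfw _) _.
by apply: (tstM (U := U)) (tst_Dw _ tc) => //; exact: sm_sub sp.
Qed.

(** Derivatives leave [psi] one at a time and enter the word in reverse order; only the length of
    [w] matters afterwards, so it stays existential. The bound on the lengths keeps every use of
    [step] below the order [k]. *)
Lemma leibniz_Dw (chi : fct) s t : tst U chi -> (size s + size t <= k)%N ->
  exists2 w, size w = (size s + size t)%N & forall psi, sm setT psi ->
    cint mu (fun x => leibniz chi t x * Dw s psi x) =
      (-1) ^+ size s * cint mu (fun x => leibniz chi w x * psi x).
Proof.
move=> tc; elim: s t => [|j s IH] t stk.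
  by exists t => // psi _; rewrite expr0 mul1r.
have [|w sw hw] := IH (j :: t); first by rewrite /= addnS.
exists w => [|psi spsi]; first by rewrite sw /= addnS.
rewrite /= leibniz_pderiv ?hw//; first by rewrite exprS mulN1r mulNr.
  exact: sm_Dw.
by apply: leq_trans stk; rewrite /= addSn ltnS leq_addl.
Qed.

Lemma fc_leibniz (chi : fct) s xi : tst U chi ->
  fc x0 (leibniz chi s) xi = (((2 * pi) ^+ n)^-1)%:C%C * cint mu (fun x => leibniz chi s x * ex (- xi) x).
Proof.
move=> tc; rewrite /fc /ip; congr (_ * cint _ _); apply/funext => x.
have [Qx|nQ] := pselect (cube x0 pi x); first by rewrite /eQ cutT// exN.
have -> : leibniz chi s x = 0; last by rewrite !mul0r.
rewrite /leibniz big1// => p _; rewrite (tst_out (tst_Dw p.1 tc)) ?mul0r// => /Ux Bx.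
by apply: nQ => i; apply: ltW; apply: lt_le_trans (Bx i) _; have := @pi_ge2 R; lra.
Qed.

Lemma fc_Dw (chi : fct) s : tst U chi -> (size s <= k)%N ->
  exists2 w, size w = size s & forall xi,
    nc (fc x0 (leibniz chi [::]) xi) * \prod_(j <- s) nc (fr R xi j) = nc (fc x0 (leibniz chi w) xi).
Proof.
move=> tc sk; have [|w sw hw] := @leibniz_Dw chi s [::] tc; first by rewrite addn0.
exists w => [|xi]; first by rewrite sw addn0.
have := hw _ (sm_ex R (- xi)).
have -> : (fun x => leibniz chi [::] x * Dw s (ex (- xi)) x) =
    (fun x => (\prod_(j <- s) fr R (- xi) j) * (leibniz chi [::] x * ex (- xi) x)).
  by apply/funext => x; rewrite Dw_ex; ring.
rewrite cintZ; last exact: leibniz_int (sm_ex R (- xi)).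
move=> e; have := congr1 (@Normc.normc R) e; rewrite nc_sign ncM nc_prod !fc_leibniz// !ncM => <-.
rewrite -mulrA; congr (_ * _); rewrite mulrC; congr (_ * _).
by apply: eq_bigr => j _; rewrite !nc_fr ffunE rmorphN normrN.
Qed.

(** Derivatives that fall on the cutoff cost powers of k, which [pow_le_Lambda] converts into the
    weights Lambda_k^(k - |t|) of the norm. *)
Lemma l2_leibniz_le (K : set E) th B X s : 0 < B -> compact K -> K `<=` U -> cutoff k (B * k.+1%:R) th ->
  (forall x, ~ K x -> th x = 0) -> (0 < k)%N -> size s = k ->
  (forall t, (size t <= k)%N -> Lambda M k ^+ (k - size t) * l2 mu (fw t) <= X) ->
  l2 mu (leibniz (rc th) s) <= C1 * (4 * h1) ^+ k * (1 + 2 * B) ^+ k * X.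
Proof.
move=> B0 cK KU cth th0 k0 sk hX; have tc := cutoff_tst cK KU cth th0.
have X0 : 0 <= X by apply: le_trans (hX [::] isT); rewrite mulr_ge0 ?l2_ge0// exprn_ge0// ltW// Lambda_gt0.
have Y0 : 0 <= C1 * (4 * h1) ^+ k.
  by rewrite mulr_ge0 ?(ltW C10)// exprn_ge0// mulr_ge0// (le_trans _ h11).
apply: le_trans (@l2_sum _ _ _ _ _ _ (fun p x => Dw p.1 (rc th) x * fw p.2 x) _) _ => [p|]; first exact: L2_dtst.
have -> : (1 + 2 * B) ^+ k = \sum_(p <- splits s) (2 * B) ^+ size p.1.
  by rewrite addrC -sk -sum_splits; apply: eq_bigr => p _; rewrite expr1n mulr1.
rewrite mulr_sumr mulr_suml.
rewrite big_seq [leRHS]big_seq; apply: ler_sum => p /size_splits sp.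
have p1k : (size p.1 <= k)%N by rewrite -sk -sp leq_addr.
have p2k : (size p.2 <= k)%N by rewrite -sk -sp leq_addl.
have ep : size p.1 = (k - size p.2)%N by rewrite -sk -sp addnK.
have [_ _ dth] := cth.
have mc : cmeas (Dw p.1 (rc th)) by apply: cmeas_cont => x; exact: tst_cont (tst_Dw p.1 tc).
apply: le_trans (L2_mulb mc (fun x => dth _ x p1k) (Lfw p.2)).2 _.
have h : (B * k.+1%:R) ^+ size p.1 <= C1 * (4 * h1) ^+ k * (2 * B) ^+ size p.1 * Lambda M k ^+ size p.1.
  apply: le_trans (_ : (2 * B) ^+ size p.1 * k%:R ^+ size p.1 <= _).
    rewrite -exprMn lerXn2r ?nnegrE ?mulr_ge0 ?(ltW B0)//.
    rewrite [2 * B]mulrC -mulrA ler_wpM2l ?(ltW B0)// -natrM ler_nat mul2n -addnn -addn1 leq_add2l//.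
  rewrite mulrC mulrAC; apply: ler_wpM2r; first by rewrite exprn_ge0// mulr_ge0// ltW.
  exact: (pow_le_Lambda wM C10 h11 hfact).
apply: le_trans (ler_wpM2r (l2_ge0 _ _) h) _; rewrite -[leLHS]mulrA; apply: ler_wpM2l.
  by apply: mulr_ge0 => //; rewrite exprn_ge0// mulr_ge0// ltW.
by rewrite ep; exact: hX.
Qed.

Lemma localized_data (K : set E) th B X : 0 < B -> compact K -> K `<=` U -> cutoff k (B * k.+1%:R) th ->
  (forall x, ~ K x -> th x = 0) ->
  (forall t, (size t <= k)%N -> Lambda M k ^+ (k - size t) * l2 mu (fw t) <= X) ->
  forall F : seq freq, uniq F ->
    \sum_(xi <- F) nc (fc x0 (fun x => rc th x * fw [::] x) xi) ^+ 2 * fmax R xi ^+ (2 * k) <=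
    (n.+1%:R * (C1 * (4 * h1) ^+ k * (1 + 2 * B) ^+ k * X)) ^+ 2.
Proof.
move=> B0 cK KU cth th0 hX F uF; have tc := cutoff_tst cK KU cth th0.
set g := (fun x => rc th x * fw [::] x).
have gE : leibniz (rc th) [::] = g.
  by apply/funext => x; rewrite /leibniz /= big_cons big_nil addr0.
set Y := C1 * _ * _ * X.
have X0 : 0 <= X by apply: le_trans (hX [::] isT); rewrite mulr_ge0 ?l2_ge0// exprn_ge0// ltW// Lambda_gt0.
have V1 : 1 <= (2 * pi) ^+ n :> R by apply: exprn_ege1; have := @pi_ge2 R; lra.
have bes G : L2 mu G -> \sum_(xi <- F) nc (fc x0 G xi) ^+ 2 <= l2 mu G ^+ 2.
  move=> LG; have [h _] := bessel x0 uF LG; apply: le_trans h.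
  by rewrite ler_peMl//; apply: sumr_ge0 => *; exact: sqr_ge0.
(* At k = 0 the weight is 1, which in dimension 0 no sum over the coordinates dominates. *)
have [k0|k0] := posnP k.
  have Lg : L2 mu g by rewrite -gE; exact: L2_leibniz.
  rewrite k0; under eq_bigr do rewrite muln0 expr0 mulr1.
  apply: le_trans (bes _ Lg) _.
  have C11 : 1 <= C1 by have := hfact 0; rewrite fact0 expr0 mulr1; case: wM => _ -> _ _ _; rewrite mulr1.
  have YX : Y = C1 * X by rewrite /Y k0 !expr0 !mulr1.
  have gX : l2 mu g <= X.
    have [_ h] := L2_mulb (cmeas_cont (fun x => tst_cont x tc)) (fun x => cutoff_nc x cth) (Lfw [::]).
    apply: le_trans h _; rewrite mul1r; apply: le_trans (hX [::] isT).
    by rewrite k0 subn0 expr0 mul1r.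
  have XY : X <= n.+1%:R * Y.
    rewrite YX mulrA ler_peMl//; apply: mulr_ege1 => //; by rewrite ler1n.
  by rewrite lerXn2r ?nnegrE ?l2_ge0 ?(le_trans X0 XY)//; exact: le_trans gX XY.
(* The pure derivatives of order k in each direction suffice, because [fmax] is attained at some
   coordinate. *)
have /choice[w hw] : forall m, exists w, size w = k /\ forall xi,
    nc (fc x0 g xi) * `|(xi m)%:~R| ^+ k = nc (fc x0 (leibniz (rc th) w) xi).
  move=> m; have [|w sw hw] := @fc_Dw (rc th) (nseq k m) tc; first by rewrite size_nseq.
  exists w; split=> [|xi]; first by rewrite sw size_nseq.
  rewrite -hw gE; congr (_ * _).
  under eq_bigr do rewrite nc_fr.
  by rewrite big_nseq iter_mulr_1.
have YM m : l2 mu (leibniz (rc th) (w m)) <= Y.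
  by apply: l2_leibniz_le cth th0 k0 _ hX => //; have [] := hw m.
have Y0 : 0 <= Y.
  by rewrite mulr_ge0// mulr_ge0 ?mulr_ge0 ?(ltW C10)// exprn_ge0// ?addr_ge0 ?mulr_ge0 ?(ltW B0)// (le_trans _ h11).
have fm (xi : freq) : fmax R xi ^+ (2 * k) <= \sum_m (`|(xi m)%:~R| ^+ k) ^+ 2.
  have [[m ->]|->] := fmax_attained R xi.
    by rewrite (bigD1 m)//= -exprM mulnC lerDl; apply: sumr_ge0 => *; exact: sqr_ge0.
  by rewrite expr0n muln_eq0 (gtn_eqF k0)/=; apply: sumr_ge0 => *; exact: sqr_ge0.
apply: le_trans (_ : \sum_m \sum_(xi <- F) nc (fc x0 (leibniz (rc th) (w m)) xi) ^+ 2 <= _).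
  rewrite exchange_big; apply: ler_sum => xi _.
  apply: le_trans (ler_wpM2l (sqr_ge0 _) (fm xi)) _; rewrite mulr_sumr.
  by apply: ler_sum => m _; have [_ <-] := hw m; rewrite exprMn.
apply: le_trans (_ : \sum_(m < n) Y ^+ 2 <= _).
  apply: ler_sum => m _; apply: le_trans (bes _ (L2_leibniz _ tc)) _.
  by rewrite lerXn2r ?nnegrE ?l2_ge0.
rewrite sumr_const card_ord -[leLHS]mulr_natl [leRHS]exprMn; apply: ler_wpM2r; first exact: sqr_ge0.
by rewrite -natrX ler_nat -[leqLHS]expn1; nia.
Qed.

End localized_data.

(** * Interior estimates from hypoellipticity *)

Section forward.
Context (R : realType) (n : nat) (M : nat -> R) (P : pdo R n) (U0 W : set 'rV[R]_n) (x0 : 'rV[R]_n).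
Context (A C1 h1 CT : R) (r : {ffun 'I_n -> int} -> 'rV[R]_n -> R[i]).
Notation E := 'rV[R]_n.
Notation fct := (E -> R[i]).
Notation mu := (@lebesgue_rV R n).
Notation freq := {ffun 'I_n -> int}.
Notation mi := {ffun 'I_n -> nat}.
Hypotheses (wM : weight_seq M) (A1 : 1 <= A)
  (mg : forall j k, M (j + k)%N <= A ^+ (j + k) * M j * M k)
  (C10 : 0 < C1) (h11 : 1 <= h1) (hfact : forall k, k`!%:R <= C1 * h1 ^+ k * M k).
Hypotheses (oU0 : open U0) (sP : smooth_coefs P U0) (hyp : hypoelliptic M P U0)
  (oW : open W) (WU : W `<=` U0) (Wx : W `<=` box x0 1).
Hypotheses (CT0 : 0 < CT) (Lr : forall xi, L2 mu (r xi))
  (rW : forall xi, weq P W (r xi) (ex xi))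
  (rC : forall (F : seq freq) (c : freq -> R[i]), uniq F ->
      l2 mu (fun x => \sum_(xi <- F) c xi * r xi x) <=
        CT * Num.sqrt (\sum_(xi <- F) nc (c xi) ^+ 2)).

Let oT : open [set: E] := @openT _.
Let M0 k : 0 < M k. Proof. exact: lt_le_trans (M_ge1 wM k). Qed.

Lemma negi_i k : (- 'i%C : R[i]) ^+ k * 'i%C ^+ k = 1.
Proof.
rewrite -exprMn (_ : - 'i%C * 'i%C = 1) ?expr1n//.
by apply: eq_cplx; rewrite /=; ring.
Qed.

Lemma Dw_Dmi (phi : fct) a : sm setT phi ->
  Dmi a phi = Dw (word a) (fun x => (- 'i%C) ^+ mabs a * phi x).
Proof.
move=> sp; apply/funext => x.
by rewrite (DmiE _ oT sp Logic.I) (DwZ _ _ oT sp Logic.I).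
Qed.

Lemma Dmi_Dw (phi : fct) s : sm setT phi ->
  Dmi (wmi s) (fun x => 'i%C ^+ size s * phi x) = Dw s phi.
Proof.
move=> sp; have sp' := smZ ('i%C ^+ size s) oT sp; apply/funext => x.
rewrite (DmiE _ oT sp' Logic.I) (DwZ _ _ oT sp Logic.I) mabs_wmi mulrA negi_i mul1r.
by rewrite (Dw_perm oT sp (perm_wmi s) Logic.I).
Qed.

Lemma nc_i k : nc ('i%C ^+ k : R[i]) = 1.
Proof. by have := congr1 (@Normc.normc R) (negi_i k); rewrite ncM nc_negi mul1r nc1. Qed.

(* The factor undoes the -i of [Dmi]: [wfam] represents the weak derivatives without them. *)
Definition wfam U k (f : mi -> fct) (s : seq 'I_n) : fct :=
  if (size s <= k)%N then fun x => 'i%C ^+ size s * cut U (f (wmi s)) x else fun=> 0.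

Lemma wfam_rep U T k f s phi : (forall a, (mabs a <= k)%N -> L2rep U (Ddistr a T) (f a)) ->
  (size s <= k)%N -> tst U phi ->
  T (Dw s phi) = (-1) ^+ size s * cint mu (fun x => wfam U k f s x * phi x).
Proof.
move=> hf sk tp; have [|_ /(_ (fun x => 'i%C ^+ size s * phi x))] := hf (wmi s); first by rewrite mabs_wmi.
rewrite tstP distr_ofE /Ddistr mabs_wmi Dmi_Dw; last exact: tst_sm tp.
move=> /(_ (tstZ _ tp)) e; rewrite /wfam sk.
have -> : (fun x => 'i%C ^+ size s * cut U (f (wmi s)) x * phi x) =
   (fun x => cut U (f (wmi s)) x * ('i%C ^+ size s * phi x)) by apply/funext => x; ring.
by rewrite -e mulrA -exprD addnn -signr_odd odd_double mul1r.
Qed.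

Lemma weak_step (U : set E) (T : fct -> R[i]) k (fw : seq 'I_n -> fct) :
  (forall s phi, (size s <= k)%N -> tst U phi ->
     T (Dw s phi) = (-1) ^+ size s * cint mu (fun x => fw s x * phi x)) ->
  forall t j phi, (size t < k)%N -> tst U phi ->
    cint mu (fun x => fw t x * pderiv j phi x) = - cint mu (fun x => fw (j :: t) x * phi x).
Proof.
move=> hT t j phi tk tp; have := hT _ _ (ltnW tk) (tst_pderiv j tp).
have -> : Dw t (pderiv j phi) = Dw (j :: t) phi.
  have -> : Dw t (pderiv j phi) = Dw (t ++ [:: j]) phi by rewrite Dw_cat.
  apply/funext => x; apply: (Dw_perm oT (tst_sm tp)) => //.
  by rewrite cats1 perm_rcons.
rewrite (hT (j :: t) _ tk tp) [X in X * _](exprS (-1) (size t)) mulN1r mulNr => e.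
by apply: (@mulfI _ ((-1) ^+ size t)); [rewrite signr_eq0|rewrite mulrN -e].
Qed.

(** The implication between Sobolev spaces says nothing about [u] being in L^2, so [h] is produced
    for any distribution: the difference with the synthesized solution is smooth by hypoellipticity
    alone. A square integrable [u0] enters only the bound, through [uniform_regularity]. *)
Lemma forward_core (U V : set E) : open U -> U `<=` W -> open V -> compact (closure V) ->
  closure V `<=` U -> exists C L : R, [/\ 0 < C, 1 <= L &
  forall u, is_distr U u -> forall k (f : mi -> fct) X,
    (forall a, (mabs a <= k)%N -> L2rep U (Ddistr a (pdo_app P u)) (f a)) ->
    (forall a, (mabs a <= k)%N -> Lambda M k ^+ (k - mabs a) * l2 mu (cut U (f a)) <= X) ->
    forall a, (mabs a <= k)%N -> exists2 h, L2rep V (Ddistr a u) h &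
      forall u0, L2rep U u u0 -> l2 mu (cut V h) <= C * L ^+ k * (X + M k * l2 mu (cut U u0))].
Proof.
move=> oU UW oV; set K0 := closure V => cK0 K0U.
have [ O' [K' [B [[oO' cK' K0O' O'K' K'U] [B0 hth]]]]] := cutoff_between cK0 oU K0U.
have K0W : K0 `<=` W by move=> x /K0U /UW.
have UU0 : U `<=` U0 by move=> x /UW /WU.
have O'U : O' `<=` U by move=> x /O'K' /K'U.
have O'U0 : O' `<=` U0 by move=> x /O'U /UU0.
have Ux : U `<=` box x0 1 by move=> x /UW /Wx.
have VK0 : V `<=` K0 by exact: subset_closure.
have sPU : smooth_coefs P U by move=> a ha; exact: sm_sub UU0 (sP ha).
have sPO : smooth_coefs P O' by move=> a ha; exact: sm_sub O'U0 (sP ha).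
have [Cs [Ls [Cs0 Ls1 syn]]] := synthesis wM A1 mg C10 h11 hfact oU0 sP hyp oW WU Wx CT0 Lr rW rC cK0 K0W.
have [Cu [Lu [Cu0 Lu0 unif]]] := uniform_regularity M0 oU0 sP hyp ltr01 oO' O'U0 cK0 K0O'.
have mV := open_measurable_rV oV; have mU := open_measurable_rV oU.
have mK0 : measurable K0 by apply: closed_measurable_rV; exact: compact_closed_rV.
pose Z := (4 * h1) * (1 + 2 * B).
have Z1 : 1 <= Z by rewrite /Z; apply: mulr_ege1; [apply: mulr_ege1 => //; rewrite ler1n|rewrite lerDl mulr_ge0// ltW].
have Z0 : 0 < Z by exact: lt_le_trans Z1.
have Ls0 : 0 < Ls by exact: lt_le_trans Ls1.
pose Cx := Cs * (1 + n.+1%:R * C1); have Cx0 : 0 < Cx by rewrite /Cx; pos_with M0.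
exists (Cx + Cu * (1 + Cs)), (Ls * Z + Lu).
have LZ1 : 1 <= Ls * Z by exact: mulr_ege1.
have L1 : 1 <= Ls * Z + Lu by rewrite (le_trans LZ1)// lerDl ltW.
have LZ0 : 0 <= Ls * Z by exact: le_trans LZ1.
have LL0 : 0 <= Ls * Z + Lu by exact: le_trans L1.
have LLZ : Ls * Z <= Ls * Z + Lu by rewrite lerDl ltW.
have LLu : Lu <= Ls * Z + Lu by rewrite lerDr.
split=> //; first by rewrite addr_gt0// mulr_gt0// addr_gt0.
move=> u du k f X hf hX.
have lu := is_distr_linear du.
pose fw := wfam U k f.
have LUf a : (mabs a <= k)%N -> L2 mu (cut U (f a)) by move=> /hf[/L2funP-/(_ mU)].
have Lfw s : L2 mu (fw s).
  rewrite /fw /wfam; case: ifP => [sk|_]; last exact: L2_0.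
  by apply: L2Z; apply: LUf; rewrite mabs_wmi.
have hXw t : (size t <= k)%N -> Lambda M k ^+ (k - size t) * l2 mu (fw t) <= X.
  move=> tk; rewrite /fw /wfam tk l2Z; last by apply: LUf; rewrite mabs_wmi.
  by rewrite nc_i mul1r -{1}(mabs_wmi t); apply: hX; rewrite mabs_wmi.
have X0 : 0 <= X by apply: le_trans (hXw [::] isT); rewrite mulr_ge0 ?l2_ge0// exprn_ge0// ltW// Lambda_gt0.
have step := weak_step (fun s phi sk tp => wfam_rep hf sk tp : _ = _ * cint mu (fun x => fw s x * phi x)).
have [th [cth th1 th0]] := hth k; have tc := cutoff_tst cK' K'U cth th0.
pose g x := rc th x * fw [::] x.
have [Lg lg] : L2 mu g /\ l2 mu g <= 1 * l2 mu (fw [::]).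
  by apply: L2_mulb => //; [apply: cmeas_cont => x; exact: tst_cont tc|move=> x; exact: cutoff_nc cth].
pose S := n.+1%:R * (C1 * (4 * h1) ^+ k * (1 + 2 * B) ^+ k * X).
have SE : S = n.+1%:R * C1 * Z ^+ k * X by rewrite /S /Z (exprMn k (4 * h1)); ring.
have S0 : 0 <= S by rewrite SE mulr_ge0// mulr_ge0 ?exprn_ge0 ?(ltW Z0)// mulr_ge0// ltW.
have data := localized_data wM C10 h11 hfact oU Ux Lfw step B0 cK' K'U cth th0 hXw.
have [ui [Lui wui lui hs]] := syn k g S Lg S0 data.
(* The cutoff makes this a distribution on all of [U0], where hypoellipticity is assumed; its
   equation is homogeneous only on [O'], where the cutoff is 1. *)
pose w phi := u (fun x => rc th x * phi x) - cint mu (fun x => ui x * phi x).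
have dw : is_distr U0 w by apply: is_distrB (is_distr_L2 oU0 Lui); exact: is_distr_mul oU oU0 du tc.
have chi1 phi : tst O' phi -> (fun x => rc th x * phi x) = phi.
  move=> tp; apply/funext => x; have [Ox|nO] := pselect (O' x); last by rewrite (tst_out tp nO) mulr0.
  by rewrite /rc th1// mul1r.
have Pw phi : tst O' phi -> w (Pt P phi) = 0.
  move=> tp; have tP := tst_Pt oO' sPO tp; rewrite /w chi1//.
  rewrite -(pdo_appE oU sPU lu (tst_sub O'U tp)) (wui _ (tst_sub _ tp)); last by move=> x /O'U /UW.
  have := wfam_rep hf (leq0n k : (size [::] <= k)%N) (tst_sub O'U tp); rewrite /= expr0 mul1r => ->.
  have -> : (fun x => g x * phi x) = (fun x => wfam U k f [::] x * phi x); last by rewrite subrr.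
  by apply/funext => x; rewrite /g -{2}(chi1 _ tp) /fw; ring.
(* The zero datum is written as the empty trigonometric sum, the form accepted by
   [uniform_regularity]. *)
have dcz : DC_class M O' (esum [::]).
  apply: (@esum_DC _ _ M [::] 1 1) => // p; rewrite big_nil.
  by rewrite mulr_ge0 ?(ltW (M0 p))// mulr_ge0// exprn_ge0.
have [|w' DCw' hw'] := hyp dw oO' O'U0.
  exists (esum [::]) => // phi /tstP tp; rewrite (pdo_appE oO' sPO _ tp).
    rewrite Pw// distr_ofE (_ : (fun x => _) = fun=> 0) ?cint0//; apply/funext => x.
    by rewrite /cut /esum big_nil if_same mul0r.
  by move=> c p1 p2 t1 t2; apply: (is_distr_linear dw); apply: tst_sub O'U0 _.
have [sw' _] := (DC_classP M w' oO').1 DCw'.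
have key phi : tst O' phi -> u phi = cint mu (fun x => ui x * phi x) + cint mu (fun x => w' x * phi x).
  move=> tp; have := hw' phi; rewrite tstP => /(_ tp).
  by rewrite distr_ofE (cut_tst _ tp) /w chi1// => <-; rewrite addrC subrK.
move=> a ak; set s := word a; have sa : size s = mabs a by exact: size_word.
have sk : (size s <= k)%N by rewrite sa.
have [hh [Lh lh hrep]] := hs s sk.
pose h x := (- 'i%C) ^+ size s * (hh x + Dw s w' x).
have LK := L2_cut_Dw s oO' cK0 K0O' sw'.
have [LVw lVw] := L2_cut_sub mV mK0 VK0 LK.
have [LVh lVh] : L2 mu (cut V hh) /\ l2 mu (cut V hh) <= l2 mu (cut K0 hh).
  by apply: L2_cut_sub => //; have [] := L2_cut mK0 Lh.
have cVh : cut V h = fun x => (- 'i%C) ^+ size s * (cut V hh x + cut V (Dw s w') x).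
  by rewrite /h cutZ cutD.
have LVhh : L2 mu (cut V h) by rewrite cVh; apply: L2Z; exact: L2D.
exists h.
  split; first by apply/L2funP.
  move=> phi /tstP tp; have tpO : tst O' phi by apply: tst_sub tp => x /VK0 /K0O'.
  rewrite distr_ofE (cut_tst _ tp) /Ddistr (Dw_Dmi a (tst_sm tp)) -/s -sa.
  pose psi x := (- 'i%C) ^+ size s * phi x; rewrite -/psi; have tpsi : tst V psi by exact: tstZ.
  have tpsO : tst O' psi by exact: tstZ.
  rewrite (key _ (tst_Dw s tpsO)) (hrep V psi VK0 tpsi) mulrDr mulrA -exprD addnn -signr_odd odd_double mul1r.
  rewrite -(ibp s oO' sw' tpsO) -cintD.
  - by congr cint; apply/funext => x; rewrite /h /psi; ring.
  - exact: L2_tst Lh tpsi.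
  - exact: tst_int (tstM oO' (sm_Dw s sw') tpsO).
move=> u0 [/L2funP-/(_ mU) Lu00 hu0].
have MgX : M k * l2 mu g <= X.
  apply: le_trans (hXw [::] isT); rewrite subn0 LambdaX// ler_wpM2l ?(ltW (M0 k))//.
  by apply: le_trans lg _; rewrite mul1r.
have b1 : l2 mu (cut K0 hh) <= Cx * (Ls * Z + Lu) ^+ k * X.
  apply: le_trans lh _; apply: le_trans (_ : Cs * Ls ^+ k * ((1 + n.+1%:R * C1) * Z ^+ k * X) <= _).
    apply: ler_wpM2l; first by rewrite mulr_ge0 ?exprn_ge0// ltW.
    rewrite mulrDl mulrDl SE; apply: lerD => //; apply: le_trans MgX _.
    by rewrite mul1r ler_peMl// exprn_ege1.
  rewrite (_ : _ * _ = Cx * (Ls * Z) ^+ k * X); last by rewrite /Cx (exprMn k Ls Z); ring.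
  apply: ler_wpM2r => //; apply: ler_wpM2l; first exact: ltW.
  by apply: lerXn2r LLZ; rewrite nnegrE.
have b2 : l2 mu (cut K0 (Dw s w')) <= Cu * Lu ^+ size s * M (size s) * (l2 mu (cut U u0) + Cs * l2 mu g).
  have Lv : L2 mu (fun x => cut U u0 x - ui x) by exact: L2B.
  apply: limit_in_eps => [|e e0]; first by pos_with M0.
  have tt0 : 0 < l2 mu (cut U u0) + Cs * l2 mu g + e.
    by rewrite ltr_wpDl// addr_ge0 ?l2_ge0// mulr_ge0 ?l2_ge0// ltW.
  have i1 phi : tst O' phi -> cintegrable mu (fun x => cut U u0 x * phi x) by exact: L2_tst.
  have i2 phi : tst O' phi -> cintegrable mu (fun x => ui x * phi x) by exact: L2_tst.
  have vE phi : tst O' phi -> cint mu (fun x => (cut U u0 x - ui x) * phi x) = u phi - cint mu (fun x => ui x * phi x).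
    move=> tp; have := hu0 phi; rewrite tstP => /(_ (tst_sub O'U tp)); rewrite distr_ofE => ->.
    rewrite -cintB; [|exact: i1|exact: i2].
    by congr cint; apply/funext => x; ring.
  have [] // := unif (fun x => cut U u0 x - ui x) [::] _ tt0 Lv _ _ _ w' sw' _ s.
  - apply: le_trans (l2D Lu00 (L2N Lui)) _; rewrite l2N -addrA lerD2l.
    by apply: le_trans lui _; rewrite lerDl ltW.
  - move=> phi tp; have tP := tst_Pt oO' sPO tp; rewrite vE//.
    have := Pw _ tp; rewrite /w chi1// => ->.
    rewrite (_ : (fun x => _) = fun=> 0) ?cint0//; apply/funext => x.
    by rewrite /esum big_nil mul0r.
  - by move=> p; rewrite big_nil; pos_with M0.
  - by move=> phi tp; rewrite vE// key// addrC addKr.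
rewrite cVh l2Z; last exact: L2D.
rewrite nc_negi mul1r; apply: le_trans (l2D LVh LVw) _.
apply: le_trans (lerD (le_trans lVh b1) (le_trans lVw b2)) _.
set LL := Ls * Z + Lu in L1 b1 LLu LL0 *; set N := l2 mu (cut U u0); set G := l2 mu g in MgX *.
have N0 : 0 <= N by exact: l2_ge0.
have G0 : 0 <= G by exact: l2_ge0.
have b3 : Cu * Lu ^+ size s * M (size s) * (N + Cs * G) <= Cu * LL ^+ k * (M k * N + Cs * X).
  rewrite -mulrA; apply: ler_pM.
  - by pos_with M0.
  - by apply: mulr_ge0; [pos_with M0|rewrite addr_ge0// mulr_ge0// ltW].
  - rewrite ler_wpM2l ?(ltW Cu0)//; apply: le_trans (_ : LL ^+ size s <= _); last exact: ler_weXn2l.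
    by apply: lerXn2r LLu; rewrite nnegrE// ltW.
  apply: le_trans (_ : M k * (N + Cs * G) <= _).
    by rewrite ler_wpM2r ?addr_ge0 ?(mulr_ge0 (ltW Cs0))// M_homo.
  by rewrite mulrDr lerD2l mulrCA ler_wpM2l// ltW.
apply: le_trans (lerD (lexx _) b3) _.
have LLk : 0 <= LL ^+ k by rewrite exprn_ge0.
have MN0 : 0 <= M k * N by rewrite mulr_ge0// ltW.
rewrite -subr_ge0 (_ : _ - _ = LL ^+ k * (Cu * X + Cu * Cs * (M k * N) + Cx * (M k * N) )); last by ring.
apply: mulr_ge0 => //; rewrite !addr_ge0//; [exact: mulr_ge0 (ltW Cu0) X0| |exact: mulr_ge0 (ltW Cx0) MN0].
exact: mulr_ge0 (mulr_ge0 (ltW Cu0) (ltW Cs0)) MN0.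
Qed.

End forward.

(** * From representatives to extended real norms *)

Section distribution_norms.
Context (R : realType) (n : nat).
Notation E := 'rV[R]_n.
Notation fct := (E -> R[i]).
Notation mu := (@lebesgue_rV R n).
Notation mi := {ffun 'I_n -> nat}.
Implicit Types (U V : set E) (u : fct -> R[i]) (f : fct).

Lemma L2rep_l2 U u f : open U -> L2rep U u f -> L2 mu (cut U f).
Proof. by move=> oU [/L2funP-/(_ (open_measurable_rV oU))]. Qed.

Lemma L2norm_distr_ge0 U u : (0 <= L2norm_distr U u)%E.
Proof. by apply: le_ereal_inf_tmp => _ [f _ <-]; exact: Lnorm_ge0. Qed.

Lemma L2norm_distr_le U u f : open U -> L2rep U u f -> (L2norm_distr U u <= (l2 mu (cut U f))%:E)%E.
Proof.
by move=> oU h; apply: ereal_inf_lbound; exists f => //; rewrite L2normE//; exact: L2rep_l2 h.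
Qed.

(** The norm of a distribution is an infimum, so representatives are chosen up to an error [e],
    which the estimates then absorb. *)
Lemma L2norm_distr_approx U u (e : R) : open U -> L2norm_distr U u \is a fin_num -> 0 < e ->
  exists2 f, L2rep U u f & l2 mu (cut U f) <= fine (L2norm_distr U u) + e.
Proof.
move=> oU fN e0; have [_ [f hf <-]] := lb_ereal_inf_adherent e0 fN.
rewrite L2normE; last exact: L2rep_l2 hf.
rewrite -/(L2norm_distr U u) -{1}(fineK fN) -EFinD lte_fin => h; exists f => //.
exact: ltW.
Qed.

Lemma size_midx_le k : (size (midx n k) <= (2 ^ n) ^ k)%N.
Proof.
rewrite /midx size_filter (leq_trans (count_size _ _))// size_map -cardE card_ffun !card_ord.
rewrite -expnM mulnC expnM; case: (n) => [|m]; first by rewrite !expn0.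
by rewrite leq_exp2r// ltn_expl.
Qed.

Lemma Sobolev_norm_le k V u (Z : R) : 0 <= Z ->
  (forall a, (mabs a <= k)%N -> (L2norm_distr V (Ddistr a u) <= Z%:E)%E) ->
  (Sobolev_norm k V u <= ((2 ^+ n) ^+ k * Z)%:E)%E.
Proof.
move=> Z0 h; have c0 : 0 <= (2 ^+ n) ^+ k :> R by rewrite !exprn_ge0.
apply: (@le_trans _ _ (sqrte ((((2 ^+ n) ^+ k * Z) ^+ 2)%:E))%E); last first.
  by rewrite /= sqrtr_sqr ger0_norm// mulr_ge0.
rewrite /Sobolev_norm lee_sqrt ?lee_fin ?sqr_ge0//.
apply: (@le_trans _ _ (\sum_(a <- midx n k) (Z ^+ 2)%:E)%E).
  rewrite big_seq [leRHS]big_seq; apply: lee_sum => a; rewrite mem_midx => /h {}h.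
  by rewrite EFin_expe !expe2; apply: lee_pmul; rewrite ?L2norm_distr_ge0.
rewrite sumEFin lee_fin big_const_seq count_predT iter_addr_0 -[leLHS]mulr_natl [leRHS]exprMn.
apply: ler_wpM2r; first exact: sqr_ge0.
rewrite expr2; apply: le_trans (_ : (2 ^+ n) ^+ k <= _).
  by rewrite -!natrX ler_nat size_midx_le.
by rewrite ler_peMl// !exprn_ege1// ler1n.
Qed.

Lemma sume_fin_term (I : eqType) (r : seq I) (F : I -> \bar R) i : (forall i, 0 <= F i)%E ->
  i \in r -> (F i <= \sum_(j <- r) F j)%E.
Proof.
move=> F0; elim: r => // j r IH; rewrite inE big_cons => /predU1P[->|/IH h].
  by apply: leeDl; exact: sume_ge0.
by apply: le_trans h _; apply: leeDr.
Qed.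

End distribution_norms.

Section forward_direction.
Context (R : realType) (n : nat) (M : nat -> R) (Omega : set 'rV[R]_n) (P : pdo R n) (x0 : 'rV[R]_n).
Notation E := 'rV[R]_n.
Notation fct := (E -> R[i]).
Notation mu := (@lebesgue_rV R n).
Notation mi := {ffun 'I_n -> nat}.

Lemma admissible_constants : admissible M -> exists A C1 h1 : R, [/\ 1 <= A, 0 < C1, 1 <= h1,
  forall j k, M (j + k)%N <= A ^+ (j + k) * M j * M k & forall k, k`!%:R <= C1 * h1 ^+ k * M k].
Proof.
move=> [wM [C [h [C0 h0 hf]]] [A A0 mg]]; exists (Num.max 1 A), C, (Num.max 1 h).
have M0 k : 0 < M k by case: wM.
split=> //; rewrite ?le_max ?lexx//.
  move=> j k; apply: le_trans (mg j k) _; rewrite ler_wpM2r ?(ltW (M0 _))// ler_wpM2r ?(ltW (M0 _))//.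
  by apply: lerXn2r; rewrite ?nnegrE ?le_max ?lexx ?ler01 ?(ltW A0) ?orbT.
move=> k; apply: le_trans (hf k) _; rewrite ler_wpM2r ?(ltW (M0 _))// ler_wpM2l ?(ltW C0)//.
by apply: lerXn2r; rewrite ?nnegrE ?le_max ?lexx ?ler01 ?(ltW h0) ?orbT.
Qed.

Lemma DC_smooth_coefs U : U `<=` Omega -> pdo_DC M Omega P -> smooth_coefs P U.
Proof. by move=> UO hP a /hP[sa _]; apply: sm_sub UO _; exact: Sm. Qed.

Hypotheses (adm : admissible M) (oOm : open Omega) (PDC : pdo_DC M Omega P).

Lemma forward_direction (T : fct -> fct) : L2_operator Omega T -> pdo_right_inverse P Omega T ->
  hypoelliptic_at M P Omega x0 ->
  exists U0 : set E, [/\ open U0, U0 x0, U0 `<=` Omega &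
    forall U V : set E, open U -> open V -> rel_compact V U -> U `<=` U0 ->
      exists C L : R, [/\ 0 < C, 0 < L &
        forall u : fct -> R[i], is_distr U u -> forall k : nat,
          (Sobolev k U (pdo_app P u) -> Sobolev k V u) /\
          (Sobolev_norm k V u <=
             (C * L ^+ k)%:E * (weighted_norm M k U (pdo_app P u) +
                                (M k)%:E * L2norm_distr U u))%E]].
Proof.
move=> hT PT [U0 [oU0 U0x U0O hyp]].
have [A [C1 [h1 [A1 C10 h11 mg hfact]]]] := admissible_constants adm.
have [wM _ _] := adm; have M0 k : 0 < M k by exact: lt_le_trans (M_ge1 wM k).
(* The unit box lies inside the cube of one period centred at [x0]. *)
pose W := U0 `&` box x0 1.
have oW : open W by apply: openI => //; exact: open_box.
have WU : W `<=` U0 by move=> x [].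
have Wx : W `<=` box x0 1 by move=> x [].
have WOm : W `<=` Omega by move=> x /WU /U0O.
have [r [CT [CT0 Lr rW rC]]] := exponential_solutions oOm (DC_smooth_coefs (@subset_refl _ Omega) PDC) hT PT WOm Wx.
exists W; split=> //; first by split=> //; exact: box_refl.
move=> U V oU oV [cV VU] UW.
have sP := DC_smooth_coefs U0O PDC.
have [C [L [C0 L1 core]]] := forward_core wM A1 mg C10 h11 hfact oU0 sP hyp oW WU Wx CT0 Lr rW rC oU UW oV cV VU.
have L0 : 0 < L by exact: lt_le_trans L1.
(* The factor 2^n pays for the number of multi-indices of order at most k. *)
exists C, (2 ^+ n * L); split=> //; first by rewrite mulr_gt0// exprn_gt0.
move=> u du k; set Pu := pdo_app P u.
have Lam0 j : 0 < Lambda M k ^+ j by rewrite exprn_gt0// Lambda_gt0.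
split.
  move=> sob; have /choice[f hf] : forall a : mi, exists f, (mabs a <= k)%N -> L2rep U (Ddistr a Pu) f.
    move=> a; case: (boolP (mabs a <= k)%N) => [/sob[f hf]|_]; first by exists f.
    by exists (fun=> 0).
  pose X := \sum_(a <- midx n k) Lambda M k ^+ (k - mabs a) * l2 mu (cut U (f a)).
  move=> a ak; have [|h hh _] := core u du k f X hf _ a ak; last by exists h.
  move=> b bk; rewrite /X (big_rem b) ?mem_midx//= lerDl; apply: sumr_ge0 => ? _.
  by rewrite mulr_ge0 ?l2_ge0// ltW.
have CL0 : 0 < C * L ^+ k by rewrite mulr_gt0// exprn_gt0.
have CL0' : 0 < C * (2 ^+ n * L) ^+ k by rewrite mulr_gt0// exprn_gt0// mulr_gt0// exprn_gt0.
pose wa a := ((Lambda M k ^+ (k - mabs a))%:E * L2norm_distr U (Ddistr a Pu))%E.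
have wa0 a : (0 <= wa a)%E by rewrite mule_ge0 ?L2norm_distr_ge0// lee_fin ltW.
have w0 : (0 <= weighted_norm M k U Pu)%E by rewrite /weighted_norm; apply: sume_ge0 => a _; exact: wa0.
have u00 : (0 <= (M k)%:E * L2norm_distr U u)%E by rewrite mule_ge0 ?L2norm_distr_ge0// lee_fin ltW.
(* If a norm on the right is infinite the estimate is void; otherwise the norms of all derivatives
   of [P u] are finite and representatives can be chosen. *)
have [fw|] := boolP (weighted_norm M k U Pu \is a fin_num); last first.
  rewrite ge0_fin_numE// -leNgt leye_eq => /eqP ->.
  by rewrite addye ?gt0_muley ?lte_fin ?leey// gt_eqF// (lt_le_trans _ u00).
have [fu|] := boolP (L2norm_distr U u \is a fin_num); last first.
  rewrite ge0_fin_numE ?L2norm_distr_ge0// -leNgt leye_eq => /eqP ->.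
  rewrite gt0_muley ?lte_fin// addey ?gt0_muley ?lte_fin ?leey//.
  by rewrite gt_eqF// (lt_le_trans _ w0).
set Wn := weighted_norm _ _ _ _ in fw *; set Nu := L2norm_distr U u in fu *.
have fa a : (mabs a <= k)%N -> L2norm_distr U (Ddistr a Pu) \is a fin_num.
  move=> ak; rewrite ge0_fin_numE ?L2norm_distr_ge0// ltNge leye_eq; apply/negP => /eqP e.
  have : (wa a <= Wn)%E by apply: sume_fin_term => //; rewrite mem_midx.
  by rewrite /wa e gt0_muley ?lte_fin// leye_eq; move: fw => /[swap] /eqP ->.
have Wn0 : 0 <= fine Wn by exact: fine_ge0.
have Nu0 : 0 <= fine Nu by apply: fine_ge0; exact: L2norm_distr_ge0.
pose Y := fine Wn + M k * fine Nu.
have Y0 : 0 <= Y by rewrite addr_ge0// mulr_ge0// ltW.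
have -> : ((C * (2 ^+ n * L) ^+ k)%:E * (Wn + (M k)%:E * Nu))%E = ((2 ^+ n) ^+ k * (C * L ^+ k * Y))%:E.
  have -> : (Wn + (M k)%:E * Nu = Y%:E)%E by rewrite -[in LHS](fineK fw) -[in LHS](fineK fu) -EFinM -EFinD.
  by rewrite -EFinM; congr EFin; rewrite (exprMn k (2 ^+ n)); ring.
apply: Sobolev_norm_le => [|a ak]; first by rewrite mulr_ge0// ltW.
apply/lee_addgt0Pr => e e0.
pose SL := \sum_(b <- midx n k) Lambda M k ^+ (k - mabs b).
have SL0 : 0 <= SL by apply: sumr_ge0 => b _; exact: ltW.
have SM0 : 0 < C * L ^+ k * (SL + M k) by rewrite mulr_gt0// ltr_wpDl.
(* Small enough for the errors of all chosen representatives together to cost at most [e]. *)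
pose d := e / (C * L ^+ k * (SL + M k)); have d0 : 0 < d by rewrite divr_gt0.
have [u0 ru0 bu0] := L2norm_distr_approx oU fu d0.
have /choice[f hf] : forall b : mi, exists f, (mabs b <= k)%N -> L2rep U (Ddistr b Pu) f /\
    l2 mu (cut U f) <= fine (L2norm_distr U (Ddistr b Pu)) + d.
  move=> b; case: (boolP (mabs b <= k)%N) => [bk|_]; last by exists (fun=> 0).
  by have [f rf bf] := L2norm_distr_approx oU (fa b bk) d0; exists f.
have hX b : (mabs b <= k)%N -> Lambda M k ^+ (k - mabs b) * l2 mu (cut U (f b)) <= fine Wn + SL * d.
  move=> bk; apply: le_trans (ler_wpM2l (ltW (Lam0 _)) (hf b bk).2) _; rewrite mulrDr; apply: lerD.
    rewrite -lee_fin EFinM (fineK (fa b bk)) (fineK fw).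
    by apply: (@sume_fin_term _ _ _ wa) => //; rewrite mem_midx.
  rewrite ler_wpM2r ?(ltW d0)// /SL (big_rem b) ?mem_midx//= lerDl.
  by apply: sumr_ge0 => ? _; exact: ltW.
have [h hh hb] := core u du k f _ (fun b bk => (hf b bk).1) hX a ak.
apply: le_trans (L2norm_distr_le oV hh) _; rewrite -EFinD lee_fin.
apply: le_trans (hb u0 ru0) _.
apply: le_trans (_ : C * L ^+ k * (fine Wn + SL * d + M k * (fine Nu + d)) <= _).
  by rewrite ler_wpM2l ?(ltW CL0)// lerD2l ler_wpM2l// ltW.
have -> : fine Wn + SL * d + M k * (fine Nu + d) = Y + (SL + M k) * d by rewrite /Y; ring.
by rewrite mulrDr lerD2l mulrA /d mulrC divfK// gt_eqF.
Qed.

End forward_direction.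

(** * Sufficiency of the estimates *)

Section gluing.
Context (R : realType) (n : nat).
Notation E := 'rV[R]_n.
Notation fct := (E -> R[i]).
Notation mu := (@lebesgue_rV R n).
Implicit Types (U V O K : set E) (f g phi : fct).

Let oT : open [set: E] := @openT _.

Lemma tst_int_nc U phi : tst U phi -> mu.-integrable setT (EFin \o (fun x => nc (phi x))).
Proof. by move=> tp; apply: cintegrable_nc; exact: tst_int tp. Qed.

(** Duality between L^1 and sup bounds: testing with a cutoff concentrated near [x] recovers [g x]
    by continuity. With B = 0 it gives uniqueness of continuous representatives. *)
Lemma sup_bound_weak O g (B : R) : open O -> (forall x, O x -> ccont g x) ->
  (forall phi, tst O phi -> cintegrable mu (fun x => g x * phi x)) ->
  (forall phi, tst O phi -> nc (cint mu (fun x => g x * phi x)) <= B * \int[mu]_x nc (phi x)) ->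
  forall x, O x -> nc (g x) <= B.
Proof.
move=> oO cg ig hB x Ox; apply/ler_addgt0Pr => e e0.
have [d1 d10 hd1] := (ccontP g x).1 (cg x Ox) e e0.
have [d2 d20 hd2] := open_boxP oO Ox.
pose d := Num.min d1 d2 / 2; have d0 : 0 < d by rewrite divr_gt0// lt_min d10.
have dd : d < Num.min d1 d2 by rewrite ltr_pdivrMr// ltr_pMr ?lt_min ?d10// ltr1n.
have cubeO y : cube x d y -> nc (g y - g x) < e /\ O y.
  move=> cy; have by' : box x (Num.min d1 d2) y by exact: cube_box dd _ cy.
  by split; [apply: hd1 => i|apply: hd2 => i]; apply: lt_le_trans (by' i) _; rewrite ge_min lexx ?orbT.
have [B' _ /(_ 0%N)[th [cth th1 th0]]] := cutoff_cube x d0.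
have tt : tst O (rc th).
  by apply: cutoff_tst (@cube_compact _ _ x d) _ cth th0 => y /cubeO[].
have [_ th01 _] := cth.
have ncth y : nc (rc th y) = th y by rewrite /rc nc_real ger0_norm//; case/andP: (th01 y).
have ith := tst_int_nc tt.
have I0 : 0 < \int[mu]_y nc (rc th y).
  pose c := cube x (d / 2); have mc : measurable c by exact: measurable_cube.
  have d20' : 0 <= d / 2 by rewrite divr_ge0// ltW.
  have muc := mu_cube x d20'.
  apply: lt_le_trans (_ : \int[mu]_y \1_c y <= _).
    rewrite /Rintegral integral_indic// setIT [X in fine X]muc /=.
    by rewrite exprn_gt0// mulr_gt0// divr_gt0.
  apply: le_Rintegral => //; first by apply: integrable_indicR => //; rewrite [X in (X < _)%E]muc ltry.
  move=> y _; rewrite ncth indicE; have [yc|_] := boolP (y \in c); last by case/andP: (th01 y).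
  by rewrite th1//; move: yc; rewrite inE.
set I := \int[mu]_y nc (rc th y) in I0.
rewrite -(ler_pM2r I0).
have i1 : cintegrable mu (rc th) by exact: tst_int tt.
have -> : nc (g x) * I = nc (cint mu (fun y => g x * rc th y)).
  rewrite cintZ// ncM; congr (_ * _).
  have -> : cint mu (rc th) = (\int[mu]_y th y)%:C%C by exact: cint_real.
  rewrite nc_real ger0_norm; last by apply: Rintegral_ge0 => y _; case/andP: (th01 y).
  by apply: eq_Rintegral => y _; rewrite ncth.
have i2 := ig _ tt.
have i3 : cintegrable mu (fun y => g x * rc th y - g y * rc th y).
  by apply: cintegrableD; [exact: cintegrableZ|exact: cintegrableN].
have -> : (fun y => g x * rc th y) = (fun y => g y * rc th y + (g x * rc th y - g y * rc th y)).
  by apply/funext => y; rewrite addrC subrK.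
rewrite cintD//; apply: le_trans (ncD _ _) _; rewrite mulrDl; apply: lerD; first exact: hB.
apply: le_trans (nc_cint i3) _.
have -> : e * I = \int[mu]_y (e * nc (rc th y)) by rewrite RintegralZl.
apply: le_Rintegral => //; [exact: cintegrable_nc|exact: integrableZR|].
move=> y _; rewrite -mulrBl ncM; have [cy|nc'] := pselect (cube x d y).
  by rewrite ler_wpM2r ?nc_ge0// ncB ltW//; case: (cubeO y cy).
by rewrite /rc th0// nc0 !mulr0.
Qed.

(* A test function is exhausted by replacing it successively by phi (1 - theta) for cutoffs theta
   of small cubes covering its support. *)
Lemma local_zero V (T : fct -> R[i]) : linear_on V T ->
  (forall x, V x -> exists O, [/\ open O, O x, O `<=` V & forall phi, tst O phi -> T phi = 0]) ->
  forall phi, tst V phi -> T phi = 0.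
Proof.
move=> lT hT phi tp; have [sp [K cK [KV K0]]] := tp.
have /choice[d hd] : forall x, exists d, V x -> 0 < d /\ exists O,
    [/\ open O, O `<=` V, cube x d `<=` O & forall phi, tst O phi -> T phi = 0].
  move=> x; have [Vx|nV] := pselect (V x); last by exists 0.
  have [ O [oO Ox OV hO]] := hT x Vx; have [d d0 hd] := open_boxP oO Ox.
  exists (d / 2) => _; split; first by rewrite divr_gt0.
  exists O; split=> // y cy; apply: hd; apply: cube_box cy.
  by rewrite ltr_pdivrMr// ltr_pMr// ltr1n.
have /choice[th hth] : forall x, exists th : E -> R, V x ->
    [/\ sm setT (rc th), (forall y, cube x (d x / 2) y -> th y = 1) &
      forall y, ~ cube x (d x) y -> th y = 0].
  move=> x; have [Vx|nV] := pselect (V x); last by exists (fun=> 0).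
  have [d0 _] := hd x Vx; have [B _ /(_ 0%N)[th [cth th1 th0]]] := cutoff_cube x d0.
  by exists th => _; split=> //; case: cth.
have [|r rK hr] := @finite_box_cover R n K (fun x => d x / 2) cK.
  by move=> x Kx; rewrite divr_gt0//; case: (hd x (KV x Kx)).
have rV y : y \in r -> V y by move=> /rK /KV.
suff key : forall r' : seq E, {subset r' <= r} ->
    tst V (fun x => (\prod_(y <- r') (1 - rc (th y) x)) * phi x) /\
    T phi = T (fun x => (\prod_(y <- r') (1 - rc (th y) x)) * phi x).
  have [_ ->] := key r (fun y h => h).
  have -> : (fun x => (\prod_(y <- r) (1 - rc (th y) x)) * phi x) = fun=> 0.
    apply/funext => x; have [Kx|nK] := pselect (K x); last by rewrite K0// mulr0.
    have [y yr bxy] := hr x Kx; have [_ h1 _] := hth y (rV y yr).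
    by rewrite (big_rem y)//= /rc h1 ?subrr ?mul0r//; exact: box_cube.
  exact: linear_on0 lT.
elim=> [_|y r' IH sub].
  suff -> : (fun x => (\prod_(y <- [::]) (1 - rc (th y) x)) * phi x) = phi by [].
  by apply/funext => x; rewrite big_nil mul1r.
have [|t' e'] := IH; first by move=> z zr; apply: sub; rewrite inE zr orbT.
have Vy : V y by apply: rV; apply: sub; rewrite inE eqxx.
have [sth _ th0] := hth y Vy; have [d0 [ O [oO OV cO hO]]] := hd y Vy.
set psi := fun x => _ * phi x in t' e'.
have tpsi : tst O (fun x => rc (th y) x * psi x).
  split; first by apply: smM => //; exact: tst_sm t'.
  exists (cube y (d y)); [exact: cube_compact|split=> // x nx].
  by rewrite /rc th0// mul0r.
have e1 : (fun x => (\prod_(z <- y :: r') (1 - rc (th z) x)) * phi x) =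
    (fun x => -1 * (rc (th y) x * psi x) + psi x).
  by apply/funext => x; rewrite big_cons /psi; ring.
rewrite e1; split; first by apply: tstD => //; apply: tstZ; exact: tst_sub OV tpsi.
by have := lT (-1) _ _ (tst_sub OV tpsi) t'; rewrite (hO _ tpsi) mulr0 add0r e' => <-.
Qed.

(** Local representatives agree where they overlap, by [sup_bound_weak] with bound 0, so evaluating
    at [x] the one attached to [x] defines a global function. On a compact set finitely many pairs
    of constants are in play and can be added. *)
Lemma glue_DC (M : nat -> R) V u : open V -> linear_on V u -> (forall k, 0 < M k) ->
  (forall x, V x -> exists O g (C L : R), [/\ open O, O x, O `<=` V, sm setT g &
     [/\ (forall phi, tst O phi -> u phi = cint mu (fun y => g y * phi y)), 0 < C, 0 < L &
       forall s y, O y -> nc (Dw s g y) <= C * L ^+ size s * M (size s)]]) ->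
  DC_distr M V u.
Proof.
move=> oV lu M0 loc.
pose Q x (p : set E * fct * (R * R)) := [/\ open p.1.1, p.1.1 x, p.1.1 `<=` V, sm setT p.1.2 &
     [/\ (forall phi, tst p.1.1 phi -> u phi = cint mu (fun y => p.1.2 y * phi y)), 0 < p.2.1, 0 < p.2.2 &
       forall s y, p.1.1 y -> nc (Dw s p.1.2 y) <= p.2.1 * p.2.2 ^+ size s * M (size s)]].
have /choice[p hp] : forall x, exists p, V x -> Q x p.
  move=> x; have [Vx|nV] := pselect (V x); last by exists (set0, fun=> 0, (0, 0)).
  by have [ O [g [C [L h]]]] := loc x Vx; exists (O, g, (C, L)).
pose f x := (p x).1.2 x.
have fE x y : V x -> (p x).1.1 y -> f y = (p x).1.2 y.
  move=> Vx Oy; have [oOx _ OV sgx [ux _ _ _]] := hp x Vx.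
  have [oOy Oyy _ sgy [uy _ _ _]] := hp y (OV y Oy).
  pose O := (p x).1.1 `&` (p y).1.1; have oO : open O by exact: openI.
  pose g z := (p y).1.2 z - (p x).1.2 z.
  have sg : sm setT g by apply: smD => //; exact: smN.
  have : nc (g y) <= 0.
    apply: (@sup_bound_weak O g) => //.
    - by move=> z _; exact: (sm_C1 sg Logic.I).1.
    - by move=> phi tp; apply: tst_int (tstM oO (sm_sub _ sg) tp).
    move=> phi tp; rewrite mul0r.
    have tx : tst (p x).1.1 phi by apply: tst_sub tp => z [].
    have ty : tst (p y).1.1 phi by apply: tst_sub tp => z [].
    have -> : (fun z => g z * phi z) = (fun z => (p y).1.2 z * phi z - (p x).1.2 z * phi z).
      by apply/funext => z; rewrite /g mulrBl.
    rewrite cintB; [|exact: tst_int (tstM oT sgy (tst_sub _ ty))|exact: tst_int (tstM oT sgx (tst_sub _ tx))].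
    by rewrite -ux// -uy// subrr nc0.
  move=> h; have /nc_eq0/eqP : nc (g y) = 0 by apply/eqP; rewrite eq_le h nc_ge0.
  by rewrite subr_eq0 => /eqP.
have smf : sm V f.
  apply: sm_local => x Vx; have [oOx Oxx OV sgx _] := hp x Vx; exists (p x).1.1 => //.
  apply: (sm_eq oOx (f := (p x).1.2)); first by move=> y Oy; rewrite (fE x).
  exact: sm_sub sgx.
exists f.
  apply/(DC_classP M f oV); split=> // K cK KV.
  have /choice[d hd] : forall x, exists d, V x -> 0 < d /\ box x d `<=` (p x).1.1.
    move=> x; have [Vx|nV] := pselect (V x); last by exists 0.
    by have [oOx Oxx _ _ _] := hp x Vx; have [d d0 hd] := open_boxP oOx Oxx; exists d.
  have [|r rK hr] := @finite_box_cover R n K d cK.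
    by move=> x Kx; case: (hd x (KV x Kx)).
  pose C := \sum_(y <- r) `|(p y).2.1| + 1; pose L := \sum_(y <- r) `|(p y).2.2| + 1.
  have sum0 (F : E -> R) : 0 <= \sum_(y <- r) `|F y| by apply: sumr_ge0.
  have sumle (F : E -> R) y : y \in r -> F y <= \sum_(y <- r) `|F y| + 1.
    move=> yr; apply: le_trans (ler_norm _) _; rewrite (big_rem y)//= -addrA lerDl addr_ge0//.
    by apply: sumr_ge0.
  exists C, L; split; rewrite ?ltr_wpDl// => x s Kx.
  have [y yr bxy] := hr x Kx; have Vy := KV _ (rK _ yr).
  have [oOy _ OV sgy [_ C0 L0 hb]] := hp y Vy; have [_ bO] := hd y Vy.
  have Ox := bO _ bxy.
  have -> : Dw s f x = Dw s (p y).1.2 x by apply: (Dw_eq s oOy) => // z Oz; exact: fE.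
  apply: le_trans (hb s x Ox) _; rewrite ler_wpM2r ?(ltW (M0 _))//.
  apply: ler_pM; rewrite ?exprn_ge0 ?(ltW C0) ?(ltW L0)//; first exact: (sumle (fun y => (p y).2.1)).
  by apply: lerXn2r; rewrite ?nnegrE ?addr_ge0 ?(ltW L0)//; exact: (sumle (fun y => (p y).2.2)).
move=> phi /tstP tp; rewrite distr_ofE (cut_tst _ tp); apply/eqP; rewrite -subr_eq0; apply/eqP.
have iV psi : tst V psi -> cintegrable mu (fun x => f x * psi x) by move=> t; exact: tst_int (tstM oV smf t).
apply: (@local_zero V (fun psi => u psi - cint mu (fun x => f x * psi x))) tp.
  move=> c p1 p2 t1 t2; rewrite (lu _ _ _ t1 t2) (linear_on_cint iV c t1 t2); ring.
move=> x Vx; have [oOx Oxx OV _ [ux _ _ _]] := hp x Vx; exists (p x).1.1; split=> // psi tpsi.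
rewrite ux//; apply/eqP; rewrite subr_eq0; apply/eqP; congr cint; apply/funext => y.
have [Oy|nO] := pselect ((p x).1.1 y); last by rewrite (tst_out tpsi nO) !mulr0.
by rewrite (fE x).
Qed.

End gluing.

(** * Fourier series of a localized family of weak derivatives *)

Section sobolev_embedding.
Context (R : realType) (n : nat) (x0 : 'rV[R]_n).
Notation E := 'rV[R]_n.
Notation fct := (E -> R[i]).
Notation mu := (@lebesgue_rV R n).
Notation freq := {ffun 'I_n -> int}.
Implicit Types (U O K : set E) (f g chi phi : fct) (fw v : seq 'I_n -> fct) (c : freq -> R[i]).

Let oT : open [set: E] := @openT _.

Lemma nc_fc_le g xi : L2 mu g -> nc (fc x0 g xi) <= l2 mu g.
Proof.
move=> Lg; have [h _] := bessel x0 (isT : uniq [:: xi]) Lg; move: h; rewrite big_seq1 => h.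
rewrite -(@ler_pXn2r _ 2) ?nnegrE ?nc_ge0 ?l2_ge0//; apply: le_trans h.
by rewrite ler_peMl ?sqr_ge0// exprn_ege1//; have := @pi_ge2 R; lra.
Qed.

Lemma fc_decay U fw chi q (B Y : R) : open U -> U `<=` box x0 1 -> (forall s, L2 mu (fw s)) ->
  (forall t j phi, tst U phi ->
     cint mu (fun x => fw t x * pderiv j phi x) = - cint mu (fun x => fw (j :: t) x * phi x)) ->
  tst U chi -> 0 <= B -> (forall s x, (size s <= q)%N -> nc (Dw s chi x) <= B) ->
  (forall s, (size s <= q)%N -> l2 mu (fw s) <= Y) ->
  forall xi, nc (fc x0 (fun x => chi x * fw [::] x) xi) * fmax R xi ^+ q <= 2 ^+ q * (B * Y).
Proof.
move=> oU Ux Lfw step tc B0 hB hY xi.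
have Y0 : 0 <= Y by apply: le_trans (hY [::] isT); exact: l2_ge0.
have gE : leibniz fw chi [::] = (fun x => chi x * fw [::] x).
  by apply/funext => x; rewrite /leibniz /= big_cons big_nil addr0.
rewrite -gE.
have lw w : (size w <= q)%N -> l2 mu (leibniz fw chi w) <= 2 ^+ q * (B * Y).
  move=> wq; apply: le_trans (@l2_sum _ _ _ _ _ _ (fun p x => Dw p.1 chi x * fw p.2 x) _) _ => [p|].
    exact: (L2_dtst Lfw p tc).
  apply: le_trans (_ : 2 ^+ size w * (B * Y) <= _); last first.
    by rewrite ler_wpM2r ?mulr_ge0// ler_weXn2l// ler1n.
  have -> : 2 ^+ size w = \sum_(p <- splits w) (1 : R).
    rewrite (_ : 2 = 1 + 1 :> R)// -sum_splits; apply: eq_bigr => p _.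
    by rewrite !expr1n mulr1.
  rewrite mulr_suml big_seq [leRHS]big_seq; apply: ler_sum => p /size_splits sp; rewrite mul1r.
  have p1 : (size p.1 <= q)%N by apply: leq_trans wq; rewrite -sp leq_addr.
  have p2 : (size p.2 <= q)%N by apply: leq_trans wq; rewrite -sp leq_addl.
  have mc : cmeas (Dw p.1 chi) by apply: cmeas_cont => x; exact: tst_cont (tst_Dw p.1 tc).
  apply: le_trans (L2_mulb mc (fun x => hB _ x p1) (Lfw p.2)).2 _.
  by rewrite ler_wpM2l// hY.
have [[m ->]|->] := fmax_attained R xi; last first.
  case: q lw {hB hY} => [|q] lw; last by rewrite expr0n mulr0 mulr_ge0 ?exprn_ge0// mulr_ge0.
  rewrite expr0 mulr1; apply: le_trans (lw [::] isT); apply: nc_fc_le.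
  exact: (L2_leibniz Lfw [::] tc).
have st t j phi : (size t < q)%N -> tst U phi ->
    cint mu (fun x => fw t x * pderiv j phi x) = - cint mu (fun x => fw (j :: t) x * phi x).
  by move=> _; exact: step.
have [|w sw hw] := fc_Dw oU Ux Lfw st (s := nseq q m) tc; first by rewrite size_nseq.
rewrite size_nseq in sw.
have -> : `|(xi m)%:~R| ^+ q = \prod_(j <- nseq q m) nc (fr R xi j).
  by under eq_bigr do rewrite nc_fr; rewrite big_nseq iter_mulr_1.
rewrite hw; apply: le_trans (nc_fc_le _ (L2_leibniz Lfw _ tc)) _.
by apply: lw; rewrite sw.
Qed.

Lemma sum_uniq_subset (F G : seq freq) (f : freq -> R) : uniq F -> uniq G -> {subset F <= G} ->
  (forall xi, 0 <= f xi) -> \sum_(xi <- F) f xi <= \sum_(xi <- G) f xi.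
Proof.
move=> uF uG FG f0; rewrite [leRHS](bigID (mem F))/=.
have pe : perm_eq [seq xi <- G | xi \in F] F.
  apply: uniq_perm => //; first exact: filter_uniq.
  by move=> xi; rewrite mem_filter andb_idr// => /FG.
have -> : \sum_(xi <- G | xi \in F) f xi = \sum_(xi <- F) f xi.
  by rewrite -big_filter; exact: perm_big.
by rewrite lerDl; apply: sumr_ge0.
Qed.

(* The dyadic block at 2^i has O(2^(i n)) frequencies, so n + 1 powers of [fmax] suffice. *)
Lemma freq_summable c q (Y0 Y : R) : 0 <= Y0 -> 0 <= Y ->
  (forall xi, nc (c xi) * fmax R xi ^+ q <= Y0) ->
  (forall xi, nc (c xi) * fmax R xi ^+ (q + n.+1) <= Y) ->
  forall F, uniq F -> \sum_(xi <- F) nc (c xi) * fmax R xi ^+ q <= 3 ^+ n * Y0 + 2 * (6 ^+ n * Y).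
Proof.
move=> Y00 Yp h0 h1 F uF; have [N hN] := fbox_exhaust R F.
pose f xi := nc (c xi) * fmax R xi ^+ q.
have f0 xi : 0 <= f xi by rewrite mulr_ge0 ?nc_ge0// exprn_ge0// fmax_ge0.
apply: le_trans (_ : \sum_(xi <- fbox n (2 ^ N * 1)) f xi <= _).
  apply: sum_uniq_subset => //; first exact: fbox_uniq.
  by move=> xi /hN; apply: (fbox_homo R); rewrite muln1 ltnW// ltn_expl.
suff key I : \sum_(xi <- fbox n (2 ^ I * 1)) f xi <=
    3 ^+ n * Y0 + 6 ^+ n * Y * \sum_(0 <= i < I) 2^-1 ^+ i.
  apply: le_trans (key N) _; rewrite lerD2l [leRHS]mulrC; apply: ler_wpM2l.
    by rewrite mulr_ge0// exprn_ge0.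
  by have := @geo_sum R 0 N (leq0n N); rewrite expr0 mulr1.
elim: I => [|I IH].
  rewrite big_geq// mulr0 addr0; apply: le_trans (_ : \sum_(xi <- fbox n (2 ^ 0 * 1)) Y0 <= _).
    by apply: ler_sum => xi _; exact: h0.
  rewrite big_const_seq count_predT iter_addr_0 size_fbox -[leLHS]mulr_natl natrX.
  by apply: ler_wpM2r.
have -> : \sum_(xi <- fbox n (2 ^ I.+1 * 1)) f xi =
    \sum_(xi <- fbox n (2 ^ I * 1)) f xi + \sum_(xi <- dbox n 1 I I.+1) f xi.
  by rewrite (sum_dbox R)// addrC subrK.
rewrite big_nat_recr//= mulrDr addrA; apply: lerD => //.
have pI : 0 < 2 ^+ I :> R by rewrite exprn_gt0.
have fb xi : xi \in dbox n 1 I I.+1 -> f xi <= Y * (2^-1 ^+ I) ^+ n.+1.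
  rewrite mem_filter (mem_fbox R) -ltNge muln1 natrX => /andP[hl _].
  rewrite exprVn exprVn -ler_pdivrMr ?invr_gt0 ?exprn_gt0// invrK.
  apply: le_trans (h1 xi); rewrite exprD mulrA; apply: ler_wpM2l; first exact: f0.
  by apply: lerXn2r; rewrite ?nnegrE ?fmax_ge0 ?(ltW pI)// ltW.
apply: le_trans (_ : \sum_(xi <- dbox n 1 I I.+1) Y * (2^-1 ^+ I) ^+ n.+1 <= _).
  by rewrite big_seq [leRHS]big_seq; apply: ler_sum.
rewrite big_const_seq count_predT iter_addr_0 -[leLHS]mulr_natl.
have sd : (size (dbox n 1 I I.+1))%:R <= (6 * 2 ^+ I) ^+ n :> R.
  apply: le_trans (_ : (size (fbox n (2 ^ I.+1 * 1)))%:R <= _).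
    by rewrite ler_nat size_filter count_size.
  rewrite size_fbox natrX; apply: lerXn2r; rewrite ?nnegrE ?mulr_ge0 ?(ltW pI)//.
  rewrite -natrX -natrM ler_nat muln1 expnS.
  by have := expn_gt0 2 I; lia.
apply: le_trans (ler_wpM2r _ sd) _; first by rewrite mulr_ge0// !exprn_ge0// invr_ge0.
rewrite le_eqVlt; apply/orP; left; apply/eqP.
rewrite exprMn [(2^-1 ^+ I) ^+ n.+1]exprS exprVn exprVn.
have p2 : 2 ^+ I != 0 :> R by rewrite gt_eqF.
have p3 : (2 ^+ I) ^+ n != 0 :> R by rewrite expf_neq0.
by field; rewrite p2 p3.
Qed.

(** The frequencies whose code is below N: nested lists that exhaust the lattice, so that series
    over frequencies become series over nat. *)
Definition enum_freq N : seq freq := pmap (@pickle_inv freq) (iota 0 N).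

Lemma enum_freq_uniq N : uniq (enum_freq N).
Proof. by apply: (pmap_uniq (@pickle_invK freq)); exact: iota_uniq. Qed.

Lemma enum_freq_exhaust (F : seq freq) : exists N, forall p, (N <= p)%N -> {subset F <= enum_freq p}.
Proof.
exists (\sum_(xi <- F) (pickle xi).+1)%N => p Np xi xF.
rewrite (can2_mem_pmap (@pickle_invK freq) (@pickleK_inv freq)) mem_iota add0n leq0n.
apply: leq_trans Np; rewrite (big_rem xi)//=; exact: leq_addr.
Qed.

Lemma sum_enum_freq (Z : zmodType) (f : freq -> Z) N :
  \sum_(xi <- enum_freq N) f xi = \sum_(m < N) oapp f 0 (pickle_inv m).
Proof. by rewrite big_pmap -(big_mkord xpredT (fun m => oapp f 0 (pickle_inv m))) /index_iota subn0. Qed.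

Lemma trig_series c (Z : nat -> R) :
  (forall q F, uniq F -> \sum_(xi <- F) nc (c xi) * fmax R xi ^+ q <= Z q) ->
  exists2 g, sm setT g & forall U phi, tst U phi ->
    clim (fun N => \sum_(xi <- enum_freq N) c xi * cint mu (fun x => ex xi x * phi x))
      (cint mu (fun x => g x * phi x)).
Proof.
move=> hZ; pose F m : fct := if pickle_inv m is Some xi then fun x => c xi * ex xi x else fun=> 0.
pose b q m : R := oapp (fun xi => nc (c xi) * fmax R xi ^+ q) 0 (pickle_inv m).
have b0 q m : 0 <= b q m.
  by rewrite /b; case: pickle_inv => //= xi; rewrite mulr_ge0 ?nc_ge0// exprn_ge0// fmax_ge0.
have sF m : sm setT (F m).
  by rewrite /F; case: pickle_inv => [xi|]; [apply: smZ => //; exact: sm_ex|exact: sm_cst].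
have psb q : psum (b q).
  split=> //; exists (Z q) => _ [N _ <-]; rewrite /series /= big_mkord -(sum_enum_freq (fun xi => nc (c xi) * fmax R xi ^+ q)).
  exact: hZ (enum_freq_uniq N).
have bF s m x : nc (Dw s (F m) x) <= b (size s) m.
  rewrite /F /b; case: pickle_inv => [xi|] /=.
    by rewrite (DwZ _ _ oT (sm_ex R xi) Logic.I) ncM ler_wpM2l ?nc_ge0// nc_Dw_ex.
  suff -> : Dw s (fun=> 0) x = 0 :> R[i] by rewrite nc0.
  elim: s x => // j s IH x; rewrite /= (_ : Dw s _ = fun=> 0) ?pderiv_cst//.
  exact/funext.
have [G [hG sG _]] := sm_series sF (fun s => ex_intro2 _ _ (b (size s)) (psb _) (bF s)).
exists (G [::]) => // U phi tp; set g := G [::].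
have unif e : 0 < e -> exists N, forall p, (N <= p)%N -> forall x, nc (\sum_(m < p) F m x - g x) <= e.
  move=> e0; have [N hN] := psum_tail (psb 0%N) e0; exists N => p Np x.
  apply/ler_addgt0Pr => e' e'0; have [K hK] := hG [::] x e' e'0.
  pose K' := maxn K p.
  have -> : \sum_(m < p) F m x - g x = (\sum_(m < K') F m x - g x) - (\sum_(m < K') F m x - \sum_(m < p) F m x).
    by ring.
  apply: le_trans (ncD _ _) _; rewrite ncN addrC; apply: lerD; last by apply: hK; exact: leq_maxl.
  rewrite (sum_ordB (fun m => F m x)) ?leq_maxr//; apply: le_trans (nc_sum _ _ _) _.
  apply: le_trans (_ : \sum_(p <= m < K') b 0%N m <= _); first by apply: ler_sum => m _; exact: (bF [::]).
  apply: le_trans (hN K'); rewrite (big_cat_nat Np) ?leq_maxr//= lerDr.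
  by apply: sumr_ge0 => m _; exact: b0.
have ip := tst_int_nc tp; set I := \int[mu]_x nc (phi x).
have I0 : 0 <= I by apply: Rintegral_ge0 => x _; exact: nc_ge0.
have ig f : sm setT f -> cintegrable mu (fun x => f x * phi x).
  by move=> sf; apply: tst_int (tstM oT sf (tst_sub (@subsetT _ U) tp)).
move=> e e0; have e1 : 0 < e / (I + 1) by rewrite divr_gt0// ltr_wpDl.
have [N hN] := unif _ e1; exists N => p Np.
have -> : \sum_(xi <- enum_freq p) c xi * cint mu (fun x => ex xi x * phi x) =
    cint mu (fun x => (\sum_(m < p) F m x) * phi x).
  have -> : (fun x => (\sum_(m < p) F m x) * phi x) =
      (fun x => \sum_(xi <- enum_freq p) c xi * (ex xi x * phi x)).
    apply/funext => x; rewrite sum_enum_freq mulr_suml; apply: eq_bigr => m _.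
    by rewrite /F; case: pickle_inv => [xi|] /=; [rewrite mulrA|rewrite mul0r].
  have i2 (xi : freq) : cintegrable mu (fun x => ex xi x * phi x) by apply: ig; exact: sm_ex.
  by rewrite cint_sum => [|xi]; [apply: eq_bigr => xi _; rewrite cintZ|exact: cintegrableZ].
have sS : sm setT (fun x => \sum_(m < p) F m x) by apply: sm_sum.
rewrite -cintB; [|exact: ig|exact: ig].
have iB : cintegrable mu (fun x => (\sum_(m < p) F m x) * phi x - g x * phi x).
  by apply: cintegrableD; [exact: ig|apply: cintegrableN; exact: ig].
apply: le_trans (nc_cint iB) _; apply: le_trans (_ : \int[mu]_x (e / (I + 1) * nc (phi x)) <= _).
  apply: le_Rintegral => //; [exact: cintegrable_nc|exact: integrableZR|].
  by move=> x _; rewrite -mulrBl ncM ler_wpM2r ?nc_ge0//; exact: hN.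
rewrite RintegralZl// -/I mulrAC ler_pdivrMr ?ltr_wpDl// ler_wpM2l ?(ltW e0)//.
by rewrite lerDl.
Qed.

(** The coefficients of chi v_[] decay faster than any power, so its Fourier series is a smooth [g];
    for this qualitative step the size of the derivatives of [chi] is irrelevant. The class bounds
    need only the orders 0 and n + 1 of [chi], and the shift of the order by n + 1 is absorbed by
    A^(n+1) M_(n+1). *)
Lemma L2_family_smooth (M : nat -> R) (A C L : R) O O' (T : fct -> R[i]) v chi :
  weight_seq M -> 1 <= A -> (forall j k, M (j + k)%N <= A ^+ (j + k) * M j * M k) ->
  0 < C -> 1 <= L -> open O -> O `<=` box x0 1 -> (forall s, L2 mu (v s)) ->
  (forall s phi, tst O phi -> T (Dw s phi) = (-1) ^+ size s * cint mu (fun x => v s x * phi x)) ->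
  (forall s, l2 mu (v s) <= C * L ^+ size s * M (size s)) ->
  open O' -> O' `<=` O -> tst O chi -> (forall x, O' x -> chi x = 1) ->
  exists g (C' L' : R), [/\ sm setT g, forall phi, tst O' phi -> T phi = cint mu (fun x => g x * phi x),
    0 < C', 0 < L' & forall s y, O' y -> nc (Dw s g y) <= C' * L' ^+ size s * M (size s)].
Proof.
move=> wM A1 mg C0 L1 oO Ox Lv hT lv oO' O'O tc chi1.
have M0 k : 0 < M k by exact: lt_le_trans (M_ge1 wM k).
have L0 : 0 < L by exact: lt_le_trans L1.
have A0 : 0 < A by exact: lt_le_trans A1.
have step k := @weak_step R n O T k v (fun s phi _ tp => hT s phi tp).
pose B q := Cnorm q chi.
have hB q s x : (size s <= q)%N -> nc (Dw s chi x) <= B q by exact: (@le_Cnorm R n q chi O s x oO tc).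
have B0 q : 0 <= B q by apply: le_trans (hB q [::] x0 isT); exact: nc_ge0.
pose Y (s : seq 'I_n) q := 2 ^+ q * (B q * (C * L ^+ (q + size s) * M (q + size s)%N)).
have Y0 s q : 0 <= Y s q by rewrite /Y; (repeat first [exact: B0 | progress pos_with M0]).
have decay s q xi : nc (fc x0 (fun x => chi x * v s x) xi) * fmax R xi ^+ q <= Y s q.
  apply: (@fc_decay O (fun t => v (t ++ s)) chi q (B q) _ oO Ox) => //.
  - by move=> t j phi tp; apply: (step (size (t ++ s)).+1).
  - exact: hB.
  move=> t tq; apply: le_trans (lv _) _; rewrite size_cat -!mulrA ler_wpM2l ?(ltW C0)//.
  apply: ler_pM; rewrite ?exprn_ge0 ?(ltW L0) ?(ltW (M0 _))//.
    by rewrite ler_weXn2l// leq_add2r.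
  by apply: M_homo => //; rewrite leq_add2r.
pose Z (s : seq 'I_n) q := 3 ^+ n * Y s q + 2 * (6 ^+ n * Y s (q + n.+1)).
have hZ s q F : uniq F ->
    \sum_(xi <- F) nc (fc x0 (fun x => chi x * v s x) xi) * fmax R xi ^+ q <= Z s q.
  by move=> uF; apply: freq_summable.
have [g sg hg] := trig_series (hZ [::]).
have Lc s : L2 mu (fun x => chi x * v s x).
  have [Bc _ hBc] := tst_bounded tc.
  by have [] := L2_mulb (cmeas_cont (fun x => tst_cont x tc)) hBc (Lv s).
have cv s phi : tst O' phi -> (fun x => chi x * v s x * phi x) = (fun x => v s x * phi x).
  move=> tp; apply/funext => x; have [Ox'|nO] := pselect (O' x); last by rewrite (tst_out tp nO) !mulr0.
  by rewrite chi1// mul1r.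
have eQex (xi : freq) phi : tst O' phi -> (fun x => eQ x0 xi x * phi x) = (fun x => ex xi x * phi x).
  move=> tp; apply/funext => x; have [Ox'|nO] := pselect (O' x); last by rewrite (tst_out tp nO) !mulr0.
  rewrite /eQ cutT// => i; apply: ltW; apply: lt_le_trans (Ox _ (O'O _ Ox') i) _.
  by have := @pi_ge2 R; lra.
have tpb phi : tst O' phi -> tst (box x0 1) phi by move=> tp; apply: tst_sub tp => x /O'O /Ox.
have Tg phi : tst O' phi -> T phi = cint mu (fun x => g x * phi x).
  move=> tp; have := hT [::] phi (tst_sub O'O tp); rewrite expr0 mul1r /= => ->.
  apply: clim_unique (hg _ _ tp) => e e0; have [r0 hr0] := fourier_weak (Lc [::]) (tpb _ tp) e0.
  have [N hN] := enum_freq_exhaust r0; exists N => p Np.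
  have := hr0 _ (enum_freq_uniq p) (hN p Np); rewrite ncB cv//.
  by under eq_bigr do rewrite eQex//.
pose D := (3 ^+ n * B 0%N * C + 2 * (6 ^+ n * (2 ^+ n.+1 * (B n.+1 * (C * L ^+ n.+1 * (A ^+ n.+1 * M n.+1)))))) + 1.
have D0 : 0 < D by rewrite /D; apply: ltr_wpDl; [(repeat first [exact: B0 | progress pos_with M0])|exact: ltr01].
exists g, D, (L * A); split=> //; first by rewrite mulr_gt0.
(* D^s g is not estimated through the coefficients of [g], which would bring in |s| derivatives of
   [chi], but through those of chi v_s, which represents the same distribution on [O'] up to
   sign. *)
move=> s y Oy; apply: le_trans (_ : Z s 0%N <= _).
  apply: (@sup_bound_weak _ _ O' (Dw s g)) Oy => //.
  - by move=> x _; exact: (sm_C1 (sm_Dw s sg) Logic.I).1.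
  - by move=> phi tp; apply: tst_int (tstM oO' (sm_sub (@subsetT _ O') (sm_Dw s sg)) tp).
  move=> phi tp; rewrite (ibp s oO' (sm_sub (@subsetT _ O') sg) tp) nc_sign -Tg; last exact: tst_Dw.
  rewrite (hT s phi (tst_sub O'O tp)) nc_sign -cv//.
  apply/ler_addgt0Pr => e e0; have [r0 hr0] := fourier_weak (Lc s) (tpb _ tp) e0.
  have [N hN] := enum_freq_exhaust r0.
  have := hr0 _ (enum_freq_uniq N) (hN N (leqnn N)).
  set S := \sum_(xi <- _) _; set I := cint _ _ => h.
  rewrite -(subrK S I); apply: le_trans (ncD _ _) _; rewrite addrC; apply: lerD => //.
  apply: le_trans (nc_sum _ _ _) _.
  apply: le_trans (_ : \sum_(xi <- enum_freq N) nc (fc x0 (fun x => chi x * v s x) xi) * fmax R xi ^+ 0 * \int[mu]_x nc (phi x) <= _).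
    apply: ler_sum => xi _; rewrite expr0 mulr1 ncM ler_wpM2l ?nc_ge0// eQex//.
    have ie : cintegrable mu (fun x => ex xi x * phi x).
      by apply: tst_int (tstM oO' (sm_sub (@subsetT _ O') (sm_ex R xi)) tp).
    apply: le_trans (nc_cint ie) _; under eq_Rintegral do rewrite ncM nc_ex mul1r.
    exact: lexx.
  rewrite -mulr_suml ler_wpM2r//; first by apply: Rintegral_ge0 => x _; exact: nc_ge0.
  exact: hZ (enum_freq_uniq N).
have MM : M (n.+1 + size s)%N <= A ^+ (n.+1 + size s) * M n.+1 * M (size s) by exact: mg.
rewrite /Z /Y /= !add0n expr0 mul1r exprMn.
set q := size s; set X := L ^+ q * A ^+ q * M q.
have X0 : 0 <= X by rewrite /X; (repeat first [exact: B0 | progress pos_with M0]).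
have -> : D * (L ^+ q * A ^+ q) * M q = 3 ^+ n * B 0%N * C * X +
    2 * (6 ^+ n * (2 ^+ n.+1 * (B n.+1 * (C * L ^+ n.+1 * (A ^+ n.+1 * M n.+1))))) * X + X.
  by rewrite /D /X; ring.
rewrite -[leLHS]addr0; apply: lerD => //; apply: lerD.
  rewrite -!mulrA; do 3 (apply: ler_wpM2l; first by (repeat first [exact: B0 | progress pos_with M0])).
  rewrite /X -mulrA ler_wpM2l ?exprn_ge0 ?(ltW L0)//.
  by rewrite ler_peMl ?(ltW (M0 _))// exprn_ege1.
rewrite -!mulrA; do 5 (apply: ler_wpM2l; first by (repeat first [exact: B0 | progress pos_with M0])).
apply: le_trans (ler_wpM2l (exprn_ge0 _ (ltW L0)) MM) _.
by rewrite le_eqVlt; apply/orP; left; apply/eqP; rewrite /X !exprD; ring.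
Qed.

End sobolev_embedding.

(** * Recovering hypoellipticity from the estimates *)

Section backward_direction.
Context (R : realType) (n : nat) (M : nat -> R) (Omega : set 'rV[R]_n) (P : pdo R n) (x0 : 'rV[R]_n).
Notation E := 'rV[R]_n.
Notation fct := (E -> R[i]).
Notation mu := (@lebesgue_rV R n).
Notation mi := {ffun 'I_n -> nat}.
Implicit Types (U V : set E) (u T : fct -> R[i]).

Let oT : open [set: E] := @openT _.

Lemma rel_compact_box (x : E) (a b : R) : a < b -> rel_compact (box x a) (box x b).
Proof.
move=> ab; have sub : closure (box x a) `<=` cube x a.
  have cq : closure (cube x a) = cube x a by apply/esym/closure_id; exact: closed_cube.
  rewrite -[X in _ `<=` X]cq.
  by apply: closureS; exact: box_cube.
split; last by move=> y /sub; exact: cube_box.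
by apply: (subclosed_compact _ (@cube_compact _ _ x a)) => //; exact: closed_closure.
Qed.

Lemma is_distr_sub U V u : V `<=` U -> is_distr U u -> is_distr V u.
Proof.
move=> VU [lu bu]; split=> [c p1 p2 t1 t2|K cK KV].
  by apply: lu; apply/tstP; apply: (tst_sub VU); exact/tstP.
have [C [m hC]] := bu K cK (subset_trans KV VU); exists C, m => phi tp; apply: hC.
by apply/tstP; apply: (tst_sub VU); exact/tstP.
Qed.

Lemma Ddistr0 V u f : L2rep V (Ddistr [ffun=> 0%N] u) f -> L2rep V u f.
Proof.
move=> [Lf hf]; split=> // phi tp; rewrite -hf// /Ddistr.
have m0 : mabs ([ffun=> 0%N] : mi) = 0%N by rewrite /mabs big1// => i _; rewrite ffunE.
have /tstP[sp _] := tp; rewrite (Dw_Dmi _ sp) m0 expr0 mul1r.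
have -> : word ([ffun=> 0%N] : mi) = [::] by apply/size0nil; rewrite size_word.
by rewrite /=; congr (u _); apply/funext => x; rewrite expr0 mul1r.
Qed.

Lemma DC_distr_L2rep V V' T : weight_seq M -> open V -> open V' -> rel_compact V' V -> DC_distr M V T ->
  exists C L : R, [/\ 0 < C, 1 <= L & forall a : mi, exists2 h, L2rep V' (Ddistr a T) h &
    l2 mu (cut V' h) <= C * L ^+ mabs a * M (mabs a)].
Proof.
move=> wM oV oV' [cV' V'V] [f /(DC_classP M f oV)[sf bf] hT].
have M0 k : 0 < M k by exact: lt_le_trans (M_ge1 wM k).
have [C [h [C0 h0 hC]]] := bf _ cV' V'V.
have [r r0 hr] := compact_L2 cV'.
have VV : V' `<=` V by apply: subset_trans V'V; exact: subset_closure.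
have mV' := open_measurable_rV oV'.
exists (C * r), (Num.max 1 h); rewrite le_max lexx; split=> //; first exact: mulr_gt0.
move=> a; set s := word a; pose g x := (- 'i%C) ^+ mabs a * Dw s f x.
have sa : size s = mabs a by exact: size_word.
have cg : cmeas (cut V' (Dw s f)).
  by apply: cmeas_cut => // x Vx; exact: (sm_C1 (sm_Dw s sf) (VV x Vx)).1.
have [|||Lg lg] := hr V' (Dw s f) (C * h ^+ size s * M (size s)) mV' _ cg.
- exact: subset_closure.
- by pos_with M0.
- by move=> x Vx; apply: hC; exact: subset_closure.
exists g.
  split; first by apply/L2funP => //; rewrite /g cutZ; exact: L2Z.
  move=> phi /tstP tp; rewrite /Ddistr (Dw_Dmi _ (tst_sm tp)) -/s.
  have tpV := tst_sub VV tp.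
  pose psi x := (- 'i%C) ^+ mabs a * phi x; rewrite -/psi.
  have tps : tst V psi by exact: tstZ.
  have := hT (Dw s psi); rewrite tstP => -> //; last exact: tst_Dw.
  rewrite !distr_ofE (cut_tst _ (tst_Dw s tps)) (cut_tst _ tp) -sa -(ibp s oV sf tps).
  by congr cint; apply/funext => x; rewrite /g /psi; ring.
rewrite /g cutZ l2Z// nc_negi mul1r; apply: le_trans lg _.
have -> : C * h ^+ size s * M (size s) * r = C * r * h ^+ mabs a * M (mabs a) by rewrite sa; ring.
apply: ler_wpM2r; first exact: ltW.
apply: ler_wpM2l; first by rewrite mulr_ge0// ltW.
by apply: lerXn2r; rewrite ?nnegrE ?le_max ?ler01 ?(ltW h0) ?lexx ?orbT.
Qed.

Lemma L2norm_le_Sobolev k V u a : (mabs a <= k)%N ->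
  (L2norm_distr V (Ddistr a u) <= Sobolev_norm k V u)%E.
Proof.
move=> ak; rewrite -[leLHS]gee0_abs ?L2norm_distr_ge0// -sqrte_sqr /Sobolev_norm.
have s0 b : (0 <= L2norm_distr V (Ddistr b u) ^+ 2)%E by rewrite expe2 mule_ge0 ?L2norm_distr_ge0.
rewrite lee_sqrt; last by apply: sume_ge0 => b _; exact: s0.
by apply: (@sume_fin_term _ _ _ (fun b => L2norm_distr V (Ddistr b u) ^+ 2)%E) => //; rewrite mem_midx.
Qed.

(** The weights are harmless for data of the class: Lambda_k^(k-j) M_j <= M_k for j <= k, since
    Lambda_j <= Lambda_k for j > 0. *)
Lemma weighted_norm_le k V T (C L : R) : weight_seq M -> open V -> 0 < C -> 1 <= L ->
  (forall a, exists2 h, L2rep V (Ddistr a T) h & l2 mu (cut V h) <= C * L ^+ mabs a * M (mabs a)) ->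
  (weighted_norm M k V T <= (C * (2 ^+ n * L) ^+ k * M k)%:E)%E.
Proof.
move=> wM oV C0 L1 hT; have M0 j : 0 < M j by exact: lt_le_trans (M_ge1 wM j).
have L0 : 0 < L by exact: lt_le_trans L1.
apply: (@le_trans _ _ (\sum_(a <- midx n k) (C * L ^+ k * M k)%:E)%E).
  rewrite /weighted_norm big_seq [leRHS]big_seq; apply: lee_sum => a; rewrite mem_midx => ak.
  have [h hr hb] := hT a.
  apply: (@le_trans _ _ ((Lambda M k ^+ (k - mabs a))%:E * (C * L ^+ mabs a * M (mabs a))%:E)%E).
    apply: lee_wpmul2l; first by rewrite lee_fin exprn_ge0// ltW// Lambda_gt0.
    by apply: le_trans (L2norm_distr_le oV hr) _; rewrite lee_fin.
  rewrite -EFinM lee_fin mulrCA; apply: ler_pM.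
  - by pos_with M0.
  - by rewrite mulr_ge0 ?exprn_ge0// ltW// Lambda_gt0.
  - by rewrite ler_wpM2l ?(ltW C0)// ler_weXn2l.
  have [a0|a0] := posnP (mabs a).
    by rewrite a0 subn0 LambdaX//; case: wM => _ -> _ _ _; rewrite mulr1.
  have -> : M k = Lambda M k ^+ (k - mabs a) * Lambda M k ^+ mabs a by rewrite -exprD subnK// LambdaX.
  rewrite -(LambdaX wM (mabs a)) ler_wpM2l ?exprn_ge0 ?(ltW (Lambda_gt0 wM _))//.
  by apply: lerXn2r; rewrite ?nnegrE ?(ltW (Lambda_gt0 wM _))//; exact: Lambda_homo.
rewrite sumEFin lee_fin big_const_seq count_predT iter_addr_0 -[leLHS]mulr_natl.
have -> : C * (2 ^+ n * L) ^+ k * M k = (2 ^+ n) ^+ k * (C * L ^+ k * M k).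
  by rewrite (exprMn k (2 ^+ n)); ring.
apply: ler_wpM2r; first by pos_with M0.
by rewrite -!natrX ler_nat size_midx_le.
Qed.

(** The hypothesis is used twice on shrinking boxes: at order 0 from [V1] to [V2], to know that [u]
    is in L^2, then at every order from [V2] to [V3], where the right-hand side of the estimate is
    now finite. *)
Lemma backward_direction (U0 : set E) : admissible M -> pdo_DC M Omega P ->
  open U0 -> U0 x0 -> U0 `<=` Omega ->
  (forall U V : set E, open U -> open V -> rel_compact V U -> U `<=` U0 ->
      exists C L : R, [/\ 0 < C, 0 < L &
        forall u : fct -> R[i], is_distr U u -> forall k : nat,
          (Sobolev k U (pdo_app P u) -> Sobolev k V u) /\
          (Sobolev_norm k V u <=
             (C * L ^+ k)%:E * (weighted_norm M k U (pdo_app P u) +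
                                (M k)%:E * L2norm_distr U u))%E]) ->
  hypoelliptic_at M P Omega x0.
Proof.
move=> adm PDC oU0 U0x U0O est.
have [A [C1 [h1 [A1 C10 h11 mg hfact]]]] := admissible_constants adm.
have [wM _ _] := adm; have M0 k : 0 < M k by exact: lt_le_trans (M_ge1 wM k).
pose W := U0 `&` box x0 1; have oW : open W by apply: openI => //; exact: open_box.
have WU : W `<=` U0 by move=> x [].
exists W; split=> //; [by split=> //; exact: box_refl|by move=> x /WU /U0O|].
move=> u du V oV VW hPu.
have lW := is_distr_linear du.
apply: glue_DC => //; first by move=> c p1 p2 t1 t2; apply: lW; exact: tst_sub VW _.
move=> x Vx; have [d d0 hd] := open_boxP oV Vx.
have bsub (a b : R) : a <= b -> box x a `<=` box x b by move=> ab y h i; exact: lt_le_trans (h i) ab.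
have dk (a b : R) : 0 < b -> b < a -> d / a < d / b.
  by move=> b0 ba; rewrite ltr_pM2l// ltf_pV2 ?posrE// (lt_trans b0).
pose V1 := box x (d / 2); pose V2 := box x (d / 4); pose V3 := box x (d / 8).
have oV1 : open V1 by exact: open_box.
have oV2 : open V2 by exact: open_box.
have oV3 : open V3 by exact: open_box.
have rc1 : rel_compact V1 V.
  have [c1 c2] := @rel_compact_box x (d / 2) d ltac:(by rewrite ltr_pdivrMr// ltr_pMr// ltr1n).
  by split=> // y /c2 /hd.
have rc12 : rel_compact V2 V1 by apply: rel_compact_box; apply: dk => //; rewrite ltr_nat.
have rc23 : rel_compact V3 V2 by apply: rel_compact_box; apply: dk => //; rewrite ltr_nat.
have sc (X Y : set E) : rel_compact X Y -> X `<=` Y.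
  by move=> [_ h]; apply: subset_trans h; exact: subset_closure.
have V1V := sc _ _ rc1; have V21 := sc _ _ rc12; have V32 := sc _ _ rc23.
have V1U0 : V1 `<=` U0 by move=> y /V1V /VW /WU.
have V2U0 : V2 `<=` U0 by move=> y /V21 /V1U0.
have rc2 : rel_compact V2 V by case: rc12 => c1 c2; split=> // y /c2 /V1V.
have [D1 [H1 [_ _ hD1]]] := DC_distr_L2rep wM oV oV1 rc1 hPu.
have [D2 [H2 [D20 H21 hD2]]] := DC_distr_L2rep wM oV oV2 rc2 hPu.
have [E1 [F1 [_ _ hE1]]] := est V1 V2 oV1 oV2 rc12 V1U0.
have [E2 [F2 [E20 F20 hE2]]] := est V2 V3 oV2 oV3 rc23 V2U0.
have du1 : is_distr V1 u by apply: is_distr_sub du => y /V1V /VW.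
have du2 : is_distr V2 u by apply: is_distr_sub du1.
have [u0 /Ddistr0 ru0] : exists f, L2rep V2 (Ddistr [ffun=> 0%N] u) f.
  apply: (hE1 u du1 0%N).1; last by rewrite /mabs big1// => i _; rewrite ffunE.
  by move=> a _; have [h hr _] := hD1 a; exists h.
pose N0 := l2 mu (cut V2 u0); have N00 : 0 <= N0 by exact: l2_ge0.
pose H := (F2 + 1) * (2 ^+ n * H2).
have H20 : 0 < H2 by exact: lt_le_trans H21.
have nH1 : 1 <= 2 ^+ n * H2 by apply: mulr_ege1 => //; rewrite exprn_ege1// ler1n.
have nH0 : 0 < 2 ^+ n * H2 by exact: lt_le_trans nH1.
have HH1 : 1 <= H by apply: mulr_ege1 => //; rewrite lerDr ltW.
have H0 : 0 < H by exact: lt_le_trans HH1.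
(* The term 1 absorbs the error in the choice of almost minimal representatives, since H^k M_k >=
   1. *)
pose D := E2 * (D2 + N0) + 1; have DD0 : 0 < D by rewrite ltr_wpDl// mulr_ge0 ?addr_ge0// ltW.
have bnd a : (L2norm_distr V3 (Ddistr a u) <= (E2 * (D2 + N0) * H ^+ mabs a * M (mabs a))%:E)%E.
  set k := mabs a; apply: le_trans (@L2norm_le_Sobolev k V3 u a (leqnn _)) _.
  apply: le_trans (hE2 u du2 k).2 _.
  have hw := weighted_norm_le k wM oV2 D20 H21 hD2.
  have hN := L2norm_distr_le oV2 ru0.
  apply: (@le_trans _ _ ((E2 * F2 ^+ k)%:E * ((D2 * (2 ^+ n * H2) ^+ k * M k)%:E + (M k)%:E * N0%:E))%E).
    apply: lee_wpmul2l; first by rewrite lee_fin mulr_ge0 ?exprn_ge0// ltW.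
    by apply: leeD => //; apply: lee_wpmul2l => //; rewrite lee_fin ltW.
  rewrite -[((M k)%:E * N0%:E)%E]EFinM -[(_ + _)%E]EFinD -[(_ * _)%E]EFinM lee_fin.
  have -> : E2 * (D2 + N0) * H ^+ k * M k = (E2 * (F2 + 1) ^+ k) * ((D2 + N0) * (2 ^+ n * H2) ^+ k * M k).
    by rewrite /H (exprMn k (F2 + 1)); ring.
  apply: ler_pM.
  - by rewrite mulr_ge0 ?exprn_ge0// ltW.
  - by rewrite addr_ge0// ?mulr_ge0 ?exprn_ge0// ltW.
  - rewrite ler_wpM2l ?(ltW E20)//; apply: lerXn2r; rewrite ?nnegrE ?addr_ge0 ?(ltW F20)//.
    by rewrite lerDl.
  rewrite !mulrDl lerD2l mulrC ler_wpM2r ?(ltW (M0 k))// ler_peMr// exprn_ege1//.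
have fin a : L2norm_distr V3 (Ddistr a u) \is a fin_num.
  by rewrite ge0_fin_numE ?L2norm_distr_ge0//; apply: le_lt_trans (bnd a) _; rewrite ltry.
have /choice[f hf] : forall a : mi, exists f, L2rep V3 (Ddistr a u) f /\
    l2 mu (cut V3 f) <= D * H ^+ mabs a * M (mabs a).
  move=> a; have [f rf bf] := L2norm_distr_approx oV3 (fin a) ltr01; exists f; split=> //.
  apply: le_trans bf _; rewrite /D !mulrDl; apply: lerD.
    by rewrite -lee_fin (fineK (fin a)); exact: bnd.
  by rewrite mul1r; apply: mulr_ege1; [exact: exprn_ege1|exact: M_ge1].
pose v s := wfam V3 (size s) f s.
have vE s : v s = fun y => 'i%C ^+ size s * cut V3 (f (wmi s)) y by rewrite /v /wfam leqnn.
have Lf a : L2 mu (cut V3 (f a)) by apply: L2rep_l2 (hf a).1.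
have Lv s : L2 mu (v s) by rewrite vE; exact: L2Z.
have lv s : l2 mu (v s) <= D * H ^+ size s * M (size s).
  by rewrite vE l2Z// nc_i mul1r; have := (hf (wmi s)).2; rewrite mabs_wmi.
have hv s phi : tst V3 phi -> u (Dw s phi) = (-1) ^+ size s * cint mu (fun y => v s y * phi y).
  by move=> tp; apply: wfam_rep => // a _; exact: (hf a).1.
have d16 : 0 < d / 16 by rewrite divr_gt0.
have [B _ /(_ 0%N)[th [cth th1 th0]]] := cutoff_cube x d16.
have tc : tst V3 (rc th).
  apply: cutoff_tst (@cube_compact _ _ x (d / 16)) _ cth th0.
  by apply: cube_box; apply: dk => //; rewrite ltr_nat.
pose O' := box x (d / 32).
have oO' : open O' by exact: open_box.
have O'V3 : O' `<=` V3 by apply: bsub; apply: ltW; apply: dk => //; rewrite ltr_nat.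
have V3V : V3 `<=` V by move=> y /V32 /V21 /V1V.
have V3x : V3 `<=` box x0 1 by move=> y /V3V /VW[].
have c1 y : O' y -> rc th y = 1.
  move=> Oy; rewrite /rc th1// => i; apply: ltW; apply: lt_le_trans (Oy i) _.
  by rewrite -mulrA -invfM -natrM.
have [g [C' [L' [sg hg C'0 L'0 bg]]]] := L2_family_smooth wM A1 mg DD0 HH1 oV3 V3x Lv hv lv oO' O'V3 tc c1.
exists O', g, C', L'; split=> //.
- by apply: box_refl; rewrite divr_gt0.
- by move=> y /O'V3 /V3V.
Qed.

End backward_direction.

Theorem theorem1 (R : realType) (n : nat) (M : nat -> R)
    (Omega : set 'rV[R]_n) (P : pdo R n) (x0 : 'rV[R]_n) :
  admissible M ->
  open Omega ->
  pdo_DC M Omega P ->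
  (exists T : ('rV[R]_n -> R[i]) -> ('rV[R]_n -> R[i]),
     L2_operator Omega T /\ pdo_right_inverse P Omega T) ->
  Omega x0 ->
  hypoelliptic_at M P Omega x0 <->
  exists U0 : set 'rV[R]_n, [/\ open U0, U0 x0, U0 `<=` Omega &
    forall U V : set 'rV[R]_n, open U -> open V -> rel_compact V U -> U `<=` U0 ->
      exists C L : R, [/\ 0 < C, 0 < L &
        forall u : ('rV[R]_n -> R[i]) -> R[i], is_distr U u -> forall k : nat,
          (Sobolev k U (pdo_app P u) -> Sobolev k V u) /\
          (Sobolev_norm k V u <=
             (C * L ^+ k)%:E * (weighted_norm M k U (pdo_app P u) +
                                (M k)%:E * L2norm_distr U u))%E]].
Proof.
move=> adm oOm PDC [T [oT PT]] _; split; first exact: (forward_direction adm oOm PDC oT PT).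
by move=> [U0 [oU0 U0x U0O est]]; exact: (backward_direction adm PDC oU0 U0x U0O est).
Qed.
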